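(* Let $C(x)$ denote the number of positive integers $n \le x$ such that $\gcd(n,\phi(n)) = 1$, where $\phi$ is Euler's totient function. Then $C(x)$ admits an asymptotic series expansion, in the sense of Poincaré, in descending powers of $\log\log\log x$. Precisely: there is a sequence of real numbers $c_1, c_2, c_3, \dots$ such that, for each fixed positive integer $N$ and all sufficiently large $x$, \[ C(x) = \frac{e^{-\gamma} x}{\log\log\log{x}} \left(1+\frac{c_1}{\log\log\log{x}} + \frac{c_2}{(\log\log\log{x})^2} + \dots + \frac{c_N}{(\log\log\log{x})^{N}}\right) + O_{N}\left(\frac{x}{(\log\log\log{x})^{N+2}}\right), \] where the implied constant depends only on $N$. *)

(* Defs.v *)
From HB Require Import structures.
From mathcomp Require Export all_boot all_order all_algebra.
From mathcomp Require Export boolp classical_sets functions filter reals.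
From mathcomp Require Export topology normedtype sequences exp.
Set Implicit Arguments.
Unset Strict Implicit.
Unset Printing Implicit Defensive.
Import Order.TTheory GRing.Theory Num.Theory.
Import numFieldTopology.Exports numFieldNormedType.Exports.

Local Open Scope classical_set_scope.
Local Open Scope ring_scope.

Definition euler_seq (R : realType) (n : nat) : R :=
  \sum_(1 <= k < n.+1) k%:R^-1 - ln n%:R.

Definition euler_gamma (R : realType) : R := lim (euler_seq R @ \oo).

(* [lim] is a total operator: this shows that [euler_gamma] is the genuine
   limit of [euler_seq]. *)
Lemma cvg_euler_gamma (R : realType) : euler_seq R @ \oo --> euler_gamma R.
Proof.
have eqS n : euler_seq R n.+1 =
    \sum_(1 <= k < n.+1) k%:R^-1 + n.+1%:R^-1 - ln n.+1%:R.
  by rewrite /euler_seq big_nat_recr.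
have lnS_le n : (0 < n)%N -> ln (n.+1%:R : R) <= ln n%:R + n%:R^-1.
  move=> n0; have n0R : 0 < n%:R :> R by rewrite ltr0n.
  have i0 : 0 < n%:R^-1 :> R by rewrite invr_gt0.
  have -> : n.+1%:R = n%:R * (1 + n%:R^-1) :> R.
    by rewrite mulrDr mulr1 divff ?gt_eqF// -natr1.
  rewrite lnM ?posrE// ?addr_gt0// lerD2l le_ln1Dx//.
  by apply: lt_trans i0; rewrite ltrN10.
have lnS_ge n : (0 < n)%N -> ln (n%:R : R) + n.+1%:R^-1 <= ln n.+1%:R.
  move=> n0; have n0R : 0 < n%:R :> R by rewrite ltr0n.
  have n1R : 0 < n.+1%:R :> R by rewrite ltr0n.
  have lt1 : (n.+1%:R^-1 : R) < 1 by rewrite invf_lt1// ltr1n ltnS.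
  have -> : n%:R = n.+1%:R * (1 - n.+1%:R^-1) :> R.
    by rewrite mulrBr mulr1 divff ?gt_eqF// -natr1 addrK.
  rewrite lnM ?posrE ?subr_gt0// -addrA gerDl -lerBrDr sub0r le_ln1Dx//.
  by rewrite ltrN2.
suff : cvgn [sequence euler_seq R n.+1]_n.
  move=> /cvg_ex[/= l]; rewrite cvg_shiftS => ul.
  by apply: cvgP; exact: ul.
apply: nonincreasing_is_cvgn.
  apply/nonincreasing_seqP => n /=.
  rewrite eqS /euler_seq -[leLHS]addrA lerD2l lerBlDr [leRHS]addrC lerBrDl.
  exact: lnS_ge.
have ge0 n : ln (n.+1%:R : R) <= \sum_(1 <= k < n.+1) k%:R^-1.
  elim: n => [|n ih]; first by rewrite ln1 big_nil.
  by rewrite big_nat_recr//= (le_trans (lnS_le _ _))// lerD2r.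
exists 0 => _ [n _ <-] /=; rewrite eqS subr_ge0 (le_trans (ge0 n))// lerDl.
by rewrite invr_ge0.
Qed.

Definition cyclic_count (R : realType) (x : R) : nat :=
  (\sum_(1 <= n < (Num.truncn x).+1 | gcdn n (totient n) == 1) 1)%N.

(* Main.v *)
(* An integer [n] is counted iff it is squarefree and no two of its prime factors satisfy
   [q = 1 mod p]. Put [v = y ^ (1 / 16)] with [y = ln (ln x)]. Almost every [n <= x] has a prime
   factor [q = 1 mod p] when [p <= v ^ 12], so such a [p] must not divide [n]; almost no condition
   is left when [p > v ^ 32]; in between, the sum of [1 / q] over the primes [q = 1 mod p] is close
   to [y / p], so that [p] may divide [n] with probability about [exp (- y / p)]. An
   inclusion-exclusion sieve over the primes up to [exp (exp (y - v ^ 4))] gives [C(x) = x * W + ...],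
   where [W] is the product of [1 - 1 / p] over [p <= v ^ 12] and of [1 - (1 - exp (- y / p)) / p] over
   [v ^ 12 < p <= v ^ 32]. By partial summation against [merL z = \sum_(p <= z) - ln (1 - 1 / p)], which
   is [ln (ln z) + euler_gamma] up to any power of [1 / ln z], the logarithm of [W] has an expansion
   in powers of [1 / ln y] whose coefficients are moments [\int s ^ k * exp (s - exp s)].

   The error term in [merL] comes from bounds for the derivatives of [zeta' / zeta] to the right of
   [Re s = 1], which follow from the 3-4-1 inequality; they are turned into bounds for sums of
   [(Lambda n - 1) / n] by averaging against powers of [(1 + cos) / 2] sampled at finitely many points,
   so that no contour integral is needed. The sums of [1 / q] over [q = 1 mod p] and [q = 1 mod p p']
   are read off from the [L]-series at [1 + d] with [- ln d] close to [y], where 3-4-1 handles the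
   non-real characters and a Lambert series the real ones. *)

Require Import Defs.
From mathcomp Require Import derive realfun trigo complex ring lra zify zmodp cyclic.
Import Order.TTheory GRing.Theory Num.Theory.
Import numFieldTopology.Exports numFieldNormedType.Exports.
Local Open Scope classical_set_scope.
Local Open Scope complex_scope.
Local Open Scope ring_scope.
Set Implicit Arguments. Unset Strict Implicit. Unset Printing Implicit Defensive.

(** Every error has to save only some fixed power of [v], because [v] exceeds each power of ln y;
    this is why the thresholds are round powers of [v] and no exponent is optimised. The obstacle is
    uniformity in the modulus m for sums over primes q = 1 mod m. The sums are compared at 1 + d and
    at 1 + D with D = m^(-1/2), so that the second-order terms of the Euler products cost O(D), and
    not O(1), for each character. Lower bounds are required only for p <= v^32, while d is near exp
    (- y): a lower bound for real L-series that is polynomial in 1/m is then enough, and possible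
    exceptional zeros do no harm. For larger moduli only upper bounds enter, and there the real
    characters have to be bounded from above alone. On the side of zeta, derivatives of all orders
    at 1 + 1/u are used, with u = ln X: a high order k brings in a factor (ln n)^k, and dividing it
    out again recovers every loss that is polynomial in u. *)

Ltac recent tac n :=
  match n with
  | O => tac
  | S ?m => match goal with
            | H : ?T |- _ => match type of T with Prop => revert H; recent tac m; intros H end
            | _ => tac
            end
  end.
(** [lra] slows down in long contexts, so it is tried with only the last 2, 5 or 10 propositional
    hypotheses before it sees everything. *)
Ltac rlra_with tac := intros; first
  [ solve [recent tac 2%nat; lra] | solve [recent tac 5%nat; lra] | solve [recent tac 10%nat; lra] | lra ].
Ltac rlra := rlra_with ltac:(clear).

Lemma sum_split (V : nmodType) (F : nat -> V) a b c : (a <= b)%N -> (b <= c)%N ->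
  \sum_(a <= n < c) F n = \sum_(a <= n < b) F n + \sum_(b <= n < c) F n.
Proof. by move=> ab bc; rewrite (big_cat_nat ab bc). Qed.

Local Notation Re := complex.Re.
Local Notation Im := complex.Im.

(** * Modulus on [R[i]] and convergence of complex series *)

Section ComplexSums.
Variable R : realType.
Implicit Types (x y : R[i]) (f g : nat -> R[i]).

(** The norm of [R[i]] takes its values in [R[i]]; this real-valued modulus keeps all estimates
    inside [R], where [lra] and [nra] apply. *)
Definition nc (x : R[i]) : R := Normc.normc x.

Lemma ncD x y : nc (x + y) <= nc x + nc y.
Proof. exact: le_normcD. Qed.
Lemma ncM x y : nc (x * y) = nc x * nc y.
Proof. exact: Normc.normcM. Qed.
Lemma ncN x : nc (- x) = nc x.
Proof. exact: (@normcN R x). Qed.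
Lemma ncB x y : nc (x - y) <= nc x + nc y.
Proof. by rewrite -(ncN y) ncD. Qed.
Lemma nc0 : nc 0 = 0. Proof. exact: Normc.normc0. Qed.
Lemma nc1 : nc 1 = 1. Proof. exact: Normc.normc1. Qed.
Lemma ncV x : nc x^-1 = (nc x)^-1. Proof. exact: Normc.normcV. Qed.
Lemma nc_ge0 x : 0 <= nc x.
Proof. by case: x => a b; exact: sqrtr_ge0. Qed.
Lemma nc_real (a : R) : nc a%:C = `|a|.
Proof. by rewrite /nc /= expr0n /= addr0 sqrtr_sqr. Qed.
Lemma nc_eq0 x : nc x = 0 -> x = 0. Proof. exact: Normc.eq0_normc. Qed.
Lemma nc_nat n : nc n%:R = n%:R.
Proof.
have -> : n%:R = (n%:R : R)%:C :> R[i] by rewrite rmorph_nat.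
by rewrite nc_real ger0_norm.
Qed.
Lemma ncX x n : nc (x ^+ n) = nc x ^+ n.
Proof. by elim: n => [|n ih]; rewrite ?expr0 ?nc1// !exprS ncM ih. Qed.
Lemma nc_distrC x y : nc (x - y) = nc (y - x).
Proof. by rewrite -ncN opprB. Qed.
Lemma nc_triB x y : nc x - nc y <= nc (x - y).
Proof. by rewrite lerBlDr (le_trans _ (ncD _ _))// subrK. Qed.
Lemma nc_Re x : `|Re x| <= nc x.
Proof.
case: x => a b; rewrite /nc /= -sqrtr_sqr; apply: ler_wsqrtr.
by rewrite lerDl sqr_ge0.
Qed.
Lemma nc_Im x : `|Im x| <= nc x.
Proof.
case: x => a b; rewrite /nc /= -sqrtr_sqr; apply: ler_wsqrtr.
by rewrite lerDr sqr_ge0.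
Qed.
Lemma nc_le_ReIm x : nc x <= `|Re x| + `|Im x|.
Proof.
case: x => a b /=; rewrite /nc /= -[leRHS]ger0_norm ?addr_ge0// -sqrtr_sqr.
apply: ler_wsqrtr; rewrite sqrrD !real_normK ?num_real//.
by have := mulr_ge0 (normr_ge0 a) (normr_ge0 b); lra.
Qed.
Lemma nc_sqr (a b : R) : nc (a +i* b) ^+ 2 = a ^+ 2 + b ^+ 2.
Proof. by rewrite /nc /= sqr_sqrtr// addr_ge0 ?sqr_ge0. Qed.
Lemma nc_sum (I : Type) (s : seq I) (P : pred I) (F : I -> R[i]) :
  nc (\sum_(i <- s | P i) F i) <= \sum_(i <- s | P i) nc (F i).
Proof.
elim/big_rec2: _ => [|i a b _ ih]; first by rewrite nc0.
by rewrite (le_trans (ncD _ _))// lerD2l.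
Qed.

Lemma Re_sum (I : Type) (s : seq I) (F : I -> R[i]) :
  Re (\sum_(i <- s) F i) = \sum_(i <- s) Re (F i).
Proof.
elim: s => [|i s ih]; first by rewrite !big_nil.
by rewrite !big_cons -ih; case: (F i) => a b; case: (\sum_(_ <- _) _).
Qed.
Lemma Im_sum (I : Type) (s : seq I) (F : I -> R[i]) :
  Im (\sum_(i <- s) F i) = \sum_(i <- s) Im (F i).
Proof.
elim: s => [|i s ih]; first by rewrite !big_nil.
by rewrite !big_cons -ih; case: (F i) => a b; case: (\sum_(_ <- _) _).
Qed.

Definition cis (t : R) : R[i] := cos t +i* sin t.
Lemma cisD (a b : R) : cis (a + b) = cis a * cis b.
Proof. by rewrite /cis cosD sinD; apply/eqP; rewrite eq_complex /= eqxx addrC mulrC [sin b * _]mulrC eqxx. Qed.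
Lemma cis0 : cis 0 = 1. Proof. by rewrite /cis cos0 sin0. Qed.
Lemma nc_cis (t : R) : nc (cis t) = 1.
Proof. by rewrite /nc /= cos2Dsin2 sqrtr1. Qed.
Lemma cisN (t : R) : cis (- t) = (cis t)^-1.
Proof.
have h : cis t * cis (- t) = 1 by rewrite -cisD subrr cis0.
have h0 : cis t != 0 by apply/eqP => e; have := nc_cis t; rewrite e nc0; lra.
by rewrite -[LHS](mulKf h0) h mulr1.
Qed.
Lemma cisMn (t : R) n : cis (n%:R * t) = cis t ^+ n.
Proof.
elim: n => [|n ih]; first by rewrite mul0r cis0 expr0.
by rewrite -natr1 mulrDl mul1r cisD ih exprSr.
Qed.

(* Series are indexed from [1]: the value at [0] never matters. *)
Definition has_sum f (l : R[i]) := forall e : R, 0 < e ->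
  exists N0, forall N, (N0 <= N)%N -> nc (l - \sum_(1 <= n < N.+1) f n) <= e.

Definition abs_bound f (B : R) := forall N, \sum_(1 <= n < N.+1) nc (f n) <= B.

Lemma has_sum_ext f g l : (forall n, (0 < n)%N -> f n = g n) ->
  has_sum f l -> has_sum g l.
Proof.
move=> fg h e e0; have [N0 hN] := h e e0; exists N0 => N /hN.
by rewrite (eq_big_nat _ _ (F2 := g))// => i /andP[i0 _]; exact: fg.
Qed.

Lemma has_sum_unique f l l' : has_sum f l -> has_sum f l' -> l = l'.
Proof.
move=> h h'; apply/eqP; rewrite -subr_eq0; apply/eqP/nc_eq0/eqP.
rewrite eq_le nc_ge0 andbT; apply/ler_addgt0Pr => e e0; rewrite add0r.
have e2 : 0 < e / 2 by lra.
have [N hN] := h _ e2; have [N' hN'] := h' _ e2.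
have h1 := hN (maxn N N') (leq_maxl _ _).
have h2 := hN' (maxn N N') (leq_maxr _ _).
set S := \sum_(_ <= _ < _) _ in h1 h2.
have -> : l - l' = (l - S) - (l' - S) by ring.
by apply: (le_trans (ncB _ _)); lra.
Qed.

Lemma has_sumD f g l l' : has_sum f l -> has_sum g l' ->
  has_sum (fun n => f n + g n) (l + l').
Proof.
move=> h h' e e0; have e2 : 0 < e / 2 by lra.
have [N hN] := h _ e2; have [N' hN'] := h' _ e2.
exists (maxn N N') => M; rewrite geq_max => /andP[/hN h1 /hN' h2].
rewrite big_split/= opprD addrACA; apply: (le_trans (ncD _ _)); lra.
Qed.

Lemma has_sumZ f l (c : R[i]) : has_sum f l -> has_sum (fun n => c * f n) (c * l).
Proof.
move=> h e e0; have c1 : 0 < nc c + 1 by have := nc_ge0 c; lra.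
have [N hN] := h (e / (nc c + 1)) (divr_gt0 e0 c1).
exists N => M /hN; rewrite -mulr_sumr -mulrBr ncM => h1.
apply: le_trans (_ : nc c * (e / (nc c + 1)) <= e).
  by rewrite ler_wpM2l ?nc_ge0.
by rewrite mulrA ler_pdivrMr// mulrC ler_wpM2l ?(ltW e0)//; lra.
Qed.

Lemma has_sum0 : has_sum (fun=> 0) 0.
Proof. by move=> e e0; exists 0%N => N _; rewrite big1// subrr nc0 ltW. Qed.

Lemma has_sum_fin (I : Type) (s : seq I) (F : I -> nat -> R[i]) (L : I -> R[i]) :
  (forall i, has_sum (F i) (L i)) ->
  has_sum (fun n => \sum_(i <- s) F i n) (\sum_(i <- s) L i).
Proof.
move=> h; elim: s => [|i s ih].
  by rewrite big_nil; apply: has_sum_ext has_sum0 => n _; rewrite big_nil.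
by rewrite big_cons; apply: has_sum_ext (has_sumD (h i) ih) => n _; rewrite big_cons.
Qed.

Lemma has_sum_le f l (B : R) : has_sum f l ->
  (forall N, nc (\sum_(1 <= n < N.+1) f n) <= B) -> nc l <= B.
Proof.
move=> h hB; apply/ler_addgt0Pr => e /h[N /(_ _ (leqnn N)) hN].
by have := nc_triB l (\sum_(1 <= n < N.+1) f n); have := hB N; lra.
Qed.

Lemma has_sum_abs_le f l (B : R) : has_sum f l -> abs_bound f B -> nc l <= B.
Proof. by move=> h hB; apply: (has_sum_le h) => N; apply: le_trans (nc_sum _ _ _) (hB N). Qed.

Lemma has_sum_tail f l (B : R) K : has_sum f l ->
  (forall N, (K <= N)%N -> nc (\sum_(K.+1 <= n < N.+1) f n) <= B) ->
  nc (l - \sum_(1 <= n < K.+1) f n) <= B.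
Proof.
move=> h hB; apply/ler_addgt0Pr => e /h[N hN].
have h1 := hN (maxn N K) (leq_maxl _ _); have h2 := hB (maxn N K) (leq_maxr _ _).
have eS := @sum_split _ (fun n => f n) 1 K.+1 (maxn N K).+1 isT.
rewrite eS ?ltnS ?leq_maxr // {eS} in h1.
set b := \sum_(K.+1 <= _ < _) _ in h1 h2; set a := \sum_(_ <= _ < _) _ in h1 *.
have -> : l - a = (l - (a + b)) + b by ring.
by apply: (le_trans (ncD _ _)); lra.
Qed.

Lemma abs_bound_ge0 f B : abs_bound f B -> 0 <= B.
Proof. by move=> /(_ 0%N); rewrite big_geq. Qed.

(** The partial sums increase to their supremum; taking [K] where they are within [e] of it bounds
    every later block. *)
Lemma bounded_cauchy (u : nat -> R) (B : R) : (forall n, 0 <= u n) ->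
  (forall N, \sum_(1 <= n < N.+1) u n <= B) ->
  forall e, 0 < e -> exists K, forall N, \sum_(K.+1 <= n < N.+1) u n <= e.
Proof.
move=> u0 uB e e0; pose S N := \sum_(1 <= n < N.+1) u n.
have Smono : {homo S : n m / (n <= m)%N >-> n <= m}.
  apply: homo_leq => //= n; first exact: le_trans.
  by rewrite /S [leRHS]big_nat_recr//= lerDl.
have hs : has_sup (range S).
  by split; [exists (S 0%N); exists 0%N|exists B => _ [n _ <-]; exact: uB].
have [_ [K _ <-] hK] := sup_adherent e0 hs.
exists K => N; have [NK|KN] := leqP N K; first by rewrite big_geq// ltW.
have : S N <= sup (range S).
  by apply: (ub_le_sup hs.2); exists N.
rewrite {1}/S (@sum_split _ _ _ K.+1)//; last exact: ltnW.
by rewrite -/(S K); lra.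
Qed.

Lemma abs_bound_real_sum (u : nat -> R) (B : R) :
  (forall N, \sum_(1 <= n < N.+1) `|u n| <= B) ->
  exists l, forall e, 0 < e -> exists N0, forall N, (N0 <= N)%N ->
    `|l - \sum_(1 <= n < N.+1) u n| <= e.
Proof.
move=> uB; pose v n := u n.+1.
have eS N : \sum_(1 <= n < N.+1) u n = series v N.
  by rewrite /series/= big_add1/= big_mkord.
have : cvgn (series v).
  apply: normed_cvg; apply: nondecreasing_is_cvgn.
    apply/nondecreasing_seqP => n; rewrite /series /= [leRHS]big_nat_recr//= lerDl//.
  by exists B => _ [N _ <-]; rewrite /series/=; move: (uB N); rewrite big_add1.
move=> /cvg_ex[l /cvgrPdist_le hl]; exists l => e e0.
have [N0 _ hN] := hl e e0; exists N0 => N NN; rewrite eS; exact: hN.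
Qed.

Lemma abs_bound_sum f B : abs_bound f B -> exists l, has_sum f l.
Proof.
move=> fB.
have [|a ha] := @abs_bound_real_sum (fun n => Re (f n)) B.
  by move=> N; apply: le_trans (fB N); apply: ler_sum => i _; exact: nc_Re.
have [|b hb] := @abs_bound_real_sum (fun n => Im (f n)) B.
  by move=> N; apply: le_trans (fB N); apply: ler_sum => i _; exact: nc_Im.
exists (a +i* b) => e e0; have e2 : 0 < e / 2 by lra.
have [N hN] := ha _ e2; have [N' hN'] := hb _ e2.
exists (maxn N N') => M; rewrite geq_max => /andP[/hN h1 /hN' h2].
have sRe := Re_sum (index_iota 1 M.+1) f; have sIm := Im_sum (index_iota 1 M.+1) f.
apply: le_trans (nc_le_ReIm _) _.
move: sRe sIm; case: (\sum_(1 <= n < M.+1) f n) => c d /= -> ->; lra.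
Qed.

(** A total operator with default value 0; [csumP] shows that it is the genuine sum as soon as some
    [abs_bound] holds. *)
Definition csum f : R[i] := xget 0 [set l | has_sum f l].
Lemma csumP f B : abs_bound f B -> has_sum f (csum f).
Proof. by move=> /abs_bound_sum[l hl]; exact: (@xgetPex _ 0 [set l | has_sum f l] (ex_intro _ _ hl)). Qed.

End ComplexSums.
Arguments nc {R} x : simpl never.
Arguments cis {R} t : simpl never.
Arguments csum {R} f : simpl never.

(** * Dirichlet convolution of absolutely convergent series *)

Lemma big_multiples (V : nmodType) (h : nat -> V) d N : (0 < d)%N ->
  \sum_(1 <= n < N.+1 | (d %| n)%N) h (n %/ d)%N = \sum_(1 <= e < (N %/ d).+1) h e.
Proof.
move=> d0; elim: N => [|N ih]; first by rewrite div0n !big_geq.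
rewrite big_mkcond big_nat_recr//= -big_mkcond ih divnS//.
case: (boolP (d %| N.+1)%N) => /= [dN|_]; last by rewrite addr0.
by rewrite add1n [RHS]big_nat_recr//=; congr (_ + h _); rewrite divnS// dN.
Qed.

Section Convolution.
Variable R : realType.
Implicit Types f g : nat -> R[i].

Definition dconv f g n := \sum_(1 <= d < n.+1 | (d %| n)%N) f d * g (n %/ d)%N.

Lemma dconv_partial f g N : \sum_(1 <= n < N.+1) dconv f g n =
  \sum_(1 <= d < N.+1) f d * \sum_(1 <= e < (N %/ d).+1) g e.
Proof.
transitivity (\sum_(1 <= n < N.+1) \sum_(1 <= d < N.+1 | (d %| n)%N) f d * g (n %/ d)%N).
  apply: eq_big_nat => n /andP[n0 nN]; rewrite /dconv [RHS](@big_cat_nat _ _ _ n.+1)//=.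
  rewrite [X in _ = _ + X]big1_seq ?addr0// => d /andP[dn]; rewrite mem_index_iota => /andP[nd _].
  by have := dvdn_leq n0 dn; rewrite leqNgt nd.
under eq_bigr do rewrite big_mkcond; rewrite exchange_big_nat/=.
apply: eq_big_nat => d /andP[d0 _]; rewrite -big_mkcond/=.
by rewrite -big_multiples// mulr_sumr.
Qed.


(** The defect F G - S(N) equals (F - S_f(N)) G plus the sum over d <= N of f(d) (G - S_g(N/d)). For
    d <= K the inner tail is small, since N >= (K+1)^2 makes N/d at least K; for d > K it is at most
    2B and the tail of |f| is small. *)
Lemma has_sum_dconv f g A B F G : abs_bound f A -> abs_bound g B ->
  has_sum f F -> has_sum g G -> has_sum (dconv f g) (F * G).
Proof.
move=> fA gB hF hG e e0.
have A0 := abs_bound_ge0 fA; have B0 := abs_bound_ge0 gB.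
have GB := has_sum_abs_le hG gB.
(* The three error terms are at most [e1 * B], [A * e1] and [e1 * (2 * B)], which together stay
   below [e1 * D], that is [e]. *)
pose D := A + 3 * B + 1; have D0 : 0 < D by rewrite /D; lra.
pose e1 := e / D; have e10 : 0 < e1 by rewrite divr_gt0.
have [K1 hK1] := bounded_cauchy (fun n => nc_ge0 (f n)) fA e10.
have [K2 hK2] := hG _ e10; have [K3 hK3] := hF _ e10.
pose K := maxn K1 K2; exists (maxn K3 (K.+1 * K.+1)) => N.
rewrite geq_max => /andP[NK3 NK]; rewrite dconv_partial.
have h3 := hK3 N NK3.
set SF := \sum_(1 <= n < N.+1) f n in h3.
have -> : F * G - \sum_(1 <= d < N.+1) f d * \sum_(1 <= e < (N %/ d).+1) g e =
   (F - SF) * G + \sum_(1 <= d < N.+1) f d * (G - \sum_(1 <= e < (N %/ d).+1) g e).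
  under [X in _ = _ + X]eq_bigr do rewrite mulrBr.
  by rewrite sumrB -mulr_suml -/SF; ring.
apply: le_trans (ncD _ _) _; rewrite ncM.
have KN : (K < N.+1)%N by rewrite (leq_trans _ (leqW NK))// leq_pmulr.
rewrite (@sum_split _ _ 1 K.+1)//.
set X2 := \sum_(K.+1 <= _ < _) _; set X1 := \sum_(_ <= _ < _) _.
have hX1 : nc X1 <= A * e1.
  apply: le_trans (nc_sum _ _ _) _.
  apply: le_trans (_ : \sum_(1 <= d < K.+1) nc (f d) * e1 <= _); last first.
    by rewrite -mulr_suml ler_wpM2r ?(ltW e10).
  apply: ler_sum_nat => d /andP[d0 dK]; rewrite ncM ler_wpM2l ?nc_ge0//.
  apply: hK2; apply: leq_trans (leq_maxr K1 _) _; rewrite -/K leq_divRL//.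
  apply: leq_trans NK; apply: leq_mul; first exact: leqnSn.
  exact: ltnW.
have hX2 : nc X2 <= e1 * (2 * B).
  apply: le_trans (nc_sum _ _ _) _.
  apply: le_trans (_ : \sum_(K.+1 <= d < N.+1) nc (f d) * (2 * B) <= _).
    apply: ler_sum => d _; rewrite ncM ler_wpM2l ?nc_ge0// (le_trans (ncB _ _))//.
    have := le_trans (nc_sum _ _ _) (gB (N %/ d)%N); lra.
  rewrite -mulr_suml ler_wpM2r ?mulr_ge0//.
  apply: le_trans (hK1 N); rewrite (@sum_split _ _ K1.+1 K.+1)//; last first.
    by rewrite ltnS leq_maxl.
  by rewrite lerDr sumr_ge0// => i _; exact: nc_ge0.
have h4 : nc (F - SF) * nc G <= e1 * B.
  by apply: ler_pM; rewrite ?nc_ge0.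
have : e1 * D = e by rewrite /e1 divfK ?gt_eqF.
have := ncD X1 X2; rewrite /D; nra.
Qed.
End Convolution.

(** * Real powers of integers *)

Section RealPowers.
Variable R : realType.
Implicit Types (a b v : R).

(** The power n^(-a). Since [ln] vanishes at 0, the value at [n = 0] is 1; statements that compare
    with 1/n therefore assume [0 < n]. *)
Definition npow a (n : nat) : R := expR (- (a * ln n%:R)).

Lemma npow_gt0 a n : 0 < npow a n. Proof. exact: expR_gt0. Qed.
Lemma npow_ge0 a n : 0 <= npow a n. Proof. exact: expR_ge0. Qed.
Lemma npow1 a : npow a 1 = 1. Proof. by rewrite /npow ln1 mulr0 oppr0 expR0. Qed.
Lemma ln_natM m n : (0 < m)%N -> (0 < n)%N ->
  ln (m * n)%:R = ln m%:R + ln n%:R :> R.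
Proof. by move=> m0 n0; rewrite natrM lnM ?posrE ?ltr0n. Qed.
Lemma ln_nat_ge0 n : 0 <= ln n%:R :> R.
Proof. by case: n => [|n]; [rewrite ln0|rewrite ln_ge0// ler1n]. Qed.
Lemma ln_nat_le m n : (0 < m)%N -> (m <= n)%N -> ln m%:R <= ln n%:R :> R.
Proof.
by move=> m0 mn; rewrite ler_ln ?ler_nat// posrE ltr0n// (leq_trans m0).
Qed.
Lemma npowM a m n : (0 < m)%N -> (0 < n)%N -> npow a (m * n) = npow a m * npow a n.
Proof. by move=> m0 n0; rewrite /npow ln_natM// -expRD; congr expR; ring. Qed.
Lemma npowD a b n : npow (a + b) n = npow a n * npow b n.
Proof. by rewrite /npow -expRD; congr expR; ring. Qed.
Lemma npow_1 n : (0 < n)%N -> npow 1 n = n%:R^-1.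
Proof. by move=> n0; rewrite /npow mul1r expRN lnK// posrE ltr0n. Qed.
Lemma npow_le a b n : a <= b -> npow b n <= npow a n.
Proof. by move=> ab; rewrite /npow ler_expR lerN2 ler_wpM2r ?ln_nat_ge0. Qed.
Lemma npow_nonincr a m n : 0 <= a -> (0 < m)%N -> (m <= n)%N -> npow a n <= npow a m.
Proof. by move=> a0 m0 mn; rewrite /npow ler_expR lerN2 ler_wpM2l// ln_nat_le. Qed.

Lemma ln_succ_ge n : (0 < n)%N -> ln n%:R + n.+1%:R^-1 <= ln n.+1%:R :> R.
Proof.
move=> n0; have n1R : 0 < n.+1%:R :> R by rewrite ltr0n.
have lt1 : (n.+1%:R^-1 : R) < 1 by rewrite invf_lt1// ltr1n ltnS.
have -> : n%:R = n.+1%:R * (1 - n.+1%:R^-1) :> R.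
  by rewrite mulrBr mulr1 divff ?gt_eqF// -natr1 addrK.
rewrite lnM ?posrE ?subr_gt0// -addrA gerDl -lerBrDr sub0r le_ln1Dx//.
by rewrite ltrN2.
Qed.

(** Telescoping takes the place of comparison with an integral: [a * npow (1 + a) n.+1 <= npow a n -
    npow a n.+1], from 1 + y <= e^y and 1/(n+1) <= ln (n+1) - ln n. *)
Lemma npow_tail a X N : 0 < a -> (0 < X)%N ->
  \sum_(X.+1 <= n < N.+1) npow (1 + a) n <= npow a X / a.
Proof.
move=> a0 X0; have [NX|XN] := leqP N X.
  by rewrite big_geq// divr_ge0 ?npow_ge0// ltW.
suff : \sum_(X.+1 <= n < N.+1) npow (1 + a) n <= (npow a X - npow a N) / a.
  by move/le_trans; apply; rewrite ler_pM2r ?invr_gt0// gerBl npow_ge0.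
have {XN} := ltnW XN; rewrite -(subnKC (leqnn X)) subnn addn0 => /subnKC <-.
elim: (N - X)%N => [|k ih].
  by rewrite addn0 big_geq// subrr mul0r.
rewrite addnS big_nat_recr ?ltnS ?leqW ?leq_addr//=; apply: le_trans (lerD ih (lexx _)) _.
set n := (X + k)%N; have n0 : (0 < n)%N by rewrite addn_gt0 X0.
suff h : npow a n.+1 * (1 + a * n.+1%:R^-1) <= npow a n.
  rewrite npowD npow_1// ler_pdivlMr// mulrDl divfK ?gt_eqF//.
  by move: (n.+1%:R^-1) h => i h; nra.
have -> : npow a n = npow a n.+1 * expR (a * (ln n.+1%:R - ln n%:R)).
  by rewrite /npow -expRD; congr expR; ring.
rewrite ler_wpM2l ?npow_ge0//; apply: le_trans (expR_ge1Dx _).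
by rewrite lerD2l ler_wpM2l ?(ltW a0)// lerBrDl ln_succ_ge.
Qed.

Lemma npow_sum a N : 0 < a -> \sum_(1 <= n < N.+1) npow (1 + a) n <= 1 + a^-1.
Proof.
move=> a0; case: N => [|N]; first by rewrite big_geq// addr_ge0 ?invr_ge0 ?ltW.
rewrite big_ltn// npow1 lerD2l; have := @npow_tail a 1 N.+1 a0 isT.
by rewrite npow1 mul1r.
Qed.

Lemma sum_inv_sqr N : \sum_(1 <= n < N.+1) npow 2 n <= 2.
Proof. by have := @npow_sum 1 N ltr01; rewrite invr1. Qed.

(** A single term of the exponential series at [b * v]. Throughout, this trades powers of a
    logarithm for an arbitrarily small power of the argument. *)
Lemma exp_pow_le b v k : 0 < b -> 0 <= v -> v ^+ k <= k`!%:R * b^-1 ^+ k * expR (b * v).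
Proof.
move=> b0 v0; case: k => [|k].
  rewrite !expr0 fact0 !mul1r; have := expR_ge1Dx (b * v).
  by have := mulr_ge0 (ltW b0) v0; lra.
have := expR_ge1Dxn k (mulr_ge0 (ltW b0) v0); rewrite exprMn => h.
have f0 : 0 < (k.+1)`!%:R :> R by rewrite ltr0n fact_gt0.
have {h} h : b ^+ k.+1 * v ^+ k.+1 <= (k.+1)`!%:R * expR (b * v).
  by rewrite [leRHS]mulrC -ler_pdivrMr//; lra.
by rewrite mulrAC exprVn ler_pdivlMr ?exprn_gt0// mulrC.
Qed.
End RealPowers.

(** * Euler products and the 3-4-1 inequality *)

Section EulerProduct.
Variable R : realType.
Implicit Types f : nat -> R[i].

Definition cmul f := f 1%N = 1 /\ forall m n, (0 < m)%N -> (0 < n)%N -> f (m * n)%N = f m * f n.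

(** The reciprocal of the usual partial product, so that multiplying a series by it removes the
    small primes. *)
Definition euler_prod f x := \prod_(1 <= p < x.+1 | prime p) (1 - f p).

Definition rough x n := all (fun q => x < q)%N (primes n).

Lemma has_sum_multiples f l p : (0 < p)%N -> has_sum f l ->
  has_sum (fun n => if (p %| n)%N then f (n %/ p)%N else 0) l.
Proof.
move=> p0 h e e0; have [N hN] := h e e0; exists (N * p)%N => M NM.
by rewrite -big_mkcond/= big_multiples//; apply: hN; rewrite leq_divRL.
Qed.

Lemma roughP x n : (0 < n)%N ->
  reflect (forall q, prime q -> (q %| n)%N -> (x < q)%N) (rough x n).
Proof.
move=> n0; apply: (iffP allP) => h q.
  by move=> qp qn; apply: h; rewrite mem_primes qp n0 qn.
by rewrite mem_primes => /and3P[qp _ qn]; exact: h.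
Qed.

(** The sieve of Eratosthenes on series: multiplication by [1 - f p] subtracts the terms at
    multiples of p. Induction on [x] keeps all products finite. *)
Lemma has_sum_rough f l x : cmul f -> has_sum f l ->
  has_sum (fun n => if rough x n then f n else 0) (l * euler_prod f x).
Proof.
move=> [f1 fM] h; elim: x => [|x ih].
  rewrite /euler_prod big_geq// mulr1; apply: has_sum_ext h => n n0.
  by rewrite (introT (roughP 0 n0))// => q /prime_gt0.
rewrite /euler_prod big_mkcond big_nat_recr//= -big_mkcond/= -/(euler_prod f x).
case: (boolP (prime x.+1)) => xp; last first.
  rewrite mulr1; apply: has_sum_ext ih => n n0; suff -> : rough x.+1 n = rough x n by [].
  apply/(roughP _ n0)/(roughP _ n0) => H q qp qn; first exact/ltnW/H.
  rewrite ltn_neqAle H// andbT; apply/eqP => e; by rewrite e qp in xp.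
have := has_sumD ih (has_sumZ (- f x.+1) (has_sum_multiples (ltn0Sn x) ih)).
have -> : l * euler_prod f x + - f x.+1 * (l * euler_prod f x) =
  l * (euler_prod f x * (1 - f x.+1)) by ring.
apply: has_sum_ext => n n0; case: (boolP (x.+1 %| n)%N) => [/dvdnP[m em]|xn].
  have m0 : (0 < m)%N by move: n0; rewrite em; case: (m).
  rewrite em mulnK// [rough x.+1 _](introF (roughP _ _)); last 2 first.
    by rewrite muln_gt0 m0.
    by move=> /(_ _ xp (dvdn_mull _ (dvdnn _))); rewrite ltnn.
  have -> : rough x (m * x.+1) = rough x m.
    apply/(roughP _ _)/(roughP _ _) => //; first by rewrite muln_gt0 m0.
      by move=> H q qp qn; apply: H => //; exact: dvdn_mulr.
    move=> H q qp; rewrite Euclid_dvdM// => /orP[|]; first exact: H.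
    by rewrite dvdn_prime2// => /eqP ->.
  by case: ifP => _; rewrite ?fM//; ring.
rewrite mulr0 addr0; suff -> : rough x.+1 n = rough x n by [].
apply/(roughP _ n0)/(roughP _ n0) => H q qp qn; first exact/ltnW/H.
rewrite ltn_neqAle H// andbT; apply/eqP => e; by rewrite e qn in xn.
Qed.

(** An x-rough integer n > 1 exceeds x, so once the primes up to x are removed only the term 1 and
    terms beyond x remain. *)
Lemma euler_prod_tail f l x e : cmul f -> has_sum f l ->
  (forall N, \sum_(x.+1 <= n < N.+1) nc (f n) <= e) ->
  nc (l * euler_prod f x - 1) <= e.
Proof.
move=> fM h he; have hr := has_sum_rough x fM h.
case: x => [|x] in he hr *.
  rewrite /euler_prod big_geq// mulr1 in hr *.
  have := @has_sum_tail _ _ _ (e) 1 h.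
  rewrite big_nat1 fM.1; apply => N _; apply: le_trans (nc_sum _ _ _) _.
  apply: le_trans (he N); rewrite [leRHS]big_mkcond/= [leRHS]big_mkcond/=.
  case: N => [|N]; first by rewrite !big_geq.
  by rewrite [leRHS]big_ltn// lerDr nc_ge0.
have := @has_sum_tail _ _ _ e x.+1 hr.
rewrite big_ltn// /rough /= fM.1 big_nat big1 ?addr0; last first.
  move=> i /andP[i2 ix]; case: ifP => // /allP/(_ (pdiv i)).
  rewrite mem_primes pdiv_prime// pdiv_dvd (leq_trans _ i2)// => /(_ isT).
  by rewrite ltnNge (leq_trans (pdiv_leq _) _)// (leq_trans _ i2).
apply => N xN; apply: le_trans (nc_sum _ _ _) _; apply: le_trans (he N).
by apply: ler_sum => i _; case: ifP => // _; rewrite nc0 nc_ge0.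
Qed.

(** |1 - w|^2 = 1 - 2 Re w + |w|^2, and 1 + y <= e^y is applied to the square. *)
Lemma nc_exp_le (w : R[i]) : nc (1 - w) <= expR (- Re w + nc w ^+ 2 / 2).
Proof.
rewrite -(@ler_pXn2r _ 2)// ?nnegrE ?nc_ge0 ?expR_ge0// -expRM_natl.
case: w => a b; have -> : 1 - (a +i* b) = (1 - a) +i* (- b) by apply/eqP; rewrite eq_complex /= sub0r !eqxx.
rewrite !nc_sqr /=; apply: le_trans (expR_ge1Dx _).
by rewrite sqrrN; lra.
Qed.

Lemma euler_prod_le f x (g : nat -> R) :
  (forall p, prime p -> nc (1 - f p) <= expR (g p)) ->
  nc (euler_prod f x) <= expR (\sum_(1 <= p < x.+1 | prime p) g p).
Proof.
move=> h; rewrite /euler_prod expR_sum.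
elim/big_rec2: _ => [|p a b pp ih]; first by rewrite nc1.
by rewrite ncM ler_pM ?nc_ge0 ?expR_ge0 ?h.
Qed.

Lemma re_cis_341 (r c : R) : c ^+ 2 <= 1 -> 0 <= r ->
  0 <= 3 * r + 4 * (r * c) + r * (2 * c ^+ 2 - 1).
Proof.
move=> _ r0; have -> : 3 * r + 4 * (r * c) + r * (2 * c ^+ 2 - 1) = r * (2 * (1 + c) ^+ 2) by ring.
by rewrite mulr_ge0// mulr_ge0// sqr_ge0.
Qed.

(* Bounding each factor by [1 + x <= e^x] loses only the convergent
   [exp (4 * \sum_p r_p ^ 2)]. *)
Lemma euler_prod_341 f0 f1 f2 (r : nat -> R) (z : nat -> R[i]) x :
  (forall p, prime p -> 0 <= r p <= npow 1 p) -> (forall p, nc (z p) = 1) ->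
  (forall p, prime p -> f0 p = (r p)%:C) ->
  (forall p, prime p -> f1 p = (r p)%:C * z p) ->
  (forall p, prime p -> f2 p = (r p)%:C * z p ^+ 2) ->
  nc (euler_prod f0 x) ^+ 3 * nc (euler_prod f1 x) ^+ 4 * nc (euler_prod f2 x) <= expR 8.
Proof.
move=> rp z1 e0 e1 e2.
have h0 := @euler_prod_le f0 x _ (fun p _ => nc_exp_le _).
have h1 := @euler_prod_le f1 x _ (fun p _ => nc_exp_le _).
have h2 := @euler_prod_le f2 x _ (fun p _ => nc_exp_le _).
have H0 := @lerXn2r _ 3 _ _ (nc_ge0 _) (expR_ge0 _) h0.
have H1 := @lerXn2r _ 4 _ _ (nc_ge0 _) (expR_ge0 _) h1.
have := ler_pM (mulr_ge0 (exprn_ge0 3 (nc_ge0 _)) (exprn_ge0 4 (nc_ge0 _))) (nc_ge0 _)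
  (ler_pM (exprn_ge0 3 (nc_ge0 _)) (exprn_ge0 4 (nc_ge0 _)) H0 H1) h2.
move=> /le_trans; apply; rewrite -!expRM_natl -!expRD ler_expR !mulr_sumr -!big_split/=.
apply: le_trans (_ : \sum_(1 <= p < x.+1 | prime p) 4 * npow 2 p <= _).
  apply: ler_sum => p pp; rewrite e0// e1// e2//.
  have /andP[r0 r1] := rp p pp; rewrite !ncM !z1 !nc_real ger0_norm// !mulr1.
  have := z1 p; case: (z p) => a b zz; have := nc_sqr a b; rewrite zz expr1n => ab.
  have -> : (a +i* b) ^+ 2 = (a ^+ 2 - b ^+ 2) +i* (a * b + b * a) by [].
  rewrite /= !mul0r !subr0.
  have h : r p ^+ 2 <= npow 2 p by rewrite -[2]/(1 + 1) npowD -expr2 lerXn2r ?nnegrE ?npow_ge0.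
  have := @re_cis_341 (r p) a _ r0; nra.
rewrite -mulr_sumr; apply: le_trans (_ : 4 * (2 : R) <= 8); last lra.
rewrite ler_wpM2l//; apply: le_trans (sum_inv_sqr R x).
by rewrite big_mkcond/=; apply: ler_sum => i _; case: ifP => // _; rewrite npow_ge0.
Qed.

(** At a finite [K] beyond which the three tails are small, each series times its product over
    primes up to [K] is close to 1. The upper bound for the finite products thus becomes a lower
    bound for the series, without any logarithm of a complex number. *)
Lemma lseries_341 f0 f1 f2 (r : nat -> R) (z : nat -> R[i]) B F0 F1 F2 :
  cmul f0 -> cmul f1 -> cmul f2 ->
  has_sum f0 F0 -> has_sum f1 F1 -> has_sum f2 F2 ->
  (forall n, (0 < n)%N -> nc (f1 n) <= nc (f0 n)) ->
  (forall n, (0 < n)%N -> nc (f2 n) <= nc (f0 n)) -> abs_bound f0 B ->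
  (forall p, prime p -> 0 <= r p <= npow 1 p) -> (forall p, nc (z p) = 1) ->
  (forall p, prime p -> f0 p = (r p)%:C) ->
  (forall p, prime p -> f1 p = (r p)%:C * z p) ->
  (forall p, prime p -> f2 p = (r p)%:C * z p ^+ 2) ->
  expR (-8) / 2 <= nc F0 ^+ 3 * nc F1 ^+ 4 * nc F2.
Proof.
move=> m0 m1 m2 h0 h1 h2 f10 f20 fB rp z1 E0 E1 E2.
(* Each of the 3 + 4 + 1 factors is then at least 15/16, and (15/16)^8 exceeds 1/2, the origin of
   the 2 in the conclusion. *)
have e0 : 0 < 1 / 16 :> R by lra.
have [K hK] := bounded_cauchy (fun n => nc_ge0 (f0 n)) fB e0.
have k1 N : \sum_(K.+1 <= n < N.+1) nc (f1 n) <= 1 / 16.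
  apply: le_trans (hK N); apply: ler_sum_nat => n /andP[n0 _].
  by apply: f10; apply: leq_trans n0.
have k2 N : \sum_(K.+1 <= n < N.+1) nc (f2 n) <= 1 / 16.
  apply: le_trans (hK N); apply: ler_sum_nat => n /andP[n0 _].
  by apply: f20; apply: leq_trans n0.
have low f l : cmul f -> has_sum f l ->
    (forall N, \sum_(K.+1 <= n < N.+1) nc (f n) <= 1 / 16) ->
    15 / 16 <= nc l * nc (euler_prod f K).
  move=> fm fl fk; have := euler_prod_tail fm fl fk.
  have := nc_triB 1 (l * euler_prod f K); rewrite nc1 ncM nc_distrC; lra.
have l0 := low _ _ m0 h0 hK; have l1 := low _ _ m1 h1 k1; have l2 := low _ _ m2 h2 k2.
have c0 : 0 <= 15 / 16 :> R by lra.
have P := euler_prod_341 K rp z1 E0 E1 E2.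
have L : (15 / 16) ^+ 3 * (15 / 16) ^+ 4 * (15 / 16) <=
   (nc F0 ^+ 3 * nc F1 ^+ 4 * nc F2) *
   (nc (euler_prod f0 K) ^+ 3 * nc (euler_prod f1 K) ^+ 4 * nc (euler_prod f2 K)).
  have -> : (nc F0 ^+ 3 * nc F1 ^+ 4 * nc F2) *
   (nc (euler_prod f0 K) ^+ 3 * nc (euler_prod f1 K) ^+ 4 * nc (euler_prod f2 K)) =
   (nc F0 * nc (euler_prod f0 K)) ^+ 3 * (nc F1 * nc (euler_prod f1 K)) ^+ 4 *
   (nc F2 * nc (euler_prod f2 K)) by ring.
  apply: ler_pM; [by rewrite mulr_ge0 ?exprn_ge0|exact: c0| |exact: l2].
  by apply: ler_pM; rewrite ?exprn_ge0// lerXn2r ?nnegrE// (le_trans c0).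
have F0' : 0 <= nc F0 ^+ 3 * nc F1 ^+ 4 * nc F2.
  by rewrite !mulr_ge0 ?exprn_ge0 ?nc_ge0.
have := le_trans L (ler_wpM2l F0' P) => H.
have e8 : expR (-8) * expR 8 = 1 :> R by rewrite -expRD addNr expR0.
rewrite -(ler_pM2r (expR_gt0 8)) mulrAC e8; move: H; set Y := _ * expR 8; lra.
Qed.
End EulerProduct.

(** * Complex functions of a real variable and primitives of (ln x)^k x^(-s-it) *)

Section ComplexDerivative.
Variable R : realType.
Implicit Types (x a b : R) (F f g : R -> R[i]).

Lemma mvt_le (f df : R -> R) a b : a <= b ->
  (forall x, a <= x <= b -> is_derive x 1 f (df x)) ->
  exists2 c, a <= c <= b & f b - f a = df c * (b - a).
Proof.
move=> ab h; have [||c cab e] := @MVT_segment R f df a b ab.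
- by move=> x; rewrite in_itv/= => /andP[ax xb]; apply: h; rewrite !ltW.
- apply: derivable_within_continuous => x; rewrite in_itv/= => xab.
  by have [] := h x xab.
- by exists c => //; move: cab; rewrite in_itv.
Qed.

Definition cder F f x := is_derive x 1 (fun y => Re (F y)) (Re (f x)) /\
  is_derive x 1 (fun y => Im (F y)) (Im (f x)).

Lemma ReD (y z : R[i]) : Re (y + z) = Re y + Re z. Proof. by case: y z => ? ? []. Qed.
Lemma ImD (y z : R[i]) : Im (y + z) = Im y + Im z. Proof. by case: y z => ? ? []. Qed.
Lemma ReN (y : R[i]) : Re (- y) = - Re y. Proof. by case: y. Qed.
Lemma ImN (y : R[i]) : Im (- y) = - Im y. Proof. by case: y. Qed.
Lemma ReM (y z : R[i]) : Re (y * z) = Re y * Re z - Im y * Im z. Proof. by case: y z => ? ? []. Qed.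
Lemma ImM (y z : R[i]) : Im (y * z) = Re y * Im z + Im y * Re z. Proof. by case: y z => ? ? []. Qed.

Lemma is_deriveZl (c : R) (f : R -> R) x df : is_derive x 1 f df ->
  is_derive x 1 (fun y => c * f y) (c * df).
Proof. by move=> h; have := @is_deriveZ _ _ _ f c x 1 df h. Qed.

Lemma cderD F f G g x : cder F f x -> cder G g x ->
  cder (fun y => F y + G y) (fun y => f y + g y) x.
Proof.
move=> [h1 h2] [k1 k2]; split.
  have -> : (fun y => Re (F y + G y)) = (fun y => Re (F y)) + (fun y => Re (G y)).
    by apply/funext => y; rewrite ReD.
  by rewrite ReD; exact: is_deriveD.
have -> : (fun y => Im (F y + G y)) = (fun y => Im (F y)) + (fun y => Im (G y)).
  by apply/funext => y; rewrite ImD.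
by rewrite ImD; exact: is_deriveD.
Qed.

Lemma cderZ F f x (c : R[i]) : cder F f x -> cder (fun y => c * F y) (fun y => c * f y) x.
Proof.
move=> [h1 h2]; split.
  have -> : (fun y => Re (c * F y)) = (fun y => Re c * Re (F y)) - (fun y => Im c * Im (F y)).
    by apply/funext => y; rewrite ReM.
  by rewrite ReM; exact: (is_deriveB (is_deriveZl _ h1) (is_deriveZl _ h2)).
have -> : (fun y => Im (c * F y)) = (fun y => Re c * Im (F y)) + (fun y => Im c * Re (F y)).
  by apply/funext => y; rewrite ImM.
by rewrite ImM; exact: (is_deriveD (is_deriveZl _ h2) (is_deriveZl _ h1)).
Qed.

Lemma cder_ext F f g x : f x = g x -> cder F f x -> cder F g x.
Proof. by rewrite /cder => ->. Qed.

Lemma real_incr (F f g : R -> R) a K :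
  (forall x, a <= x <= a + 1 -> is_derive x 1 F (f x)) ->
  (forall x, a <= x <= a + 1 -> is_derive x 1 f (g x)) ->
  (forall x, a <= x <= a + 1 -> `|g x| <= K) ->
  `|F (a + 1) - F a - f a| <= K.
Proof.
move=> hF hf hg; have aa : a <= a + 1 by lra.
have [c ca ->] := mvt_le aa hF; have /andP[ac ca1] := ca.
rewrite addrAC subrr add0r mulr1.
have [|d /andP[ad dc] ->] := @mvt_le f g a c ac.
  by move=> x /andP[ax xc]; apply: hf; lra.
have gd : `|g d| <= K by apply: hg; lra.
rewrite normrM (ger0_norm (_ : 0 <= c - a)); last lra.
have := normr_ge0 (g d); nra.
Qed.

(** The mean value theorem fails for complex values, so it is applied to the real and the imaginary
    part separately; hence the factor 2. *)
Lemma cder_incr F f g a K :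
  (forall x, a <= x <= a + 1 -> cder F f x) ->
  (forall x, a <= x <= a + 1 -> cder f g x) ->
  (forall x, a <= x <= a + 1 -> nc (g x) <= K) ->
  nc (F (a + 1) - F a - f a) <= 2 * K.
Proof.
move=> hF hf hg; apply: le_trans (nc_le_ReIm _) _.
rewrite !(ReD, ImD, ReN, ImN) mulr_natl mulr2n lerD//.
  apply: (@real_incr (fun x => Re (F x)) (fun x => Re (f x)) (fun x => Re (g x))) => x xa; [exact: (hF x xa).1|exact: (hf x xa).1|].
  exact: le_trans (nc_Re _) (hg x xa).
apply: (@real_incr (fun x => Im (F x)) (fun x => Im (f x)) (fun x => Im (g x))) => x xa; [exact: (hF x xa).2|exact: (hf x xa).2|].
exact: le_trans (nc_Im _) (hg x xa).
Qed.

(** At x = n these are the terms of (-1)^k times the k-th derivative of zeta at s + it; the sign is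
    absorbed into the conventions from here on. *)
Definition W k (s t : R) x : R[i] :=
  (ln x ^+ k * expR (- (s * ln x)))%:C * cis (- (t * ln x)).

Lemma ReZr (r : R) (z : R[i]) : Re (r%:C * z) = r * Re z.
Proof. by case: z => c d /=; rewrite mul0r subr0. Qed.
Lemma ImZr (r : R) (z : R[i]) : Im (r%:C * z) = r * Im z.
Proof. by case: z => c d /=; rewrite mul0r addr0. Qed.

Lemma is_deriveM_fun (f g : R -> R) x df dg : is_derive x 1 f df -> is_derive x 1 g dg ->
  is_derive x 1 (fun y => f y * g y) (f x * dg + g x * df).
Proof. by move=> h k; exact: (is_deriveM h k). Qed.

Lemma is_derive_lnX k x : 0 < x ->
  is_derive x 1 (fun y => ln y ^+ k : R) (k%:R * ln x ^+ k.-1 * x^-1).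
Proof.
move=> x0; have d := is_derive1_ln x0; elim: k => [|k ih].
  rewrite !mul0r (_ : (fun y => _) = cst 1); first exact: is_derive_cst.
  by apply/funext => y; rewrite expr0.
rewrite (_ : (fun y => _) = (fun y => ln y * ln y ^+ k)); last first.
  by apply/funext => y; rewrite exprS.
have /is_derive_eq := is_deriveM_fun d ih; apply.
by case: k {ih} => [|k] /=; rewrite ?expr0 ?exprS; ring.
Qed.

Lemma is_derive_explin (c x : R) : 0 < x ->
  is_derive x 1 (fun y => expR (- (c * ln y)) : R) (- c * x^-1 * expR (- (c * ln x))).
Proof.
move=> x0; have d := is_derive1_ln x0.
have h : is_derive x 1 (fun y => - (c * ln y)) (- c * x^-1).
  rewrite mulNr; exact: (is_deriveN (is_deriveZl c d)).
have := @is_derive1_comp R expR (fun y => - (c * ln y)) x _ _ (is_derive_expR (- (c * ln x))) h.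
by rewrite mulrC.
Qed.

Lemma is_derive_coslin (c x : R) : 0 < x ->
  is_derive x 1 (fun y => cos (- (c * ln y)) : R) (c * x^-1 * sin (- (c * ln x))).
Proof.
move=> x0; have d := is_derive1_ln x0.
have h : is_derive x 1 (fun y => - (c * ln y)) (- c * x^-1).
  rewrite mulNr; exact: (is_deriveN (is_deriveZl c d)).
have := @is_derive1_comp R cos (fun y => - (c * ln y)) x _ _ (is_derive_cos (- (c * ln x))) h.
by move/is_derive_eq; apply; ring.
Qed.

Lemma is_derive_sinlin (c x : R) : 0 < x ->
  is_derive x 1 (fun y => sin (- (c * ln y)) : R) (- c * x^-1 * cos (- (c * ln x))).
Proof.
move=> x0; have d := is_derive1_ln x0.
have h : is_derive x 1 (fun y => - (c * ln y)) (- c * x^-1).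
  rewrite mulNr; exact: (is_deriveN (is_deriveZl c d)).
have := @is_derive1_comp R sin (fun y => - (c * ln y)) x _ _ (is_derive_sin (- (c * ln x))) h.
by move/is_derive_eq; apply; ring.
Qed.

Definition dW k (s t : R) x : R[i] :=
  k%:R * W k.-1 (s + 1) t x - (s +i* t) * W k (s + 1) t x.

Lemma exp_lnS (s x : R) : 0 < x -> expR (- ((s + 1) * ln x)) = expR (- (s * ln x)) * x^-1.
Proof.
by move=> x0; rewrite mulrDl mul1r opprD expRD [expR (- ln x)]expRN lnK ?posrE.
Qed.

Lemma natCE k : k%:R = (k%:R : R)%:C. Proof. by rewrite rmorph_nat. Qed.

Lemma cder_W k s t x : 0 < x -> cder (W k s t) (dW k s t) x.
Proof.
move=> x0; split.
  rewrite (_ : (fun y => _) = (fun y => ln y ^+ k * expR (- (s * ln y)) * cos (- (t * ln y)))); last by apply/funext => y; rewrite ReZr.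
  have := is_deriveM_fun (is_deriveM_fun (is_derive_lnX k x0) (is_derive_explin s x0)) (is_derive_coslin t x0).
  move/is_derive_eq; apply; rewrite /dW /W natCE ReD ReN !ReZr ReM !ReZr !ImZr /= !exp_lnS//.
  ring.
rewrite (_ : (fun y => _) = (fun y => ln y ^+ k * expR (- (s * ln y)) * sin (- (t * ln y)))); last by apply/funext => y; rewrite ImZr.
have := is_deriveM_fun (is_deriveM_fun (is_derive_lnX k x0) (is_derive_explin s x0)) (is_derive_sinlin t x0).
move/is_derive_eq; apply; rewrite /dW /W natCE ImD ImN !ImZr ImM !ReZr !ImZr /= !exp_lnS//.
ring.
Qed.

Lemma nc_W k s t x : 1 <= x -> nc (W k s t x) = ln x ^+ k * expR (- (s * ln x)).
Proof.
by move=> x1; rewrite ncM nc_cis mulr1 nc_real ger0_norm// mulr_ge0 ?expR_ge0// exprn_ge0// ln_ge0.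
Qed.

(** A primitive of [W k s t], from repeated integration by parts: each step divides by s - 1 +
    it. *)
Fixpoint Wprim k (s t : R) x : R[i] :=
  if k is k'.+1 then (k%:R * Wprim k' s t x - W k (s - 1) t x) / ((s - 1) +i* t)
  else - W 0 (s - 1) t x / ((s - 1) +i* t).

Lemma cder_Wprim k s t x : 0 < x -> 1 < s -> cder (Wprim k s t) (W k s t) x.
Proof.
move=> x0 s1; have s0 : (s - 1) +i* t != 0.
  by rewrite eq_complex negb_and/= subr_eq0 gt_eqF.
elim: k => [|k ih] /=.
  rewrite (_ : (fun y => _) = (fun y => - ((s - 1) +i* t)^-1 * W 0 (s - 1) t y)); last first.
    by apply/funext => y; rewrite !mulNr mulrC.
  apply: cder_ext (cderZ (- ((s - 1) +i* t)^-1) (cder_W 0 (s - 1) t x0)).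
  by rewrite /dW mul0r sub0r subrK mulNr mulrN opprK mulKf.
have := cderD (cderZ (k.+1%:R / ((s - 1) +i* t)) ih) (cderZ (- ((s - 1) +i* t)^-1) (cder_W k.+1 (s - 1) t x0)).
set F := fun y => _; set f := fun y => _ => h.
have -> : (fun x0 => (k.+1%:R * Wprim k s t x0 - W k.+1 (s - 1) t x0) / ((s - 1) +i* t)) = F.
  by apply/funext => y; rewrite /F; field.
by apply: cder_ext h; rewrite /f /dW subrK /=; field.
Qed.

(** On [n, n + 1] the quantity 1 + ln x is at most 2 + ln n; being at least 1, it also dominates the
    lower power [k.-1] produced by differentiation. *)
Lemma nc_dW k s t x n : 1 < s -> (0 < n)%N -> n%:R <= x <= n%:R + 1 ->
  nc (dW k s t x) <= (k%:R + nc (s +i* t)) * (2 + ln n%:R) ^+ k * npow 2 n.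
Proof.
move=> s1 n0 /andP[nx xn]; have n1 : 1 <= n%:R :> R by rewrite ler1n.
have x1 : 1 <= x by rlra.
apply: le_trans (ncB _ _) _; rewrite (ncM k%:R) (ncM (s +i* t)) nc_nat !nc_W//.
have l0 := ln_ge0 x1; have ln0 := ln_ge0 n1.
have lx : 1 + ln x <= 2 + ln n%:R.
  have : x <= n%:R * (1 + n%:R^-1) by rewrite mulrDr mulr1 divff ?gt_eqF//; rlra.
  have i0 : 0 < n%:R^-1 :> R by rewrite invr_gt0; rlra.
  have i1 : n%:R^-1 <= 1 :> R by rewrite invf_le1//; rlra.
  rewrite -ler_ln ?posrE; [|rlra|rewrite mulr_gt0//; rlra].
  rewrite lnM ?posrE; [|rlra|rlra] => h.
  have : ln (1 + n%:R^-1) <= n%:R^-1 :> R by apply: le_ln1Dx; rlra.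
  rlra.
have E : expR (- ((s + 1) * ln x)) <= npow 2 n.
  rewrite /npow ler_expR lerN2; apply: ler_pM => //; first rlra.
  by rewrite ler_ln ?posrE//; rlra.
have pw j : (j <= k)%N -> ln x ^+ j <= (2 + ln n%:R) ^+ k.
  move=> jk; apply: le_trans (_ : (1 + ln x) ^+ j <= _).
    by rewrite lerXn2r ?nnegrE//; rlra.
  apply: le_trans (_ : (1 + ln x) ^+ k <= _).
    by rewrite ler_weXn2l//; rlra.
  by rewrite lerXn2r ?nnegrE//; rlra.
have H j : (j <= k)%N -> ln x ^+ j * expR (- ((s + 1) * ln x)) <= (2 + ln n%:R) ^+ k * npow 2 n.
  by move=> jk; apply: ler_pM; rewrite ?exprn_ge0 ?expR_ge0 ?pw.
rewrite -[leRHS]mulrA [leRHS]mulrDl; apply: lerD; rewrite ler_wpM2l ?nc_ge0// H//.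
exact: leq_pred.
Qed.

Lemma Wprim_incr k s t n : 1 < s -> (0 < n)%N ->
  nc (Wprim k s t n.+1%:R - Wprim k s t n%:R - W k s t n%:R) <=
  2 * ((k%:R + nc (s +i* t)) * (2 + ln n%:R) ^+ k * npow 2 n).
Proof.
move=> s1 n0; rewrite -natr1; have n1 : 1 <= n%:R :> R by rewrite ler1n.
apply: (@cder_incr _ _ (dW k s t)) => x /andP[nx xn].
- by apply: cder_Wprim => //; lra.
- by apply: cder_W; lra.
- by apply: nc_dW => //; rewrite nx.
Qed.
End ComplexDerivative.
Arguments W {R} k s t x : simpl never.

(** * Zeta and its derivatives to the right of Re s = 1 *)

Section ZetaBounds.
Variable R : realType.
Implicit Types (s t : R).

Lemma lt_truncnS (x : R) : x < (Num.truncn x).+1%:R.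
Proof. exact: truncnS_gt. Qed.

Lemma npow_to0 (a e : R) : 0 < a -> 0 < e ->
  exists N, forall n, (N <= n)%N -> npow a n <= e.
Proof.
move=> a0 e0; pose M := (a * e)^-1; have M0 : 0 < M by rewrite invr_gt0 mulr_gt0.
exists (Num.truncn (expR M)).+1 => n nN.
have n0 : (0 < n)%N by apply: leq_trans nN.
have ln_M : M <= ln n%:R.
  rewrite -[M]expRK ler_ln ?posrE ?expR_gt0 ?ltr0n//.
  by apply: le_trans (ltW (lt_truncnS _)) _; rewrite ler_nat.
rewrite /npow expRN invf_ple ?posrE ?expR_gt0//; apply: le_trans (expR_ge1Dx _).
have : a * M <= a * ln n%:R by rewrite ler_wpM2l ?(ltW a0).
have -> : a * M = e^-1 by rewrite /M invfM mulrA divff ?gt_eqF// mul1r.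
lra.
Qed.

(** Half of the decay n^(-a) absorbs the power of the logarithm. *)
Lemma ln_npow_le k (a : R) n : 0 < a -> (0 < n)%N ->
  ln n%:R ^+ k * npow a n <= k`!%:R * (a / 2)^-1 ^+ k * npow (a / 2) n.
Proof.
move=> a0 n0; have a2 : 0 < a / 2 by lra.
have := exp_pow_le k a2 (ln_nat_ge0 R n) => h.
apply: le_trans (ler_wpM2r (npow_ge0 a n) h) _.
rewrite -[leLHS]mulrA /npow -expRD; set c := _ * _ ^+ k.
by rewrite (_ : _ + _ = - (a / 2 * ln n%:R))//; field.
Qed.

Lemma nc_Wn k s t n : nc (W k s t n%:R) = ln n%:R ^+ k * npow s n.
Proof.
case: n => [|n]; last by rewrite nc_W// ler1n.
rewrite /W /npow ln0// !mulr0 ncM nc_cis mulr1 nc_real ger0_norm//.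
by rewrite mulr_ge0 ?expR_ge0// exprn_ge0.
Qed.

Lemma W_abs k s : 1 < s -> exists2 B, 0 <= B & forall t, abs_bound (fun n => W k s t n%:R) B.
Proof.
move=> s1; have a0 : 0 < s - 1 by lra.
have a2 : 0 < (s - 1) / 2 by lra.
set a := s - 1 in a0 a2.
pose c := k`!%:R * (a / 2)^-1 ^+ k; have c0 : 0 <= c.
  by rewrite mulr_ge0// exprn_ge0// invr_ge0 ltW.
exists (c * (1 + (a / 2)^-1)).
  by rewrite mulr_ge0// addr_ge0// invr_ge0 ltW.
move=> t N; apply: le_trans (ler_wpM2l c0 (npow_sum N a2)).
rewrite mulr_sumr; apply: ler_sum_nat => n /andP[n0 _]; rewrite nc_Wn.
have -> : s = 1 + a by rewrite /a; lra.
rewrite [npow (1 + a) n]npowD [npow (1 + a / 2) n]npowD mulrCA [leRHS]mulrCA.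
rewrite ler_wpM2l ?npow_ge0//; exact: ln_npow_le.
Qed.

(** (-1)^k times the k-th derivative of zeta at s + it, for [1 < s]. *)
Definition Zk k s t : R[i] := csum (fun n => W k s t n%:R).

Lemma ZkP k s t : 1 < s -> has_sum (fun n => W k s t n%:R) (Zk k s t).
Proof. by move=> /(W_abs k)[B _ /(_ t)]; exact: csumP. Qed.

Lemma Wprim_to0 k s t e : 1 < s -> 0 < e ->
  exists N, forall n, (N <= n)%N -> nc (Wprim k s t n%:R) <= e.
Proof.
move=> s1; have a0 : 0 < s - 1 by lra.
have s0 : (s - 1) +i* t != 0 by rewrite eq_complex negb_and/= gt_eqF.
have S0 : 0 < nc ((s - 1) +i* t).
  rewrite lt_neqAle nc_ge0 andbT eq_sym; apply/eqP => /nc_eq0 h.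
  by rewrite h eqxx in s0.
have W0 j d : 0 < d -> exists N, forall n, (N <= n)%N -> nc (W j (s - 1) t n%:R) <= d.
  move=> d0; have a2 : 0 < (s - 1) / 2 by lra.
  have C0 : 0 < j`!%:R * ((s - 1) / 2)^-1 ^+ j by rewrite mulr_gt0 ?ltr0n ?fact_gt0// exprn_gt0 ?invr_gt0.
  have [N hN] := npow_to0 a2 (divr_gt0 d0 C0).
  exists (maxn 1 N) => n; rewrite geq_max => /andP[n0 /hN h]; rewrite nc_Wn.
  apply: le_trans (ln_npow_le j a0 n0) _.
  by rewrite mulrC -ler_pdivlMr.
elim: k e => [|k ih] e e0 /=.
  have [N hN] := W0 0%N _ (mulr_gt0 e0 S0); exists N => n /hN h.
  by rewrite ncM ncN ncV ler_pdivrMr.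
have d0 : 0 < e * nc ((s - 1) +i* t) / 2 by rewrite divr_gt0// mulr_gt0.
have [N hN] := W0 k.+1 _ d0.
have k0 : 0 < k.+1%:R :> R by rewrite ltr0n.
have [M hM] := ih _ (divr_gt0 d0 k0); exists (maxn N M) => n.
rewrite geq_max => /andP[/hN h1 /hM h2]; rewrite ncM ncV ler_pdivrMr//.
apply: le_trans (ncB _ _) _; rewrite ncM nc_nat.
rewrite ler_pdivlMr// mulrC in h2; lra.
Qed.

Definition Ktail k : R := 3 * (k`!%:R * 2 ^+ k * expR 1).
Lemma Ktail_ge0 k : 0 <= Ktail k.
Proof. by rewrite !mulr_ge0 ?expR_ge0// exprn_ge0. Qed.

(** With v = ln (n/X) one has 2 + ln n <= (2 + ln X) (1 + v), and (1 + v)^k costs at most a constant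
    times (n/X)^(1/2); what is left is the tail of n^(-3/2). *)
Lemma lnpow_tail k X N : (0 < X)%N ->
  \sum_(X <= n < N.+1) (2 + ln n%:R) ^+ k * npow 2 n <=
  Ktail k * (2 + ln X%:R) ^+ k * npow 1 X.
Proof.
move=> X0; have lX := ln_nat_ge0 R X.
pose c : R := k`!%:R * 2 ^+ k * expR 1.
have c0 : 0 <= c by rewrite !mulr_ge0 ?expR_ge0// exprn_ge0.
pose A := (2 + ln X%:R) ^+ k * c * npow (1 / 2) X.
have l2 : 0 <= 2 + ln X%:R :> R by rlra.
have A0 : 0 <= A by rewrite /A mulr_ge0 ?npow_ge0// mulr_ge0// exprn_ge0.
apply: le_trans (_ : \sum_(X <= n < N.+1) A * npow (3 / 2) n <= _).
  apply: ler_sum_nat => n /andP[Xn _].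
  have n0 : (0 < n)%N by apply: leq_trans Xn.
  have v0 : 0 <= ln n%:R - ln X%:R :> R by rewrite subr_ge0 ln_nat_le.
  set v := ln n%:R - ln X%:R in v0.
  have h1 : (2 + ln n%:R) ^+ k <= (2 + ln X%:R) ^+ k * (1 + v) ^+ k.
    rewrite -exprMn lerXn2r ?nnegrE; [by []|by rewrite addr_ge0 ?ln_nat_ge0|by rewrite mulr_ge0; rlra|].
    have -> : ln n%:R = ln X%:R + v by rewrite /v; rlra.
    by have := mulr_ge0 lX v0; clearbody v; rlra.
  have h2 : (1 + v) ^+ k <= c * expR (v / 2).
    have h12 : 0 < 1 / 2 :> R by rlra.
    have v1 : 0 <= 1 + v by rlra.
    apply: le_trans (exp_pow_le k h12 v1) _.
    have -> : (1 / 2 : R)^-1 = 2 by rewrite div1r invrK.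
    rewrite /c -!mulrA ler_wpM2l// ler_wpM2l ?exprn_ge0// -expRD ler_expR; rlra.
  have h3 : expR (v / 2) * npow 2 n = npow (1 / 2) X * npow (3 / 2) n.
    by rewrite /npow -!expRD; congr expR; rewrite /v; field.
  have p0 : 0 <= (2 + ln X%:R) ^+ k :> R by rewrite exprn_ge0//; rlra.
  apply: le_trans (ler_wpM2r (npow_ge0 2 n) (le_trans h1 (ler_wpM2l p0 h2))) _.
  by rewrite mulrA -[leLHS]mulrA h3 /A; rlra.
rewrite -mulr_sumr; have h12 : 0 < 1 / 2 :> R by rlra.
have [NX|XN] := ltnP N X.
  by rewrite big_geq// mulr0 mulr_ge0 ?npow_ge0// mulr_ge0 ?Ktail_ge0// exprn_ge0.
have e3 : 3 / 2 = 1 + 1 / 2 :> R by rlra.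
have h4 : \sum_(X <= n < N.+1) npow (3 / 2) n <= 3 * npow (1 / 2) X :> R.
  rewrite big_ltn ?ltnS//.
  have := npow_tail N h12 X0; rewrite -e3 => h5.
  have h6 : npow (3 / 2) X <= npow (1 / 2) X :> R by apply: npow_le; rlra.
  have -> : 3 * npow (1 / 2) X = npow (1 / 2) X + npow (1 / 2) X / (1 / 2) :> R by field.
  exact: lerD.
apply: le_trans (ler_wpM2l A0 h4) _.
have eh : 1 / 2 + 1 / 2 = 1 :> R by rlra.
have e12 : npow (1 / 2 + 1 / 2) X = npow (1 / 2) X * npow (1 / 2) X :> R := npowD _ _ _.
rewrite eh in e12; rewrite e12.
by rewrite /A /Ktail -/c; rlra.
Qed.

(** First-order Euler-Maclaurin summation: from X on, the series is replaced by minus the primitive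
    at X, with an error that grows with |s + it| but decays like 1/X up to logarithms. X = 1
    isolates the pole, and X close to |t| bounds the series at height t. *)
Lemma Zk_approx k s t X : 1 < s -> (0 < X)%N ->
  nc (Zk k s t - \sum_(1 <= n < X) W k s t n%:R + Wprim k s t X%:R) <=
  2 * (k%:R + nc (s +i* t)) * (Ktail k * (2 + ln X%:R) ^+ k * npow 1 X).
Proof.
move=> s1; case: X => // X X0.
apply/ler_addgt0Pr => e e0; have [N1 hN1] := Wprim_to0 k t s1 e0.
have h := @has_sum_tail _ _ (Zk k s t - (- Wprim k s t X.+1%:R)) 
  (2 * (k%:R + nc (s +i* t)) * (Ktail k * (2 + ln X.+1%:R) ^+ k * npow 1 X.+1) + e) X.
have : nc (Zk k s t - \sum_(1 <= n < X.+1) W k s t n%:R - (- Wprim k s t X.+1%:R)) <=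
  2 * (k%:R + nc (s +i* t)) * (Ktail k * (2 + ln X.+1%:R) ^+ k * npow 1 X.+1) + e; last by rewrite opprK.
apply/ler_addgt0Pr => d d0; have [N2 hN2] := ZkP k t s1 d0.
pose N := maxn X.+1 (maxn N1 N2).
have XN : (X.+1 <= N.+1)%N by rewrite ltnS /N (leq_trans (leqnSn X))// leq_maxl.
have h2 : nc (Zk k s t - \sum_(1 <= n < N.+1) W k s t n%:R) <= d.
  by apply: hN2; rewrite /N !leq_max leqnn !orbT.
have h1 : nc (Wprim k s t N.+1%:R) <= e.
  by apply: hN1; rewrite leqW// /N !leq_max leqnn !orbT.
rewrite (sum_split _ _ XN)// in h2.
have tele : Wprim k s t N.+1%:R - Wprim k s t X.+1%:R =
   \sum_(X.+1 <= n < N.+1) (Wprim k s t n.+1%:R - Wprim k s t n%:R).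
  by rewrite telescope_sumr// ltnS.
have h3 : nc (Wprim k s t N.+1%:R - Wprim k s t X.+1%:R - \sum_(X.+1 <= n < N.+1) W k s t n%:R) <=
    2 * (k%:R + nc (s +i* t)) * (Ktail k * (2 + ln X.+1%:R) ^+ k * npow 1 X.+1).
  rewrite tele -sumrB; apply: le_trans (nc_sum _ _ _) _.
  have kk : 0 <= 2 * (k%:R + nc (s +i* t)) by rewrite mulr_ge0// addr_ge0// nc_ge0.
  apply: le_trans (ler_wpM2l kk (lnpow_tail k N X0)).
  rewrite mulr_sumr; apply: ler_sum_nat => n /andP[Xn _].
  have := Wprim_incr k t s1 (leq_trans X0 Xn); lra.
set S1 := \sum_(1 <= _ < _) _ in h2 *; set S2 := \sum_(X.+1 <= _ < _) _ in h2 h3.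
set Z := Zk k s t in h2 *; set G := Wprim _ _ _ _ in h1 h3; set G' := Wprim k s t X.+1%:R in h3 *.
have -> : Z - S1 - - G' = (Z - (S1 + S2)) + (G - (G - G' - S2)) by ring.
have := ncD (Z - (S1 + S2)) (G - (G - G' - S2)); have := ncB G (G - G' - S2); lra.
Qed.

Definition lam t : R := 2 + ln (2 + `|t|).
Lemma lam_ge2 t : 2 <= lam t.
Proof. by rewrite lerDl ln_ge0//; have := normr_ge0 t; lra. Qed.
Lemma lam_gt0 t : 0 < lam t. Proof. by have := lam_ge2 t; lra. Qed.
Lemma lam_double t : lam (2 * t) <= 2 * lam t.
Proof.
rewrite /lam; have a0 := normr_ge0 t; suff : ln (2 + `|2 * t|) <= 2 * ln (2 + `|t|) by lra.
have -> : 2 * ln (2 + `|t|) = ln ((2 + `|t|) * (2 + `|t|)).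
  by rewrite lnM ?posrE; lra.
rewrite normrM ger0_norm// ler_ln ?posrE; nra.
Qed.

(** (-1)^k times the k-th derivative of 1/(s - 1), taken at s + it. *)
Definition polar k s t : R[i] := k`!%:R / ((s - 1) +i* t) ^+ k.+1.

Lemma Wprim1 k s t : 1 < s -> Wprim k s t 1 = - polar k s t.
Proof.
move=> s1; have s0 : (s - 1) +i* t != 0 by rewrite eq_complex negb_and/= gt_eqF//; lra.
have W1 j : W j (s - 1) t 1 = (j == 0)%:R.
  rewrite /W ln1 !mulr0 oppr0 expR0 cis0 expr0n !mulr1; by case: j.
elim: k => [|k ih] /=; first by rewrite W1 /polar fact0 expr1 mulNr.
rewrite ih W1 subr0 /polar factS natrM !exprSr; move: s0; set S := (_ +i* _) => s0.
by rewrite !invfM; ring.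
Qed.

Lemma nc_polar k s t : nc (polar k s t) = k`!%:R / nc ((s - 1) +i* t) ^+ k.+1.
Proof. by rewrite /polar ncM nc_nat ncV ncX. Qed.

Lemma nc_le_add s t : nc (s +i* t) <= `|s| + `|t|.
Proof. exact: nc_le_ReIm. Qed.

Lemma Zk_polar k : exists2 C : R, 0 <= C & forall s t, 1 < s <= 2 -> `|t| <= 1 ->
  nc (Zk k s t - polar k s t) <= C.
Proof.
move: (Ktail k) (Ktail_ge0 k) (Zk_approx k) => K K0 hK.
exists (2 * (k%:R + 3) * (K * 2 ^+ k)).
  have k3 : 0 <= k%:R + 3 :> R by rewrite addr_ge0.
  by rewrite mulr_ge0// mulr_ge0// exprn_ge0.
move=> s t /andP[s1 s2] t1; have := hK s t 1%N s1 (ltn0Sn 0).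
rewrite big_geq// subr0 Wprim1// ln1 addr0 npow1 mulr1 => /le_trans; apply.
rewrite ler_wpM2r ?mulr_ge0 ?exprn_ge0//.
by rewrite ler_wpM2l// lerD2l; have := nc_le_add s t; rewrite (ger0_norm (_ : 0 <= s)); lra.
Qed.

Lemma harmonic_le N : \sum_(1 <= n < N.+1) npow 1 n <= 1 + ln N%:R :> R.
Proof.
elim: N => [|N ih]; first by rewrite big_geq// ln0// addr0.
rewrite big_nat_recr//= npow_1//; case: N ih => [|N] ih.
  by rewrite big_geq// ln1 invr1; lra.
by apply: le_trans (lerD ih (lexx _)) _; rewrite -addrA lerD2l ln_succ_ge.
Qed.

Lemma Wprim_bound k : exists2 C : R, 0 <= C & forall s t X, 1 < s -> 1 <= `|t| -> (0 < X)%N ->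
  nc (Wprim k s t X%:R) <= C * (1 + ln X%:R) ^+ k.
Proof.
have Wb j s t X : 1 < s -> nc (W j (s - 1) t X%:R) <= (1 + ln X%:R) ^+ j.
  move=> s1; rewrite nc_Wn; have l0 := ln_nat_ge0 R X.
  apply: le_trans (_ : ln X%:R ^+ j <= _).
    rewrite ler_piMr ?exprn_ge0// /npow expR_le1 oppr_le0 mulr_ge0//; lra.
  by rewrite lerXn2r ?nnegrE//; lra.
have S1 s t : 1 <= `|t| -> (nc ((s - 1) +i* t))^-1 <= 1.
  move=> t1; have := nc_Im ((s - 1) +i* t) => /= h.
  by rewrite invf_le1//; lra.
have Sdiv (z : R[i]) s t B : 1 <= `|t| -> nc z <= B -> nc (z / ((s - 1) +i* t)) <= B.
  move=> t1 zB; rewrite ncM ncV; apply: le_trans zB.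
  by rewrite ler_piMr ?nc_ge0// S1.
elim: k => [|k [C C0 ih]].
  exists 1 => // s t X s1 t1 X0; rewrite /= expr0 mulr1; apply: Sdiv => //.
  by rewrite ncN; have := Wb 0%N s t X s1; rewrite expr0.
exists (k.+1%:R * C + 1); first by rewrite addr_ge0// mulr_ge0.
move=> s t X s1 t1 X0 /=; apply: Sdiv => //; apply: le_trans (ncB _ _) _.
rewrite mulrDl mul1r lerD ?Wb// ncM nc_nat -mulrA ler_wpM2l//.
apply: le_trans (ih s t X s1 t1 X0) _; rewrite ler_wpM2l// exprS.
have l0 := ln_nat_ge0 R X; rewrite ler_peMl ?exprn_ge0//; lra.
Qed.

Lemma Zk_far k : exists2 C : R, 0 <= C & forall s t, 1 < s <= 2 -> 1 <= `|t| ->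
  nc (Zk k s t) <= C * lam t ^+ k.+1.
Proof.
have [C C0 hC] := Wprim_bound k.
move: (Ktail k) (Ktail_ge0 k) (Zk_approx k) => K K0 hK.
exists (1 + C + 2 * (k%:R + 3) * K).
  by rewrite !addr_ge0// !mulr_ge0// addr_ge0.
(* This cut-off keeps (k + |s + it|) / X bounded, while the terms before X still sum to at most
   lam(t)^(k+1). *)
move=> s t /andP[s1 s2] t1; pose X := (Num.truncn `|t|).+1.
have t0 := normr_ge0 t; have X1 : `|t| < X%:R := lt_truncnS _.
have X2 : X%:R <= 1 + `|t|.
  by rewrite /X -addn1 natrD addrC lerD2l truncn_le.
have X3 : 1 <= X%:R :> R by rewrite ler1n.
have lX : 2 + ln X%:R <= lam t.
  by rewrite /lam lerD2l ler_ln ?posrE; rlra.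
have l0 := ln_nat_ge0 R X; have L := lam_ge2 t.
have h := hK s t X s1 (ltn0Sn (Num.truncn `|t|)).
set S := \sum_(1 <= n < X) _ in h; set G := Wprim _ _ _ _ in h.
have Lk : (2 + ln X%:R) ^+ k <= lam t ^+ k by rewrite lerXn2r ?nnegrE//; rlra.
have Lk1 : lam t ^+ k <= lam t ^+ k.+1.
  by rewrite exprS ler_peMl ?exprn_ge0//; rlra.
have hS : nc S <= lam t ^+ k.+1.
  apply: le_trans (nc_sum _ _ _) _.
  apply: le_trans (_ : \sum_(1 <= n < X.+1) lam t ^+ k * npow 1 n <= _); last first.
    rewrite -mulr_sumr exprSr ler_wpM2l ?exprn_ge0//; first rlra.
    by have := harmonic_le X; rlra.
  apply: (@le_trans _ _ (\sum_(1 <= i < X) lam t ^+ k * npow 1 i)); last first.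
    by rewrite [leRHS]big_nat_recr//= lerDl mulr_ge0 ?npow_ge0// exprn_ge0; rlra.
  apply: ler_sum_nat => n /andP[n0 nX]; rewrite nc_Wn; apply: ler_pM.
  - by rewrite exprn_ge0// ln_nat_ge0.
  - exact: npow_ge0.
  - have := ln_nat_le R n0 (ltnW nX); have := ln_nat_ge0 R n => ? ?.
    by rewrite lerXn2r ?nnegrE//; rlra.
  - by apply: npow_le; rlra.
have hG : nc G <= C * lam t ^+ k.+1.
  apply: le_trans (hC s t X s1 t1 isT) _; rewrite ler_wpM2l//; apply: le_trans Lk1.
  by rewrite lerXn2r ?nnegrE//; rlra.
have hE : 2 * (k%:R + nc (s +i* t)) * (K * (2 + ln X%:R) ^+ k * npow 1 X) <=
   2 * (k%:R + 3) * K * lam t ^+ k.+1.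
  rewrite npow_1//; have k0 : 0 <= k%:R :> R by [].
  have sX : k%:R + nc (s +i* t) <= (k%:R + 3) * X%:R.
    have := nc_le_add s t; rewrite (ger0_norm (_ : 0 <= s)); [nra|rlra].
  have i0 : 0 < X%:R^-1 :> R by rewrite invr_gt0; rlra.
  have sX' : (k%:R + nc (s +i* t)) * X%:R^-1 <= k%:R + 3.
    by rewrite ler_pdivrMr//; rlra.
  have -> : 2 * (k%:R + nc (s +i* t)) * (K * (2 + ln X%:R) ^+ k * X%:R^-1) =
    2 * ((k%:R + nc (s +i* t)) * X%:R^-1) * K * (2 + ln X%:R) ^+ k by ring.
  apply: ler_pM; rewrite ?mulr_ge0 ?exprn_ge0 ?addr_ge0 ?nc_ge0 ?(ltW i0)//; last by rlra.
  by rewrite ler_wpM2r// ler_wpM2l.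
have -> : Zk k s t = (Zk k s t - S + G) + S - G by ring.
have := ncB (Zk k s t - S + G + S) G; have := ncD (Zk k s t - S + G) S; rlra.
Qed.

Lemma Zk_away k (t0 : R) : 0 < t0 -> exists2 C : R, 0 < C & forall s t, 1 < s <= 2 -> t0 <= `|t| ->
  nc (Zk k s t) <= C * lam t ^+ k.+1.
Proof.
move=> t00; have [C1 C10 h1] := Zk_far k; have [C2 C20 h2] := Zk_polar k.
have P0 : 0 <= k`!%:R / t0 ^+ k.+1 by rewrite divr_ge0// exprn_ge0// ltW.
exists (C1 + C2 + k`!%:R / t0 ^+ k.+1 + 1); first lra.
move=> s t s12 tt; have L : 1 <= lam t ^+ k.+1.
  by rewrite exprn_ege1//; have := lam_ge2 t; lra.
have [t1|/ltW t1] := lerP `|t| 1; last first.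
  by apply: le_trans (h1 s t s12 t1) _; rewrite ler_wpM2r//; lra.
have := nc_triB (Zk k s t) (polar k s t); have := h2 s t s12 t1.
suff : nc (polar k s t) <= k`!%:R / t0 ^+ k.+1 by nra.
rewrite nc_polar ler_wpM2l// lef_pV2 ?posrE ?exprn_gt0//.
  by rewrite lerXn2r ?nnegrE ?nc_ge0 ?(ltW t00)// (le_trans tt)//; exact: (nc_Im ((s-1) +i* t)).
by rewrite (lt_le_trans t00)// (le_trans tt)//; exact: (nc_Im ((s-1) +i* t)).
Qed.

Lemma exp_taylor1 (y : R) : 0 <= y -> `|expR (- y) - 1 + y| <= y ^+ 2.
Proof.
move=> y0; have h1 := expR_ge1Dx (- y).
have h2 : expR (- y) <= (1 + y)^-1.
  by rewrite expRN lef_pV2 ?posrE ?expR_gt0// ?expR_ge1Dx//; lra.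
have y1 : 0 < 1 + y by lra.
have h3 : (1 + y)^-1 - 1 + y <= y ^+ 2.
  have -> : (1 + y)^-1 - 1 + y = y ^+ 2 / (1 + y) by field; rewrite gt_eqF.
  by rewrite ler_piMr ?sqr_ge0// invf_le1//; lra.
rewrite ger0_norm; lra.
Qed.

Lemma Z0_step (smin : R) : 1 < smin -> exists2 M : R, 0 <= M & forall s h t, smin <= s -> 0 <= h ->
  nc (Zk 0 (s + h) t - Zk 0 s t + h%:C * Zk 1 s t) <= h ^+ 2 * M.
Proof.
move=> s1; have [M M0 hM] := W_abs 2 s1; exists M => // s h t ss h0.
have s1' : 1 < s by lra. have s2' : 1 < s + h by lra.
have := has_sumD (has_sumD (ZkP 0 t s2') (has_sumZ (-1) (ZkP 0 t s1'))) (has_sumZ h%:C (ZkP 1 t s1')).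
rewrite mulN1r => /has_sum_abs_le; apply => N.
apply: le_trans (ler_wpM2l (sqr_ge0 h) (hM t N)); rewrite mulr_sumr.
apply: ler_sum_nat => n /andP[n0 _].
have -> : W 0 (s + h) t n%:R + -1 * W 0 s t n%:R + h%:C * W 1 s t n%:R =
   (npow s n * (expR (- (h * ln n%:R)) - 1 + h * ln n%:R))%:C * cis (- (t * ln n%:R)).
  rewrite /W /npow !expr0 !mul1r expr1.
  have -> : - ((s + h) * ln n%:R) = - (s * ln n%:R) + - (h * ln n%:R) by ring.
  rewrite expRD; move: (expR (- (s * ln n%:R))) (expR (- (h * ln n%:R))) => a b.
  by rewrite !(rmorphM, rmorphD, rmorphN, rmorph1) /=; ring.
rewrite ncM nc_cis mulr1 nc_real normrM (ger0_norm (npow_ge0 _ _)) nc_Wn.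
have hl : 0 <= h * ln n%:R by rewrite mulr_ge0 ?ln_nat_ge0.
apply: le_trans (ler_wpM2l (npow_ge0 _ _) (exp_taylor1 hl)) _.
rewrite exprMn mulrCA ler_wpM2l ?sqr_ge0// mulrC ler_wpM2l ?sqr_ge0//.
exact: npow_le.
Qed.

(** Differentiation under the sum is avoided: the interval is cut into K + 1 steps, every
    first-order step has an error quadratic in its length, and the total error tends to 0 as K
    grows. *)
Lemma Z0_lip (s h t S : R) : 1 < s -> 0 <= h ->
  (forall s', s <= s' <= s + h -> nc (Zk 1 s' t) <= S) ->
  nc (Zk 0 (s + h) t - Zk 0 s t) <= h * S.
Proof.
move=> s1 h0 hS; have [M M0 hM] := Z0_step s1.
have key K : nc (Zk 0 (s + h) t - Zk 0 s t) <= h * S + h ^+ 2 * M / K.+1%:R.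
  pose d := h / K.+1%:R; have K0 : 0 < K.+1%:R :> R by rewrite ltr0n.
  have d0 : 0 <= d by rewrite divr_ge0// ltW.
  have dK : d * K.+1%:R = h by rewrite divfK ?gt_eqF.
  have ind j : (j <= K.+1)%N -> nc (Zk 0 (s + d * j%:R) t - Zk 0 s t) <= j%:R * (d * S + d ^+ 2 * M).
    elim: j => [|j ih] jK; first by rewrite mulr0 addr0 subrr nc0 mul0r.
    have jK' : (j%:R : R) <= K.+1%:R by rewrite ler_nat ltnW.
    have dj0 : 0 <= d * j%:R by rewrite mulr_ge0.
    have djh : d * j%:R <= h by rewrite -dK ler_wpM2l.
    have H1 : nc (Zk 0 (s + d * j%:R + d) t - Zk 0 (s + d * j%:R) t + d%:C * Zk 1 (s + d * j%:R) t) <= d ^+ 2 * M.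
      by apply: hM => //; lra.
    have H2 : nc (Zk 1 (s + d * j%:R) t) <= S by apply: hS; lra.
    have H3 := ler_wpM2l d0 H2.
    have -> : s + d * j.+1%:R = s + d * j%:R + d by rewrite -natr1; ring.
    have {}ih := ih (ltnW jK).
    set a := Zk 0 (s + d * j%:R + d) t in H1 *; set b := Zk 0 (s + d * j%:R) t in H1 ih.
    set c := Zk 1 _ _ in H1 H3.
    have -> : a - Zk 0 s t = (b - Zk 0 s t) + ((a - b + d%:C * c) - d%:C * c) by ring.
    have := ncD (b - Zk 0 s t) ((a - b + d%:C * c) - d%:C * c).
    have := ncB (a - b + d%:C * c) (d%:C * c).
    rewrite ncM nc_real (ger0_norm d0) -natr1; lra.
  have := ind K.+1 (leqnn _); rewrite dK => /le_trans; apply.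
  rewrite /d le_eqVlt; apply/orP; left; apply/eqP; move: (K.+1%:R) K0 => k K0.
  by field; rewrite gt_eqF.
apply/ler_addgt0Pr => e e0; pose K := Num.truncn (h ^+ 2 * M / e).
apply: le_trans (key K) _; rewrite lerD2l ler_pdivrMr ?ltr0n// [leRHS]mulrC -ler_pdivrMr//.
exact/ltW/lt_truncnS.
Qed.

Lemma cmul_W s t : cmul (fun n => W 0 s t n%:R).
Proof.
split; first by rewrite /W ln1 expr0 !mulr0 oppr0 expR0 cis0 !mulr1.
move=> m n m0 n0; rewrite /W !expr0 !mul1r ln_natM// !mulrDr !opprD expRD cisD rmorphM.
ring.
Qed.

Lemma cmul_npow s : cmul (fun n => (npow s n)%:C : R[i]).
Proof. by split=> [|m n m0 n0]; rewrite ?npow1// npowM// rmorphM. Qed.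

Lemma npow_csum s : 1 < s -> exists2 l : R[i], has_sum (fun n => (npow s n)%:C) l &
  nc l <= 1 + (s - 1)^-1.
Proof.
move=> s1; have a0 : 0 < s - 1 by lra.
have ab : abs_bound (fun n => (npow s n)%:C : R[i]) (1 + (s - 1)^-1).
  move=> N; have := npow_sum N a0; rewrite addrC subrK => /(le_trans _); apply.
  by apply: ler_sum => n _; rewrite nc_real ger0_norm ?npow_ge0.
have [l hl] := abs_bound_sum ab; exists l => //; exact: has_sum_abs_le hl ab.
Qed.

(** The three series are taken at s, s + it and s + 2it; of the first only the bound 1 + 1/(s - 1)
    is kept. *)
Lemma Z0_341 s t : 1 < s -> expR (-8) / 2 <= (1 + (s - 1)^-1) ^+ 3 * nc (Zk 0 s t) ^+ 4 * nc (Zk 0 s (2 * t)).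
Proof.
move=> s1; have [l hl lB] := npow_csum s1.
have [B B0 hB] := W_abs 0 s1.
have ab : abs_bound (fun n => (npow s n)%:C : R[i]) B.
  move=> N; apply: le_trans (hB 0 N); apply: ler_sum => n _.
  by rewrite nc_real nc_Wn expr0 mul1r ger0_norm ?npow_ge0.
have H := @lseries_341 R _ _ _ (npow s) (fun n => cis (- (t * ln n%:R))) B _ _ _
  (cmul_npow s) (cmul_W s t) (cmul_W s (2 * t)) hl (ZkP 0 t s1) (ZkP 0 (2 * t) s1).
have nW u n : nc (W 0 s u n%:R) <= nc (npow s n)%:C.
  by rewrite nc_real nc_Wn expr0 mul1r ger0_norm ?npow_ge0.
have {}H := H (fun n _ => nW _ n) (fun n _ => nW _ n) ab; apply: le_trans (H _ _ _ _ _) _.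
- by move=> p _; rewrite npow_ge0 npow_le// ltW.
- by move=> p; rewrite nc_cis.
- by [].
- by move=> p _; rewrite /W expr0 mul1r.
- move=> p _; rewrite /W expr0 mul1r -cisMn; congr (_ * cis _); ring.
- rewrite ler_wpM2r ?nc_ge0// ler_wpM2r ?exprn_ge0 ?nc_ge0//.
  by rewrite lerXn2r ?nnegrE ?nc_ge0// (le_trans (nc_ge0 _) lB).
Qed.

(* [c0] is chosen so that moving from [1 + c0 / Lam ^ 9] down to [s] costs at most
   half of the 3-4-1 lower bound. *)
Lemma lower_from_341 (E C0 C1 : R) : 0 < E -> 0 < C0 -> 0 < C1 -> exists2 c : R, 0 < c &
  forall (F : R -> R[i]) Lam, 1 <= Lam ->
  (forall s, 1 < s <= 2 -> E <= (1 + (s - 1)^-1) ^+ 3 * nc (F s) ^+ 4 * (C0 * Lam)) ->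
  (forall s s', 1 < s -> s <= s' -> s' <= 2 -> nc (F s' - F s) <= (s' - 1) * (C1 * Lam ^+ 2)) ->
  forall s, 1 < s <= 2 -> c <= nc (F s) * Lam ^+ 7.
Proof.
move=> E0 C00 C10; pose c1 := E / (8 * C0); have c10 : 0 < c1 by rewrite divr_gt0// mulr_gt0.
pose c0 := Num.min 1 (c1 / (16 * C1 ^+ 4)).
have C14 : 0 < C1 ^+ 4 by rewrite exprn_gt0.
have c00 : 0 < c0 by rewrite lt_min ltr01 divr_gt0// mulr_gt0.
have c0_1 : c0 <= 1 by rewrite ge_min lexx.
have c0_2 : 16 * C1 ^+ 4 * c0 <= c1.
  by rewrite mulrC -ler_pdivlMr ?mulr_gt0// ge_min lexx orbT.
exists (C1 * c0); first by rewrite mulr_gt0.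
move=> F Lam L1 h341 hlip; have L0 : 0 < Lam by exact: lt_le_trans L1.
have low s : 1 < s <= 2 -> c1 * (s - 1) ^+ 3 <= nc (F s) ^+ 4 * Lam.
  move=> s12; have := h341 s s12; move: s12 => /andP[s1 s2] h; have a0 : 0 < s - 1 by rewrite subr_gt0.
  have i2 : 1 + (s - 1)^-1 <= 2 / (s - 1).
    by rewrite ler_pdivlMr// mulrDl mulVf ?gt_eqF//; rlra.
  have i3 : (1 + (s - 1)^-1) ^+ 3 <= (2 / (s - 1)) ^+ 3.
    by rewrite lerXn2r ?nnegrE ?addr_ge0 ?invr_ge0 ?divr_ge0// ltW.
  have : E <= (2 / (s - 1)) ^+ 3 * nc (F s) ^+ 4 * (C0 * Lam).
    apply: le_trans h _; rewrite ler_wpM2r ?mulr_ge0 ?(ltW C00) ?(ltW L0)//.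
    by rewrite ler_wpM2r// exprn_ge0 ?nc_ge0.
  rewrite expr_div_n => h4; rewrite /c1 mulrAC ler_pdivrMr ?mulr_gt0//.
  have d0 : 0 < (s - 1) ^+ 3 by rewrite exprn_gt0.
  rewrite -ler_pdivlMr//; apply: le_trans h4 _; move: (nc _ ^+ 4) => Q.
  by rewrite (_ : _ / _ * Q * _ = Q * Lam * (8 * C0) / (s - 1) ^+ 3)//; field; rewrite gt_eqF.
(* At 1 + th the 3-4-1 inequality makes |F|^4 at least of order th^3 / Lam, and moving costs th
   Lam^2. With th of order Lam^(-9) both |F| and the cost are of order Lam^(-7). *)
pose th := c0 / Lam ^+ 9; have th0 : 0 < th by rewrite divr_gt0// exprn_gt0.
have th1 : th <= 1.
  by rewrite ler_pdivrMr ?exprn_gt0// mul1r (le_trans c0_1)// exprn_ege1.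
have big s' : 1 + th <= s' <= 2 -> 2 * C1 * c0 <= nc (F s') * Lam ^+ 7.
  move=> /andP[ss' s2']; have s1' : 1 < s' <= 2 by rewrite s2' andbT (lt_le_trans _ ss')// ltrDl.
  have h := low s' s1'.
  rewrite -(@ler_pXn2r _ 4)// ?nnegrE; last 2 first.
  - by rewrite !mulr_ge0// ltW.
  - by rewrite mulr_ge0 ?nc_ge0// exprn_ge0// ltW.
  rewrite [leRHS]exprMn -exprM.
  have -> : (2 * C1 * c0) ^+ 4 = 16 * C1 ^+ 4 * c0 * c0 ^+ 3 by ring.
  have h5 : th ^+ 3 <= (s' - 1) ^+ 3 by rewrite lerXn2r ?nnegrE ?(ltW th0)//; rlra.
  have h6 : c1 * th ^+ 3 <= nc (F s') ^+ 4 * Lam.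
    by apply: le_trans h; rewrite ler_wpM2l// ltW.
  have h7 : c0 ^+ 3 = th ^+ 3 * Lam ^+ 27.
    by rewrite /th expr_div_n -exprM divfK// expf_neq0// gt_eqF.
  apply: le_trans (_ : c1 * c0 ^+ 3 <= _).
    by rewrite ler_wpM2r// exprn_ge0// ltW.
  rewrite h7 mulrA.
  have -> : nc (F s') ^+ 4 * Lam ^+ (7 * 4) = nc (F s') ^+ 4 * Lam * Lam ^+ 27.
    by rewrite -mulrA -exprS.
  by rewrite ler_wpM2r// exprn_ge0// ltW.
move=> s /andP[s1 s2]; have cc := mulr_gt0 C10 c00; have [sb|sb] := lerP (1 + th) s.
  by have := big s (introT andP (conj sb s2)); rlra.
have th2 : 1 + th <= 2 by rlra.
have hl := hlip s (1 + th) s1 (ltW sb) th2.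
have hb : 2 * C1 * c0 <= nc (F (1 + th)) * Lam ^+ 7 by apply: big; rewrite lexx.
have L7 : 0 < Lam ^+ 7 by rewrite exprn_gt0.
have e7 : (1 + th - 1) * (C1 * Lam ^+ 2) * Lam ^+ 7 = C1 * c0.
  rewrite /th; field; by rewrite gt_eqF.
have h8 := ler_wpM2r (ltW L7) hl; rewrite e7 in h8.
have := nc_triB (F (1 + th)) (F s) => h9.
have := ler_wpM2r (ltW L7) h9; rewrite mulrBl; rlra.
Qed.

Lemma Z0_lower (t0 : R) : 0 < t0 -> exists2 c : R, 0 < c & forall s t, 1 < s <= 2 -> t0 <= `|t| ->
  c <= nc (Zk 0 s t) * lam t ^+ 7.
Proof.
move=> t00; have [C0 C00 h0] := Zk_away 0 t00; have [C1 C10 h1] := Zk_away 1 t00.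
have E0 : 0 < expR (-8) / 2 :> R by rewrite divr_gt0 ?expR_gt0.
have C02 : 0 < C0 * 2 by rewrite mulr_gt0.
have [c c0 hc] := lower_from_341 E0 C02 C10; exists c => // s t s12 tt.
apply: (hc (fun s => Zk 0 s t) (lam t)) => //; first by have := lam_ge2 t; lra.
  move=> s' s12'; have /andP[s1 _] := s12'; apply: le_trans (Z0_341 t s1) _.
  rewrite ler_wpM2l ?mulr_ge0 ?exprn_ge0 ?nc_ge0 ?addr_ge0 ?invr_ge0 ?subr_ge0 ?(ltW s1)//.
  have t2 : t0 <= `|2 * t| by rewrite normrM ger0_norm//; have := normr_ge0 t; lra.
  have h2 := h0 s' (2 * t) s12' t2; rewrite expr1 in h2.
  by apply: le_trans h2 _; rewrite -mulrA ler_wpM2l ?lam_double// ltW.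
move=> s1 s2 s11 s12' s22; have hh : 0 <= s2 - s1 by rewrite subr_ge0.
have := @Z0_lip s1 (s2 - s1) t (C1 * lam t ^+ 2) s11 hh.
rewrite addrC subrK => hl; apply: le_trans (hl _) _.
  by move=> s' /andP[s'1 s'2]; apply: h1 => //; rewrite (lt_le_trans s11)// (le_trans s'2).
by rewrite ler_wpM2r ?mulr_ge0 ?exprn_ge0 ?(ltW C10) ?(ltW (lam_gt0 t))// lerD2l lerN2 ltW.
Qed.
End ZetaBounds.

(** * The von Mangoldt function *)

Section VonMangoldt.
Variable R : realType.

(** A double sum over the representations n = p^j instead of a case distinction, so that later
    rearrangements are interchanges of finite sums. At most one term is nonzero. *)
Definition vonM (n : nat) : R :=
  \sum_(1 <= p < n.+1 | prime p) \sum_(1 <= j < n.+1 | n == (p ^ j)%N) ln p%:R.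

Lemma vonM_widen n N : (0 < n)%N -> (n <= N)%N ->
  vonM n = \sum_(1 <= p < N.+1 | prime p) \sum_(1 <= j < N.+1 | n == (p ^ j)%N) ln p%:R.
Proof.
move=> n0 nN; rewrite /vonM [RHS](@big_cat_nat _ _ _ n.+1)//=.
rewrite [X in _ = _ + X]big1_seq ?addr0 => [|p /andP[pp]]; last first.
  rewrite mem_index_iota => /andP[np _]; rewrite big1_seq// => j /andP[/eqP e].
  rewrite mem_index_iota => /andP[j0 _]; suff : (p <= n)%N by rewrite leqNgt np.
  by rewrite e -{1}(expn1 p) leq_exp2l// prime_gt1.
apply: eq_bigr => p pp; rewrite [RHS](@big_cat_nat _ _ _ n.+1)//=.
rewrite [X in _ = _ + X]big1_seq ?addr0// => j /andP[/eqP e].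
rewrite mem_index_iota => /andP[nj _]; move: nj; rewrite e => h.
by have := ltn_expl j (prime_gt1 pp); rewrite ltnNge (ltnW h).
Qed.

Lemma ln_prod_primes n : (0 < n)%N ->
  ln n%:R = \sum_(1 <= p < n.+1 | prime p) (logn p n)%:R * ln p%:R :> R.
Proof.
move=> n0; rewrite -{1}[n]partnT// /partn.
have lnprod (s : seq nat) : all (leq 1) s ->
    ln (\prod_(p <- s) p ^ logn p n)%:R = \sum_(p <- s) (logn p n)%:R * ln p%:R :> R.
  elim: s => [|p s ih] /=; first by rewrite !big_nil ln1.
  move=> /andP[p0 s0]; rewrite !big_cons ln_natM ?expn_gt0 ?p0//.
    by rewrite ih// natrX lnXn ?ltr0n// mulr_natl.
  by rewrite big_seq; apply: prodn_cond_gt0 => q qs; rewrite expn_gt0 (allP s0 q qs).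
rewrite (eq_bigl xpredT)//= big_ltn// [X in (0 ^ X)%N]lognE expn0 mul1n.
rewrite lnprod; last by apply/allP => p; rewrite mem_index_iota => /andP[].
rewrite [RHS]big_mkcond; apply: eq_bigr => p _.
by case: ifP => // pp; rewrite lognE pp mul0r.
Qed.

Lemma sum_vonM n : (0 < n)%N -> \sum_(1 <= d < n.+1 | (d %| n)%N) vonM d = ln n%:R.
Proof.
move=> n0; rewrite ln_prod_primes// big_mkcond/=.
transitivity (\sum_(1 <= d < n.+1) \sum_(1 <= p < n.+1 | prime p) \sum_(1 <= j < n.+1)
   (if (d %| n)%N && (d == p ^ j)%N then ln p%:R else 0 : R)).
  apply: eq_big_nat => d /andP[d0 dn]; case: ifP => dvd /=; last first.
    by rewrite big1// => p _; rewrite big1.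
  by rewrite (vonM_widen d0 dn); apply: eq_bigr => p _; rewrite big_mkcond.
under [LHS]eq_bigr do rewrite big_mkcond.
rewrite exchange_big_nat/= [RHS]big_mkcond; apply: eq_big_nat => p /andP[p0 pn].
case: ifP => pp; last by rewrite big1.
rewrite exchange_big_nat/=.
transitivity (\sum_(1 <= j < n.+1) (if (j <= logn p n)%N then ln p%:R else 0 : R)).
  apply: eq_big_nat => j /andP[j0 jn]; rewrite -pfactor_dvdn//.
  case: ifP => pj.
    rewrite (bigD1_seq (p ^ j)%N) ?iota_uniq//=; last first.
      by rewrite mem_index_iota expn_gt0 p0 ltnS dvdn_leq.
    rewrite pj eqxx/= big1 ?addr0// => d /negbTE ->; by rewrite andbF.
  rewrite big1// => d _; case: ifP => // /andP[dn /eqP e].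
  by rewrite -e dn in pj.
have ln_le : (logn p n <= n)%N.
  by apply: leq_trans (ltnW (ltn_expl _ (prime_gt1 pp))) _; rewrite dvdn_leq// pfactor_dvdnn.
rewrite (sum_split _ (_ : 1 <= (logn p n).+1)%N)//.
rewrite [X in _ + X]big_nat_cond [X in _ + X]big1 ?addr0; last first.
  by move=> j /andP[/andP[h _] _]; rewrite leqNgt h.
rewrite (eq_big_nat _ _ (F2 := fun=> ln p%:R)); last by move=> j /andP[_]; rewrite ltnS => ->.
by rewrite big_const_nat subn1/= iter_addr_0 mulr_natl.
Qed.

Lemma vonM_ge0 n : 0 <= vonM n.
Proof. by apply: sumr_ge0 => p _; apply: sumr_ge0 => j _; exact: ln_nat_ge0. Qed.

Lemma vonM_le n : vonM n <= ln n%:R.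
Proof.
case: n => [|n]; first by rewrite /vonM big_geq// ln0.
rewrite -sum_vonM// big_mkcond/= big_nat_recr//= dvdnn lerDr.
by apply: sumr_ge0 => d _; case: ifP => // _; exact: vonM_ge0.
Qed.
End VonMangoldt.

(** * Leibniz calculus on sequences of derivatives *)

Section Jets.
Variable R : realType.
Implicit Types (a b f g h : nat -> R[i]).

(* Product of the sequences of derivatives of two functions at a point. *)
Definition bconv a b k := \sum_(i < k.+1) 'C(k, i)%:R * a i * b (k - i)%N.

Lemma bconvC a b k : bconv a b k = bconv b a k.
Proof.
rewrite /bconv (reindex_inj rev_ord_inj)/=; apply: eq_bigr => i _.
by rewrite subSS bin_sub ?leq_ord// subKn ?leq_ord//; ring.
Qed.

Lemma bconvDr a b c k : bconv a (fun i => b i + c i) k = bconv a b k + bconv a c k.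
Proof. by rewrite /bconv -big_split; apply: eq_bigr => i _; rewrite /= mulrDr. Qed.

Lemma bconvBl a b c k : bconv (fun i => a i - b i) c k = bconv a c k - bconv b c k.
Proof. by rewrite /bconv -sumrB; apply: eq_bigr => i _; ring. Qed.

Lemma bconv_sqr a b k : bconv (fun i => a i + b i) (fun i => a i + b i) k =
  bconv a a k + 2 * bconv b a k + bconv b b k.
Proof.
rewrite bconvDr (bconvC _ a) (bconvC _ b) !bconvDr (bconvC a b); ring.
Qed.

Lemma eq_bconv a a' b b' k : (forall i, a i = a' i) -> (forall i, b i = b' i) ->
  bconv a b k = bconv a' b' k.
Proof. by move=> e e'; apply: eq_bigr => i _; rewrite e e'. Qed.

(** Multiplication by the function s - 1 + it in this calculus; it clears the pole at 1. The
    sequences carry the sign (-1)^k, so the derivative 1 of that function enters with a minus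
    sign. *)
Definition sgm (S : R[i]) b k := S * b k - k%:R * b k.-1.

Lemma bconv_sgm S a b k : bconv a (sgm S b) k = sgm S (bconv a b) k.
Proof.
rewrite /sgm {2}/bconv mulr_sumr.
have -> : k%:R * bconv a b k.-1 = \sum_(i < k.+1) 'C(k, i)%:R * a i * ((k - i)%:R * b (k - i).-1).
  case: k => [|k]; first by rewrite mul0r big_ord_recl big_ord0 subnn; ring.
  rewrite big_ord_recr/= subnn mul0r mulr0 addr0 /bconv mulr_sumr.
  apply: eq_bigr => i _; have := mul_bin_down k.+1 i => /= e.
  rewrite subSn ?leq_ord//=.
  have {}e : k.+1%:R * 'C(k, i)%:R = (k - i).+1%:R * 'C(k.+1, i)%:R :> R[i].
    by rewrite -!natrM e subSn ?leq_ord.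
  by rewrite !mulrA e; ring.
by rewrite /bconv -sumrB; apply: eq_bigr => i _; ring.
Qed.

Lemma bconv_le a b k (A B : R) : (forall i, (i <= k)%N -> nc (a i) <= A) ->
  (forall i, (i <= k)%N -> nc (b i) <= B) -> nc (bconv a b k) <= 2 ^+ k * (A * B).
Proof.
move=> hA hB; apply: le_trans (nc_sum _ _ _) _.
apply: le_trans (_ : \sum_(i < k.+1) 'C(k, i)%:R * (A * B) <= _).
  apply: ler_sum => i _; rewrite -mulrA !ncM nc_nat ler_wpM2l//.
  by apply: ler_pM; rewrite ?nc_ge0 ?hA ?hB ?leq_ord// leq_subr.
rewrite -mulr_suml -natr_sum -natrX.
suff -> : (\sum_(i < k.+1) 'C(k, i) = 2 ^ k)%N by [].
have := expnDn 1 1 k; rewrite addn1 => ->.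
by apply: eq_bigr => i _; rewrite !exp1n !muln1.
Qed.

(** Division: the equations form a triangular system with diagonal [f 0], solved one order at a
    time, and each order multiplies the bound by a power of [F]. The hypothesis on [f 0] says that
    its inverse is at most [F] as well. *)
Lemma bconv_solve k : exists c e, 0 <= c /\ forall (F : R) f g h, 1 <= F ->
  (forall i, (i <= k)%N -> nc (f i) <= F) -> (forall i, (i <= k)%N -> nc (h i) <= F) ->
  1 <= nc (f 0%N) * F -> (forall i, (i <= k)%N -> bconv g f i = h i) ->
  forall i, (i <= k)%N -> nc (g i) <= c * F ^+ e.
Proof.
have g0 k' (F : R) f g h B : 1 <= F -> 0 <= B -> (forall i, (i <= k')%N -> nc (f i) <= F) ->
    nc (h k') <= F -> 1 <= nc (f 0%N) * F -> bconv g f k' = h k' ->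
    (forall i, (i < k')%N -> nc (g i) <= B) -> nc (g k') <= F * (F + 2 ^+ k' * (B * F)).
  move=> F1 B0 hf hh f0 e hB; pose g' i := if (i < k')%N then g i else 0.
  have eg : h k' = bconv g' f k' + g k' * f 0%N.
    rewrite -e /bconv !big_ord_recr/= /g' ltnn subnn binn mul1r mulr0 mul0r addr0.
    by congr (_ + _); apply: eq_bigr => i _; rewrite ltn_ord.
  have hg' : nc (bconv g' f k') <= 2 ^+ k' * (B * F).
    apply: bconv_le => // i ik; rewrite /g'; case: ifP => [/hB //|_]; by rewrite nc0.
  have : nc (g k') * nc (f 0%N) <= F + 2 ^+ k' * (B * F).
    rewrite -ncM; have -> : g k' * f 0%N = h k' - bconv g' f k' by rewrite eg; ring.
    by apply: le_trans (ncB _ _) _; rewrite lerD.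
  have F0 : 0 <= F by lra.
  move=> /(ler_wpM2l F0); apply: le_trans.
  by rewrite mulrCA ler_peMr ?nc_ge0// mulrC.
elim: k => [|k [c [e [c0 ih]]]].
  exists 2, 2%N; split=> // F f g h F1 hf hh f0 E i; rewrite leqn0 => /eqP ->.
  have : nc (g 0%N) <= F * (F + 2 ^+ 0 * (0 * F)).
    by apply: (@g0 0%N F f g h 0) => //; [exact: hh|exact: E].
  by rewrite mul0r mulr0 addr0 expr2; nra.
exists (c + 1 + 2 ^+ k.+1 * c), (e + 2)%N; split.
  by rewrite addr_ge0 ?addr_ge0// mulr_ge0// exprn_ge0.
move=> F f g h F1 hf hh f0 E.
have {}ih := ih F f g h F1 (fun i ik => hf i (leqW ik)) (fun i ik => hh i (leqW ik)) f0 (fun i ik => E i (leqW ik)).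
have Fe : 1 <= F ^+ e by rewrite exprn_ege1.
have Fe0 : 0 <= F ^+ e by lra.
have F2 : F ^+ (e + 2) = F ^+ e * (F * F) by rewrite exprD expr2.
have FF : 1 <= F * F by nra.
have p0 : 0 <= 2 ^+ k.+1 :> R by rewrite exprn_ge0.
move=> i; rewrite leq_eqVlt => /orP[/eqP ->|]; last first.
  rewrite ltnS => ik; apply: le_trans (ih i ik) _; rewrite F2 mulrA.
  have cF : 0 <= c * F ^+ e by rewrite mulr_ge0.
  have pc : 0 <= (1 + 2 ^+ k.+1 * c) * F ^+ e * (F * F).
    by rewrite !mulr_ge0 ?addr_ge0 ?mulr_ge0//; lra.
  have : c * F ^+ e <= c * F ^+ e * (F * F) by rewrite ler_peMr.
  lra.
have := @g0 k.+1 F f g h (c * F ^+ e) F1 (mulr_ge0 c0 Fe0) hf (hh _ (leqnn _)) f0 (E _ (leqnn _)).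
move=> /(_ (fun i ik => ih i ik)) /le_trans; apply; rewrite F2.
have h1 : F * F <= F ^+ e * (F * F) by rewrite ler_peMl//; lra.
have h2 : 0 <= c * (F ^+ e * (F * F)) by rewrite mulr_ge0// mulr_ge0//; lra.
have -> : F * (F + 2 ^+ k.+1 * (c * F ^+ e * F)) = F * F + 2 ^+ k.+1 * c * (F ^+ e * (F * F)) by ring.
lra.
Qed.
End Jets.

(** * The logarithmic derivative of zeta *)

Section LogDerivative.
Variable R : realType.
Implicit Types (s t : R).

Lemma vonMW_abs k s : 1 < s ->
  exists B, forall t, abs_bound (fun n => (vonM R n)%:C * W k s t n%:R) B.
Proof.
move=> s1; have [B B0 hB] := W_abs k.+1 s1; exists B => t N; apply: le_trans (hB t N).
apply: ler_sum => n _; rewrite ncM !nc_Wn nc_real ger0_norm ?vonM_ge0// exprS -mulrA.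
by rewrite ler_wpM2r ?vonM_le// mulr_ge0 ?npow_ge0 ?exprn_ge0 ?ln_nat_ge0.
Qed.

(** (-1)^k times the k-th derivative of -zeta'/zeta at s + it. *)
Definition Lk k s t : R[i] := csum (fun n => (vonM R n)%:C * W k s t n%:R).
Lemma LkP k s t : 1 < s -> has_sum (fun n => (vonM R n)%:C * W k s t n%:R) (Lk k s t).
Proof. by move=> /(vonMW_abs k)[B /(_ t)]; exact: csumP. Qed.

Lemma W0M s t m n : (0 < m)%N -> (0 < n)%N ->
  W 0 s t (m * n)%:R = W 0 s t m%:R * W 0 s t n%:R :> R[i].
Proof. exact: (cmul_W s t).2. Qed.

Lemma W_ln k s t x : W k s t x = (ln x ^+ k)%:C * W 0 s t x :> R[i].
Proof. by rewrite /W expr0 mul1r rmorphM mulrA. Qed.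

(** The Leibniz rule for (-zeta'/zeta) zeta = -zeta', read off from coefficients: one factor ln n is
    the divisor sum of [vonM], and the k-th power of ln n = ln d + ln (n/d) is expanded by the
    binomial formula. *)
Lemma bconv_L_Z k s t : 1 < s -> bconv (fun i => Lk i s t) (fun i => Zk i s t) k = Zk k.+1 s t.
Proof.
move=> s1; have HB i : exists b, abs_bound (fun n => (vonM R n)%:C * W i s t n%:R) b.
  by have [b hb] := vonMW_abs i s1; exists b.
have HB' i : exists b, abs_bound (fun n => W i s t n%:R) b.
  by have [b _ hb] := W_abs i s1; exists b.
have [B hB] := choice HB; have [B' hB'] := choice HB'.
have H i : has_sum (fun n => 'C(k, i)%:R * dconv (fun n => (vonM R n)%:C * W i s t n%:R) (fun n => W (k - i) s t n%:R) n)
    ('C(k, i)%:R * (Lk i s t * Zk (k - i) s t)).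
  by apply/has_sumZ/(has_sum_dconv (hB i) (hB' _) (LkP _ _ s1) (ZkP _ _ s1)).
have := has_sum_fin (index_enum 'I_k.+1) (fun i : 'I_k.+1 => H i) => {}H.
have -> : bconv (fun i => Lk i s t) (fun i => Zk i s t) k = \sum_(i < k.+1) 'C(k, i)%:R * (Lk i s t * Zk (k - i) s t).
  by apply: eq_bigr => i _; rewrite mulrA.
apply: has_sum_unique H _; apply: has_sum_ext (ZkP k.+1 t s1) => n n0.
rewrite W_ln exprS -{1}(sum_vonM R n0) rmorphM rmorph_sum/= -mulrA.
under [RHS]eq_bigr do rewrite /dconv mulr_sumr.
rewrite [RHS]exchange_big/= mulr_suml [LHS]big_nat_cond [RHS]big_nat_cond.
apply: eq_bigr => d /andP[/andP[d0 _] dn].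
have e0 : (0 < n %/ d)%N by rewrite divn_gt0// dvdn_leq.
have en : n = (d * (n %/ d))%N by rewrite mulnC divnK.
move: (vonM R d) => v.
rewrite {1 2}en ln_natM// W0M// addrC exprDn rmorph_sum/=.
rewrite !(mulr_sumr, mulr_suml); apply: eq_bigr => i _.
rewrite [W i _ _ _]W_ln [W (k - i) _ _ _]W_ln.
by rewrite rmorphMn rmorphM/= -mulr_natl; ring.
Qed.

(** Derivatives of -zeta'/zeta - zeta, the series with coefficients Lambda(n) - 1: the poles at 1
    cancel. *)
Definition Adiff s t k : R[i] := Lk k s t - Zk k s t.

Lemma bconv_A_Z k s t : 1 < s -> bconv (Adiff s t) (fun i => Zk i s t) k =
  Zk k.+1 s t - bconv (fun i => Zk i s t) (fun i => Zk i s t) k.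
Proof. by move=> s1; rewrite -bconv_L_Z// -bconvBl. Qed.

Lemma Zk_away_unif k (t0 : R) : 0 < t0 -> exists2 C : R, 0 < C & forall i s t, (i <= k)%N ->
  1 < s <= 2 -> t0 <= `|t| -> nc (Zk i s t) <= C * lam t ^+ k.+1.
Proof.
move=> t00; elim: k => [|k [C C0 ih]].
  have [C C0 h] := Zk_away 0 t00; exists C => // i s t; rewrite leqn0 => /eqP ->; exact: h.
have [C' C'0 h] := Zk_away k.+1 t00; exists (C + C'); first lra.
move=> i s t; rewrite leq_eqVlt => /orP[/eqP ->|ik] s12 tt.
  by apply: le_trans (h s t s12 tt) _; rewrite ler_wpM2r ?exprn_ge0 ?(ltW (lam_gt0 _))//; lra.
apply: le_trans (ih i s t ik s12 tt) _; have L := lam_ge2 t.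
apply: ler_pM; rewrite ?exprn_ge0 ?ler_weXn2l//; lra.
Qed.

Lemma Zk_polar_unif k : exists2 C : R, 0 < C & forall i s t, (i <= k)%N ->
  1 < s <= 2 -> `|t| <= 1 -> nc (Zk i s t - polar i s t) <= C.
Proof.
elim: k => [|k [C C0 ih]].
  have [C C0 h] := Zk_polar R 0; exists (C + 1); first lra.
  by move=> i s t; rewrite leqn0 => /eqP -> s12 t1; have := h s t s12 t1; lra.
have [C' C'0 h] := Zk_polar R k.+1; exists (C + C'); first lra.
move=> i s t; rewrite leq_eqVlt => /orP[/eqP ->|ik] s12 tt.
  by have := h s t s12 tt; lra.
by have := ih i s t ik s12 tt; lra.
Qed.

Lemma sgm_polar k s t : 1 < s -> sgm ((s - 1) +i* t) (fun i => polar i s t) k = (k == 0%N)%:R.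
Proof.
move=> s1; have s0 : (s - 1) +i* t != 0 by rewrite eq_complex negb_and/= gt_eqF//; lra.
rewrite /sgm /polar; move: s0; set S := (_ +i* _) => s0; case: k => [|k] /=.
  by rewrite mul0r subr0 fact0 expr1 div1r divff.
by rewrite factS natrM [S ^+ k.+2]exprS invfM mulrCA !mulrA mulfK// subrr.
Qed.

Lemma bconv_polar k s t : bconv (fun i => polar i s t) (fun i => polar i s t) k = polar k.+1 s t :> R[i].
Proof.
rewrite /bconv /polar; move: ((s - 1) +i* t) => S.
transitivity (\sum_(i < k.+1) k`!%:R / S ^+ k.+2).
  apply: eq_bigr => i _; have ik : (i <= k)%N by rewrite leq_ord.
  have -> : k.+2 = (i.+1 + (k - i).+1)%N by rewrite addSn addnS subnKC.
  rewrite exprD invfM -(bin_fact ik) !natrM; ring.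
by rewrite sumr_const card_ord factS natrM -[LHS]mulr_natl mulrA.
Qed.

(** Write zeta = 1/S + B with S = s - 1 + it. Multiplying (-zeta'/zeta - zeta) zeta = -zeta' -
    zeta^2 by S gives S (-B' - B^2) - 2B, free of poles, while S zeta = 1 + S B has modulus at least
    1/2 because |S| <= 2r and 4r |B| <= 1. Division by S zeta is therefore harmless. *)
Lemma Adiff_near k : exists2 C : R, 0 <= C & forall r s t, 0 < r <= 1 ->
  (forall s t, 1 < s <= 2 -> `|t| <= 1 -> nc (Zk 0 s t - polar 0 s t) * (4 * r) <= 1) ->
  1 < s <= 1 + r -> `|t| <= r -> nc (Adiff s t k) <= C.
Proof.
have [b b0 hb] := Zk_polar_unif k.+1; have [c [e [c0 sol]]] := @bconv_solve R k.
pose q := b + 2 ^+ k * (b * b); have q0 : 0 <= q by rewrite addr_ge0 ?mulr_ge0 ?exprn_ge0//; rlra.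
pose F := 2 + 2 * b + k%:R * b + (2 * q + k%:R * q + 2 * b).
have kb : 0 <= k%:R * b by rewrite mulr_ge0//; rlra.
have kq : 0 <= k%:R * q by rewrite mulr_ge0.
have F2 : 2 <= F by rewrite /F; rlra.
exists (c * F ^+ e); first by rewrite mulr_ge0// exprn_ge0//; rlra.
move=> r s t /andP[r0 r1] hr /andP[s1 sr] tr; set S := (s - 1) +i* t.
have s12 : 1 < s <= 2 by rlra.
have t1 : `|t| <= 1 by rlra.
have nS : nc S <= 2 * r.
  apply: le_trans (nc_le_ReIm _) _; rewrite /= (ger0_norm (_ : 0 <= s - 1)); rlra.
pose B i := Zk i s t - polar i s t.
have hB i : (i <= k.+1)%N -> nc (B i) <= b by move=> ik; exact: hb.
have ZB i : Zk i s t = polar i s t + B i by rewrite /B; ring.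
have sZ i : sgm S (fun i => Zk i s t) i = (i == 0%N)%:R + (S * B i - i%:R * B i.-1).
  by rewrite -(sgm_polar i t s1) /sgm /= (ZB i) (ZB i.-1) -/S; ring.
pose g i := B i.+1 - bconv B B i.
have hg i : (i <= k)%N -> nc (g i) <= q.
  move=> ik; apply: le_trans (ncB _ _) _; rewrite lerD ?hB//.
  apply: le_trans (@bconv_le _ B B i b b _ _) _.
  - by move=> j ji; apply: hB; rewrite (leq_trans ji)// leqW.
  - by move=> j ji; apply: hB; rewrite (leq_trans ji)// leqW.
  - by rewrite ler_wpM2r ?mulr_ge0 ?ler_weXn2l ?ler1n//; rlra.
pose h i := sgm S g i - 2 * B i.
have nsg (u : nat -> R[i]) M i : (i <= k)%N -> 0 <= M -> (forall j, (j <= k)%N -> nc (u j) <= M) ->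
    nc (S * u i - i%:R * u i.-1) <= 2 * M + k%:R * M.
  move=> ik M0 hu; apply: le_trans (ncB _ _) _; rewrite !ncM nc_nat lerD//.
    by apply: ler_pM; rewrite ?nc_ge0 ?hu//; rlra.
  by apply: ler_pM; rewrite ?nc_ge0 ?ler_nat ?hu ?(leq_trans (leq_pred _)).
apply: (sol F (sgm S (fun i => Zk i s t)) (Adiff s t) h) => //; first rlra.
- move=> i ik; rewrite sZ; apply: le_trans (ncD _ _) _.
  have := nsg B b i ik (ltW b0) (fun j jk => hB j (leqW jk)).
  have : nc ((i == 0%N)%:R : R[i]) <= 1 by rewrite nc_nat; case: (i == 0%N).
  rewrite /F; rlra.
- move=> i ik; rewrite /h /sgm; apply: le_trans (ncB _ _) _; rewrite ncM nc_nat.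
  have := nsg g q i ik q0 hg; have := hB i (leqW ik); rewrite /F; rlra.
- rewrite sZ eqxx mul0r subr0; have := nc_triB 1 (- (S * B 0%N)); rewrite opprK ncN nc1 ncM => h1.
  have h2 := hr s t s12 t1; rewrite -/(B 0%N) in h2.
  have h3 : nc S * nc (B 0%N) <= 2 * r * nc (B 0%N) by rewrite ler_wpM2r ?nc_ge0.
  have : 1 / 2 <= nc (1 + S * B 0%N) by rlra.
  nra.
- move=> i ik; rewrite bconv_sgm /h.
  have E j : bconv (Adiff s t) (fun i => Zk i s t) j = g j - 2 * bconv B (fun i => polar i s t) j.
    by rewrite bconv_A_Z// (eq_bconv _ ZB ZB) bconv_sqr bconv_polar (ZB j.+1) /g; ring.
  have -> : sgm S (bconv (Adiff s t) (fun i => Zk i s t)) i =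
    sgm S g i - 2 * sgm S (bconv B (fun i => polar i s t)) i.
    by rewrite /sgm !E; ring.
  rewrite -bconv_sgm; congr (_ - 2 * _).
  rewrite bconvC /bconv big_ord_recl/= sgm_polar// bin0 !mul1r subn0 big1 ?addr0// => j _.
  by rewrite sgm_polar// mulr0 mul0r.
Qed.

(** Near the pole the previous lemma applies; elsewhere the lower bound for zeta permits division at
    the cost of a power of [lam t]. The radius [r] depends only on the size of zeta - 1/(s - 1),
    hence not on [k]. *)
Theorem Adiff_bound : exists2 r : R, 0 < r <= 1 & forall k, exists C D, 0 <= C /\
  forall s t, 1 < s <= 1 + r -> nc (Adiff s t k) <= C * lam t ^+ D.
Proof.
have [b b0 hb] := Zk_polar R 0.
have b4 : 0 < 4 * (b + 1) by rlra.
(* Then [4 * r * b <= 1], the condition under which s - 1 + it times zeta stays away from 0. *)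
pose r := (4 * (b + 1))^-1; have r0 : 0 < r by rewrite invr_gt0.
have r1 : r <= 1 by rewrite invf_le1//; rlra.
have rr : 0 < r <= 1 by rewrite r0.
exists r => // k; have [C1 C10 h1] := Adiff_near k.
have [c c0 hc] := Z0_lower r0; have [G G0 hG] := Zk_away_unif k.+1 r0.
have [d [e [d0 sol]]] := @bconv_solve R k.
pose M := 1 + G + 2 ^+ k * (G * G) + c^-1.
have p2 : 0 <= 2 ^+ k * (G * G) by rewrite mulr_ge0 ?exprn_ge0// mulr_ge0 ?ltW.
have ci : 0 < c^-1 by rewrite invr_gt0.
have M1 : 1 <= M by rewrite /M; rlra.
have M0 : 0 < M by rlra.
have GM : G <= M by rewrite /M; rlra.
have cM : c^-1 <= M by rewrite /M; rlra.
pose m := (k.+2 + k.+2 + 7)%N.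
exists (C1 + d * M ^+ e), (m * e)%N; split; first by rewrite addr_ge0 ?mulr_ge0 ?exprn_ge0// ltW.
move=> s t s1r; have L := lam_ge2 t.
have l0 : 0 <= lam t by exact: le_trans L.
have Lp n : 1 <= lam t ^+ n by rewrite exprn_ege1//; rlra.
have [tr|/ltW tr] := lerP `|t| r.
  apply: le_trans (h1 r s t rr _ s1r tr) _.
    move=> s' t' s12 t1; apply: le_trans (ler_wpM2r _ (hb s' t' s12 t1)) _; first rlra.
    have -> : 4 * r = (b + 1)^-1 by rewrite /r invfM mulrA divff ?mul1r ?pnatr_eq0.
    by rewrite ler_pdivrMr; rlra.
  have := Lp (m * e)%N; have : 0 <= d * M ^+ e by rewrite mulr_ge0 ?exprn_ge0// ltW.
  nra.
have s12 : 1 < s <= 2 by rlra.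
have s1 : 1 < s by rlra.
pose F := M * lam t ^+ m.
have Lm : lam t ^+ m = lam t ^+ k.+2 * lam t ^+ k.+2 * lam t ^+ 7 by rewrite /m !exprD.
have mk : (k.+2 <= m)%N by rewrite /m -addnA leq_addr.
have mkk : (k.+2 + k.+2 <= m)%N by exact: leq_addr.
have m7 : (7 <= m)%N by exact: leq_addl.
have l1 : 1 <= lam t by exact: Lp 1%N.
have Lkm : lam t ^+ k.+2 <= lam t ^+ m by apply: ler_weXn2l.
have Lkkm : lam t ^+ k.+2 * lam t ^+ k.+2 <= lam t ^+ m by rewrite -exprD; apply: ler_weXn2l.
have L7m : lam t ^+ 7 <= lam t ^+ m by apply: ler_weXn2l.
have Lm1 := Lp m.
have hZ i : (i <= k.+1)%N -> nc (Zk i s t) <= G * lam t ^+ k.+2 by move=> ik; exact: hG.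
have := sol F (fun i => Zk i s t) (Adiff s t) (fun i => Zk i.+1 s t - bconv (fun i => Zk i s t) (fun i => Zk i s t) i).
move=> /(_ _ _ _ _ _ k (leqnn k)) H; apply: le_trans (H _ _ _ _ _) _.
- by rewrite /F mulr_ege1.
- move=> i ik; apply: le_trans (hZ i (leqW ik)) _; apply: ler_pM => //; rewrite ?exprn_ge0 ?(ltW G0)//.
- move=> i ik; apply: le_trans (ncB _ _) _.
  apply: le_trans (_ : G * lam t ^+ k.+2 + 2 ^+ k * (G * lam t ^+ k.+2 * (G * lam t ^+ k.+2)) <= _).
    rewrite lerD ?hZ//; apply: le_trans (@bconv_le _ _ _ i (G * lam t ^+ k.+2) (G * lam t ^+ k.+2) _ _) _.
    - by move=> j ji; apply: hZ; rewrite (leq_trans ji)// leqW.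
    - by move=> j ji; apply: hZ; rewrite (leq_trans ji)// leqW.
    - have gl : 0 <= G * lam t ^+ k.+2 by rewrite mulr_ge0 ?exprn_ge0 ?(ltW G0).
      by rewrite ler_wpM2r ?(mulr_ge0 gl gl)// ler_weXn2l ?ler1n.
  have -> : 2 ^+ k * (G * lam t ^+ k.+2 * (G * lam t ^+ k.+2)) = 2 ^+ k * (G * G) * (lam t ^+ k.+2 * lam t ^+ k.+2) by ring.
  have h2 := ler_wpM2l p2 Lkkm; have h3 := ler_wpM2l (ltW G0) Lkm.
  have h4 : 0 <= c^-1 * lam t ^+ m by rewrite mulr_ge0 ?(ltW ci) ?exprn_ge0.
  by move: h2 h3 h4 Lm1; rewrite /F /M !mulrDl mul1r; clear; lra.
- have h2 := hc s t s12 tr; have n0 := nc_ge0 (Zk 0 s t).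
  have h3 : c^-1 * lam t ^+ 7 <= F.
    exact: ler_pM (ltW ci) (exprn_ge0 _ l0) cM L7m.
  have := ler_wpM2l n0 h3; apply: le_trans.
  by rewrite mulrCA mulrC ler_pdivlMr// mul1r.
- by move=> i ik; rewrite bconv_A_Z.
by rewrite /F exprMn -exprM mulrA mulrDl lerDr mulr_ge0 ?exprn_ge0.
Qed.
End LogDerivative.

(** * A nonnegative kernel with finite spectrum *)

Section Kernel.
Variable R : realType.
Implicit Types (e v w x : R).

(** A trigonometric polynomial, since (1 + cos x)/2 = |1 + e^(ix)|^2 / 4. Its spectrum is finite, so
    a sum weighted by it is a finite combination of values of a Dirichlet series. *)
Definition kern M e v : R := ((1 + cos (e * v)) / 2) ^+ M.

Lemma kern_base v : 0 <= (1 + cos v) / 2 <= 1.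
Proof. by have := cos_geN1 v; have := cos_le1 v; lra. Qed.
Lemma kern_ge0 M e v : 0 <= kern M e v.
Proof. by apply: exprn_ge0; have /andP[] := kern_base (e * v). Qed.

Definition kcoef M a b : R[i] := (4^-1 ^+ M : R)%:C * ('C(M, a) * 'C(M, b))%:R.

Lemma kern_expand M e v : (kern M e v)%:C =
  \sum_(a < M.+1) \sum_(b < M.+1) kcoef M a b * cis ((a%:R - b%:R) * e * v).
Proof.
have -> : kern M e v = 4^-1 ^+ M * (2 + 2 * cos (e * v)) ^+ M.
  by rewrite /kern -exprMn; congr (_ ^+ _); field.
have -> : ((4^-1 ^+ M * (2 + 2 * cos (e * v)) ^+ M)%:C =
   (4^-1 ^+ M : R)%:C * ((1 + cis (e * v)) ^+ M * (1 + cis (- (e * v))) ^+ M)).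
  rewrite rmorphM; congr (_ * _); rewrite -exprMn rmorphXn; congr (_ ^+ _).
  have c1 : cis (e * v) * cis (- (e * v)) = 1 :> R[i] by rewrite -cisD subrr cis0.
  transitivity (1 + cis (e * v) + cis (- (e * v)) + cis (e * v) * cis (- (e * v))); last by ring.
  rewrite c1 -[LHS]/((2 + 2 * cos (e * v))%:C).
  by rewrite /cis cosN sinN; apply/eqP; rewrite eq_complex /=; apply/andP; split; apply/eqP; ring.
have ex z : (1 + z) ^+ M = \sum_(a < M.+1) 'C(M, a)%:R * z ^+ a :> R[i].
  by rewrite exprDn; apply: eq_bigr => a _; rewrite expr1n mul1r mulr_natl.
rewrite !ex big_distrlr/= mulr_sumr; apply: eq_bigr => a _; rewrite mulr_sumr.
apply: eq_bigr => b _; rewrite /kcoef natrM -!cisMn.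
have -> : (a%:R - b%:R) * e * v = a%:R * (e * v) + b%:R * - (e * v) by ring.
by rewrite cisD; ring.
Qed.

(** The coefficients are nonnegative, and their sum is the value of the kernel at 0. *)
Lemma kcoef_sum M : \sum_(a < M.+1) \sum_(b < M.+1) nc (kcoef M a b) = 1.
Proof.
have e2 : (1 + 1) / 2 = 1 :> R by lra.
have := kern_expand M 0 0; rewrite /kern mul0r cos0 e2 expr1n => h.
have -> : 1 = Re (1%:C : R[i]) by [].
rewrite h Re_sum; apply: eq_bigr => a _; rewrite Re_sum; apply: eq_bigr => b _.
rewrite mulr0 cis0 mulr1 /kcoef ncM nc_nat nc_real ger0_norm ?exprn_ge0 ?invr_ge0//.
by rewrite ReZr; congr (_ * _); rewrite -[RHS]/(Re _%:R) natCE.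
Qed.

(** Expanding the kernel gives a combination of values [f t] with |t| <= M |e| and coefficients of
    total modulus 1. *)
Lemma kern_sum_le M e (f : R -> R[i]) (F B w : R) (c : nat -> R) :
  (forall t, has_sum (fun n => (c n)%:C * cis (- (t * ln n%:R))) (f t)) ->
  (forall t, `|t| <= M%:R * `|e| -> nc (f t) <= B) ->
  exists2 l, has_sum (fun n => (c n * kern M e (w - ln n%:R))%:C) l & nc l <= B.
Proof.
move=> hf hB; pose t (a b : nat) : R := (a%:R - b%:R) * e.
exists (\sum_(a < M.+1) \sum_(b < M.+1) (kcoef M a b * cis (t a b * w)) * f (t a b)).
  apply: has_sum_ext (has_sum_fin _ (fun a : 'I_M.+1 => has_sum_fin (index_enum 'I_M.+1)
    (fun b : 'I_M.+1 => has_sumZ (kcoef M a b * cis (t a b * w)) (hf (t a b))))) => n n0.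
  have -> : (c n * kern M e (w - ln n%:R))%:C = (c n)%:C * (kern M e (w - ln n%:R))%:C by rewrite rmorphM.
  rewrite kern_expand mulr_sumr; apply: eq_bigr => a _; rewrite mulr_sumr.
  apply: eq_bigr => b _; rewrite /t mulrBr cisD; ring.
apply: le_trans (nc_sum _ _ _) _.
rewrite -[leRHS]mul1r -(kcoef_sum M) mulr_suml; apply: ler_sum => a _.
apply: le_trans (nc_sum _ _ _) _; rewrite mulr_suml; apply: ler_sum => b _.
rewrite 2!ncM nc_cis mulr1 ler_wpM2l ?nc_ge0// hB// normrM ler_wpM2r//.
have ha : (a%:R : R) <= M%:R by rewrite ler_nat leq_ord.
have hb : (b%:R : R) <= M%:R by rewrite ler_nat leq_ord.
have a0 : 0 <= a%:R :> R by []. have b0 : 0 <= b%:R :> R by [].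
rewrite ler_norml; lra.
Qed.

Lemma cis_neq1 x : 0 < `|x| -> `|x| < 2 * pi -> cis x != 1.
Proof.
move=> x0 x2; apply/eqP => /(congr1 (@complex.Re R)) /=; rewrite -cos_norm => h.
have s0 : 0 < sin (`|x| / 2) by apply: sin_gt0_pi; lra.
have := cos2sin2 (`|x| / 2); have := cos_mulr2n (`|x| / 2).
have -> : `|x| / 2 *+ 2 = `|x| by rewrite mulr2n; lra.
rewrite h mulr2n => e1 e2; have : 0 < sin (`|x| / 2) ^+ 2 by rewrite exprn_gt0.
lra.
Qed.

Lemma cis2pi k : cis (k%:R * (2 * pi)) = 1 :> R[i].
Proof.
rewrite cisMn (_ : cis (2 * pi) = 1) ?expr1n//.
by rewrite /cis mulr_natl cos2pi sin2pi.
Qed.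

Lemma root_unity_sum L d : (0 < L)%N -> 0 < `|d| -> `|d| < L%:R -> (exists k : nat, `|d| = k%:R) ->
  \sum_(r < L) cis (r%:R * (d * (2 * pi) / L%:R)) = 0 :> R[i].
Proof.
move=> L0 d0 dL [k dk]; have Lr : 0 < L%:R :> R by rewrite ltr0n.
set x := d * (2 * pi) / L%:R; have p0 := pi_gt0 R.
have nx : `|x| = `|d| * (2 * pi) / L%:R.
  by rewrite /x 2!normrM normfV (ger0_norm (_ : 0 <= 2 * pi)) ?(ger0_norm (ltW Lr))//; lra.
have x1 : cis x != 1.
  apply: cis_neq1; rewrite nx; first by rewrite divr_gt0// mulr_gt0//; lra.
  by rewrite ltr_pdivrMr// mulrC ltr_pM2l//; lra.
have xL : cis x ^+ L = 1.
  rewrite -cisMn; have -> : L%:R * x = d * (2 * pi) by rewrite /x mulrCA divff ?mulr1 ?gt_eqF.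
  have [dd|dd] := lerP 0 d.
    by rewrite -(ger0_norm dd) dk cis2pi.
  have -> : d = - k%:R by rewrite -dk ltr0_norm// opprK.
  by rewrite mulNr cisN cis2pi invr1.
under eq_bigr do rewrite cisMn.
have := subrX1 (cis x) L; rewrite xL subrr => /esym/eqP.
by rewrite mulf_eq0 subr_eq0 (negbTE x1)/= => /eqP.
Qed.

(** A trigonometric polynomial of degree at most M has the same sum over every translate of L > M
    equally spaced points of a period: each non-constant frequency contributes a vanishing sum of
    roots of unity. *)
Lemma kern_full_sum M L (P v : R) : 0 < P -> (M < L)%N ->
  \sum_(r < L) kern M (2 * pi / P) (v + r%:R * (P / L%:R)) =
  \sum_(r < L) kern M (2 * pi / P) (r%:R * (P / L%:R)).
Proof.
move=> P0 ML; have L0 : (0 < L)%N by apply: leq_ltn_trans ML.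
have Lr : 0 < L%:R :> R by rewrite ltr0n.
have main x : (\sum_(r < L) kern M (2 * pi / P) (x + r%:R * (P / L%:R)))%:C =
   \sum_(a < M.+1) \sum_(b < M.+1) (if a == b then kcoef M a b * L%:R else 0).
  rewrite rmorph_sum/=; under eq_bigr do rewrite kern_expand.
  rewrite exchange_big/=; apply: eq_bigr => a _; rewrite exchange_big/=; apply: eq_bigr => b _.
  under eq_bigr => r _.
    rewrite (_ : cis _ = cis ((a%:R - b%:R) * (2 * pi / P) * x) * cis (r%:R * ((a%:R - b%:R) * (2 * pi) / L%:R))); last first.
      by rewrite -cisD; congr cis; field; rewrite !gt_eqF.
    rewrite mulrA; over.
  rewrite -mulr_sumr; case: eqP => [->|/eqP ab].
    rewrite subrr !mul0r cis0 mulr1; under eq_bigr do rewrite mulr0 cis0.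
    by rewrite sumr_const card_ord.
  have nab : exists k : nat, `|a%:R - b%:R : R| = k%:R.
    have [ba|/ltnW ba] := leqP b a; [exists (a - b)%N|exists (b - a)%N]; rewrite natrB//.
      by rewrite ger0_norm// subr_ge0 ler_nat.
    by rewrite distrC ger0_norm// subr_ge0 ler_nat.
  have ab0 : 0 < `|a%:R - b%:R : R| by rewrite normr_gt0 subr_eq0 eqr_nat.
  have abL : `|a%:R - b%:R : R| < L%:R.
    have ha : (a%:R : R) <= M%:R by rewrite ler_nat leq_ord.
    have hb : (b%:R : R) <= M%:R by rewrite ler_nat leq_ord.
    have hM : M%:R < L%:R :> R by rewrite ltr_nat.
    have a0 : 0 <= a%:R :> R by []. have b0 : 0 <= b%:R :> R by [].
    rewrite ltr_norml; lra.
  by rewrite root_unity_sum// mulr0.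
apply: (@complexI R); rewrite (main v) -(main 0).
by congr (_%:C); apply: eq_bigr => r _; rewrite add0r.
Qed.

Lemma sin_ge_lin x : 0 <= x <= 1 -> x * cos 1 <= sin x.
Proof.
move=> /andP[x0 x1].
have [c /andP[c0 cx] e] := @mvt_le R sin cos 0 x x0 (fun y _ => is_derive_sin y).
rewrite sin0 !subr0 in e; rewrite e mulrC ler_wpM2r//.
have pi2 := pi_ge2 R.
have [->//|c1] := eqVneq c 1; apply/ltW; rewrite ltr_cos ?in_itv/=; lra.
Qed.

(** The base of the power is 1 - sin^2 (pi v / P), at most exp (- sin^2 (pi v / P)). At distance at
    least h from the peaks the sine is at least sin (pi h / P), hence at least h cos 1 / P. *)
Lemma kern_tail M (P h v : R) : 0 < P -> 0 < h -> pi * h <= P -> h <= `|v| <= P - h ->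
  kern M (2 * pi / P) v <= expR (- (M%:R * (cos 1 * h / P) ^+ 2)).
Proof.
move=> P0 h0 hP /andP[hv vh]; have p2 := pi_ge2 R.
have q0 := cos1_gt0 R.
rewrite -mulrN expRM_natl; apply: lerXn2r; rewrite ?nnegrE ?expR_ge0//.
  by have /andP[] := kern_base (2 * pi / P * v).
apply: le_trans (expR_ge1Dx _).
have -> : cos (2 * pi / P * v) = cos (pi / P * `|v| *+ 2).
  rewrite -[LHS]cos_norm normrM (ger0_norm (_ : 0 <= 2 * pi / P)); last by rewrite divr_ge0//; rlra.
  by congr cos; rewrite mulr2n; field; rewrite gt_eqF.
rewrite cos_mulr2n cos2sin2 mulr2n.
suff hs : cos 1 * h / P <= sin (pi / P * `|v|).
  have : (cos 1 * h / P) ^+ 2 <= sin (pi / P * `|v|) ^+ 2.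
    by rewrite lerXn2r ?nnegrE// ?(le_trans _ hs)// divr_ge0 ?mulr_ge0//; rlra.
  rlra.
have hP1 : pi / P * h <= 1 by rewrite mulrAC ler_pdivrMr//; rlra.
have hP0 : 0 <= pi / P * h by rewrite mulr_ge0 ?divr_ge0//; rlra.
have s1 : cos 1 * h / P <= sin (pi / P * h).
  apply: le_trans (sin_ge_lin (introT andP (conj hP0 hP1))).
  rewrite (_ : pi / P * h * cos 1 = pi * (cos 1 * h / P)); last by field; rewrite gt_eqF.
  by rewrite ler_peMl ?divr_ge0 ?mulr_ge0//; rlra.
apply: le_trans s1 _.
have mono x y : 0 <= x -> x <= y -> y <= pi / 2 -> sin x <= sin y.
  move=> x0 xy yp; have [->//|nxy] := eqVneq x y; apply/ltW.
  rewrite ltr_sin ?in_itv/=; [by rewrite lt_neqAle nxy|rlra|rlra].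
have vP : pi / P * `|v| <= pi / P * (P - h) by rewrite ler_wpM2l ?divr_ge0//; rlra.
have vP2 : pi / P * h <= pi / P * `|v| by rewrite ler_wpM2l ?divr_ge0//; rlra.
have PP : pi / P * (P - h) = pi - pi / P * h by field; rewrite gt_eqF.
have [yp|yp] := lerP (pi / P * `|v|) (pi / 2); first exact: mono.
have -> : sin (pi / P * `|v|) = sin (pi - pi / P * `|v|).
  by rewrite sinB sinpi cospi mul0r sub0r mulN1r opprK.
by apply: mono => //; rlra.
Qed.
End Kernel.

(** * Sums of Lambda(n) - 1 over logarithmic windows *)

Section Unsmoothing.
Variable R : realType.
Implicit Types (P h u v w : R).

Lemma sum_kern_le_tau (F : nat -> R) (a b : nat) (tau : R) : 0 <= tau ->
  (forall r, (a <= r < b)%N -> F r <= tau) -> \sum_(a <= r < b) F r <= b%:R * tau.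
Proof.
move=> t0 hF; apply: le_trans (_ : \sum_(a <= r < b) tau <= _); first exact: ler_sum_nat.
by rewrite sumr_const_nat -[leLHS]mulr_natl ler_wpM2r// ler_nat leq_subr.
Qed.

Lemma kern_step M P h v1 v2 v : let L := M.+1 in let e := 2 * pi / P in
  let tau := expR (- (M%:R * (cos 1 * h / P) ^+ 2)) in
  let kap := \sum_(r < L) kern M e (r%:R * (P / L%:R)) in
  let n := (Num.truncn ((v2 - v1) * L%:R / P)).+1 in
  0 < P -> 0 < h -> pi * h <= P -> P / L%:R <= h -> 0 <= v1 -> v1 <= v2 -> 4 * v2 <= P ->
  4 * h <= P -> 0 <= v ->
  [/\ 1 <= kap, (n <= L)%N &
  `|((v1 < v) && (v <= v2))%R%:R - kap^-1 * \sum_(0 <= r < n) kern M e (v1 - v + r%:R * (P / L%:R))|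
   <= L%:R * tau + (`|v - v1| <= 2 * h)%R%:R + (`|v - v2| <= 2 * h)%R%:R + (P / 2 < v)%R%:R].
Proof.
move=> L e tau kap n P0 h0 pih PL v10 v12 vP hP v0.
have Lr : 0 < L%:R :> R by rewrite ltr0n.
have K0 x : 0 <= kern M e x by exact: kern_ge0.
have s0 : 0 < P / L%:R by rewrite divr_gt0.
have kap1 : 1 <= kap.
  rewrite /kap /L big_ord_recl/= mul0r /kern mulr0 cos0.
  have -> : (1 + 1) / 2 = 1 :> R by rlra.
  by rewrite expr1n lerDl; apply: sumr_ge0 => i _; exact: (K0 _).
have x0 : 0 <= (v2 - v1) * L%:R / P by rewrite divr_ge0 ?mulr_ge0//; rlra.
have nL : (n <= L)%N.
  rewrite /n truncn_lt_nat// ltr_pdivrMr// mulrC ltr_pM2l//; rlra.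
have full x : \sum_(0 <= r < L) kern M e (x + r%:R * (P / L%:R)) = kap.
  by rewrite big_mkord kern_full_sum.
set S := \sum_(0 <= r < n) _; set S' := \sum_(n <= r < L) kern M e (v1 - v + r%:R * (P / L%:R)).
have SS : S + S' = kap.
  by rewrite -(full (v1 - v)) (sum_split _ (leq0n n) nL).
have S0 : 0 <= S by apply: sumr_ge0.
have S'0 : 0 <= S' by apply: sumr_ge0.
have t0 : 0 <= tau by exact: expR_ge0.
have Lt0 : 0 <= L%:R * tau by rewrite mulr_ge0// ltW.
have rn r : (r < n)%N -> 0 <= r%:R * (P / L%:R) <= v2 - v1.
  rewrite /n ltnS truncn_ge_nat// => h1; rewrite mulr_ge0 ?(ltW s0)//=.
  by rewrite mulrA ler_pdivrMr// -ler_pdivlMr.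
have nr r : (n <= r)%N -> v2 - v1 < r%:R * (P / L%:R).
  rewrite /n => h1; have : (v2 - v1) * L%:R / P < r%:R.
    by rewrite -truncn_lt_nat.
  by rewrite ltr_pdivrMr// mulrA ltr_pdivlMr.
have rL r : (r < L)%N -> r%:R * (P / L%:R) <= P - P / L%:R.
  move=> h1; rewrite -subr_ge0; have : (r.+1%:R : R) <= L%:R by rewrite ler_nat.
  rewrite -natr1 => h2; have h3 := ler_wpM2r (ltW s0) h2.
  by rewrite mulrDl mul1r [L%:R * _]mulrCA divff ?gt_eqF// mulr1 in h3; rlra.
have k0 : 0 < kap by rlra.
have kS : kap^-1 * S <= S by rewrite ler_piMl// invf_le1//.
have kS' : 1 - kap^-1 * S = kap^-1 * S'.
  by rewrite -[1](mulVf (lt0r_neq0 k0)) -SS; ring.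
have kS'_le : kap^-1 * S' <= S' by rewrite ler_piMl// invf_le1//.
have kS0 : 0 <= kap^-1 * S by rewrite mulr_ge0// invr_ge0 ltW.
have kS'0 : 0 <= kap^-1 * S' by rewrite mulr_ge0// invr_ge0 ltW.
have ind (b : bool) : `|b%:R - kap^-1 * S| <= 1.
  by move: kS' kS0 kS'0; move: (_ * S) (_ * S'); clear => x y; case: b => /= *; rewrite ler_norml; apply/andP; split; lra.
split=> //.
have [|v1h] := boolP (`|v - v1| <= 2 * h).
  have := ind ((v1 < v) && (v <= v2)).
  have : 0 <= ((`|v - v2| <= 2 * h)%R%:R : R) by [].
  have : 0 <= ((P / 2 < v)%R%:R : R) by [].
  by move: Lt0; clear => /= *; lra.
have [|v2h] := boolP (`|v - v2| <= 2 * h).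
  have := ind ((v1 < v) && (v <= v2)).
  have : 0 <= ((P / 2 < v)%R%:R : R) by [].
  by move: Lt0; clear => /= *; lra.
rewrite -!ltNge in v1h v2h.
have [/= Pv|vP2] := boolP (P / 2 < v).
  have := ind ((v1 < v) && (v <= v2)).
  by move: Lt0; clear => /= *; lra.
rewrite -leNgt in vP2; rewrite /= !addr0.
have tail x : h <= `|x| <= P - h -> kern M e x <= tau by exact: kern_tail.
have [vv1|vv1] := lerP v v1.
  rewrite /= sub0r normrN ger0_norm// (le_trans kS)//.
  apply: le_trans (sum_kern_le_tau t0 _) _; last by rewrite ler_wpM2r// ler_nat.
  move=> r /andP[_ rn']; have /andP[r1 r2] := rn r rn'.
  apply: tail; move: v1h r1 r2 hP vP v0 h0 v12 v10 vv1; clear => v1h *.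
  by rewrite distrC ger0_norm in v1h; [rewrite ger0_norm; lra|lra].
have [vv2|vv2] := lerP v v2.
  rewrite /= kS' ger0_norm// (le_trans kS'_le)//.
  apply: (sum_kern_le_tau t0) => r /andP[nr' rL'].
  have r1 := nr r nr'; have r2 := rL r rL'.
  apply: tail; move: v1h v2h r1 r2 hP vP v0 h0 v12 v10 vv1 vv2 s0; clear => v1h v2h *.
  rewrite ger0_norm in v1h; last lra.
  rewrite distrC ger0_norm in v2h; last lra.
  by rewrite ger0_norm; lra.
rewrite /= sub0r normrN ger0_norm// (le_trans kS)//.
apply: le_trans (sum_kern_le_tau t0 _) _; last by rewrite ler_wpM2r// ler_nat.
move=> r /andP[_ rn']; have /andP[r1 r2] := rn r rn'.
apply: tail; move: v2h r1 r2 hP vP v0 h0 v12 v10 vv2 vP2; clear => v2h *.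
by rewrite ger0_norm in v2h; [rewrite ler0_norm; lra|lra].
Qed.

Lemma count_window (X Y N : nat) :
  (\sum_(1 <= n < N.+1 | (X < n) && (n <= Y)) 1 <= minn N Y - X)%N.
Proof.
elim: N => [|N ih]; first by rewrite big_geq.
rewrite big_mkcond big_nat_recr//= -big_mkcond/=.
case: ifP => [/andP[h1 h2]|_]; last by rewrite addn0 (leq_trans ih)//; lia.
by apply: leq_trans (leq_add ih (leqnn _)) _; lia.
Qed.

Lemma exp_le_lin (x : R) : 0 <= x -> x <= 1 / 2 -> expR x <= 1 + 2 * x.
Proof.
move=> x0 x1; have h := expR_ge1Dx (- x); rewrite expRN in h.
have e0 := expR_gt0 x; have : (1 - x) * expR x <= 1.
  by rewrite -ler_pdivlMr// div1r; lra.
nra.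
Qed.

(** The integers concerned number at most about 4 g e^w, plus 2 for the ends, and each has weight
    about e^(-w). *)
Lemma log_window w g N : 1 <= w -> 0 < g -> g <= 1 / 4 ->
  \sum_(1 <= n < N.+1 | `|ln n%:R - w| <= g) npow 1 n <= 4 * g + 4 * expR (- w).
Proof.
move=> w1 g0 g4; pose X := Num.truncn (expR (w - g)); pose Y := Num.truncn (expR (w + g)).
have eg0 := expR_gt0 (w - g).
have E1 : expR (w + g) = expR (w - g) * expR (2 * g) by rewrite -expRD; congr expR; ring.
have E2 : expR (2 * g) <= 1 + 2 * (2 * g) by apply: exp_le_lin; rlra.
have E3 : expR (- (w - g)) <= 2 * expR (- w).
  have -> : - (w - g) = - w + g by ring.
  rewrite expRD mulrC ler_wpM2r ?expR_ge0//.
  by apply: le_trans (exp_le_lin _ _) _; rlra.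
have EE : expR (- (w - g)) * expR (w - g) = 1 by rewrite -expRD addNr expR0.
apply: le_trans (_ : \sum_(1 <= n < N.+1 | ((X.-1 < n) && (n <= Y))%N) expR (- (w - g)) <= _).
  rewrite big_mkcond [leRHS]big_mkcond; apply: ler_sum_nat => n /andP[n0 _].
  have nr : 0 < n%:R :> R by rewrite ltr0n.
  case: ifP => [|_]; last by case: ifP => // _; exact: expR_ge0.
  rewrite ler_norml => /andP[h1 h2].
  have h3 : expR (w - g) <= n%:R by rewrite -[n%:R]lnK ?posrE// ler_expR; rlra.
  have h4 : n%:R <= expR (w + g) by rewrite -[n%:R]lnK ?posrE// ler_expR; rlra.
  have Xn : (X <= n)%N.
    rewrite -(ler_nat R) (le_trans _ h3)// truncn_le; exact: ltW.
  have nY : (n <= Y)%N by rewrite truncn_ge_nat ?expR_ge0.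
  have -> : (X.-1 < n)%N by case: (X) Xn.
  rewrite nY /= npow_1// expRN lef_pV2 ?posrE//.
have -> : \sum_(1 <= n < N.+1 | ((X.-1 < n) && (n <= Y))%N) expR (- (w - g)) =
   (\sum_(1 <= n < N.+1 | (X.-1 < n) && (n <= Y)) 1)%N%:R * expR (- (w - g)).
  by rewrite natr_sum mulr_suml; apply: eq_bigr => i _; rewrite mul1r.
have c1 : ((\sum_(1 <= n < N.+1 | (X.-1 < n) && (n <= Y)) 1)%N%:R : R) <=
    expR (w + g) - expR (w - g) + 2.
  have YY : Y%:R <= expR (w + g) by rewrite truncn_le expR_ge0.
  have XX : expR (w - g) < X.+1%:R := lt_truncnS _.
  have hX : (X <= Y)%N by apply: le_truncn; rewrite ler_expR; rlra.
  apply: le_trans (_ : (Y - X.-1)%:R <= _).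
    by rewrite ler_nat (leq_trans (count_window _ _ _))//; lia.
  rewrite natrB ?(leq_trans (leq_pred _))//.
  have : X%:R <= X.-1%:R + 1 :> R by rewrite natr1 ler_nat; lia.
  rewrite -natr1 in XX; rlra.
apply: le_trans (ler_wpM2r (expR_ge0 _) c1) _.
rewrite mulrDl mulrBl E1 mulrAC [expR (w - g) * _]mulrC EE mul1r.
have := expR_ge0 (- (w - g)); rlra.
Qed.

(** Coefficients of the series [Adiff (1 + u^-1) t k], without the oscillating factor n^(-it). *)
Definition wgt k u n : R := (vonM R n - 1) * (ln n%:R ^+ k * npow (1 + u^-1) n).

Lemma wgt_le k u n : `|wgt k u n| <= (1 + ln n%:R) ^+ k.+1 * npow (1 + u^-1) n.
Proof.
have l0 := ln_nat_ge0 R n; have v0 := vonM_ge0 R n; have vl := vonM_le R n.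
rewrite /wgt normrM (ger0_norm (_ : 0 <= ln n%:R ^+ k * _)); last first.
  by rewrite mulr_ge0 ?npow_ge0 ?exprn_ge0.
rewrite exprS -mulrA; apply: ler_pM => //.
- by rewrite mulr_ge0 ?npow_ge0 ?exprn_ge0.
- by rewrite ler_norml; lra.
- by rewrite ler_wpM2r ?npow_ge0// lerXn2r ?nnegrE//; lra.
Qed.

(** The exponent 1 + 1/u is split as 1/(2u) + (1 + 1/(4u)) + 1/(4u): the last part absorbs the
    logarithms, the middle one is summable, and the first is left to make large n negligible. *)
Lemma wgt_decay k : exists2 C : R, 0 <= C & forall u n, 1 <= u ->
  `|wgt k u n| <= C * u ^+ k.+1 * (npow ((2 * u)^-1) n * npow (1 + (4 * u)^-1) n).
Proof.
exists ((k.+1)`!%:R * 4 ^+ k.+1 * expR 1).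
  by rewrite !mulr_ge0 ?expR_ge0 ?exprn_ge0.
move=> u n u1; apply: le_trans (wgt_le k u n) _.
have l0 := ln_nat_ge0 R n; have i0 : 0 < (4 * u)^-1 by rewrite invr_gt0; lra.
have i1 : (4 * u)^-1 <= 1 by rewrite invf_le1; lra.
have y0 : 0 <= 1 + ln n%:R :> R by lra.
have := exp_pow_le k.+1 i0 y0; rewrite invrK => h.
apply: le_trans (ler_wpM2r (npow_ge0 _ _) h) _.
have -> : npow (1 + u^-1) n = npow ((2 * u)^-1) n * npow (1 + (4 * u)^-1) n * npow ((4 * u)^-1) n.
  have eu : 1 + u^-1 = (2 * u)^-1 + (1 + (4 * u)^-1) + (4 * u)^-1 by field; rewrite gt_eqF//; lra.
  by rewrite {1}eu (npowD _ (4 * u)^-1) (npowD (2 * u)^-1).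
have E : expR ((4 * u)^-1 * (1 + ln n%:R)) * npow ((4 * u)^-1) n <= expR 1.
  by rewrite /npow -expRD ler_expR; lra.
set A := npow ((2 * u)^-1) n * npow (1 + (4 * u)^-1) n.
have A0 : 0 <= A by rewrite mulr_ge0 ?npow_ge0.
rewrite exprMn.
have -> : (k.+1)`!%:R * (4 ^+ k.+1 * u ^+ k.+1) * expR ((4 * u)^-1 * (1 + ln n%:R)) * (A * npow (4 * u)^-1 n) =
  (k.+1)`!%:R * 4 ^+ k.+1 * u ^+ k.+1 * A * (expR ((4 * u)^-1 * (1 + ln n%:R)) * npow (4 * u)^-1 n) by ring.
have -> : (k.+1)`!%:R * 4 ^+ k.+1 * expR 1 * u ^+ k.+1 * A = (k.+1)`!%:R * 4 ^+ k.+1 * u ^+ k.+1 * A * expR 1 by ring.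
have u00 : 0 <= u by lra.
by rewrite ler_wpM2l// mulr_ge0// mulr_ge0 ?exprn_ge0// mulr_ge0 ?exprn_ge0.
Qed.

Lemma pow_exp_bound (b : R) j : 0 < b -> exists2 C : R, 0 <= C & forall u, 0 <= u -> u ^+ j * expR (- (b * u)) <= C.
Proof.
move=> b0; exists (j`!%:R * b^-1 ^+ j).
  by rewrite mulr_ge0 ?exprn_ge0 ?invr_ge0// ltW.
move=> u u0; have := exp_pow_le j b0 u0 => /(ler_wpM2r (expR_ge0 (- (b * u)))) /le_trans; apply.
by rewrite -[leLHS]mulrA -expRD subrr expR0 mulr1.
Qed.

Lemma wgt_has_sum k u (M : nat) (e w B : R) : 1 < 1 + u^-1 ->
  (forall t, `|t| <= M%:R * `|e| -> nc (Adiff (1 + u^-1) t k) <= B) ->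
  exists2 l, has_sum (fun n => (wgt k u n * kern M e (w - ln n%:R))%:C) l & nc l <= B.
Proof.
move=> s1 hB; apply: (@kern_sum_le R M e (fun t => Adiff (1 + u^-1) t k) 0 B w (wgt k u)) => // t.
have := has_sumD (LkP k t s1) (has_sumZ (-1) (ZkP k t s1)).
rewrite mulN1r -/(Adiff _ _ _); apply: has_sum_ext => n n0.
rewrite /wgt /W -/(npow (1 + u^-1) n) !(rmorphM, rmorphB, rmorph1) /=; ring.
Qed.

End Unsmoothing.
Arguments wgt {R} k u n : simpl never.

Section Unsmoothing2.
Variable R : realType.
Implicit Types (P h u v w : R).

Lemma unsmooth_final (s1 s2 y c q1 q2 k U X : R) : s1 <= 1 + y ->
  s2 <= q1 + k * X + q2 -> y <= 2 * c * U -> 0 <= c -> 0 <= q1 -> 0 <= q2 -> 0 <= k ->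
  1 <= U -> 0 <= X -> s1 + s2 <= (2 * c + 1 + q1 + q2 + k) * (U + X).
Proof.
move=> h1 h2 h3 c0 q10 q20 k0 U1 X0; have U0 : 0 <= U by lra.
have := mulr_ge0 c0 X0; have := mulr_ge0 q10 X0; have := mulr_ge0 q20 X0.
have := mulr_ge0 k0 U0; have := ler_wpM2l q10 U1; have := ler_wpM2l q20 U1; lra.
Qed.

Lemma four_le (s1 s2 s3 s4 q1 q2 k X : R) : s1 <= q1 -> s2 <= k * X -> s3 <= k * X ->
  s4 <= q2 -> s1 + s2 + s3 + s4 <= q1 + 2 * k * X + q2.
Proof. lra. Qed.

Lemma wgt_all k : exists2 C : R, 0 <= C & forall u N, 20 <= u ->
  \sum_(1 <= n < N.+1) `|wgt k u n| <= C * u ^+ k.+2.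
Proof.
have [C C0 hw] := wgt_decay R k; exists (5 * C); first lra.
move=> u N u20; have u0 : 0 < u by lra.
have i0 : 0 < (4 * u)^-1 by rewrite invr_gt0; lra.
have X0 : 0 <= C * u ^+ k.+1 by rewrite mulr_ge0 ?exprn_ge0//; lra.
apply: le_trans (_ : \sum_(1 <= n < N.+1) C * u ^+ k.+1 * npow (1 + (4 * u)^-1) n <= _).
  apply: ler_sum => n _; apply: le_trans (@hw u n _) _; first lra.
  rewrite ler_wpM2l// ler_piMl ?npow_ge0//.
  by rewrite /npow expR_le1 oppr_le0 mulr_ge0 ?ln_nat_ge0// invr_ge0; lra.
rewrite -mulr_sumr; apply: le_trans (ler_wpM2l X0 (npow_sum N i0)) _.
rewrite invrK [u ^+ k.+2]exprS.
have -> : 5 * C * (u * u ^+ k.+1) = C * u ^+ k.+1 * (5 * u) by ring.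
by rewrite ler_wpM2l//; lra.
Qed.

Lemma wgt_far k : exists2 C : R, 0 <= C & forall u N, 20 <= u ->
  \sum_(1 <= n < N.+1) `|wgt k u n| * (u ^+ 2 / 2 < ln n%:R)%R%:R <= C.
Proof.
have [C C0 hw] := wgt_decay R k.
have q4 : 0 < 4^-1 :> R by rewrite invr_gt0.
have [C4 C40 h4] := @pow_exp_bound R 4^-1 k.+2 q4.
exists (5 * C * C4); first by rewrite !mulr_ge0.
move=> u N u20; have u0 : 0 < u by lra.
have i0 : 0 < (4 * u)^-1 by rewrite invr_gt0; lra.
have X0 : 0 <= C * u ^+ k.+1 by rewrite mulr_ge0 ?exprn_ge0//; lra.
have XE : 0 <= C * u ^+ k.+1 * expR (- (4^-1 * u)) by rewrite mulr_ge0 ?expR_ge0.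
apply: le_trans (_ : \sum_(1 <= n < N.+1) C * u ^+ k.+1 * expR (- (4^-1 * u)) * npow (1 + (4 * u)^-1) n <= _).
  apply: ler_sum => n _; case: ltP => /= [Pn|_]; last by rewrite mulr0 mulr_ge0 ?npow_ge0.
  rewrite mulr1; apply: le_trans (@hw u n _) _; first lra.
  rewrite mulrA ler_wpM2r ?npow_ge0// ler_wpM2l//.
  rewrite /npow ler_expR lerN2 -ler_pdivrMl ?invr_gt0 ?invrK; [|lra].
  apply: le_trans (ltW Pn); rewrite expr2; lra.
rewrite -mulr_sumr; apply: le_trans (ler_wpM2l XE (npow_sum N i0)) _.
rewrite invrK; have Y := h4 u (ltW u0).
apply: le_trans (_ : C * u ^+ k.+1 * expR (- (4^-1 * u)) * (5 * u) <= _).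
  by rewrite ler_wpM2l//; lra.
have := ler_wpM2l (_ : 0 <= 5 * C) Y; rewrite mulr_ge0// => /(_ isT).
rewrite [u ^+ k.+2]exprS; lra.
Qed.

Lemma wgt_edge k m : (0 < m)%N -> exists2 C : R, 0 <= C & forall u w N, 20 <= u -> u <= w -> w <= 2 * u ->
  \sum_(1 <= n < N.+1) `|wgt k u n| * (`|ln n%:R - w| <= 2 * (u ^+ m)^-1)%R%:R <= C * (u ^+ k.+1 / u ^+ m).
Proof.
move=> m0; have [C5 C50 h5] := @pow_exp_bound R 1 m ltr01.
exists (4 ^+ k.+1 * (8 + 4 * C5)); first by rewrite mulr_ge0 ?exprn_ge0//; rlra.
move=> u w N u20 uw wu; have u0 : 0 < u by rlra.
have un0 n : 0 < u ^+ n by apply: exprn_gt0.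
set h := (u ^+ m)^-1; have h0 : 0 < h by rewrite invr_gt0.
have h8 : 2 * h <= 1 / 4.
  have um : u <= u ^+ m by rewrite -{1}[u]expr1 ler_weXn2l//; rlra.
  have hu : h <= u^-1 by rewrite lef_pV2 ?posrE.
  have : u^-1 <= 20^-1 by rewrite lef_pV2 ?posrE//; rlra.
  rlra.
apply: le_trans (_ : (4 * u) ^+ k.+1 * \sum_(1 <= n < N.+1 | `|ln n%:R - w| <= 2 * h) npow 1 n <= _).
  rewrite mulr_sumr [leRHS]big_mkcond; apply: ler_sum_nat => n /andP[n0 _].
  case: ifP => [|_]; last by rewrite mulr0.
  rewrite ler_norml => /andP[w1 w2]; rewrite mulr1; apply: le_trans (wgt_le k u n) _.
  have l0 := ln_nat_ge0 R n.
  apply: ler_pM; rewrite ?npow_ge0 ?exprn_ge0//; first rlra.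
    by rewrite lerXn2r ?nnegrE//; rlra.
  by apply: npow_le; rewrite lerDl invr_ge0 ltW.
have w1 : 1 <= w by rlra.
have hh : 0 < 2 * h by rlra.
apply: le_trans (ler_wpM2l _ (log_window N w1 hh h8)) _; first by rewrite exprn_ge0//; rlra.
have Ew : expR (- w) <= C5 * h.
  apply: le_trans (_ : expR (- u) <= _); first by rewrite ler_expR; rlra.
  by have := h5 u (ltW u0); rewrite mul1r /h ler_pdivlMr// mulrC.
rewrite exprMn -[leLHS]mulrA.
have -> : 4 ^+ k.+1 * (8 + 4 * C5) * (u ^+ k.+1 / u ^+ m) = 4 ^+ k.+1 * (u ^+ k.+1 * ((8 + 4 * C5) * h)).
  by rewrite /h; ring.
by rewrite ler_wpM2l ?exprn_ge0// ler_wpM2l ?(ltW (un0 _))//; rlra.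
Qed.

(** The period is u^2, the transition width u^(-m) and the degree about u^(2m+5). This degree makes
    the kernel tail about exp (- q u), and it keeps the heights |t| below a power of u, so that the
    logarithmic bound for [Adiff] is at most a constant times u. The translates, at most 2 u^(2m+5)
    in number, then give u^(2m+6), and the two endpoints give u^(k+1-m). *)
Lemma unsmooth k m : (0 < m)%N -> exists C u0 : R, [/\ 0 <= C, 1 <= u0 & forall u v1 v2, u0 <= u -> u <= v1 ->
  v1 <= v2 -> v2 <= 2 * u -> exists N0, forall N, (N0 <= N)%N ->
  `|\sum_(1 <= n < N.+1) ((v1 < ln n%:R) && (ln n%:R <= v2))%R%:R * wgt k u n| <=
  C * (u ^+ (2 * m + 6) + u ^+ k.+1 / u ^+ m)].
Proof.
move=> m0; have [r /andP[r0 r1] /(_ k)[C1 [D [C10 hA]]]] := Adiff_bound R.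
have q0 : 0 < cos 1 ^+ 2 :> R by rewrite exprn_gt0 ?cos1_gt0.
set q := cos 1 ^+ 2 in q0.
have [KA KA0 hA1] := wgt_all k.
have [KE KE0 hE] := wgt_edge k m0.
have [KF KF0 hF] := wgt_far k.
have [C3 C30 h3] := @pow_exp_bound R q (5 + 2 * m + k.+2) q0.
(* Chosen so that exp (b (2 + (6 + 2m) ln u)), which bounds powers of [lam t], is a constant times
   u. *)
pose b : R := (6 + 2 * m)%:R^-1.
have b0 : 0 < b by rewrite invr_gt0 ltr0n.
pose C6 := C1 * (D`!%:R * b^-1 ^+ D * expR (2 * b)).
have C60 : 0 <= C6 by rewrite !mulr_ge0 ?expR_ge0 ?exprn_ge0 ?invr_ge0// ltW.
pose K1 := 2 * C6 + 1 + 2 * expR q * KA * C3 + KF.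
pose K2 := 2 * KE.
have K20 : 0 <= K2 by rewrite mulr_ge0.
have K10 : 0 <= K1.
  have : 0 <= 2 * expR q * KA * C3 by rewrite !mulr_ge0 ?expR_ge0.
  rewrite /K1; rlra.
exists (K1 + K2), (20 + r^-1); split; [rlra|have : 0 < r^-1 by rewrite invr_gt0|]; first rlra.
move=> u v1 v2 ur uv1 v12 v2u.
have ri : 0 < r^-1 by rewrite invr_gt0.
have u20 : 20 <= u by rlra.
have u0 : 0 < u by rlra.
have ui : 0 < u^-1 by rewrite invr_gt0.
have s1 : 1 < 1 + u^-1 by rlra.
have sr : 1 + u^-1 <= 1 + r.
  by rewrite lerD2l -[r]invrK lef_pV2 ?posrE//; rlra.
have un n : 1 <= u ^+ n by apply: exprn_ege1; rlra.
have un0 n : 0 < u ^+ n by apply: exprn_gt0.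
pose P := u ^+ 2; pose h := (u ^+ m)^-1.
have P0 : 0 < P := un0 2%N. have h0 : 0 < h by rewrite invr_gt0.
have h1 : h <= 1 by rewrite invf_le1.
pose Uo := u ^+ (5 + 2 * m); have Uo1 : 1 <= Uo := un _.
pose M := Num.truncn Uo.
have M1 : M%:R <= Uo by rewrite truncn_le; rlra.
have M2 : Uo < M.+1%:R by exact: lt_truncnS.
have L2 : M.+1%:R <= 2 * Uo by rewrite -natr1; rlra.
have p4 : pi <= 4 :> R by have := pihalf_lt2 R; rlra.
have p2 := pi_ge2 R.
have PE : P = u * u by rewrite /P expr2.
have pih : pi * h <= P by rewrite PE; move: h0 h1 p4 p2 u20; clear; nra.
have PL : P / M.+1%:R <= h.
  rewrite ler_pdivrMr ?ltr0n//; apply: le_trans (_ : h * Uo <= _); last first.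
    by rewrite ler_wpM2l ?(ltW h0)// ltW.
  rewrite /h /Uo /P ler_pdivlMl// -exprD ler_weXn2l//; [move: u20; clear; lra|by rewrite addnC leq_add// mul2n -addnn leq_addr].
have vP : 4 * v2 <= P by rewrite PE; move: v2u u20; clear; nra.
have hP : 4 * h <= P by rewrite PE; move: h0 h1 u20; clear; nra.
have v10 : 0 <= v1 := le_trans (ltW u0) uv1.
pose e := 2 * pi / P.
have e0 : 0 <= e by rewrite divr_ge0 ?(ltW P0)//; move: p2; clear; lra.
pose kap := \sum_(i < M.+1) kern M e (i%:R * (P / M.+1%:R)).
pose nn := (Num.truncn ((v2 - v1) * M.+1%:R / P)).+1.
pose tau := expR (- (M%:R * (cos 1 * h / P) ^+ 2)).
have step v : 0 <= v -> [/\ 1 <= kap, (nn <= M.+1)%N & _] :=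
  @kern_step R M P h v1 v2 v P0 h0 pih PL v10 v12 vP hP.
pose T n := kap^-1 * \sum_(0 <= r < nn) kern M e (v1 - ln n%:R + r%:R * (P / M.+1%:R)).
have [kap1 nnL _] := step 0 (lexx _).
have tau_le : tau <= expR q * expR (- (q * u)).
  rewrite /tau -expRD ler_expR; have -> : (cos 1 * h / P) ^+ 2 = q * (u ^+ (4 + 2 * m))^-1.
    rewrite /h /P /q !exprMn -!exprVn -!exprM -mulrA -exprD; congr (_ * _ ^+ _).
    by rewrite addnC mulnC.
  have MU : Uo - 1 <= M%:R by have := M2; rewrite -natr1; rlra.
  have q4m : 0 < q * (u ^+ (4 + 2 * m))^-1 by rewrite mulr_gt0// invr_gt0.
  have := ler_wpM2r (ltW q4m) MU; rewrite mulrBl mul1r.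
  have -> : Uo * (q * (u ^+ (4 + 2 * m))^-1) = q * u.
    by rewrite /Uo addSn exprS mulrCA mulfK ?gt_eqF// mulrC.
  have : q * (u ^+ (4 + 2 * m))^-1 <= q by rewrite ler_piMr ?(ltW q0)// invf_le1.
  rlra.
have hB t : `|t| <= M%:R * `|e| -> nc (Adiff (1 + u^-1) t k) <= C6 * u.
  move=> te; apply: le_trans (hA _ _ (introT andP (conj s1 sr))) _.
  rewrite /C6 -mulrA ler_wpM2l//.
  have t8 : `|t| <= 8 * Uo.
    apply: le_trans te _; rewrite ger0_norm// mulrC; apply: ler_pM => //.
    by rewrite /e ler_pdivrMr//; have := un 2%N; rewrite -/P; move: p4; clear; lra.
  have lamt : lam t <= 2 + (6 + 2 * m)%:R * ln u.
    rewrite /lam lerD2l mulr_natl -lnXn// ler_ln ?posrE//; last first.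
      by have := normr_ge0 t; rlra.
    have -> : u ^+ (6 + 2 * m) = u * Uo by rewrite /Uo -exprS.
    by move: t8 u20 Uo1; clear; nra.
  have l0 : 0 <= ln u by apply: ln_ge0; move: u20; clear; lra.
  have Y0 : 0 <= 2 + (6 + 2 * m)%:R * ln u by rewrite addr_ge0 ?mulr_ge0.
  apply: le_trans (_ : (2 + (6 + 2 * m)%:R * ln u) ^+ D <= _).
    by rewrite lerXn2r ?nnegrE// ltW ?lam_gt0.
  apply: le_trans (exp_pow_le D b0 Y0) _; rewrite -[leRHS]mulrA ler_wpM2l//.
    by rewrite mulr_ge0 ?exprn_ge0 ?invr_ge0// ltW.
  have -> : b * (2 + (6 + 2 * m)%:R * ln u) = 2 * b + ln u.
    by rewrite mulrDr mulrA mulVf ?mul1r ?pnatr_eq0// mulrC.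
  by rewrite expRD lnK// posrE.
have [l hl lB] : exists2 l, has_sum (fun n => (wgt k u n * T n)%:C) l & nc l <= nn%:R * (C6 * u).
  have W' (j : nat) : exists l, has_sum (fun n => (wgt k u n * kern M e (v1 + j%:R * (P / M.+1%:R) - ln n%:R))%:C) l /\ nc l <= C6 * u.
    by have [l h1' h2'] := wgt_has_sum (v1 + j%:R * (P / M.+1%:R)) s1 hB; exists l.
  have [ll hll] := choice W'.
  exists ((kap^-1)%:C * \sum_(r <- index_iota 0 nn) ll r).
    apply: has_sum_ext (has_sumZ (kap^-1)%:C (has_sum_fin (index_iota 0 nn) (fun r => (hll r).1))) => n n0.
    rewrite -rmorph_sum -rmorphM; congr (_%:C); rewrite /T mulrCA; congr (_ * _).
    rewrite [RHS]mulr_sumr; apply: eq_bigr => j _.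
    by rewrite (_ : v1 + j%:R * _ - _ = v1 - ln n%:R + j%:R * (P / M.+1%:R))//; ring.
  rewrite ncM nc_real ger0_norm ?invr_ge0; last rlra.
  have S0 : 0 <= nc (\sum_(r <- index_iota 0 nn) ll r) by exact: nc_ge0.
  apply: le_trans (_ : nc (\sum_(r <- index_iota 0 nn) ll r) <= _).
    by rewrite ler_piMl// invf_le1//; rlra.
  apply: le_trans (nc_sum _ _ _) _.
  apply: le_trans (_ : \sum_(r <- index_iota 0 nn) C6 * u <= _).
    by apply: ler_sum => j _; exact: (hll j).2.
  by rewrite sumr_const_nat subn0 -[leLHS]mulr_natl.
have [N0 hN0] := hl 1 ltr01.
exists N0 => N /hN0 hN.
have eT : \sum_(1 <= n < N.+1) (wgt k u n * T n)%:C = (\sum_(1 <= n < N.+1) wgt k u n * T n)%:C :> R[i].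
  by rewrite rmorph_sum.
rewrite eT in hN.
have S1 : `|\sum_(1 <= n < N.+1) wgt k u n * T n| <= 1 + nn%:R * (C6 * u).
  rewrite -nc_real; have := nc_triB (\sum_(1 <= n < N.+1) wgt k u n * T n)%:C l.
  rewrite nc_distrC; rlra.
pose Ind n : R := ((v1 < ln n%:R) && (ln n%:R <= v2))%R%:R.
have -> : \sum_(1 <= n < N.+1) Ind n * wgt k u n =
  \sum_(1 <= n < N.+1) wgt k u n * T n + \sum_(1 <= n < N.+1) wgt k u n * (Ind n - T n).
  by rewrite -big_split; apply: eq_bigr => n _ /=; ring.
have T1 : \sum_(1 <= n < N.+1) `|wgt k u n| * (M.+1%:R * tau) <= 2 * expR q * KA * C3.
  rewrite -mulr_suml; apply: le_trans (_ : KA * u ^+ k.+2 * (2 * Uo * (expR q * expR (- (q * u)))) <= _).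
    apply: ler_pM; rewrite ?sumr_ge0 ?hA1//; first by rewrite mulr_ge0 ?expR_ge0.
    by apply: ler_pM => //; exact: expR_ge0.
  have := h3 u (ltW u0); rewrite exprD -/Uo => Y.
  have := ler_wpM2l (_ : 0 <= 2 * expR q * KA) Y; rewrite !mulr_ge0 ?expR_ge0// => /(_ isT).
  rlra.
apply: le_trans (ler_normD _ _) _.
have S2 : `|\sum_(1 <= n < N.+1) wgt k u n * (Ind n - T n)| <=
   2 * expR q * KA * C3 + K2 * (u ^+ k.+1 / u ^+ m) + KF.
  apply: le_trans (ler_norm_sum _ _ _) _.
  have A1 := hE u v1 N u20 uv1 (le_trans v12 v2u).
  have A2 := hE u v2 N u20 (le_trans uv1 v12) v2u.
  have A3 := hF u N u20.
  apply: le_trans (_ : \sum_(1 <= n < N.+1) `|wgt k u n| * (M.+1%:R * tau) +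
    \sum_(1 <= n < N.+1) `|wgt k u n| * (`|ln n%:R - v1| <= 2 * h)%R%:R +
    \sum_(1 <= n < N.+1) `|wgt k u n| * (`|ln n%:R - v2| <= 2 * h)%R%:R +
    \sum_(1 <= n < N.+1) `|wgt k u n| * (P / 2 < ln n%:R)%R%:R <= _); last first.
    by apply: (@four_le _ _ _ _ _ _ _ _ T1 A1 A2 A3).
  rewrite -!big_split /=; apply: ler_sum => n _; rewrite normrM -!mulrDr ler_wpM2l//.
  by have [_ _] := step (ln n%:R) (ln_nat_ge0 R n).
have nnU : nn%:R * (C6 * u) <= 2 * C6 * u ^+ (2 * m + 6).
  apply: le_trans (_ : 2 * Uo * (C6 * u) <= _).
    have nU : nn%:R <= 2 * Uo by apply: le_trans L2; rewrite ler_nat.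
    have cu : 0 <= C6 * u by rewrite mulr_ge0 // ltW.
    exact: ler_wpM2r.
  have -> : u ^+ (2 * m + 6) = Uo * u by rewrite /Uo -exprSr addnC.
  rlra.
have U1 := un (2 * m + 6)%N.
have U2 : 0 <= u ^+ k.+1 / u ^+ m by rewrite divr_ge0 ?ltW.
have Q1 : 0 <= 2 * expR q * KA * C3 by rewrite !mulr_ge0 ?expR_ge0.
exact: unsmooth_final S1 S2 nnU C60 Q1 KF0 K20 U1 U2.
Qed.
End Unsmoothing2.

(** * Abel summation *)

Section AbelBound.
Variable R : realType.
Implicit Types (b : nat -> R).

Lemma abel_sum (A : comPzRingType) (f b : nat -> A) X Z : (X <= Z)%N ->
  \sum_(X <= n < Z.+1) f n * b n = (\sum_(X <= n < Z.+1) f n) * b Z +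
    \sum_(X <= n < Z) (\sum_(X <= j < n.+1) f j) * (b n - b n.+1).
Proof.
elim: Z => [|Z ih]; first by rewrite leqn0 => /eqP ->; rewrite [X in _ + X]big_geq// !big_nat1 addr0.
rewrite leq_eqVlt => /orP[/eqP ->|XZ]; first by rewrite [X in _ + X]big_geq// !big_nat1 addr0.
rewrite big_nat_recr ?ih//=; last exact: leqW.
rewrite [\sum_(X <= n < Z.+2) f n]big_nat_recr/=; last exact: leqW.
rewrite [\sum_(X <= n < Z.+1) _ * (_ - _)]big_nat_recr//=.
move: (\sum_(X <= n < Z.+1) f n) (\sum_(X <= n < Z) _) => s t.
ring.
Qed.

Lemma abel_nc (f : nat -> R[i]) b X Y (B : R) : (X < Y)%N -> 0 <= B ->
  (forall Z, (X < Z)%N -> (Z <= Y)%N -> nc (\sum_(X <= n < Z) f n) <= B) ->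
  (forall n, (X <= n)%N -> (n < Y)%N -> 0 <= b n) ->
  (forall n, (X <= n)%N -> (n.+1 < Y)%N -> b n.+1 <= b n) ->
  nc (\sum_(X <= n < Y) f n * (b n)%:C) <= B * b X.
Proof.
case: Y => // Z; rewrite ltnS => XZ B0 hB b0 bd.
rewrite abel_sum//; apply: le_trans (ncD _ _) _.
apply: le_trans (_ : B * b Z + \sum_(X <= n < Z) B * (b n - b n.+1) <= _); last first.
  rewrite -mulr_sumr -mulrDr ler_wpM2l//.
  by have := telescope_sumr b XZ; under eq_bigr do rewrite -opprB; rewrite sumrN; lra.
apply: lerD.
  by rewrite ncM nc_real ger0_norm ?b0// ler_wpM2r ?b0// hB.
apply: le_trans (nc_sum _ _ _) _; apply: ler_sum_nat => n /andP[Xn nZ].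
rewrite ncM -rmorphB nc_real ger0_norm ?subr_ge0 ?bd//.
by rewrite ler_wpM2r ?subr_ge0 ?bd// hB// ltnS ltnW.
Qed.

Lemma abel_le (f : nat -> R) b X Y (B : R) : (X < Y)%N -> 0 <= B ->
  (forall Z, (X < Z)%N -> (Z <= Y)%N -> `|\sum_(X <= n < Z) f n| <= B) ->
  (forall n, (X <= n)%N -> (n < Y)%N -> 0 <= b n) ->
  (forall n, (X <= n)%N -> (n.+1 < Y)%N -> b n.+1 <= b n) ->
  `|\sum_(X <= n < Y) f n * b n| <= B * b X.
Proof.
move=> XY B0 hB b0 bd; rewrite -nc_real rmorph_sum.
under eq_bigr do rewrite rmorphM.
by apply: abel_nc b0 bd => // Z XZ ZY; rewrite -rmorph_sum nc_real hB.
Qed.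
End AbelBound.

(** * Cancellation in sums of (Lambda(n) - 1) / (n ln n) *)

Section LogIntegers.
Variable R : realType.
Implicit Types (u v w : R).

Definition invln (n : nat) : R := npow 1 n / ln n%:R.

Definition lamw n : R := (vonM R n - 1) * invln n.


Lemma ln_nat_gt0 n : (1 < n)%N -> 0 < ln n%:R :> R.
Proof. by move=> n1; rewrite ln_gt0// ltr1n. Qed.

Lemma ln_nat_lt m n : (0 < m)%N -> (m < n)%N -> ln m%:R < ln n%:R :> R.
Proof.
move=> m0 mn; rewrite ltr_ln ?ltr_nat// posrE ltr0n//; exact: leq_trans mn.
Qed.

Lemma ln_nat_gt0_gt1 n : 0 < ln n%:R :> R -> (1 < n)%N.
Proof.
case: n => [|[|n]] //; last by rewrite ln1 ltxx.
by rewrite (@ln0 R 0%:R)// ltxx.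
Qed.

(** The logarithmic derivative in w is 1/u - (k+1)/w, not positive while w <= 2u and k >= 1. With w
    = ln n this is the factor that turns [wgt k u n] into [lamw n]. *)
Lemma ln_ratio_dec (k : nat) u v w : (0 < k)%N -> 0 < u -> u <= v -> v <= w -> w <= 2 * u ->
  expR (w / u) / w ^+ k.+1 <= expR (v / u) / v ^+ k.+1.
Proof.
move=> k0 u0 uv vw w2; have v0 : 0 < v by lra. have w0 : 0 < w by lra.
have key : w / u - k.+1%:R * ln w <= v / u - k.+1%:R * ln v.
  have h : (w - v) / w <= ln w - ln v.
    have := @le_ln1Dx R (v / w - 1).
    rewrite (_ : 1 + (v / w - 1) = v / w); last ring.
    rewrite ltrBrDr addrC subrr divr_gt0// => /(_ isT).
    rewrite ln_div ?posrE// mulrBl divff ?gt_eqF//; lra.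
  have h2 : (w - v) / u <= 2 * ((w - v) / w) -> 2 * ((w - v) / w) <= k.+1%:R * ((w - v) / w) -> w / u - k.+1%:R * ln w <= v / u - k.+1%:R * ln v.
    have := ler_wpM2l (ler0n R k.+1) h; rewrite mulrBr [(w - v) / u]mulrBl; lra.
  have d0 : 0 <= (w - v) / w by rewrite divr_ge0 ?subr_ge0// ltW.
  apply: h2; last by rewrite ler_wpM2r// ler_nat.
  rewrite mulrCA ler_wpM2l ?subr_ge0// -[u^-1]mul1r ler_pdivrMr// mulrAC ler_pdivlMr//; lra.
have e z : 0 < z -> expR (z / u) / z ^+ k.+1 = expR (z / u - k.+1%:R * ln z).
  by move=> z0; rewrite expRD expRN expRM_natl lnK.
by rewrite !e// ler_expR.
Qed.

(** Abel summation against that factor gains u^(-k-1), with u = ln X. For k = 3m + 5 both error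
    terms of [unsmooth] equal u^(2m+6), and u^(2m+6) / u^(3m+6) = u^(-m). *)
Lemma vonM_invln_short m : (0 < m)%N -> exists C u0 : R, [/\ 0 <= C, 1 <= u0 &
  forall X Y : nat, u0 <= ln X%:R -> (X <= Y)%N -> (Y <= X ^ 2)%N ->
  `|\sum_(X.+1 <= n < Y.+1) lamw n| <= C / ln X%:R ^+ m].
Proof.
move=> m0; pose k := (3 * m + 5)%N; have k0 : (0 < k)%N by rewrite /k; lia.
have [C [u0 [C0 u01 h]]] := @unsmooth R k m m0.
exists (C * 2 * expR 2), u0; split => //; first by rewrite !mulr_ge0 ?expR_ge0.
move=> X Y uX XY YX; set u := ln X%:R in uX *.
have up : 0 < u by rlra.
have X1 := ln_nat_gt0_gt1 up.
have [/eqP <-|XY'] := boolP (X == Y).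
  by rewrite big_geq// normr0 divr_ge0 ?exprn_ge0 ?(ltW up)// !mulr_ge0 ?expR_ge0.
have {XY XY'}XY : (X < Y)%N by rewrite ltn_neqAle XY' XY.
have lnX2 : ln Y%:R <= 2 * u.
  apply: le_trans (ln_nat_le R _ YX) _; first by apply: leq_trans XY.
  by rewrite natrX lnXn ?mulr_natl// ltr0n ltnW.
pose b n : R := expR (ln n%:R / u) / ln n%:R ^+ k.+1.
have lb n : (X < n)%N -> u <= ln n%:R by move=> Xn; apply: ln_nat_le; [exact: ltnW|exact: ltnW].
have eqb n : (X.+1 <= n < Y.+1)%N -> lamw n = wgt k u n * b n.
  move=> /andP[Xn _]; rewrite /lamw /invln /wgt /b -!mulrA; congr (_ * _).
  have l0 : 0 < ln n%:R :> R by apply: lt_le_trans (lb n Xn).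
  have -> : npow (1 + u^-1) n = npow 1 n / expR (ln n%:R / u).
    by rewrite npowD /npow [u^-1 * _]mulrC [expR (- (_ / u))]expRN.
  by rewrite exprS; field; rewrite !gt_eqF ?exprn_gt0 ?expR_gt0.
rewrite (eq_big_nat _ _ eqb).
have UB : 0 <= C * (u ^+ (2 * m + 6) + u ^+ k.+1 / u ^+ m).
  by rewrite mulr_ge0// addr_ge0 ?divr_ge0 ?exprn_ge0// ltW.
apply: le_trans (@abel_le R (wgt k u) b X.+1 Y.+1 _ _ UB _ _ _) _.
- by rewrite ltnS.
- case=> // Z; rewrite !ltnS => XZ ZY.
  have [||||N0 hN] := h u u (ln Z%:R) => //; first exact: lb.
    by apply: le_trans lnX2; rewrite ln_nat_le// (leq_trans _ XZ).
  have := hN (maxn N0 Y) (leq_maxl _ _); set S := \sum_(_ <= _ < _) _ * _.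
  suff -> : S = \sum_(X.+1 <= n < Z.+1) wgt k u n by [].
  have ZN : (Z.+1 <= (maxn N0 Y).+1)%N by rewrite ltnS (leq_trans ZY)// leq_maxr.
  rewrite /S (@sum_split _ _ _ X.+1) ?(leq_trans (ltnW _) ZN)// (@sum_split _ _ X.+1 Z.+1)//; last exact: ltnW.
  rewrite big1_seq ?add0r; last first.
    move=> n /andP[_]; rewrite mem_index_iota ltnS => /andP[n0 nX].
    by have := ln_nat_le R n0 nX; rewrite -/u ltNge => ->; rewrite mul0r.
  rewrite [X in _ + X]big1_seq ?addr0; last first.
    move=> n /andP[_]; rewrite mem_index_iota => /andP[Zn _].
    have Z0 : (0 < Z)%N by exact: leq_trans XZ.
    by have := ln_nat_lt Z0 Zn; rewrite ltNge => /negbTE ->; rewrite andbF mul0r.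
  apply: eq_big_nat => n /andP[Xn nZ].
  rewrite (ln_nat_lt _ Xn) ?(ltnW X1)// ln_nat_le ?mul1r//.
  by rewrite (leq_trans _ Xn).
- move=> n Xn _; rewrite /b divr_ge0 ?expR_ge0// exprn_ge0//.
  exact: ln_nat_ge0.
- move=> n Xn nY; apply: ln_ratio_dec => //; first exact: lb.
    by apply: ln_nat_le => //; exact: leq_trans Xn.
  by apply: le_trans lnX2; apply: ln_nat_le.
have bX : b X.+1 <= expR 2 / u ^+ k.+1.
  rewrite /b ler_pM ?expR_ge0 ?invr_ge0 ?exprn_ge0 ?ln_nat_ge0//.
    rewrite ler_expR ler_pdivrMr//; apply: le_trans lnX2; exact: ln_nat_le.
  by rewrite lef_pV2 ?posrE ?exprn_gt0// ?(lt_le_trans up)// ?lerXn2r ?nnegrE ?ln_nat_ge0// ?(ltW up)// lb.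
apply: le_trans (ler_wpM2l UB bX) _.
have -> : u ^+ k.+1 / u ^+ m = u ^+ (2 * m + 6).
  by rewrite /k (_ : (3 * m + 5).+1 = (2 * m + 6) + m)%N ?exprD ?mulfK ?gt_eqF ?exprn_gt0//; lia.
have -> : u ^+ k.+1 = u ^+ (2 * m + 6) * u ^+ m.
  by rewrite -exprD; congr (_ ^+ _); rewrite /k; lia.
have A0 : u ^+ (2 * m + 6) != 0 by rewrite gt_eqF// exprn_gt0.
have B0 : u ^+ m != 0 by rewrite gt_eqF// exprn_gt0.
move: (u ^+ (2 * m + 6)) (u ^+ m) A0 B0 => A B A0 B0.
rewrite le_eqVlt; apply/orP; left; apply/eqP; field.
by rewrite A0 B0.
Qed.

(** Iteration along X, X^2, X^4, ...: each squaring doubles ln X, and since m >= 1 the errors at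
    least halve, so their total is at most twice the first. *)
Lemma vonM_invln m : (0 < m)%N -> exists C u0 : R, [/\ 0 <= C, 1 <= u0 &
  forall X Y : nat, u0 <= ln X%:R -> (X <= Y)%N ->
  `|\sum_(X.+1 <= n < Y.+1) lamw n| <= C / ln X%:R ^+ m].
Proof.
move=> m0; have [C [u0 [C0 u01 h]]] := vonM_invln_short m0.
exists (2 * C), u0; split => //; first lra.
move=> X Y uX; have [d] := ubnP (Y - X)%N; elim: d X uX => // d ih X uX dXY XY.
have up : 0 < ln X%:R :> R by lra.
have X1 := ln_nat_gt0_gt1 up.
have q0 : 0 <= C / ln X%:R ^+ m by rewrite divr_ge0// exprn_ge0 ?ltW.
have [YX|XY2] := leqP Y (X ^ 2).
  apply: le_trans (h _ _ uX XY YX) _; rewrite -mulrA; lra.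
have XX : (X < X ^ 2)%N by rewrite -[X in (X < _)%N]expn1 ltn_exp2l.
rewrite (@sum_split _ _ _ (X ^ 2).+1) ?ltnS//; last first; [exact: ltnW|exact: ltnW|].
have lX2 : ln (X ^ 2)%:R = 2 * ln X%:R :> R by rewrite natrX lnXn ?mulr_natl// ltr0n ltnW.
apply: le_trans (ler_normD _ _) _.
have h1 := h X (X ^ 2)%N uX (ltnW XX) (leqnn _).
have h2 : `|\sum_((X ^ 2).+1 <= n < Y.+1) lamw n| <= 2 * C / ln (X ^ 2)%:R ^+ m.
  by apply: ih; [rewrite lX2; lra|lia|exact: ltnW].
have : 2 * C / ln (X ^ 2)%:R ^+ m <= C / ln X%:R ^+ m.
  rewrite lX2 exprMn invfM mulrA ler_wpM2r ?invr_ge0 ?exprn_ge0 ?(ltW up)//.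
  rewrite mulrAC ler_piMl// ler_pdivrMr ?exprn_gt0// mul1r.
  by rewrite -{1}[2]expr1 ler_weXn2l// ler1n.
by rewrite -mulrA; lra.
Qed.
End LogIntegers.

(** * The Mertens sum with a strong error term *)

Section Mertens.
Variable R : realType.
Implicit Types (a b e : R).

Lemma ln_diff_le a b : 0 < a -> 0 < b -> ln b - ln a <= (b - a) / a.
Proof.
move=> a0 b0; have := @le_ln1Dx R (b / a - 1).
rewrite (_ : 1 + (b / a - 1) = b / a); last ring.
rewrite ltrBrDr addrC subrr divr_gt0// => /(_ isT).
by rewrite ln_div ?posrE// mulrBl divff ?gt_eqF//; lra.
Qed.

Lemma ln_diff_ge a b : 0 < a -> 0 < b -> (b - a) / b <= ln b - ln a.
Proof.
move=> a0 b0; have := ln_diff_le b0 a0.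
by rewrite -[ln b - _]opprB -[b - a]opprB mulNr lerN2.
Qed.

Lemma ln2_half : 2^-1 <= ln 2%:R :> R.
Proof. by have := ln_diff_ge ltr01 (ltr0n R 2); rewrite ln1 subr0; lra. Qed.

Lemma invln_ge0 n : 0 <= invln R n.
Proof. by rewrite divr_ge0 ?npow_ge0 ?ln_nat_ge0. Qed.

Lemma lnln_step n : (1 < n)%N ->
  invln R n.+1 <= ln (ln n.+1%:R) - ln (ln n%:R) <= invln R n.
Proof.
move=> n1; have l0 := ln_nat_gt0 R n1; have l1 : 0 < ln n.+1%:R :> R by exact/ln_nat_gt0/ltnW.
have n0R : 0 < n%:R :> R by rewrite ltr0n ltnW.
have n1R : 0 < n.+1%:R :> R by rewrite ltr0n.
have d : n.+1%:R - n%:R = 1 :> R by rewrite -natr1 addrAC subrr add0r.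
have := ln_diff_le n0R n1R; have := ln_diff_ge n0R n1R; rewrite d !div1r => d1 d2.
have E0 : npow 1 n = n%:R^-1 :> R by rewrite npow_1// ltnW.
have E1 : npow 1 n.+1 = n.+1%:R^-1 :> R by rewrite npow_1.
rewrite /invln E0 E1; apply/andP; split.
  by apply: le_trans (ln_diff_ge l0 l1); rewrite ler_wpM2r// invr_ge0 ltW.
by apply: le_trans (ln_diff_le l0 l1) _; rewrite ler_wpM2r// invr_ge0 ltW.
Qed.

Lemma sum_invln X Y : (1 < X)%N -> (X <= Y)%N ->
  `|\sum_(X.+1 <= n < Y.+1) invln R n - (ln (ln Y%:R) - ln (ln X%:R))| <= 2 * npow 1 X.
Proof.
move=> X1.
suff main Z : (X <= Z)%N -> 0 <= ln (ln Z%:R) - ln (ln X%:R) - \sum_(X.+1 <= n < Z.+1) invln R n <= invln R X - invln R Z.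
  move=> /main /andP[h1 h2]; rewrite distrC ger0_norm//; apply: le_trans h2 _.
  apply: le_trans (_ : invln R X <= _); first by rewrite gerBl invln_ge0.
  rewrite /invln ler_pdivrMr ?ln_nat_gt0// mulrAC ler_peMl ?npow_ge0//.
  by have := @ln_nat_le R 2 X isT X1; have := ln2_half; lra.
elim: Z => [|Z ih']; first by rewrite leqn0 => /eqP ->; rewrite big_geq// !subrr lexx.
rewrite leq_eqVlt => /orP[/eqP <-|XZ]; first by rewrite big_geq// !subrr lexx.
have /andP[a1 a2] := ih' XZ; have Z1 : (1 < Z)%N by exact: leq_trans X1 XZ.
have /andP[b1 b2] := lnln_step Z1.
by rewrite big_nat_recr//=; apply/andP; split; lra.
Qed.

Definition kap (p : nat) : R := - ln (1 - p%:R^-1).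

Lemma kap_bounds p : (1 < p)%N -> npow 1 p <= kap p <= npow 1 p + 2 * npow 2 p.
Proof.
move=> p1; have p0 : (0 < p)%N by exact: ltnW.
have i2 : p%:R^-1 <= 2^-1 :> R by rewrite lef_pV2 ?posrE ?ltr0n// ler_nat.
have i0 : 0 < p%:R^-1 :> R by rewrite invr_gt0 ltr0n.
have -> : npow 2 p = p%:R^-1 * p%:R^-1 :> R.
  by rewrite -[2]/(1 + 1) npowD npow_1.
rewrite npow_1// /kap; set x := p%:R^-1 in i2 i0 *.
have x1 : 0 < 1 - x by lra.
have := ln_diff_le x1 ltr01; have := ln_diff_ge x1 ltr01.
rewrite ln1 sub0r divr1 opprB addrCA subrr addr0 => h1 h2.
apply/andP; split => //; apply: le_trans h2 _; rewrite ler_pdivrMr//; nra.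
Qed.

Definition merL z := \sum_(1 <= p < z.+1 | prime p) kap p.

Lemma npow_exp a p j : (0 < p)%N -> npow a (p ^ j) = npow a p ^+ j.
Proof.
move=> p0; elim: j => [|j ih]; first by rewrite expn0 npow1.
by rewrite expnS npowM ?expn_gt0 ?p0// ih exprS.
Qed.

Lemma geom_le e J : 0 <= e -> e < 1 -> \sum_(2 <= j < J) e ^+ j <= e ^+ 2 / (1 - e).
Proof.
move=> e0 e1; have d0 : 0 < 1 - e by lra.
rewrite ler_pdivlMr//; have [J2|J2] := leqP J 2.
  by rewrite big_geq// mul0r exprn_ge0.
have {J2} -> : J = ((J - 2) + 2)%N by lia.
elim: (J - 2)%N => [|i ih]; first by rewrite big_geq// mul0r exprn_ge0.
suff h : (\sum_(2 <= j < i.+1 + 2) e ^+ j) * (1 - e) = e ^+ 2 - e ^+ (i.+1 + 2) by rewrite h gerBl exprn_ge0.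
elim: i {ih} => [|i ih]; first by rewrite big_nat1; ring.
have -> : \sum_(2 <= j < i.+2 + 2) e ^+ j = \sum_(2 <= j < i.+1 + 2) e ^+ j + e ^+ (i.+1 + 2).
  by rewrite (addSn i.+1 2) big_nat_recr//; lia.
by rewrite mulrDl ih (addSn i.+1 2) [e ^+ (i.+1 + 2).+1]exprS; ring.
Qed.

Lemma sum_vonM_invln X Y : (0 < X)%N -> (X <= Y)%N ->
  \sum_(X.+1 <= n < Y.+1) vonM R n * invln R n =
  \sum_(1 <= p < Y.+1 | prime p) \sum_(1 <= j < Y.+1)
    if (X < p ^ j <= Y)%N then npow 1 p ^+ j / j%:R else 0.
Proof.
move=> X0 XY.
transitivity (\sum_(X.+1 <= n < Y.+1) \sum_(1 <= p < Y.+1 | prime p) \sum_(1 <= j < Y.+1)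
   if n == (p ^ j)%N then npow 1 p ^+ j / j%:R else 0 : R).
  apply: eq_big_nat => n /andP[Xn nY]; rewrite (@vonM_widen R n Y) ?mulr_suml//; last exact: leq_trans Xn.
  apply: eq_bigr => p pp; rewrite mulr_suml [LHS]big_mkcond; apply: eq_big_nat => j /andP[j0 _].
  case: eqP => // ->; rewrite /invln npow_exp ?prime_gt0// natrX lnXn ?ltr0n ?prime_gt0//.
  have : 0 < ln p%:R :> R by rewrite ln_nat_gt0 ?prime_gt1.
  have : j%:R != 0 :> R by rewrite pnatr_eq0 -lt0n.
  move: (ln p%:R) (npow 1 p ^+ j) => l q j0' l0; rewrite -[l *+ j]mulr_natl; field.
  by rewrite j0' gt_eqF.
rewrite exchange_big /=; apply: eq_bigr => p pp.
rewrite exchange_big_nat /=; apply: eq_bigr => j _.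
case: ifPn => [h|h].
  rewrite (bigD1_seq (p ^ j)%N) ?iota_uniq ?mem_index_iota ?ltnS//= eqxx big1 ?addr0//.
  by move=> n /negbTE ->.
rewrite big_nat_cond big1// => n /andP[]; rewrite ltnS; case: eqP => // -> h'.
by rewrite h' in h.
Qed.

(** For p^j > X with j >= 2, p^(-j) <= X^(-1/4) p^(-3j/4). The geometric series in p^(-3/4), which
    is at most 3/4, contributes at most 4 p^(-3/2), and the sum of n^(-3/2) is at most 3. *)
Lemma sum_vonM_primes X Y : (0 < X)%N -> (X <= Y)%N ->
  0 <= \sum_(X.+1 <= n < Y.+1) vonM R n * invln R n -
       \sum_(X.+1 <= p < Y.+1 | prime p) npow 1 p <= 12 * npow (1 / 4) X.
Proof.
move=> X0 XY; rewrite sum_vonM_invln//; have Y0 : (0 < Y)%N by exact: leq_trans XY.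
under eq_bigr do rewrite big_ltn// expn1 expr1 divr1.
rewrite big_split /=.
have -> : \sum_(1 <= p < Y.+1 | prime p) (if (X < p <= Y)%N then npow 1 p else 0) =
   \sum_(X.+1 <= p < Y.+1 | prime p) npow 1 p :> R.
  rewrite big_mkcond /= (@sum_split _ _ _ X.+1)//.
  rewrite big1_seq ?add0r; last first.
    by move=> p /andP[_]; rewrite mem_index_iota ltnS => /andP[_ pX]; rewrite ltnNge pX /= if_same.
  rewrite [RHS]big_mkcond /=; apply: eq_big_nat => p; rewrite ltnS => -> //.
rewrite addrAC subrr add0r; apply/andP; split.
  apply: sumr_ge0 => p _; apply: sumr_ge0 => j _; case: ifP => // _.
  by rewrite divr_ge0// exprn_ge0// npow_ge0.
have q1 p : (1 < p)%N -> npow (3 / 4) p <= 3 / 4 :> R.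
  move=> p1; apply: le_trans (npow_nonincr _ _ p1) _ => //; first lra.
  have l2 := ln2_half.
  rewrite /npow expRN.
  have := expR_ge1Dx (3 / 4 * ln 2%:R : R) => h.
  rewrite invf_ple ?posrE ?expR_gt0//; lra.
apply: le_trans (_ : \sum_(1 <= p < Y.+1) npow (1 / 4) X * (4 * npow (1 + 1 / 2) p) <= _); last first.
  rewrite -mulr_sumr -mulr_sumr mulrCA mulrC.
  have h2 : 0 < 1 / 2 :> R by lra.
  have := @npow_sum R (1 / 2) Y h2; rewrite -[_^-1]div1r => h.
  by have := npow_ge0 (1 / 4 : R) X; nra.
rewrite big_mkcond /=; apply: ler_sum_nat => p /andP[p0 _]; case: ifP => [pp|_]; last first.
  by rewrite !mulr_ge0 ?npow_ge0.
have p1 := prime_gt1 pp; have := q1 _ p1; set q := npow (3 / 4) p => q34.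
have q0 : 0 <= q by exact: npow_ge0.
have -> : npow (1 + 1 / 2) p = q ^+ 2 :> R.
  have e : 1 + 1 / 2 = 3 / 4 + 3 / 4 :> R by lra.
  by rewrite e npowD expr2.
apply: le_trans (_ : npow (1 / 4) X * \sum_(2 <= j < Y.+1) q ^+ j <= _).
  rewrite mulr_sumr; apply: ler_sum_nat => j /andP[j2 _]; case: ifP => [/andP[Xp _]|_]; last first.
    by rewrite mulr_ge0 ?npow_ge0 ?exprn_ge0.
  apply: le_trans (_ : npow 1 p ^+ j <= _).
    by rewrite ler_pdivrMr ?ler_peMr ?exprn_ge0 ?npow_ge0 ?ler1n ?ltr0n//; exact: ltnW.
  have e : 1 = 1 / 4 + 3 / 4 :> R by lra.
  rewrite -npow_exp ?prime_gt0// {1}e npowD [X in _ * X]npow_exp ?prime_gt0// ler_wpM2r ?exprn_ge0//.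
  by apply: npow_nonincr; [lra|done|exact: ltnW].
rewrite ler_wpM2l ?npow_ge0//; apply: le_trans (geom_le _ q0 _) _; first lra.
rewrite mulrC ler_wpM2r ?exprn_ge0// -[4]invrK lef_pV2 ?posrE//; lra.
Qed.

Lemma npow_ln_bound a m : 0 < a -> exists2 C : R, 0 <= C & forall X, (1 < X)%N ->
  npow a X <= C / ln X%:R ^+ m.
Proof.
move=> a0; have [C C0 h] := @pow_exp_bound R a m a0; exists C => // X X1.
have l0 := ln_nat_gt0 R X1; rewrite ler_pdivlMr ?exprn_gt0// mulrC.
exact: h (ltW l0).
Qed.

(** Besides the cancellation in Lambda(n) - 1, the prime powers, the passage from 1/p to [kap p] and
    the comparison of the sum of 1/(n ln n) with ln ln cost at most X^(-1/4) or 1/X, hence less than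
    any power of 1/ln X. *)
Lemma merL_diff m : (0 < m)%N -> exists C X0, [/\ 0 <= C, (1 < X0)%N & forall X Y,
  (X0 <= X)%N -> (X <= Y)%N ->
  `|(merL Y - ln (ln Y%:R)) - (merL X - ln (ln X%:R))| <= C / ln X%:R ^+ m].
Proof.
move=> m0; have [C1 [u0 [C10 u01 h1]]] := @vonM_invln R m m0.
have q0 : 0 < 1 / 4 :> R by rlra.
have [C2 C20 h2] := npow_ln_bound m q0; have [C3 C30 h3] := npow_ln_bound m ltr01.
exists (C1 + 12 * C2 + 4 * C3), (Num.truncn (expR u0)).+2; split => //; first rlra.
move=> X Y X0X XY; have X1 : (1 < X)%N by apply: leq_trans X0X.
have uX : u0 <= ln X%:R.
  rewrite -[u0]expRK ler_ln ?posrE ?expR_gt0 ?ltr0n ?(ltnW X1)//.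
  by apply: ltW; apply: lt_le_trans (lt_truncnS _) _; rewrite ler_nat ltnW.
have H1 := h1 X Y uX XY; have X0 : (0 < X)%N by exact: ltnW.
have /andP[H2 H3] := sum_vonM_primes X0 XY; have H4 := sum_invln X1 XY.
have H5 : 0 <= merL Y - merL X - \sum_(X.+1 <= p < Y.+1 | prime p) npow 1 p <= 2 * npow 1 X.
  rewrite /merL (@big_cat_nat _ _ _ X.+1)//= [X in X - _ - _]addrC addrK -sumrB.
  apply/andP; split; [apply: sumr_ge0|].
    by move=> p pp; rewrite subr_ge0; have /andP[] := kap_bounds (prime_gt1 pp).
  apply: le_trans (_ : \sum_(X.+1 <= p < Y.+1) 2 * npow 2 p <= _).
    rewrite big_mkcond; apply: ler_sum => p _; case: ifP => [pp|_].
      by have /andP[] := kap_bounds (prime_gt1 pp); rlra.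
    by rewrite mulr_ge0 ?npow_ge0.
  have t := @npow_tail R 1 X Y ltr01 X0; rewrite divr1 in t.
  by rewrite -mulr_sumr ler_wpM2l.
have {}H1 : `|\sum_(X.+1 <= n < Y.+1) vonM R n * invln R n - \sum_(X.+1 <= n < Y.+1) invln R n| <= C1 / ln X%:R ^+ m.
  by rewrite -sumrB; under eq_bigr do rewrite -[X in _ - X]mul1r -mulrBl.
have := h2 X X1; have := h3 X X1; rewrite !mulrDl -!mulrA.
move: H1 H2 H3 H4 H5; move: (C1 * _) (C2 * _) (C3 * _) (npow 1 X) (npow (1 / 4) X) => c1 c2 c3 n1 n4.
move: (\sum_(_ <= _ < _) _ * _) (\sum_(_ <= _ < _) _) (\sum_(_ <= _ < _ | prime _) _) => s1 s2 s3.
rewrite !ler_norml => /andP[a1 a2] a3 a4 /andP[a5 a6] /andP[a7 a8] a9 a10.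
by apply/andP; split; rlra.
Qed.

Lemma merL_limit : exists g, forall m, exists2 C, 0 <= C & forall X, (1 < X)%N ->
  `|merL X - ln (ln X%:R) - g| <= C / ln X%:R ^+ m.
Proof.
pose E X := merL X - ln (ln X%:R).
have [C [X0 [C0 X01 h]]] := @merL_diff 1 isT.
have l0 X : (X0 <= X)%N -> 0 < ln X%:R :> R by move=> X0X; apply/ln_nat_gt0/(leq_trans X01 X0X).
pose A := [set E X - C / ln X%:R | X in [set X | (X0 <= X)%N]].
have ub Y : (X0 <= Y)%N -> ubound A (E Y + C / ln Y%:R).
  move=> X0Y _ [X /= X0X <-]; have [XY|YX] := leqP X Y.
    have := h X Y X0X XY; rewrite expr1 ler_norml => /andP[a1 a2].
    have : 0 <= C / ln Y%:R by rewrite divr_ge0// ltW// l0.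
    rewrite /E; rlra.
  have := h Y X X0Y (ltnW YX); rewrite expr1 ler_norml => /andP[a1 a2].
  have : 0 <= C / ln X%:R by rewrite divr_ge0// ltW// l0.
  rewrite /E; rlra.
have A0 : A !=set0 by exists (E X0 - C / ln X0%:R), X0 => /=.
have gE Y : (X0 <= Y)%N -> `|E Y - sup A| <= C / ln Y%:R.
  move=> X0Y; rewrite ler_norml; apply/andP; split.
    have : sup A <= E Y + C / ln Y%:R by apply: ge_sup => //; exact: ub.
    rlra.
  have : E Y - C / ln Y%:R <= sup A.
    by apply: ub_le_sup; [exists (E X0 + C / ln X0%:R); exact: ub|exists Y].
  rlra.
exists (sup A) => m.
(* Order m + 1 also covers [m = 0]; because ln X >= 1/2, the extra power costs only a factor 2. *)
have [C' [X1 [C'0 X11 h']]] := @merL_diff m.+1 isT.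
have main X : (X1 <= X)%N -> `|E X - sup A| <= C' / ln X%:R ^+ m.+1.
  move=> X1X; apply/ler_addgt0Pr => e e0.
  have [Y [XY X0Y Ye]] : exists Y, [/\ (X <= Y)%N, (X0 <= Y)%N & C / ln Y%:R <= e].
    pose Y := maxn (maxn X X0) (Num.truncn (expR (C / e))).+1.
    have X0Y : (X0 <= Y)%N by rewrite /Y; lia.
    have XY : (X <= Y)%N by rewrite /Y; lia.
    exists Y; split => //; rewrite ler_pdivrMr ?l0// -ler_pdivrMl//.
    rewrite mulrC -[C / e]expRK ler_ln ?posrE ?expR_gt0 ?ltr0n ?(leq_trans (ltnW X01) X0Y)//.
    by apply: ltW; apply: lt_le_trans (lt_truncnS _) _; rewrite ler_nat leq_maxr.
  have a1 := h' X Y X1X XY; have a2 := gE Y X0Y; rewrite -/(E X) -/(E Y) distrC in a1.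
  by have := ler_distD (E Y) (E X) (sup A); rlra.
(* Added to the constant, this makes the bound hold for the finitely many X below [X1] as well. *)
pose S := \sum_(0 <= X < X1) `|E X - sup A| * ln X%:R ^+ m.
exists (C' * 2 + S); first by rewrite addr_ge0 ?mulr_ge0 ?sumr_ge0// => X _; rewrite mulr_ge0 ?exprn_ge0 ?ln_nat_ge0.
have S0 : 0 <= S by rewrite sumr_ge0// => X _; rewrite mulr_ge0 ?exprn_ge0 ?ln_nat_ge0.
move=> X X1'; have lX := ln_nat_gt0 R X1'; have lm : 0 < ln X%:R ^+ m :> R by rewrite exprn_gt0.
rewrite ler_pdivlMr//; have [X1X|XX1] := leqP X1 X; last first.
  apply: le_trans (_ : S <= _); last by rewrite lerDr mulr_ge0.
  rewrite /S (bigD1_seq X) ?iota_uniq ?mem_index_iota//= lerDl sumr_ge0// => Y _.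
  by rewrite mulr_ge0 ?exprn_ge0 ?ln_nat_ge0.
apply: le_trans (ler_wpM2r (ltW lm) (main X X1X)) _.
apply: le_trans (_ : C' * 2 <= _); last by rewrite lerDl.
rewrite exprS -mulrA ler_wpM2l// invfM -mulrA mulVf ?mulr1 ?gt_eqF//.
have h2 : 2^-1 <= ln X%:R :> R by apply: le_trans ln2_half _; exact: ln_nat_le.
by rewrite invf_ple ?posrE.
Qed.

End Mertens.

(** * Identification of the constant with Euler's *)

Section MertensConstant.
Variable R : realType.
Implicit Types (a b d e q x : R).

Lemma npow_le1 a n : 0 <= a -> npow a n <= 1.
Proof. by move=> a0; rewrite /npow expR_le1 oppr_le0 mulr_ge0 ?ln_nat_ge0. Qed.

Lemma is_derive_pow k x : is_derive x 1 (fun y : R => y ^+ k) (k%:R * x ^+ k.-1).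
Proof.
elim: k => [|k ih].
  by rewrite mul0r (_ : (fun y => _) = cst 1); [exact: is_derive_cst|apply/funext => y; rewrite expr0].
have /is_derive_eq := is_deriveM_fun (@is_derive_id R R x 1) ih.
rewrite (_ : (fun y => y * y ^+ k) = (fun y => y ^+ k.+1)); last by apply/funext => y; rewrite exprS.
apply; rewrite /= -natr1; case: k {ih} => [|k] /=; first by rewrite expr0; ring.
by rewrite exprS; ring.
Qed.

Lemma is_derive_sum (F dF : nat -> R -> R) x n : (forall k, is_derive x 1 (F k) (dF k x)) ->
  is_derive x 1 (fun y => \sum_(1 <= k < n.+1) F k y) (\sum_(1 <= k < n.+1) dF k x).
Proof.
move=> h; elim: n => [|n ih].
  rewrite big_geq// (_ : (fun y => _) = cst 0); first exact: is_derive_cst.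
  by apply/funext => y; rewrite big_geq.
rewrite big_nat_recr//= (_ : (fun y => _) = (fun y => \sum_(1 <= k < n.+1) F k y) + F n.+1).
  exact: is_deriveD.
by apply/funext => y; rewrite big_nat_recr.
Qed.

(** The remainder vanishes at 0 and has derivative y^K / (1 - y). *)
Lemma ln_series x K : 0 <= x -> x < 1 ->
  0 <= - ln (1 - x) - \sum_(1 <= k < K.+1) x ^+ k / k%:R <= x ^+ K.+1 / (1 - x).
Proof.
move=> x0 x1.
pose f y : R := - ln (1 - y) - \sum_(1 <= k < K.+1) y ^+ k / k%:R.
have df y : 0 <= y <= x -> is_derive y 1 f (y ^+ K / (1 - y)).
  move=> /andP[y0 yx]; have y1 : 0 < 1 - y by lra.
  have d1 : is_derive y 1 (fun y : R => 1 - y) (- 1).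
    have /is_derive_eq := is_deriveB (is_derive_cst (1 : R) y 1) (@is_derive_id R R y 1).
    by apply; rewrite sub0r.
  have d2 := @is_derive1_comp R (@ln R) (fun y => 1 - y) y _ _ (is_derive1_ln y1) d1.
  have d3 : is_derive y 1 (fun y => \sum_(1 <= k < K.+1) k%:R^-1 * y ^+ k) (\sum_(1 <= k < K.+1) k%:R^-1 * (k%:R * y ^+ k.-1)).
    exact: (@is_derive_sum (fun k y => k%:R^-1 * y ^+ k) (fun k y => k%:R^-1 * (k%:R * y ^+ k.-1)) y K (fun k => is_deriveZl _ (is_derive_pow k y))).
  have /is_derive_eq := is_deriveB (is_deriveN d2) d3.
  rewrite (_ : _ - _ = f); last first.
    by apply/funext => z; rewrite /f; congr (_ - _); apply: eq_bigr => k _; rewrite mulrC.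
  apply; rewrite mulrN1 opprK.
  have -> : \sum_(1 <= k < K.+1) k%:R^-1 * (k%:R * y ^+ k.-1) = (1 - y ^+ K) / (1 - y).
    elim: K {f d2 d3} => [|k ih]; first by rewrite big_geq// expr0 subrr mul0r.
    rewrite big_nat_recr//= ih mulrA mulVf ?mul1r ?pnatr_eq0// exprS; field; rewrite gt_eqF//; lra.
  field; rewrite gt_eqF//; lra.
have [c /andP[c0 cx]] := mvt_le x0 df.
have -> : f 0 = 0.
  rewrite /f subr0 ln1 oppr0 sub0r big_nat big1 ?oppr0// => k /andP[k0 _].
  by rewrite expr0n gtn_eqF// mul0r.
rewrite !subr0 -/(f x) => ->; have c1 : 0 < 1 - c by lra.
apply/andP; split; first by rewrite !mulr_ge0 ?exprn_ge0 ?invr_ge0// ltW.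
rewrite [x ^+ K.+1]exprSr [leRHS]mulrAC; apply: ler_wpM2r => //.
apply: ler_pM; rewrite ?exprn_ge0 ?invr_ge0 ?(ltW c1)//.
  by rewrite lerXn2r ?nnegrE.
by rewrite lef_pV2 ?posrE ?subr_gt0//; lra.
Qed.

Lemma expN_bounds d : 0 <= d -> d <= 1 / 2 -> d - d ^+ 2 <= 1 - expR (- d) <= d.
Proof.
move=> d0 d1; have h1 := exp_taylor1 d0; have h2 := expR_ge1Dx (- d).
by move: h1; rewrite ler_norml => /andP[a1 a2]; apply/andP; split; lra.
Qed.

(** With x = 1/p and z = p^(-d), the function ln (1 - x z) - z ln (1 - x) vanishes at z = 1 and has
    derivative O(x^2), while 1 - p^(-d) <= d ln p. *)
Lemma kap_twist d p : 0 <= d -> (1 < p)%N ->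
  `|kap R p * npow d p + ln (1 - npow (1 + d) p)| <= 8 * d * npow (1 + 1 / 2) p.
Proof.
move=> d0 p1; have p0 : (0 < p)%N by exact: ltnW.
have x0 := npow_gt0 (1 : R) p; have y0 := npow_gt0 d p.
have y1 : npow d p <= 1 by rewrite -(npow1 d); apply: npow_nonincr.
have x2 : npow 1 p <= 1 / 2 :> R by rewrite npow_1// div1r lef_pV2 ?posrE ?ltr0n// ler_nat.
have yl : 1 - npow d p <= d * ln p%:R by rewrite /npow; have := expR_ge1Dx (- (d * ln p%:R)); rlra.
have lx : ln p%:R * npow 2 p <= 4 * npow (1 + 1 / 2) p :> R.
  have q0 : 0 < 1 / 2 :> R by rlra.
  have := @ln_npow_le R 1 (1 / 2) p q0 p0; rewrite !expr1 (_ : 1`!%:R = 1 :> R)// => h.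
  have e : 2 = (1 + 1 / 2) + 1 / 2 :> R by rlra.
  have -> : npow 2 p = npow (1 + 1 / 2) p * npow (1 / 2) p :> R by rewrite -npowD -e.
  rewrite mulrCA mulrC; apply: ler_wpM2r; first exact: npow_ge0.
  apply: le_trans h _.
  have : npow (1 / 2 / 2) p <= 1 :> R by apply: npow_le1; rlra.
  have -> : (1 / 2 / 2)^-1 = 4 :> R by field.
  rlra.
have e2 : npow 2 p = npow 1 p * npow 1 p :> R by rewrite -[2]/(1 + 1) npowD.
rewrite npowD; have kE : kap R p = - ln (1 - npow 1 p) by rewrite /kap npow_1.
rewrite kE; move: x0 y0 y1 x2 yl e2; set x := npow 1 p; set y := npow d p => x0 y0 y1 x2 yl e2.
pose f z := ln (1 - x * z) - ln (1 - x) * z.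
have df z : y <= z <= 1 -> is_derive z 1 f (- x / (1 - x * z) - ln (1 - x)).
  move=> /andP[yz z1]; have z0 : 0 < 1 - x * z by nra.
  have d1 : is_derive z 1 (fun z : R => 1 - x * z) (- x).
    have /is_derive_eq := is_deriveB (is_derive_cst (1 : R) z 1) (is_deriveZl x (@is_derive_id R R z 1)).
    by apply; rewrite mulr1 sub0r.
  have d2 := @is_derive1_comp R (@ln R) (fun z => 1 - x * z) z _ _ (is_derive1_ln z0) d1.
  have /is_derive_eq := is_deriveB d2 (is_deriveZl (ln (1 - x)) (@is_derive_id R R z 1)).
  by apply; rewrite mulr1 mulrC.
have [c /andP[yc c1]] := mvt_le y1 df.
rewrite {1}/f !mulr1 subrr sub0r => e.
have x1 : 0 < 1 - x by rlra.
have := ln_diff_le x1 ltr01; have := ln_diff_ge x1 ltr01.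
rewrite ln1 sub0r divr1 opprB addrCA subrr addr0 => h1 h2.
have xc : 0 < 1 - x * c by nra.
have i1 : (1 - x)^-1 <= 2 by rewrite -[2]invrK lef_pV2 ?posrE//; rlra.
have i2 : 1 <= (1 - x * c)^-1 by rewrite -[1]invr1 lef_pV2 ?posrE//; nra.
have i3 : (1 - x * c)^-1 <= (1 - x)^-1 by rewrite lef_pV2 ?posrE//; nra.
have i4 : x / (1 - x) = x + x * x / (1 - x) by field; rewrite gt_eqF.
have i5 : x * x / (1 - x) <= 2 * (x * x) by rewrite mulrC ler_wpM2r// mulr_ge0// ltW.
have i6 : x <= x / (1 - x * c) by rewrite ler_peMr// ltW.
have i7 : x / (1 - x * c) <= x / (1 - x) by rewrite ler_wpM2l// ltW.
have D : `|- x / (1 - x * c) - ln (1 - x)| <= 2 * (x * x).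
  by rewrite ler_norml mulNr; apply/andP; split; rlra.
have -> : - ln (1 - x) * y + ln (1 - x * y) = f y by rewrite /f; ring.
rewrite -normrN e normrM (ger0_norm (_ : 0 <= 1 - y)) ?subr_ge0//.
apply: le_trans (ler_pM _ _ D yl) _; rewrite ?subr_ge0//.
rewrite -e2; have := ler_wpM2l d0 lx; rlra.
Qed.

(** zeta(1 + d) = 1/d + O(1), and the Euler product at 1 + d is within d of its limit once enough
    primes are taken. *)
Lemma kap_dirichlet : exists2 C : R, 0 <= C & forall d, 0 < d -> d * (4 * C + 4) <= 1 ->
  exists x0 : nat, forall x : nat, (x0 <= x)%N ->
  `|\sum_(1 <= p < x.+1 | prime p) kap R p * npow d p + ln d| <= C * d.
Proof.
have [C0 C00 hZ] := Zk_polar R 0; exists (4 * C0 + 26); first rlra.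
move=> d d0 dC; have Cd : 0 <= C0 * d by rewrite mulr_ge0// ltW.
have d2 : d * 100 <= 1 by rlra.
have Cd4 : 16 * (C0 * d) <= 1 by rlra.
have dd : 0 < d ^+ 2 by rewrite exprn_gt0.
(* So far out that x^(-d) <= d^2; the tail x^(-d) / d is then at most d. *)
have [N hN] := npow_to0 d0 dd; exists N.+1 => x Nx.
have x0 : (0 < x)%N by exact: leq_trans Nx.
have s1 : 1 < 1 + d by rlra.
pose f n : R[i] := (npow (1 + d) n)%:C.
have hf : has_sum f (Zk 0 (1 + d) 0).
  apply: has_sum_ext (ZkP 0 0 s1) => n n0.
  by rewrite /W expr0 mul1r !mul0r oppr0 cis0 mulr1.
have ht : nc (Zk 0 (1 + d) 0 * euler_prod f x - 1) <= d.
  apply: euler_prod_tail hf _; first exact: cmul_npow.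
  move=> M; under eq_bigr do rewrite nc_real ger0_norm ?npow_ge0//.
  apply: le_trans (npow_tail _ d0 x0) _; rewrite ler_pdivrMr//.
  by rewrite -expr2; apply: hN; exact: ltnW.
have n1 p : prime p -> 0 < 1 - npow (1 + d) p.
  move=> pp; rewrite subr_gt0 npowD npow_1 ?prime_gt0//.
  have : npow d p <= 1 by apply: npow_le1; exact: ltW.
  have : p%:R^-1 <= 2^-1 :> R by rewrite lef_pV2 ?posrE ?ltr0n ?prime_gt0// ler_nat prime_gt1.
  have : 0 <= p%:R^-1 :> R by rewrite invr_ge0.
  by have := npow_ge0 d p; nra.
pose S := \sum_(1 <= p < x.+1 | prime p) ln (1 - npow (1 + d) p).
have eP : euler_prod f x = (expR S)%:C.
  rewrite /euler_prod /S expR_sum rmorph_prod; apply: eq_bigr => p pp.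
  by rewrite lnK ?posrE ?n1// rmorphB.
have hp : nc (Zk 0 (1 + d) 0 - (d^-1)%:C) <= C0.
  have := hZ (1 + d) 0; rewrite normr0 ler01 s1 /= => /(_ _ isT); rewrite /polar.
  rewrite fact0 expr1 div1r addrAC subrr add0r -[d +i* 0]/(d%:C) -fmorphV; apply; rlra.
rewrite eP in ht; have P0 := expR_gt0 S; set P := expR S in ht P0.
have key : `|P / d - 1| <= C0 * P + d.
  rewrite -nc_real rmorphB rmorphM rmorph1.
  have -> : P%:C * (d^-1)%:C - 1 = (Zk 0 (1 + d) 0 * P%:C - 1) - (Zk 0 (1 + d) 0 - (d^-1)%:C) * P%:C by ring.
  apply: le_trans (ncB _ _) _; rewrite addrC; apply: lerD => //.
  by rewrite ncM nc_real ger0_norm ?(ltW P0)// ler_wpM2r// ltW.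
have Pd : P <= 2 * d.
  move: key; rewrite ler_norml => /andP[_ k2].
  have : P / d * d = P by rewrite divfK ?gt_eqF.
  have := ler_wpM2r (ltW d0) k2; rewrite mulrBl mul1r => h1 h2.
  nra.
have k3 : `|P / d - 1| <= (2 * C0 + 1) * d.
  by apply: le_trans key _; have := ler_wpM2l C00 Pd; rlra.
have l3 : `|S - ln d| <= 2 * ((2 * C0 + 1) * d).
  rewrite -[S]expRK -/P; set k := (2 * C0 + 1) * d in k3 *.
  have k2 : k <= 1 / 2 by rewrite /k; rlra.
  have k0 : 0 <= k by rewrite /k; rlra.
  move: k3; rewrite ler_norml => /andP[a1 a2].
  have q0 : 0 < P / d by rewrite divr_gt0.
  have := ln_diff_le ltr01 q0; have := ln_diff_ge ltr01 q0.
  rewrite ln1 !subr0 divr1 ln_div ?posrE// => b1 b2.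
  have b3 : - (2 * k) <= (P / d - 1) / (P / d) by rewrite ler_pdivlMr//; nra.
  by rewrite ler_norml; apply/andP; split; rlra.
have l4 : `|\sum_(1 <= p < x.+1 | prime p) kap R p * npow d p + S| <= 24 * d.
  rewrite /S -big_split /=; apply: le_trans (ler_norm_sum _ _ _) _.
  apply: le_trans (_ : \sum_(1 <= p < x.+1) 8 * d * npow (1 + 1 / 2) p <= _).
    rewrite big_mkcond; apply: ler_sum => p _; case: ifP => [pp|_].
      by apply: kap_twist; rewrite ?prime_gt1// ltW.
    by rewrite !mulr_ge0 ?npow_ge0// ltW.
  rewrite -mulr_sumr; have q0 : 0 < 1 / 2 :> R by rlra.
  have := npow_sum x q0; rewrite -[_^-1]div1r => h.
  have := ler_wpM2l (_ : 0 <= 8 * d) h; rewrite mulr_ge0 ?(ltW d0)// => /(_ isT); rlra.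
have -> : \sum_(1 <= p < x.+1 | prime p) kap R p * npow d p + ln d =
  (\sum_(1 <= p < x.+1 | prime p) kap R p * npow d p + S) - (S - ln d) by ring.
by apply: le_trans (ler_normB _ _) _; rlra.
Qed.

Definition epart k : nat := Num.truncn (expR k%:R : R).

Lemma epart_gt k n : (epart k < n)%N -> k%:R <= ln n%:R :> R.
Proof.
move=> h; rewrite -[k%:R]expRK ler_ln ?posrE ?expR_gt0 ?ltr0n ?(leq_trans _ h)//.
by apply: ltW; apply: lt_le_trans (lt_truncnS _) _; rewrite ler_nat.
Qed.

Lemma epart_le k n : (0 < n)%N -> (n <= epart k)%N -> ln n%:R <= k%:R :> R.
Proof.
move=> n0 h; rewrite -[k%:R]expRK ler_ln ?posrE ?expR_gt0 ?ltr0n//.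
by apply: le_trans (_ : (epart k)%:R <= _); rewrite ?ler_nat// truncn_le// expR_ge0.
Qed.

Lemma epartS k : (epart k <= epart k.+1)%N.
Proof. by rewrite /epart le_truncn// ler_expR ler_nat. Qed.

Lemma epart_ge k : (k < epart k.+1)%N.
Proof.
rewrite /epart truncn_gt_nat; have := expR_ge1Dx (k.+1%:R : R).
lra.
Qed.

Definition hsum k : R := \sum_(1 <= j < k) j%:R^-1.

Lemma abel_geom (g : nat -> R) q e B k0 K : 0 <= q <= 1 -> 0 <= e -> 0 <= B ->
  (forall k, `|g k| <= B) -> (forall k, (k0 <= k)%N -> `|g k| <= e) -> (k0 <= K)%N -> (0 < K)%N ->
  `|\sum_(1 <= k < K) (g k.+1 - g k) * q ^+ k + g 1%N * q| <= 2 * e + B * k0%:R * (1 - q).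
Proof.
move=> /andP[q0 q1] e0 B0 gB ge k0K K0.
have qk k : 0 <= q ^+ k <= 1 by rewrite exprn_ge0// exprn_ile1.
have qd k : 0 <= q ^+ k - q ^+ k.+1 <= 1 - q.
  have /andP[a b] := qk k; rewrite exprS; apply/andP; split; nra.
have -> : \sum_(1 <= k < K) (g k.+1 - g k) * q ^+ k + g 1%N * q =
   g K * q ^+ K + \sum_(1 <= k < K) g k.+1 * (q ^+ k - q ^+ k.+1).
  case: K K0 {k0K} => // K _; elim: K => [|K ih]; first by rewrite !big_geq// expr1; ring.
  have r (F : nat -> R) : \sum_(1 <= k < K.+2) F k = \sum_(1 <= k < K.+1) F k + F K.+1.
    by rewrite big_nat_recr.
  by rewrite !r addrAC ih; ring.
apply: le_trans (ler_normD _ _) _.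
have h1 : `|g K * q ^+ K| <= e.
  have /andP[a b] := qk K; rewrite normrM (ger0_norm a); apply: le_trans (ge K k0K).
  by rewrite ler_piMr.
have h2 : `|\sum_(1 <= k < K) g k.+1 * (q ^+ k - q ^+ k.+1)| <=
   \sum_(1 <= k < K) (e * (q ^+ k - q ^+ k.+1) + (k < k0)%N%:R * (B * (1 - q))).
  apply: le_trans (ler_norm_sum _ _ _) _; apply: ler_sum => k _.
  have /andP[a b] := qd k; rewrite normrM (ger0_norm a); have [kk|kk] := ltnP k k0.
    rewrite mul1r; have := ler_pM (normr_ge0 _) a (gB k.+1) b.
    by have := mulr_ge0 e0 a; rlra.
  by rewrite mul0r addr0 ler_wpM2r// ge// leqW.
move: h2; rewrite big_split /= -mulr_sumr -mulr_suml => h2.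
have h3 : \sum_(1 <= k < K) (q ^+ k - q ^+ k.+1) <= 1.
  have := @telescope_sumr R 1 K (fun k => - q ^+ k) K0.
  under eq_bigr do rewrite opprK addrC.
  by move=> ->; have /andP[a b] := qk K; rewrite expr1; rlra.
have h4 : \sum_(1 <= k < K) (k < k0)%N%:R <= k0%:R :> R.
  have -> : \sum_(1 <= k < K) (k < k0)%N%:R = (\sum_(1 <= k < K) (k < k0)%N)%N%:R :> R by rewrite natr_sum.
  rewrite ler_nat; elim: K {k0K K0 h1 h2 h3} => [|K ih]; first by rewrite big_geq.
  suff : (\sum_(1 <= k < K.+1) (k < k0) <= minn K k0)%N by move/leq_trans; apply; exact: geq_minr.
  elim: K {ih} => [|K ih]; first by rewrite big_geq.
  by rewrite big_nat_recr//=; move: ih; case: ltnP; lia.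
have h5 := ler_wpM2l e0 h3; have h6 := ler_wpM2r (mulr_ge0 B0 (_ : 0 <= 1 - q)) h4.
have {}h6 := h6 (_ : 0 <= 1 - q); rlra.
Qed.

(** Primes are grouped by k <= ln p <= k + 1, where p^(-d) lies between q^(k+1) and q^k. This turns
    the Dirichlet series into a power series in q = e^(-d). *)
Lemma merL_block d K : 0 <= d -> let q := expR (- d) in
  let U := merL R (epart 1) + \sum_(1 <= k < K.+1) (merL R (epart k.+1) - merL R (epart k)) * q ^+ k in
  q * U <= \sum_(1 <= p < (epart K.+1).+1 | prime p) kap R p * npow d p <= U.
Proof.
rewrite /=; move=> d0; set q := expR (- d).
have q0 : 0 <= q by exact: expR_ge0.
have q1 : q <= 1 by rewrite /q expR_le1 oppr_le0.
have kap0 p : prime p -> 0 <= kap R p.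
  by move=> pp; have /andP[a _] := kap_bounds R (prime_gt1 pp); apply: le_trans a; exact: npow_ge0.
have qE k : q ^+ k = expR (- (d * k%:R)) by rewrite /q -expRM_natl; congr expR; ring.
elim: K => [|K ih].
  rewrite big_geq// addr0 /merL mulr_sumr; apply/andP; split; rewrite big_seq_cond [leRHS]big_seq_cond;
    apply: ler_sum => p /andP[]; rewrite mem_index_iota ltnS => /andP[p0 pe] pp.
    rewrite mulrC ler_wpM2l ?kap0//.
    by rewrite /npow /q ler_expR lerN2; have := epart_le p0 pe; nra.
  by rewrite ler_piMr ?kap0// npow_le1.
have lmono : merL R (epart K.+2) - merL R (epart K.+1) = \sum_((epart K.+1).+1 <= p < (epart K.+2).+1 | prime p) kap R p.
  by rewrite /merL (@big_cat_nat _ _ _ (epart K.+1).+1) ?ltnS ?epartS//= [X in X - _]addrC addrK.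
rewrite [\sum_(1 <= p < (epart K.+2).+1 | prime p) _](@big_cat_nat _ _ _ (epart K.+1).+1) ?ltnS ?epartS//=.
have r (F : nat -> R) : \sum_(1 <= k < K.+2) F k = \sum_(1 <= k < K.+1) F k + F K.+1.
  by rewrite big_nat_recr.
rewrite r addrA mulrDr; move: ih => /andP[a1 a2].
have : q * ((merL R (epart K.+2) - merL R (epart K.+1)) * q ^+ K.+1) <=
   \sum_((epart K.+1).+1 <= p < (epart K.+2).+1 | prime p) kap R p * npow d p <=
   (merL R (epart K.+2) - merL R (epart K.+1)) * q ^+ K.+1.
  rewrite lmono mulrCA -exprS !mulr_suml; apply/andP; split; rewrite big_seq_cond [leRHS]big_seq_cond;
    apply: ler_sum => p /andP[]; rewrite mem_index_iota ltnS => /andP[p0 pe] pp; rewrite ler_wpM2l ?kap0// qE /npow ler_expR lerN2 ler_wpM2l//.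
    by apply: epart_le => //; exact: leq_trans p0.
  by apply: epart_gt.
by move=> /andP[b1 b2]; apply/andP; split; apply: lerD.
Qed.

(** Tends to 0: [merL] at e^k is close to ln k + g, and the harmonic sum to ln k plus Euler's
    constant. *)
Definition gdiff g k : R := merL R (epart k) - hsum k - (g - euler_gamma R).

Lemma gdiff_to0 g : (forall m, exists2 C, 0 <= C & forall X, (1 < X)%N ->
    `|merL R X - ln (ln X%:R) - g| <= C / ln X%:R ^+ m) ->
  forall e, 0 < e -> exists k0, forall k, (k0 <= k)%N -> `|gdiff g k| <= e.
Proof.
move=> /(_ 1%N)[C C0 hC] e e0.
have e4 : 0 < e / 4 by rlra.
have /cvgrPdist_le/(_ _ e4)[k1 _ hk1] := @cvg_euler_gamma R.
pose k2 := (Num.truncn ((C + 4) / e * 4)).+3.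
exists (maxn k1 k2.+1) => -[|k]; rewrite geq_max; first by rewrite ltn0 andbF.
rewrite ltnS => /andP[kk1 kk2].
have hk := hk1 _ kk1; rewrite /= in hk.
have k0 : 0 < k%:R :> R by rewrite ltr0n; apply: leq_trans kk2.
have kb : (C + 4) / e * 4 < k%:R.
  by apply: lt_le_trans (lt_truncnS _) _; rewrite ler_nat (leq_trans _ kk2)// /k2; lia.
have X1 : (1 < epart k.+1)%N by apply: leq_trans (epart_ge k); rewrite ltnS (leq_trans _ kk2).
set X := epart k.+1 in X1 *.
have lk : k%:R <= ln X%:R :> R.
  rewrite -[k%:R]expRK ler_ln ?posrE ?expR_gt0 ?ltr0n ?(ltnW X1)//.
  have h1 := lt_truncnS (expR k.+1%:R : R); rewrite -/(epart k.+1) -/X in h1.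
  have h2 : expR k.+1%:R = expR 1 * expR k%:R :> R by rewrite -expRD nat1r.
  have h3 := expR_ge1Dx (1 : R); have h4 := expR_ge1Dx (k%:R : R).
  have h5 : X.+1%:R = X%:R + 1 :> R by rewrite natr1.
  have := expR_gt0 (k%:R : R); nra.
have lk' : ln X%:R <= k.+1%:R :> R by apply: epart_le => //; exact: ltnW.
have lX : 0 < ln X%:R :> R by rlra.
have i1 : C / ln X%:R <= C / k%:R by rewrite ler_wpM2l// lef_pV2 ?posrE.
have kp : 0 < k.+1%:R :> R by rewrite ltr0n.
have i2 : 0 <= ln (k.+1%:R : R) - ln (ln X%:R) <= k%:R^-1.
  apply/andP; split; first by rewrite subr_ge0 ler_ln ?posrE.
  apply: le_trans (ln_diff_le lX kp) _; rewrite -[k%:R^-1]mul1r; apply: ler_pM.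
  - by rewrite subr_ge0.
  - by rewrite invr_ge0 ltW.
  - by rewrite lerBlDr -natr1 addrC lerD2l.
  - by rewrite lef_pV2 ?posrE.
have i3 : hsum k.+1 = euler_seq R k.+1 + ln k.+1%:R - k.+1%:R^-1.
  have r : \sum_(1 <= j < k.+2) j%:R^-1 = \sum_(1 <= j < k.+1) j%:R^-1 + k.+1%:R^-1 :> R by rewrite big_nat_recr.
  by rewrite /euler_seq r /hsum; ring.
have i4 : 0 <= (k.+1%:R^-1 : R) <= k%:R^-1.
  by rewrite invr_ge0 ltW//= lef_pV2 ?posrE// ler_nat.
have i5 : (C + 4) / k%:R <= e / 4.
  rewrite ler_pdivrMr//; move: kb; rewrite -mulrA [_^-1 * _]mulrC mulrA ltr_pdivrMr//; rlra.
have := hC X X1; rewrite expr1 /gdiff -/X i3.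
move: i2 i4 i5 hk i1; rewrite mulrDl.
move: (k%:R^-1) (k.+1%:R^-1) => a b /andP[j1 j2] /andP[j3 j4] j5 hk i1.
have Ck : 0 <= C / k%:R by rewrite divr_ge0// ltW.
move: hk; rewrite !ler_norml => /andP[j6 j7] /andP[j8 j9].
by apply/andP; split; rlra.
Qed.

Lemma merL_const_ineq (c U S T T' E G L d i C b b1 b2 e y1 y2 t : R) :
  c = U - T' - E - G -> S <= U -> U - S <= 2 * (d * S) -> d * S <= 2 * i + C * d ->
  C * d <= C * i -> d <= i -> `|S + L| <= C * d -> T = T' + y2 -> 0 <= y2 <= d ->
  0 <= y1 - T -> y1 - T <= t -> t <= d -> 0 <= y1 - - L <= 2 * d ->
  `|E| <= 2 * (e / 8) + b -> b <= b1 -> `|G| <= b2 ->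
  3 * (C * i) + 20 * i + b1 + b2 <= e / 8 -> 0 < e -> 0 < d -> `|c| <= e.
Proof.
move=> -> h1 h2 h3 h4 h5 h6 h7 /andP[h8 h9] h10 h11 h12 /andP[h13 h14] h15 h16 h17 h18 e0 d0.
move: h6 h15 h17; rewrite !ler_norml => /andP[a1 a2] /andP[a3 a4] /andP[a5 a6].
by apply/andP; split; lra.
Qed.

(** An Abelian argument in place of the integral of e^(-x) ln x. Up to small errors the twisted sum
    is g - gamma plus the sum of q^k / k, that is - ln (1 - q), which is close to - ln d. But it is
    also - ln d + O(d), so letting d tend to 0 forces g = gamma. *)
Lemma merL_const g : (forall m, exists2 C, 0 <= C & forall X, (1 < X)%N ->
    `|merL R X - ln (ln X%:R) - g| <= C / ln X%:R ^+ m) -> g = euler_gamma R.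
Proof.
move=> hg; have h0 := gdiff_to0 hg; set c := g - euler_gamma R.
have [C C0 hC] := kap_dirichlet.
have [k1 hk1] := h0 1 ltr01.
pose B := 1 + \sum_(0 <= k < k1) `|gdiff g k|.
have B0 : 0 <= B by rewrite addr_ge0// sumr_ge0.
have gB k : `|gdiff g k| <= B.
  have [/hk1 h|kk] := leqP k1 k; first by apply: le_trans h _; rewrite lerDl sumr_ge0.
  apply: le_trans (_ : \sum_(0 <= k < k1) `|gdiff g k| <= _); last by rewrite lerDr.
  by rewrite (bigD1_seq k) ?iota_uniq ?mem_index_iota//= lerDl sumr_ge0.
suff c0 : `|c| <= 0 by apply/eqP; rewrite -subr_eq0 -normr_le0.
apply/ler_addgt0Pr => e e0; rewrite add0r.
have e4 : 0 < e / 8 by rlra.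
have [k0 hk0] := h0 _ e4.
pose A := 3 * C + 20 + B * k0%:R + B.
have Bk0 : 0 <= B * k0%:R by rewrite mulr_ge0.
have A0 : 0 < A by rewrite /A; rlra.
pose M := (Num.truncn (4 * C + 20 + A * 8 / e)).+1.
have M0 : 0 < M%:R :> R by rewrite ltr0n.
have AM : 4 * C + 20 + A * 8 / e < M%:R by exact: lt_truncnS.
have Ae : 0 <= A * 8 / e by rewrite divr_ge0 ?mulr_ge0// ltW.
(* With this square, d (- ln d) = 2 ln M / M^2 is at most 2/M. *)
pose d : R := M%:R^-1 ^+ 2.
have iM : 0 < M%:R^-1 :> R by rewrite invr_gt0.
have iMM : M%:R^-1 * M%:R = 1 :> R by rewrite mulVf ?gt_eqF.
have iM1 : M%:R^-1 <= 1 / 20 :> R by rewrite div1r lef_pV2 ?posrE//; rlra.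
have iMA : A * M%:R^-1 <= e / 8.
  have : A * 8 / e <= M%:R by rlra.
  rewrite ler_pdivrMr// => h; have := ler_wpM2r (ltW iM) h; nra.
have dM : d <= M%:R^-1 by rewrite /d expr2; nra.
have d0 : 0 < d by rewrite exprn_gt0.
have dC : d * (4 * C + 4) <= 1.
  by apply: le_trans (_ : M%:R^-1 * (4 * C + 4) <= _); [rewrite ler_wpM2r//; move: C0; clear; lra|move: AM Ae C0 iM iMM; clear; nra].
have ld : - ln d = 2 * ln M%:R by rewrite /d lnXn// lnV ?posrE//; ring.
have dl : d * (- ln d) <= 2 * M%:R^-1.
  have := ln_diff_le ltr01 M0; rewrite ln1 subr0 divr1 ld => h.
  have : 0 <= ln M%:R :> R by exact: ln_nat_ge0.
  rewrite /d expr2; nra.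
have dl0 : 0 <= - ln d by rewrite ld mulr_ge0// ln_nat_ge0.
have [x0 hx0] := hC d d0 dC.
have [|b1 b2] := andP (expN_bounds (ltW d0) _); first rlra.
set q := expR (- d) in b1 b2.
have q0 : 0 < q by exact: expR_gt0.
have q1 : q < 1 by rewrite expR_lt1 oppr_lt0.
have [N hN] : exists N, forall n, (N <= n)%N -> q ^+ n <= d * (1 - q).
  have dq : 0 < d * (1 - q) by rewrite mulr_gt0// subr_gt0.
  have [N hN] := npow_to0 d0 dq; exists (N + N)%N => n Nn.
  have := hN n.+1 (leq_trans (leq_addr _ _) (leqW Nn)).
  apply: le_trans; rewrite /npow /q -expRM_natl ler_expR mulrN lerN2 mulrC ler_wpM2r ?(ltW d0)//.
  by have := ln_diff_le ltr01 (ltr0n R n.+1); rewrite ln1 subr0 divr1 -natr1; rlra.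
pose K := maxn x0 (maxn N k0).
have KN : (N <= K)%N by rewrite /K maxnCA leq_maxl.
have Kk : (k0 <= K)%N by rewrite /K maxnA leq_maxr.
have Kx : (x0 <= epart K.+1)%N by apply: leq_trans (ltnW (epart_ge K)); exact: leq_maxl.
have := hx0 _ Kx; have := @merL_block d K (ltW d0); rewrite /= -/q.
set S := \sum_(1 <= p < _ | prime p) _; set U := merL R _ + _ => /andP[s1 s2] s3.
have [t1 t2] := andP (ln_series K.+1 (ltW q0) q1).
have t3 : q ^+ K.+2 / (1 - q) <= d.
  rewrite ler_pdivrMr ?subr_gt0//; apply: hN.
  by apply: leq_trans KN _; apply: leq_trans (leqnSn _) _.
have l1 : 0 <= - ln (1 - q) - - ln d <= 2 * d.
  have q1' : 0 < 1 - q by rewrite subr_gt0.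
  have := ln_diff_le q1' d0; have := ln_diff_ge q1' d0 => w1 w2.
  have w3 : 0 <= (d - (1 - q)) / d by rewrite divr_ge0 ?subr_ge0 ?(ltW d0).
  have w4 : (d - (1 - q)) / (1 - q) <= 2 * d.
    rewrite ler_pdivrMr//.
    have : d / 2 <= 1 - q by move: b1 d0 dM iM1; clear; nra.
    by move: b1 d0 dM iM1; clear; nra.
  by apply/andP; split; rlra.
have ab : `|\sum_(1 <= k < K.+1) (gdiff g k.+1 - gdiff g k) * q ^+ k + gdiff g 1%N * q| <= 2 * (e / 8) + B * k0%:R * (1 - q).
  apply: abel_geom => //; rewrite ?(ltW q0) ?(ltW q1) ?(ltW e4)//.
  exact: leqW.
have UE : U = merL R (epart 1) + \sum_(1 <= k < K.+1) q ^+ k / k%:R + \sum_(1 <= k < K.+1) (gdiff g k.+1 - gdiff g k) * q ^+ k.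
  rewrite /U -addrA -big_split /=; congr (_ + _); apply: eq_big_nat => k /andP[k00 _].
  have -> : gdiff g k.+1 - gdiff g k = merL R (epart k.+1) - merL R (epart k) - k%:R^-1.
    by rewrite /gdiff /hsum big_nat_recr//=; ring.
  ring.
have g1 : gdiff g 1 = merL R (epart 1) - c by rewrite /gdiff /hsum big_geq// subr0.
have gb := gB 1%N.
set T := \sum_(1 <= k < K.+2) _ in t1 t2.
have TE : T = \sum_(1 <= k < K.+1) q ^+ k / k%:R + q ^+ K.+1 / K.+1%:R by rewrite /T big_nat_recr.
have t4 : 0 <= q ^+ K.+1 / K.+1%:R <= d.
  rewrite divr_ge0 ?exprn_ge0 ?(ltW q0)//=; apply: le_trans (_ : q ^+ K.+1 <= _).
    by rewrite ler_pdivrMr ?ltr0n// ler_peMr ?exprn_ge0 ?(ltW q0)// ler1n.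
  apply: le_trans (hN K.+1 _) _; first exact: leqW.
  by rewrite ler_piMr ?(ltW d0)// gerBl (ltW q0).
have S0 : 0 <= S.
  apply: sumr_ge0 => p pp; rewrite mulr_ge0 ?npow_ge0//.
  by have /andP[a _] := kap_bounds R (prime_gt1 pp); apply: le_trans a; exact: npow_ge0.
have q2 : 1 / 2 <= q by move: b2 dM iM1; clear; lra.
have U2 : U <= 2 * S by move: s1 s2 S0 q2; clear; nra.
have US : U - S <= 2 * (d * S) by move: s1 s2 S0 U2 b2 d0; clear; nra.
have dS : d * S <= 2 * M%:R^-1 + C * d.
  have : S <= - ln d + C * d by move: s3; rewrite ler_norml => /andP[_]; rlra.
  move=> /(ler_wpM2l (ltW d0)); rewrite mulrDr => h.
  have d1 : d <= 1 by move: dM iM1; clear; lra.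
  have : d * (C * d) <= C * d := ler_piMl (mulr_ge0 C0 (ltW d0)) d1.
  by move: h dl; clear; lra.
have Ad : C * d <= C * M%:R^-1 by rewrite ler_wpM2l.
have Bd : B * k0%:R * (1 - q) <= B * k0%:R * M%:R^-1 by rewrite ler_wpM2l// (le_trans b2 dM).
have gd : `|gdiff g 1 * (1 - q)| <= B * M%:R^-1.
  by rewrite normrM (ger0_norm (_ : 0 <= 1 - q)) ?ler_pM ?subr_ge0 ?(ltW q1)// (le_trans b2 dM).
have cE : c = U - \sum_(1 <= k < K.+1) q ^+ k / k%:R -
  (\sum_(1 <= k < K.+1) (gdiff g k.+1 - gdiff g k) * q ^+ k + gdiff g 1%N * q) - gdiff g 1 * (1 - q).
  by rewrite UE; have -> : merL R (epart 1) = gdiff g 1 + c; [rewrite g1; ring|ring].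
apply: (merL_const_ineq cE s2 US dS Ad dM s3 TE t4 t1 t2 t3 l1 ab Bd gd) => //.
by apply: le_trans iMA; rewrite /A le_eqVlt; apply/orP; left; apply/eqP; ring.
Qed.

End MertensConstant.

(** * Dirichlet characters and their series *)

Section CharacterSums.
Variable R : realType.

Lemma ln_ge1 n : (3 < n)%N -> 1 <= ln n%:R :> R.
Proof.
move=> n3; apply: le_trans (@ln_nat_le R 4 n isT n3).
rewrite (_ : 4%:R = 2%:R * 2%:R :> R) ?lnM ?posrE//; last by rewrite -natrM.
by have := ln2_half R; lra.
Qed.

(* The Dirichlet characters modulo [m]: [i0] is the principal one and [S]
   contains the characters of order at most 2. *)
Record dchar m (I : finType) (chi : I -> nat -> R[i]) (i0 : I) (S : {set I}) : Prop := DChar {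
  dc_m : (1 < m)%N;
  dc_cmul : forall i, cmul (chi i);
  dc_mod : forall i n, chi i n = chi i (n %% m)%N;
  dc_nc : forall i n, nc (chi i n) = (coprime n m)%:R;
  dc_i0 : forall n, chi i0 n = (coprime n m)%:R;
  dc_orth : forall n, \sum_i chi i n = (#|I| * (n == 1 %[mod m]))%:R;
  dc_nonprinc : forall i, i != i0 -> exists2 u, coprime u m & chi i u != 1;
  dc_nonreal : forall i, i \notin S -> exists2 u, coprime u m & chi i u ^+ 2 != 1;
  dc_real : forall i n, i \in S -> chi i n ^+ 2 = (coprime n m)%:R;
  dc_in : i0 \in S }.

(** Multiplication by u permutes the residues, so the sum over a period equals [f u] times
    itself. *)
Lemma period_sum0 m (f : nat -> R[i]) u : (0 < m)%N -> (forall n, f n = f (n %% m)%N) ->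
  (forall n, f (u * n)%N = f u * f n) -> coprime u m -> f u != 1 ->
  \sum_(0 <= n < m) f n = 0.
Proof.
case: m => // m _ fm fM um fu; rewrite big_mkord.
pose h (i : 'I_m.+1) : 'I_m.+1 := inZp (u * i).
have hi : injective h.
  move=> i j; wlog ij : i j / (j <= i)%N => [hw|].
    by case/orP: (leq_total j i) => /hw hij; [|move/esym] => /hij.
  move=> /(congr1 val) /= /eqP; rewrite eqn_mod_dvd ?leq_mul// -mulnBr.
  rewrite Gauss_dvdr 1?coprime_sym// -eqn_mod_dvd// !modn_small// => /eqP; exact: val_inj.
have e : \sum_(i < m.+1) f i = f u * \sum_(i < m.+1) f i.
  by rewrite mulr_sumr {1}(reindex_inj hi)/=; apply: eq_bigr => i _; rewrite -fm fM.
apply/eqP; have : (1 - f u) * \sum_(i < m.+1) f i == 0 by rewrite mulrBl mul1r -e subrr.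
by rewrite mulf_eq0 subr_eq0 eq_sym (negbTE fu).
Qed.

Lemma period_sum_le m (f : nat -> R[i]) X Y : (0 < m)%N -> (forall n, f n = f (n %% m)%N) ->
  (forall n, nc (f n) <= 1) -> \sum_(0 <= n < m) f n = 0 ->
  nc (\sum_(X <= n < Y) f n) <= m%:R.
Proof.
move=> m0 fm f1 f0.
have blk X' : \sum_(X' <= n < X' + m) f n = 0.
  elim: X' => [|X' ih]; first by rewrite add0n.
  have : \sum_(X' <= n < (X' + m).+1) f n = \sum_(X'.+1 <= n < X'.+1 + m) f n + f X'.
    by rewrite big_ltn ?ltnS ?leq_addr// addrC addSn.
  rewrite big_nat_recr ?leq_addr//= ih add0r fm modnDr -fm => e.
  by apply: (addIr (f X')); rewrite -e add0r.
have [d] := ubnP (Y - X)%N; elim: d X => // d ih X dXY.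
have [mm|mm] := ltnP (Y - X)%N m.
  apply: le_trans (nc_sum _ _ _) _; apply: le_trans (_ : \sum_(X <= n < Y) 1 <= _).
    by apply: ler_sum => n _; exact: f1.
  by rewrite big_const_nat iter_addr addr0 ler_nat ltnW.
have XmY : (X + m <= Y)%N by lia.
rewrite (@sum_split _ _ _ (X + m)) ?leq_addr// blk add0r; apply: ih; lia.
Qed.

Variables (m : nat) (I : finType) (chi : I -> nat -> R[i]) (i0 : I) (S : {set I}).
Hypothesis dc : dchar m chi i0 S.

Lemma dc_m0 : (0 < m)%N. Proof. exact/ltnW/(dc_m dc). Qed.

Lemma dc_le1 i n : nc (chi i n) <= 1.
Proof. by rewrite (dc_nc dc); case: coprime. Qed.

Lemma dcM i u n : chi i (u * n)%N = chi i u * chi i n.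
Proof.
have z : chi i 0%N = 0.
  apply: nc_eq0; rewrite (dc_nc dc) /coprime gcd0n; have := dc_m dc.
  by case: (m) => [|[|]].
case: u => [|u]; first by rewrite mul0n z mul0r.
case: n => [|n]; first by rewrite muln0 z mulr0.
by have [_ h] := dc_cmul dc i; exact: h.
Qed.

Lemma dc_sum i X Y : i != i0 -> nc (\sum_(X <= n < Y) chi i n) <= m%:R.
Proof.
move=> /(dc_nonprinc dc)[u um cu]; apply: period_sum_le dc_m0 (dc_mod dc i) (dc_le1 i) _.
exact: period_sum0 dc_m0 (dc_mod dc i) (dcM i u) um cu.
Qed.

Lemma dc_sqr_sum i X Y : i \notin S -> nc (\sum_(X <= n < Y) chi i n ^+ 2) <= m%:R.
Proof.
move=> /(dc_nonreal dc)[u um cu].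
have fm n : chi i n ^+ 2 = chi i (n %% m)%N ^+ 2 by rewrite {1}(dc_mod dc).
apply: (@period_sum_le m (fun n => chi i n ^+ 2) _ _ dc_m0 fm).
  by move=> n; rewrite ncX exprn_ile1 ?nc_ge0 ?dc_le1.
apply: (@period_sum0 m (fun n => chi i n ^+ 2) u dc_m0 fm) => //.
by move=> n; rewrite dcM exprMn.
Qed.

(* A function with bounded partial sums has a convergent Dirichlet series,
   which we only evaluate to the right of 1. *)
Definition lterm (f : nat -> R[i]) s n : R[i] := f n * (npow s n)%:C.
Definition lser f s : R[i] := csum (lterm f s).

Lemma lterm_abs f s : 1 < s -> (forall n, nc (f n) <= 1) -> abs_bound (lterm f s) (1 + (s - 1)^-1).
Proof.
move=> s1 f1 N; have a0 : 0 < s - 1 by lra.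
have := npow_sum N a0; rewrite addrC subrK; apply: le_trans.
apply: ler_sum => n _; rewrite ncM nc_real ger0_norm ?npow_ge0//.
by rewrite ler_piMl ?npow_ge0.
Qed.

Lemma lserP f s : 1 < s -> (forall n, nc (f n) <= 1) -> has_sum (lterm f s) (lser f s).
Proof. by move=> s1 f1; exact: csumP (lterm_abs s1 f1). Qed.

Definition lm : R := 2 + ln m%:R.
Lemma lm_ge2 : 2 <= lm. Proof. by rewrite lerDl ln_nat_ge0. Qed.

Variable f : nat -> R[i].
Hypotheses (f1 : forall n, nc (f n) <= 1).
Hypothesis fS : forall X Y, nc (\sum_(X <= n < Y) f n) <= m%:R.

(** The terms up to m are bounded trivially; beyond m, Abel summation uses the bound m for the
    partial sums. *)
Lemma lser_split (b : nat -> R) N : (forall n, (0 < n)%N -> 0 <= b n) ->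
  (forall n, (m < n)%N -> b n.+1 <= b n) ->
  nc (\sum_(1 <= n < N.+1) f n * (b n)%:C) <= \sum_(1 <= n < m.+1) b n + m%:R * b m.+1.
Proof.
move=> b0 bd; have mb : 0 <= m%:R * b m.+1 by rewrite mulr_ge0 ?b0.
have small M : (M <= m)%N -> nc (\sum_(1 <= n < M.+1) f n * (b n)%:C) <= \sum_(1 <= n < m.+1) b n.
  move=> Mm; apply: le_trans (nc_sum _ _ _) _.
  apply: le_trans (_ : \sum_(1 <= n < M.+1) b n <= _).
    apply: ler_sum_nat => n /andP[n0 _]; rewrite ncM nc_real ger0_norm ?b0//.
    by rewrite ler_piMl ?b0.
  rewrite [leRHS](@sum_split _ _ _ M.+1) ?ltnS// lerDl big_nat sumr_ge0// => n /andP[n0 _].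
  by rewrite b0// (leq_trans _ n0).
have [Nm|mN] := leqP N m; first by apply: le_trans (small N Nm) _; rewrite lerDl.
rewrite (@sum_split _ _ _ m.+1) ?ltnS ?(ltnW mN)//; apply: le_trans (ncD _ _) _; apply: lerD.
  exact: small.
apply: (@abel_nc R f b m.+1 N.+1 m%:R) => //.
  by move=> n mn _; rewrite b0// (leq_trans _ mn).
by move=> n mn _; exact: bd.
Qed.

Lemma lser_le s : 1 < s -> nc (lser f s) <= lm.
Proof.
move=> s1; apply: has_sum_le (lserP s1 f1) _ => N.
apply: le_trans (lser_split _ _ _) _ => [n _|n mn|]; first exact: npow_ge0.
  by apply: npow_nonincr => //; [lra|exact: leq_trans mn].
have h1 : \sum_(1 <= n < m.+1) npow s n <= 1 + ln m%:R.
  by apply: le_trans (harmonic_le R m); apply: ler_sum => n _; apply: npow_le; exact: ltW.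
have h2 : m%:R * npow s m.+1 <= 1.
  apply: le_trans (_ : m%:R * npow 1 m.+1 <= _); first by rewrite ler_wpM2l// npow_le// ltW.
  by rewrite npow_1// ler_pdivrMr ?ltr0n// mul1r ler_nat.
rewrite /lm; lra.
Qed.

(** As a function of c = ln n, the derivative is not positive as soon as (1 + b) e^(-(b-a)c) <= 1 +
    a. This holds for c >= 1, which is what [3 < n] provides. *)
Lemma npow_diff_dec a b n : 0 <= a -> a <= b -> (3 < n)%N ->
  npow (1 + a) n.+1 - npow (1 + b) n.+1 <= npow (1 + a) n - npow (1 + b) n :> R.
Proof.
move=> a0 ab n2; pose g u : R := expR (- ((1 + a) * u)) - expR (- ((1 + b) * u)).
pose dg u : R := - (1 + a) * expR (- ((1 + a) * u)) - - (1 + b) * expR (- ((1 + b) * u)).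
have dE (c u : R) : is_derive u 1 (fun u => expR (- (c * u))) (- c * expR (- (c * u))).
  have h : is_derive u 1 (fun u : R => - (c * u)) (- c).
    have /is_derive_eq := is_deriveN (is_deriveZl c (@is_derive_id R R u 1)).
    by apply; rewrite mulr1.
  have /is_derive_eq := @is_derive1_comp R expR (fun y => - (c * y)) u _ _ (is_derive_expR (- (c * u))) h.
  by apply; rewrite mulrC.
have ln3 : 1 <= ln n%:R :> R by apply: ln_ge1.
have le12 : ln n%:R <= ln n.+1%:R :> R by apply: ln_nat_le => //; exact: leq_trans n2.
have [c /andP[c1 c2] e] := @mvt_le R g dg _ _ le12 (fun u _ => is_deriveB (dE _ u) (dE _ u)).
suff : dg c * (ln n.+1%:R - ln n%:R) <= 0 by rewrite -e /g /npow; lra.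
rewrite mulr_le0_ge0 ?subr_ge0// /dg.
have -> : expR (- ((1 + b) * c)) = expR (- ((1 + a) * c)) * expR (- ((b - a) * c)) by rewrite -expRD; congr expR; ring.
have := expR_ge1Dx ((b - a) * c); have e0 := expR_gt0 (- ((1 + a) * c)).
have : expR (- ((b - a) * c)) * expR ((b - a) * c) = 1 by rewrite -expRD addNr expR0.
have : (b - a) <= (b - a) * c by rewrite ler_peMr//; lra.
have e1 := expR_gt0 (- ((b - a) * c)).
set X := expR _ in e0 *; set Y := expR _ in e1 *; set Z := expR _ => h1 h2 h3.
have : (1 + b) * Y <= 1 + a by nra.
nra.
Qed.

(** Stated for finite sums and with [a = 0] allowed, so that partial sums at 1, where absolute
    convergence fails, can be compared with those at 1 + b. *)
Lemma lser_lip_fin a b N : 0 <= a -> a <= b -> 0 < b -> (3 < m)%N ->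
  nc (\sum_(1 <= n < N.+1) f n * (npow (1 + a) n - npow (1 + b) n)%:C) <= b * lm ^+ 2.
Proof.
move=> a0 ab b0 m3.
have d0 n : 0 <= npow (1 + a) n - npow (1 + b) n by rewrite subr_ge0 npow_le// lerD2l.
apply: le_trans (lser_split _ (fun n _ => d0 n) _) _ => [n mn|].
  by apply: npow_diff_dec => //; exact: leq_trans m3 (ltnW mn).
have dn n : npow (1 + a) n - npow (1 + b) n <= npow 1 n * (b * ln n%:R).
  rewrite !npowD -mulrBr ler_wpM2l ?npow_ge0//.
  have := expR_ge1Dx (- (b * ln n%:R)); rewrite -/(npow b n); have := npow_le1 n a0; lra.
have l0 := ln_nat_ge0 R m; have lm2 := ln_nat_ge0 R m.+1.
have h1 : \sum_(1 <= n < m.+1) (npow (1 + a) n - npow (1 + b) n) <= b * ln m%:R * (1 + ln m%:R).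
  apply: le_trans (_ : \sum_(1 <= n < m.+1) b * ln m%:R * npow 1 n <= _); last first.
    by rewrite -mulr_sumr ler_wpM2l ?harmonic_le// mulr_ge0// ltW.
  apply: ler_sum_nat => n /andP[n0 nm]; apply: le_trans (dn n) _; rewrite mulrC ler_wpM2r ?npow_ge0//.
  by rewrite ler_wpM2l ?(ltW b0)// ln_nat_le.
have h2 : m%:R * (npow (1 + a) m.+1 - npow (1 + b) m.+1) <= b * (1 + ln m%:R).
  apply: le_trans (_ : m%:R * (npow 1 m.+1 * (b * ln m.+1%:R)) <= _); first by rewrite ler_wpM2l.
  rewrite npow_1// mulrA; apply: le_trans (_ : b * ln m.+1%:R <= _).
    by rewrite ler_piMl ?mulr_ge0 ?(ltW b0)// ler_pdivrMr ?ltr0n// mul1r ler_nat.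
  rewrite ler_wpM2l ?(ltW b0)//; have mp : 0 < m%:R :> R by rewrite ltr0n (leq_trans _ m3).
  have := ln_diff_le mp (ltr0n R m.+1); rewrite -natr1 addrAC subrr add0r div1r.
  have : m%:R^-1 <= 1 :> R by rewrite invf_le1// ler1n (leq_trans _ m3).
  lra.
have := mulr_ge0 (ltW b0) l0; have := mulr_ge0 (mulr_ge0 (ltW b0) l0) l0; rewrite /lm; nra.
Qed.

Lemma lser_lip a b : 0 < a -> a <= b -> (3 < m)%N ->
  nc (lser f (1 + a) - lser f (1 + b)) <= b * lm ^+ 2.
Proof.
move=> a0 ab m3; have b0 : 0 < b by lra.
have h : has_sum (fun n => f n * (npow (1 + a) n - npow (1 + b) n)%:C) (lser f (1 + a) - lser f (1 + b)).
  have sa : 1 < 1 + a by lra. have sb : 1 < 1 + b by lra.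
  rewrite -[- lser f (1 + b)]mulN1r.
  apply: has_sum_ext (has_sumD (lserP sa f1) (has_sumZ (-1) (lserP sb f1))) => n _.
  by rewrite /lterm rmorphB; ring.
by apply: has_sum_le h _ => N; apply: lser_lip_fin => //; exact: ltW.
Qed.
End CharacterSums.

(** * Characters modulo a prime and modulo a product of coprime moduli *)

Section CharacterConstruction.
Variable R : realType.

Lemma cis_primitive n : (0 < n)%N -> n.-primitive_root (cis (2 * pi / n%:R) : R[i]).
Proof.
move=> n0; have nR : 0 < n%:R :> R by rewrite ltr0n.
have p0 := pi_gt0 R.
have on : cis (2 * pi / n%:R) ^+ n = 1 :> R[i].
  rewrite -cisMn (_ : n%:R * _ = 1%:R * (2 * pi)); first exact: cis2pi.
  by field; rewrite gt_eqF.
rewrite /primitive_root_of_unity n0; apply/forallP => i.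
rewrite unity_rootE -cisMn; apply/eqP; have [->|ni] := eqVneq i.+1 n.
  by rewrite cisMn on eqxx.
apply/negbTE/cis_neq1.
  by rewrite normr_gt0 mulf_neq0 ?pnatr_eq0// gt_eqF// divr_gt0// mulr_gt0.
have lin : i.+1%:R < n%:R :> R by rewrite ltr_nat ltn_neqAle ni ltn_ord.
rewrite ger0_norm; last by rewrite mulr_ge0// divr_ge0 ?mulr_ge0 ?ltW.
by rewrite mulrA ltr_pdivrMr// mulrC ltr_pM2l// mulr_gt0.
Qed.

Lemma prim_sum n (z : R[i]) k : (0 < n)%N -> n.-primitive_root z ->
  \sum_(a < n) z ^+ (a * k) = (n * (n %| k))%:R.
Proof.
move=> n0 zn; under eq_bigr do rewrite mulnC exprM.
have [nk|nk] := boolP (n %| k)%N.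
  have -> : z ^+ k = 1.
    by apply/eqP; rewrite -(expr0 z) (eq_prim_root_expr zn) mod0n.
  under eq_bigr do rewrite expr1n.
  by rewrite sumr_const card_ord muln1.
have zk : z ^+ k != 1 by rewrite -(expr0 z) (eq_prim_root_expr zn) mod0n.
apply/eqP; rewrite muln0; have := subrX1 (z ^+ k) n.
rewrite -exprM mulnC exprM (prim_expr_order zn) expr1n subrr => /esym/eqP.
by rewrite mulf_eq0 subr_eq0 (negbTE zk).
Qed.

(** The character of index a sends k to w^(a dl(k)), where w is a primitive root of unity of order p
    - 1 and [dl] a discrete logarithm to the base of a primitive root [g]. The characters of order
    at most 2 have index 0 or (p - 1)/2. *)
Lemma dchar_prime p : prime p -> (2 < p)%N ->
  exists chi i0 S, [/\ @dchar R p 'I_p.-1 chi i0 S & (#|S| <= 2)%N].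
Proof.
move=> pp p2; set n := p.-1.
have n0 : (0 < n)%N by rewrite /n; case: (p) p2 => [|[|]].
have ferm (x : 'F_p) : x != 0 -> x ^+ n = 1.
  move=> x0; apply: (mulfI x0); rewrite -exprS mulr1 /n prednK ?prime_gt0//.
  rewrite -[x]natr_Zp -natrX -[LHS](Fp_nat_mod pp) fermat_little// (Fp_nat_mod pp)//.
have [g gn] : exists g : 'F_p, n.-primitive_root g.
  have /hasP[g _ gn] : has n.-primitive_root (enum (predC1 (0 : 'F_p))).
    apply: has_prim_root => //.
    - by apply/allP => x; rewrite mem_enum => x0; rewrite unity_rootE ferm.
    - exact: enum_uniq.
    - by rewrite -cardE cardC1 card_Fp.
  by exists g.
have [dl hdl] : exists dl : 'F_p -> nat, forall x, x != 0 -> x = g ^+ dl x.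
  have h (x : 'F_p) : exists k : nat, x != 0 -> x = g ^+ k.
    have [->|x0] := eqVneq x 0; first by exists 0%N.
    by have [i hi] := prim_rootP gn (ferm x x0); exists i.
  by have [dl hdl] := boolp.choice h; exists dl.
pose w : R[i] := cis (2 * pi / n%:R); have wn := cis_primitive n0; rewrite -/w in wn.
pose chi (a : 'I_n) k : R[i] := if (k%:R : 'F_p) == 0 then 0 else w ^+ (a * dl k%:R).
have k0 k : ((k%:R : 'F_p) == 0) = ~~ coprime k p.
  rewrite coprime_sym -(unitFpE pp k) unitfE negbK//.
have modw a j k : j = k %[mod n] -> w ^+ (a * j) = w ^+ (a * k).
  by move=> jk; apply/eqP; rewrite (eq_prim_root_expr wn) -modnMmr jk modnMmr.
pose S : {set 'I_n} := finset (fun a : 'I_n => (n %| 2 * a)%N).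
have gco : coprime g p.
  have g0 : g != 0.
    apply/eqP => g0; have := oner_neq0 'F_p.
    by rewrite -(prim_expr_order gn) g0 expr0n gtn_eqF// eqxx.
  by have := k0 g; rewrite natr_Zp (negbTE g0) => /esym/negbFE.
have chig a : chi a g = w ^+ a.
  have g0 : (g%:R : 'F_p) != 0 by rewrite k0 gco.
  rewrite /chi (negbTE g0) -[in RHS](muln1 a); apply: modw; apply/eqP.
  by rewrite -(eq_prim_root_expr gn) -hdl// natr_Zp.
exists chi, (Ordinal n0), S; split; first split.
- exact: prime_gt1.
- move=> a; split.
    rewrite /chi oner_eq0; have := hdl 1 (oner_neq0 _) => /esym/eqP.
    rewrite -{2}(expr0 g) (eq_prim_root_expr gn) => /eqP /modw ->.
    by rewrite muln0.
  move=> j k _ _; rewrite /chi natrM mulf_eq0.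
  have [//|j0] := eqVneq (j%:R : 'F_p) 0; first by rewrite mul0r.
  have [//|k0'] := eqVneq (k%:R : 'F_p) 0; first by rewrite mulr0.
  rewrite /= -exprD -mulnDr; apply: modw; apply/eqP; rewrite -(eq_prim_root_expr gn).
  by rewrite exprD -!hdl// mulf_neq0.
- by move=> a k; rewrite /chi (Fp_nat_mod pp).
- move=> a k; rewrite /chi k0; case: coprime => /=; last exact: nc0.
  by rewrite ncX nc_cis expr1n.
- by move=> k; rewrite /chi k0 mul0n expr0; case: coprime.
- move=> k; rewrite /chi card_ord k0; have [c|c] := boolP (coprime k p) => /=.
    rewrite prim_sum//; congr (_ * _)%:R.
    have kn0 : (k%:R : 'F_p) != 0 by rewrite k0 c.
    have -> : (n %| dl k%:R)%N = ((k%:R : 'F_p) == 1).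
      by rewrite [X in _ = (X == _)](hdl _ kn0) -[X in _ = (_ == X)](expr0 g) (eq_prim_root_expr gn) mod0n.
    by rewrite -[1]/(1%:R) -val_eqE /= !(val_Fp_nat pp) (Fp_cast pp).
  rewrite big1// (_ : (_ == _) = false) ?muln0//; apply/negbTE; apply: contra c => /eqP c.
  by rewrite /coprime -gcdn_modl c gcdn_modl gcd1n.
- move=> a a0; exists (val g : nat); first exact: gco.
  rewrite chig -(expr0 w) (eq_prim_root_expr wn) mod0n modn_small ?ltn_ord//.
- move=> a; rewrite inE => aS; exists (val g : nat); first exact: gco.
  by rewrite chig -exprM mulnC -(expr0 w) (eq_prim_root_expr wn) mod0n.
- move=> a k; rewrite inE /chi k0 => aS; case: coprime => /=; last by rewrite expr0n.
  apply/eqP; rewrite -exprM mulnAC -(expr0 w) (eq_prim_root_expr wn) mod0n.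
  by rewrite -/(dvdn n _) dvdn_mulr// mulnC.
- by rewrite inE muln0 dvdn0.
have nh : (n./2 < n)%N by rewrite ltn_half_double -addnn -[X in (X < _)%N]addn0 ltn_add2l.
apply: leq_trans (_ : #|[set Ordinal n0; Ordinal nh]%SET| <= 2)%N; last by rewrite cards2; case: eqP.
apply/subset_leq_card/fintype.subsetP => a; rewrite !inE => /dvdnP[k hk].
have := ltn_ord a; rewrite -!val_eqE /=; case: k hk => [|[|k]] hk an.
- by move: hk; rewrite mul0n => /eqP; rewrite muln_eq0 /= => ->.
- by rewrite mul1n in hk; apply/orP; right; apply/eqP; have := congr1 half hk; rewrite mul2n doubleK.
- by move: hk; rewrite !mulSn; lia.
Qed.

(** By the Chinese remainder theorem one component can be tested while the other is kept at 1; hence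
    the real characters are the pairs of real ones. *)
Lemma dchar_mul m1 m2 (I1 I2 : finType) chi1 chi2 i1 i2 S1 S2 : coprime m1 m2 ->
  @dchar R m1 I1 chi1 i1 S1 -> @dchar R m2 I2 chi2 i2 S2 ->
  dchar (m1 * m2) (fun (i : I1 * I2) n => chi1 i.1 n * chi2 i.2 n) (i1, i2) (finset.setX S1 S2).
Proof.
move=> co d1 d2; have m10 := dc_m0 d1; have m20 := dc_m0 d2.
have u12 u1 u2 : coprime u1 m1 -> coprime u2 m2 -> exists u, [/\ coprime u (m1 * m2),
    forall i, chi1 i u = chi1 i u1 & forall i, chi2 i u = chi2 i u2].
  move=> c1 c2; exists (chinese m1 m2 u1 u2).
  have e1 := chinese_modl co u1 u2; have e2 := chinese_modr co u1 u2; split.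
  - rewrite coprimeMr /coprime -gcdn_modl e1 gcdn_modl -[X in _ && X]/(coprime _ _) /coprime.
    by rewrite -[X in _ && (X == _)]gcdn_modl e2 gcdn_modl; apply/andP.
  - by move=> i; rewrite (dc_mod d1) e1 -(dc_mod d1).
  - by move=> i; rewrite (dc_mod d2) e2 -(dc_mod d2).
have one1 i : chi1 i 1%N = 1 by have [] := dc_cmul d1 i.
have one2 i : chi2 i 1%N = 1 by have [] := dc_cmul d2 i.
split.
- by apply: leq_trans (dc_m d1) _; rewrite leq_pmulr.
- move=> i; split; first by rewrite one1 one2 mulr1.
  by move=> j k j0 k0; rewrite (dcM d1) (dcM d2) mulrACA.
- move=> i k; rewrite (dc_mod d1) (dc_mod d2) [in RHS](dc_mod d1) [in RHS](dc_mod d2).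
  by rewrite modn_dvdm ?dvdn_mulr// modn_dvdm ?dvdn_mull.
- move=> i k; rewrite ncM (dc_nc d1) (dc_nc d2) coprimeMr.
  by case: coprime; case: coprime; rewrite ?mulr1 ?mulr0 ?mul0r.
- move=> k; rewrite /= (dc_i0 d1) (dc_i0 d2) coprimeMr.
  by case: coprime; case: coprime; rewrite ?mulr1 ?mulr0 ?mul0r.
- move=> k; rewrite -(pair_bigA _ (fun i j => chi1 i k * chi2 j k))/=.
  under eq_bigr do rewrite -mulr_sumr (dc_orth d2).
  rewrite -mulr_suml (dc_orth d1) -natrM card_prod chinese_remainder//.
  by congr _%:R; case: eqP; case: eqP; rewrite ?muln1 ?muln0.
- move=> [j1 j2]; rewrite xpair_eqE negb_and => /orP[/(dc_nonprinc d1)[u uc hu]|/(dc_nonprinc d2)[u uc hu]].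
    have [v [vc v1 v2]] := u12 u 1%N uc (coprime1n _).
    by exists v => //=; rewrite v1 v2 one2 mulr1.
  have [v [vc v1 v2]] := u12 1%N u (coprime1n _) uc.
  by exists v => //=; rewrite v1 v2 one1 mul1r.
- move=> [j1 j2]; rewrite inE negb_and => /orP[/(dc_nonreal d1)[u uc hu]|/(dc_nonreal d2)[u uc hu]].
    have [v [vc v1 v2]] := u12 u 1%N uc (coprime1n _).
    by exists v => //=; rewrite v1 v2 one2 mulr1.
  have [v [vc v1 v2]] := u12 1%N u (coprime1n _) uc.
  by exists v => //=; rewrite v1 v2 one1 mul1r.
- move=> [j1 j2] k; rewrite inE => /andP[/= h1 h2]; rewrite exprMn (dc_real d1)// (dc_real d2)// coprimeMr.
  by case: coprime; case: coprime; rewrite ?mulr1 ?mulr0 ?mul0r.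
- by rewrite inE /= (dc_in d1) (dc_in d2).
Qed.
End CharacterConstruction.

(** * Logarithms of Euler products and primes congruent to 1 *)

Section PrimesInProgressions.
Variable R : realType.

Lemma ln_npow2_le n : (0 < n)%N -> ln n%:R * npow 2 n <= 4 * npow (1 + 1 / 2) n :> R.
Proof.
move=> n0; have q0 : 0 < 1 / 2 :> R by lra.
have := @ln_npow_le R 1 (1 / 2) n q0 n0; rewrite !expr1 (_ : 1`!%:R = 1 :> R)// => h.
have e : 2 = (1 + 1 / 2) + 1 / 2 :> R by lra.
have -> : npow 2 n = npow (1 + 1 / 2) n * npow (1 / 2) n :> R by rewrite -npowD -e.
rewrite mulrCA mulrC; apply: ler_wpM2r; first exact: npow_ge0.
apply: le_trans h _.
have : npow (1 / 2 / 2) n <= 1 :> R by apply: npow_le1; lra.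
have -> : (1 / 2 / 2)^-1 = 4 :> R by field.
lra.
Qed.

Lemma sum_ln_npow2 x : \sum_(1 <= n < x.+1) ln n%:R * npow 2 n <= 12 :> R.
Proof.
apply: le_trans (_ : \sum_(1 <= n < x.+1) 4 * npow (1 + 1 / 2) n <= _).
  by apply: ler_sum_nat => n /andP[n0 _]; exact: ln_npow2_le.
rewrite -mulr_sumr; have q0 : 0 < 1 / 2 :> R by lra.
by have := npow_sum x q0; rewrite -[_^-1]div1r; lra.
Qed.

(** The real part of the logarithm of an Euler factor; complex logarithms never occur. *)
Definition lnfac (z : R[i]) (r : R) : R := - ln (nc (1 - z * r%:C)).

Lemma nc_fac_sqr (z : R[i]) (r : R) :
  nc (1 - z * r%:C) ^+ 2 = 1 - 2 * r * Re z + r ^+ 2 * nc z ^+ 2.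
Proof.
case: z => a b; have -> : 1 - (a +i* b) * r%:C = (1 - r * a) +i* (- (r * b)).
  by apply/eqP; rewrite eq_complex /=; apply/andP; split; apply/eqP; ring.
by rewrite !nc_sqr /=; ring.
Qed.

Lemma nc_fac_ge (z : R[i]) (r : R) : nc z <= 1 -> 0 <= r -> 1 - r <= nc (1 - z * r%:C).
Proof.
move=> z1 r0; have := nc_triB 1 (z * r%:C); rewrite nc1 ncM nc_real ger0_norm//.
have := ler_wpM2r r0 z1; lra.
Qed.

Lemma nc_fac_le (z : R[i]) (r : R) : nc z <= 1 -> 0 <= r -> nc (1 - z * r%:C) <= 1 + r.
Proof.
move=> z1 r0; have := ncB 1 (z * r%:C); rewrite nc1 ncM nc_real ger0_norm//.
have := ler_wpM2r r0 z1; lra.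
Qed.

(** The second-order error is proportional to r1 - r2. Summed over primes with r1 and r2 taken at 1
    + d and 1 + D, it is O(D). *)
Lemma lnfac_lip (z : R[i]) (r1 r2 : R) : nc z <= 1 -> 0 <= r2 -> r2 <= r1 -> r1 <= 1 / 2 ->
  `|lnfac z r1 - lnfac z r2 - (r1 - r2) * Re z| <= 16 * (r1 * (r1 - r2)).
Proof.
move=> z1 r20 r21 r12; have r10 : 0 <= r1 by rlra.
set a := Re z; set rho := nc z ^+ 2.
have a1 : `|a| <= 1 by apply: le_trans (nc_Re z) z1.
have rho1 : 0 <= rho <= 1 by rewrite exprn_ge0 ?nc_ge0// exprn_ile1 ?nc_ge0.
pose den r : R := 1 - 2 * r * a + r ^+ 2 * rho.
have den4 r : 0 <= r -> r <= 1 / 2 -> 1 / 4 <= den r.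
  move=> r0 rh; have := nc_fac_ge z1 r0 => h.
  by rewrite /den -nc_fac_sqr expr2; nra.
have lE r : 0 <= r -> r <= 1 / 2 -> lnfac z r = - (1 / 2) * ln (den r).
  move=> r0 rh; have h := nc_fac_ge z1 r0; have h0 : 0 < nc (1 - z * r%:C) by rlra.
  by rewrite /den -nc_fac_sqr lnXn// /lnfac -mulr_natl; field.
pose g r : R := - (1 / 2) * ln (den r) - r * a.
pose dg r : R := (a - r * rho) / den r - a.
have dgE r : r2 <= r <= r1 -> is_derive r 1 g (dg r).
  move=> /andP[rr1 rr2]; have d0 : 0 < den r by have := den4 r; rlra.
  have d1 : is_derive r 1 den (- 2 * a + rho * (2 * r)).
    have i1 := is_deriveZl (- 2 * a) (@is_derive_id R R r 1).
    have i2 := is_deriveZl rho (is_derive_pow 2 r).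
    have /is_derive_eq := is_deriveD (is_deriveD (is_derive_cst (1 : R) r 1) i1) i2.
    rewrite (_ : _ + _ = den); last by apply/funext => y; rewrite /den /cst /= !fctE; ring.
    by apply; rewrite /= expr1; ring.
  have d2 := @is_derive1_comp R (@ln R) den r _ _ (is_derive1_ln d0) d1.
  have /is_derive_eq := is_deriveB (is_deriveZl (- (1 / 2)) d2) (is_deriveZl a (@is_derive_id R R r 1)).
  rewrite (_ : _ - _ = g); last by apply/funext => y; rewrite /g /= !fctE; ring.
  by apply; rewrite /dg; field; rewrite gt_eqF.
have [c /andP[c1 c2] e] := mvt_le r21 dgE.
have -> : lnfac z r1 - lnfac z r2 - (r1 - r2) * a = g r1 - g r2.
  by rewrite /g !lE //; [ring|rlra].
have c0 : 0 <= c by rlra.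
rewrite e normrM (ger0_norm (_ : 0 <= r1 - r2)) ?subr_ge0// mulrA ler_wpM2r ?subr_ge0//.
have d4 := den4 c c0 (le_trans c2 r12).
have -> : dg c = (- c * rho + 2 * c * a ^+ 2 - a * c ^+ 2 * rho) / den c.
  by rewrite /dg; move: (den4 c c0 (le_trans c2 r12)); rewrite /den => h; field; rewrite gt_eqF//; rlra.
have d0 : 0 < den c by rlra.
rewrite normrM normfV (ger0_norm (ltW d0)) ler_pdivrMr//.
have a2 : 0 <= a ^+ 2 <= 1 by rewrite sqr_ge0 -real_normK ?num_real// exprn_ile1.
apply: le_trans (_ : 4 * c <= _); last by nra.
have := ler_norml (a * c ^+ 2 * rho) c => hh.
have b3 : `|a * c ^+ 2 * rho| <= c.
  have n1 := normr_ge0 a; case/andP: (rho1) => rho0 _.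
  rewrite normrM normrM (ger0_norm (sqr_ge0 c)) (ger0_norm rho0).
  have : `|a| * c ^+ 2 <= c by rewrite expr2; nra.
  move=> h; apply: le_trans h; rewrite ler_piMr ?mulr_ge0 ?sqr_ge0//; by case/andP: rho1.
move: b3; rewrite !ler_norml => /andP[b1 b2]; case/andP: rho1 => p1 p2; case/andP: a2 => p3 p4.
by apply/andP; split; nra.
Qed.

Variables (m : nat) (I : finType) (chi : I -> nat -> R[i]) (i0 : I) (S : {set I}).
Hypothesis dc : dchar m chi i0 S.
Implicit Types (s d D : R).

Definition lnE i s x : R := \sum_(1 <= q < x.+1 | prime q) lnfac (chi i q) (npow s q).
Definition lnZ s x : R := \sum_(1 <= q < x.+1 | prime q) - ln (1 - npow s q).

Lemma npow_half s q : 1 <= s -> prime q -> npow s q <= 1 / 2 :> R.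
Proof.
move=> s1 pq; apply: le_trans (npow_le _ s1) _; rewrite npow_1 ?prime_gt0//.
by rewrite div1r lef_pV2 ?posrE ?ltr0n ?prime_gt0// ler_nat prime_gt1.
Qed.

Lemma nc_fac_gt0 i s q : 1 <= s -> prime q -> 0 < nc (1 - chi i q * (npow s q)%:C).
Proof.
move=> s1 pq; apply: lt_le_trans (nc_fac_ge (dc_le1 dc i q) (npow_ge0 _ _)).
by have := npow_half s1 pq; lra.
Qed.

Lemma lnE_prod i s x : 1 <= s -> nc (euler_prod (lterm (chi i) s) x) = expR (- lnE i s x).
Proof.
move=> s1; rewrite /lnE -sumrN expR_sum /euler_prod.
rewrite (big_morph (@nc R) (@ncM R) (nc1 R)); apply: eq_bigr => q pq.
by rewrite opprK lnK ?posrE// nc_fac_gt0.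
Qed.

Lemma cmul_lterm i s : cmul (lterm (chi i) s).
Proof.
have [c1 cM] := dc_cmul dc i; split; first by rewrite /lterm c1 npow1 mulr1.
by move=> j k j0 k0; rewrite /lterm cM// npowM// rmorphM; ring.
Qed.

Lemma lser_lnE i d e : 0 < d -> 0 < e -> e <= 1 / 2 -> exists x0 : nat, forall x, (x0 <= x)%N ->
  0 < nc (lser (chi i) (1 + d)) /\ `|lnE i (1 + d) x - ln (nc (lser (chi i) (1 + d)))| <= 2 * e.
Proof.
move=> d0 e0 e2; have s1 : 1 < 1 + d by lra.
have de : 0 < d * e by rewrite mulr_gt0.
have [N hN] := npow_to0 d0 de; exists N.+1 => x Nx.
have x0 : (0 < x)%N by exact: leq_trans Nx.
have : nc (lser (chi i) (1 + d) * euler_prod (lterm (chi i) (1 + d)) x - 1) <= e.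
  apply: euler_prod_tail (cmul_lterm i (1 + d)) (lserP s1 (dc_le1 dc i)) _ => M.
  apply: le_trans (_ : \sum_(x.+1 <= n < M.+1) npow (1 + d) n <= _).
    apply: ler_sum => n _; rewrite ncM nc_real ger0_norm ?npow_ge0//.
    by rewrite ler_piMl ?npow_ge0 ?(dc_le1 dc).
  apply: le_trans (npow_tail _ d0 x0) _; rewrite ler_pdivrMr// mulrC.
  by apply: hN; exact: ltnW.
set L := lser _ _ => h.
have h1 := nc_triB 1 (L * euler_prod (lterm (chi i) (1 + d)) x); rewrite nc1 nc_distrC in h1.
have h2 := nc_triB (L * euler_prod (lterm (chi i) (1 + d)) x) 1; rewrite nc1 in h2.
rewrite ncM (lnE_prod i x (ltW s1)) in h1 h2; set E := lnE i _ x in h1 h2 *.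
have P0 := expR_gt0 (- E).
have L0 : 0 < nc L.
  rewrite lt_neqAle nc_ge0 andbT; apply/eqP => z; move: h1; rewrite -z mul0r; lra.
split => //; have q0 : 0 < nc L * expR (- E) by rewrite mulr_gt0.
have lq : ln (nc L * expR (- E)) = ln (nc L) - E by rewrite lnM ?posrE// expRK.
have := ln_diff_le ltr01 q0; have := ln_diff_ge ltr01 q0; rewrite ln1 !subr0 divr1 lq => a1 a2.
have a3 : - (2 * e) <= (nc L * expR (- E) - 1) / (nc L * expR (- E)) by rewrite ler_pdivlMr//; nra.
by rewrite ler_norml; apply/andP; split; lra.
Qed.

Definition apsum s x : R := \sum_(1 <= q < x.+1 | prime q && (q == 1 %[mod m])) npow s q.

Lemma lnE_diff i d D x : 0 < d -> d <= D ->
  `|lnE i (1 + d) x - lnE i (1 + D) x -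
    \sum_(1 <= q < x.+1 | prime q) (npow (1 + d) q - npow (1 + D) q) * Re (chi i q)| <= 192 * D.
Proof.
move=> d0 dD; rewrite /lnE -!sumrB; apply: le_trans (ler_norm_sum _ _ _) _.
apply: le_trans (_ : \sum_(1 <= q < x.+1) 16 * D * (ln q%:R * npow 2 q) <= _); last first.
  rewrite -mulr_sumr; have := sum_ln_npow2 x; have D0 : 0 <= 16 * D by lra.
  by move/(ler_wpM2l D0); lra.
rewrite big_mkcond; apply: ler_sum => q _; case: ifP => [pq|_]; last first.
  by rewrite !mulr_ge0 ?ln_nat_ge0 ?npow_ge0//; lra.
have s1 : 1 <= 1 + d by lra.
have le12 : npow (1 + D) q <= npow (1 + d) q by apply: npow_le; rewrite lerD2l.
apply: le_trans (lnfac_lip (dc_le1 dc i q) (npow_ge0 _ _) le12 (npow_half s1 pq)) _.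
rewrite -!mulrA ler_wpM2l//.
have e2 : npow 2 q = npow 1 q * npow 1 q :> R by rewrite -[2]/(1 + 1) npowD.
have h1 : npow (1 + d) q <= npow 1 q :> R by apply: npow_le.
have h2 : npow (1 + d) q - npow (1 + D) q <= npow 1 q * (D * ln q%:R).
  rewrite !npowD -mulrBr ler_wpM2l ?npow_ge0//.
  have := expR_ge1Dx (- (D * ln q%:R)); rewrite -/(npow D q); have := npow_le1 q (ltW d0); lra.
rewrite e2; apply: le_trans (ler_pM (npow_ge0 _ _) _ h1 h2) _; first by rewrite subr_ge0.
by rewrite le_eqVlt; apply/orP; left; apply/eqP; ring.
Qed.

Lemma apsum_orth d D x : #|I|%:R * (apsum (1 + d) x - apsum (1 + D) x) =
  \sum_i \sum_(1 <= q < x.+1 | prime q) (npow (1 + d) q - npow (1 + D) q) * Re (chi i q).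
Proof.
rewrite exchange_big /= /apsum !(big_mkcondr _ _ _ (fun q => q == 1 %[mod m])) -sumrB mulr_sumr.
apply: eq_bigr => q _; rewrite -mulr_sumr -Re_sum (dc_orth dc).
have -> : Re ((#|I| * (q == 1 %[mod m]))%:R : R[i]) = (#|I| * (q == 1 %[mod m]))%:R.
  have -> : (#|I| * (q == 1 %[mod m]))%:R = ((#|I| * (q == 1 %[mod m]))%:R : R)%:C :> R[i] by rewrite rmorph_nat.
  by [].
by rewrite natrM; case: eqP => _; rewrite ?mulr1 ?mulr0 ?subr0 //; ring.
Qed.

(** Primality is dropped, and q is replaced by q - 1, a multiple of m. *)
Lemma apsum_triv D x : 0 < D -> apsum (1 + D) x <= npow 1 m * (1 + D^-1).
Proof.
move=> D0; have m1 := dc_m dc; have m0 := ltnW m1.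
apply: le_trans (_ : \sum_(1 <= k < (x %/ m).+1) npow (1 + D) (k * m) <= _); last first.
  apply: le_trans (_ : npow 1 m * \sum_(1 <= k < (x %/ m).+1) npow (1 + D) k <= _); last first.
    by rewrite ler_wpM2l ?npow_ge0// npow_sum.
  rewrite mulr_sumr; apply: ler_sum_nat => k /andP[k0 _]; rewrite npowM// mulrC.
  by rewrite ler_wpM2r ?npow_ge0// npow_le// lerDl ltW.
rewrite -(@big_multiples R (fun k => npow (1 + D) (k * m)) m x)//.
have -> : \sum_(1 <= n < x.+1 | (m %| n)%N) npow (1 + D) (n %/ m * m) = \sum_(1 <= n < x.+1 | (m %| n)%N) npow (1 + D) n :> R.
  by apply: eq_bigr => n mn; rewrite divnK.
elim: x => [|x ih]; first by rewrite /apsum !big_geq.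
suff key : apsum (1 + D) x.+1 <= \sum_(1 <= n < x.+1 | (m %| n)%N) npow (1 + D) n.
  apply: le_trans key _; rewrite [leRHS]big_mkcond big_nat_recr//= -big_mkcond lerDl.
  by case: ifP => _; rewrite ?npow_ge0.
elim: x {ih} => [|x ih]; first by rewrite [leRHS]big_geq// /apsum big_mkcond big_nat1.
rewrite /apsum big_mkcond big_nat_recr//= -big_mkcond [leRHS]big_mkcond big_nat_recr//= -big_mkcond.
apply: lerD => //; case: ifP => [/andP[_ h]|_]; last by case: ifP; rewrite ?npow_ge0.
have -> : (m %| x.+1)%N.
  by have := h; rewrite eqn_mod_dvd// subn1.
by apply: npow_nonincr => //; lra.
Qed.

End PrimesInProgressions.

(** * Separating the principal, real and non-real characters *)

Section Equidistribution.
Variable R : realType.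
Implicit Types (s d D : R).

(** 3-4-1 with the principal character, chi and chi^2: since chi^2 is nontrivial, its series is at
    most [lm], as are the increments of the series of chi up to one more factor [lm]. *)
Lemma nonreal_lower : exists2 c : R, 0 < c &
  forall m (I : finType) (chi : I -> nat -> R[i]) (i0 : I) (S : {set I}),
  dchar m chi i0 S -> (3 < m)%N -> forall i s, i \notin S -> 1 < s <= 2 ->
  c <= nc (lser (chi i) s) * lm R m ^+ 7.
Proof.
have E0 : 0 < expR (-8) / 2 :> R by rewrite divr_gt0 ?expR_gt0.
have [c c0 hc] := lower_from_341 E0 (@ltr01 R) (@ltr01 R); exists c => //.
move=> m I chi i0 S dc m3 i s iS s12.
have ii0 : i != i0 by apply: contraNneq iS => ->; exact: dc_in dc.
have chi21 n : nc (chi i n ^+ 2) <= 1 by rewrite ncX exprn_ile1 ?nc_ge0 ?(dc_le1 dc).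
apply: (hc (lser (chi i)) (lm R m)) => //; first by have := lm_ge2 R m; lra.
  move=> {s12}s /andP[s1 _].
  have F0 : nc (lser (chi i0) s) <= 1 + (s - 1)^-1.
    by apply: has_sum_abs_le (lserP s1 (dc_le1 dc i0)) (lterm_abs s1 (dc_le1 dc i0)).
  have F2 := lser_le chi21 (fun X Y => dc_sqr_sum dc X Y iS) s1.
  pose r p : R := (coprime p m)%:R * npow s p.
  (* The inequality wants unimodular values; at primes dividing m the value 1 is harmless, because
     there [r] vanishes. *)
  pose z p : R[i] := if coprime p m then chi i p else 1.
  have c2 : cmul (lterm (fun n => chi i n ^+ 2) s).
    have [d1 dM] := dc_cmul dc i; split; first by rewrite /lterm d1 npow1 expr1n mulr1.
    by move=> j k j0 k0; rewrite /lterm dM// npowM// rmorphM; ring.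
  have coz n : coprime n m = false -> chi i n = 0.
    by move=> cn; apply: nc_eq0; rewrite (dc_nc dc) cn.
  have := @lseries_341 R _ _ _ r z _ _ _ _ (cmul_lterm dc i0 s) (cmul_lterm dc i s) c2
    (lserP s1 (dc_le1 dc i0)) (lserP s1 (dc_le1 dc i)) (lserP s1 chi21).
  move=> h; apply: le_trans (h (1 + (s - 1)^-1) _ _ (lterm_abs s1 (dc_le1 dc i0)) _ _ _ _ _) _.
  - by move=> n _; rewrite /lterm !ncM !(dc_nc dc).
  - move=> n _; rewrite /lterm !ncM !(dc_nc dc).
    by case: coprime; rewrite ?mul1r ?mul0r.
  - move=> p _; rewrite /r mulr_ge0 ?npow_ge0//=; case: coprime; rewrite ?mul1r ?mul0r ?npow_ge0//.
    by rewrite npow_le// ltW.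
  - by move=> p; rewrite /z; case: ifP => cp; rewrite ?nc1// (dc_nc dc) cp.
  - by move=> p _; rewrite /lterm /r (dc_i0 dc); case: coprime; rewrite ?mul1r ?mul0r.
  - move=> p _; rewrite /lterm /r /z; case: ifP => cp; first by rewrite mul1r mulrC.
    by rewrite coz// !mul0r.
  - move=> p _; rewrite /lterm /r /z; case: ifP => cp; first by rewrite mul1r mulrC.
    by rewrite coz// expr0n !mul0r.
  rewrite mul1r; apply: ler_pM => //; rewrite ?mulr_ge0 ?exprn_ge0 ?nc_ge0//.
  rewrite ler_wpM2r ?exprn_ge0 ?nc_ge0// lerXn2r ?nnegrE ?nc_ge0//.
  exact: le_trans (nc_ge0 _) F0.
move=> s1 s2 h1 h2 h3; rewrite mul1r nc_distrC.
have := @lser_lip R m (chi i) (dc_le1 dc i) (fun X Y => dc_sum dc X Y ii0) (s1 - 1) (s2 - 1).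
rewrite !(addrC 1) !subrK; apply => //; lra.
Qed.

Lemma lnZ_bound : exists2 C : R, 1 <= C & forall d, 0 < d -> d * C <= 1 ->
  exists x0 : nat, forall x, (x0 <= x)%N -> `|lnZ (1 + d) x + ln d| <= C.
Proof.
have [C C0 hC] := kap_dirichlet R; exists (4 * C + 200); first rlra.
move=> d d0 dC; have dC' : d * (4 * C + 4) <= 1 by nra.
have d1 : d <= 1 by nra.
have [x0 h0] := hC d d0 dC'; exists x0 => x /h0 h.
have l4 : `|\sum_(1 <= p < x.+1 | prime p) kap R p * npow d p - lnZ (1 + d) x| <= 24 * d.
  rewrite /lnZ sumrN opprK -big_split /=; apply: le_trans (ler_norm_sum _ _ _) _.
  apply: le_trans (_ : \sum_(1 <= p < x.+1) 8 * d * npow (1 + 1 / 2) p <= _).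
    rewrite big_mkcond; apply: ler_sum => p _; case: ifP => [pp|_].
      by apply: kap_twist; rewrite ?prime_gt1// ltW.
    by rewrite !mulr_ge0 ?npow_ge0// ltW.
  rewrite -mulr_sumr; have q0 : 0 < 1 / 2 :> R by rlra.
  have := npow_sum x q0; rewrite -[_^-1]div1r => h1.
  have := ler_wpM2l (_ : 0 <= 8 * d) h1; rewrite mulr_ge0 ?(ltW d0)// => /(_ isT); rlra.
have : C * d <= C by rewrite ler_piMr.
move: h l4; set s1 := \sum_(_ <= _ < _ | _) _; rewrite !ler_norml => /andP[a1 a2] /andP[a3 a4] a5.
by apply/andP; split; rlra.
Qed.

Variables (m : nat) (I : finType) (chi : I -> nat -> R[i]) (i0 : I) (S : {set I}).
Hypothesis dc : dchar m chi i0 S.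
Ltac dlra := rlra_with ltac:(clear - dc).
Hypotheses (m3 : (3 < m)%N) (S4 : (#|S| <= 4)%N) (mI : (m <= 4 * #|I|)%N) (m2 : (size (primes m) <= 2)%N).

(** Only the factors at the primes dividing m are missing; there are at most two, each contributing
    at most 1. *)
Lemma lnE_i0 s x : 1 <= s -> lnZ s x - 2 <= lnE chi i0 s x <= lnZ s x.
Proof.
move=> s1; have e : lnZ s x - lnE chi i0 s x =
    \sum_(1 <= q < x.+1 | prime q && ~~ coprime q m) - ln (1 - npow s q).
  rewrite /lnZ /lnE -sumrB [RHS]big_mkcondr; apply: eq_bigr => q pq.
  rewrite /lnfac (dc_i0 dc); case: coprime => /=.
    have -> : 1 - 1 * (npow s q)%:C = (1 - npow s q)%:C by rewrite mul1r rmorphB.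
    rewrite nc_real ger0_norm ?subrr//.
    by have := npow_half s1 pq; lra.
  by rewrite mul0r subr0 nc1 ln1 oppr0 subr0.
have b q : prime q -> 0 <= - ln (1 - npow s q) <= 1.
  move=> pq; have h := npow_half s1 pq; have h0 := npow_ge0 s q.
  have q1 : 0 < 1 - npow s q by lra.
  have := ln_diff_le q1 ltr01; have := ln_diff_ge q1 ltr01; rewrite ln1 divr1 sub0r => a1 a2.
  have : (1 - (1 - npow s q)) / (1 - npow s q) <= 1 by rewrite ler_pdivrMr//; lra.
  by move=> a3; apply/andP; split; lra.
suff : 0 <= lnZ s x - lnE chi i0 s x <= 2 by move=> /andP[a1 a2]; apply/andP; split; lra.
rewrite e; apply/andP; split; first by apply: sumr_ge0 => q /andP[pq _]; have /andP[] := b q pq.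
apply: le_trans (_ : \sum_(1 <= q < x.+1 | prime q && ~~ coprime q m) 1 <= _).
  by apply: ler_sum => q /andP[pq _]; have /andP[] := b q pq.
have -> : \sum_(1 <= q < x.+1 | prime q && ~~ coprime q m) 1 =
  (\sum_(1 <= q < x.+1 | prime q && ~~ coprime q m) 1)%N%:R :> R by rewrite natr_sum.
rewrite sum1_count -size_filter ler_nat.
apply: leq_trans m2; apply: uniq_leq_size; first by rewrite filter_uniq// iota_uniq.
move=> q; rewrite mem_filter => /andP[/andP[pq cq] _].
by rewrite mem_primes pq (ltnW (dc_m dc))/=; move: cq; rewrite prime_coprime// negbK.
Qed.

(** |1 - chi(q) r| <= 1 + r <= 1/(1 - r). *)
Lemma lnE_ge i s x : 1 <= s -> - lnZ s x <= lnE chi i s x.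
Proof.
move=> s1; rewrite /lnZ -sumrN /lnE; apply: ler_sum => q pq; rewrite opprK /lnfac.
have h := npow_half s1 pq; have h0 := npow_ge0 s q.
have h1 := nc_fac_le (dc_le1 dc i q) h0; have h2 := nc_fac_gt0 dc i s1 pq.
have q1 : 0 < 1 - npow s q by lra.
rewrite lerNr -lnV ?posrE// ler_ln ?posrE ?invr_gt0//; apply: le_trans h1 _.
by rewrite -[leRHS]div1r ler_pdivlMr//; nra.
Qed.

Lemma sum_three (T : I -> R) (a b c : R) : 0 <= b ->
  (forall i, T i <= (i == i0)%:R * a + (i \in S)%:R * b + c) ->
  \sum_i T i <= a + 4 * b + #|I|%:R * c.
Proof.
move=> b0 h; apply: le_trans (ler_sum _ (fun i _ => h i)) _.
rewrite !big_split /=; apply: lerD; last by rewrite sumr_const -[leLHS]mulr_natl.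
apply: lerD; first by rewrite (bigD1 i0)//= eqxx big1 ?addr0 ?mul1r// => i /negbTE ->; rewrite mul0r.
rewrite -mulr_suml ler_wpM2r// -natr_sum ler_nat.
by apply: leq_trans S4; rewrite -sum1_card [leqRHS]big_mkcond; apply: leq_sum => i _; case: (i \in S).
Qed.

Lemma apsum_ge0 M s x : 0 <= apsum M s x :> R.
Proof. by apply: sumr_ge0 => q _; exact: npow_ge0. Qed.

Opaque lser lnE lnZ apsum nc npow lm.

Lemma nc_dist_le (x y : R[i]) : `|nc x - nc y| <= nc (x - y).
Proof.
have := nc_triB x y; have := nc_triB y x; rewrite (nc_distrC y) ler_norml => h1 h2.
by apply/andP; split; lra.
Qed.

Lemma close_diff (x y x' y' e u v : R) : `|x - x'| <= e -> `|y - y'| <= e ->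
  y' <= u -> - v <= x' -> - (x - y) <= u + v + 2 * e.
Proof. by rewrite !ler_norml => /andP[a1 a2] /andP[a3 a4]; lra. Qed.

Lemma close_diff_abs (x y x' y' D z : R) : `|x - x'| <= 2 * D -> `|y - y'| <= 2 * D ->
  y' - x' <= z -> x' - y' <= z -> `|x - y| <= 4 * D + z.
Proof.
rewrite !ler_norml => /andP[a1 a2] /andP[a3 a4] h1 h2.
by apply/andP; split; lra.
Qed.

Lemma lnE_nonreal c d D i x : 0 < c -> 0 < d -> d <= D -> D <= 1 / 2 -> i \notin S ->
  (forall s, 1 < s <= 2 -> c <= nc (lser (chi i) s) * lm R m ^+ 7) ->
  `|lnE chi i (1 + d) x - ln (nc (lser (chi i) (1 + d)))| <= 2 * D ->
  `|lnE chi i (1 + D) x - ln (nc (lser (chi i) (1 + D)))| <= 2 * D ->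
  `|lnE chi i (1 + d) x - lnE chi i (1 + D) x| <= 4 * D + D * lm R m ^+ 9 / c.
Proof.
move=> c0 d0 dD D2; have D0 : 0 < D by lra.
have sd12 : 1 < 1 + d <= 2 by apply/andP; split; lra.
have sD12 : 1 < 1 + D <= 2 by apply/andP; split; lra.
have l0 : 0 < lm R m by have := lm_ge2 R m; lra.
move=> iS hc hd hD.
have ii0 : i != i0 by apply: contraNneq iS => ->; exact: dc_in dc.
have lip := lser_lip (dc_le1 dc i) (fun X Y => dc_sum dc X Y ii0) d0 dD m3.
have low s : 1 < s <= 2 -> c / lm R m ^+ 7 <= nc (lser (chi i) s).
  by move=> s12; rewrite ler_pdivrMr ?exprn_gt0//; exact: hc.
have low1 := low _ sd12; have low2 := low _ sD12.
have q0 : 0 < c / lm R m ^+ 7 by rewrite divr_gt0 ?exprn_gt0.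
have diff a b : c / lm R m ^+ 7 <= a -> 0 < b -> `|a - b| <= D * lm R m ^+ 2 -> ln b - ln a <= D * lm R m ^+ 9 / c.
  move=> a1 b0 ab; have a0 : 0 < a by exact: lt_le_trans a1.
  apply: le_trans (ln_diff_le a0 b0) _; rewrite ler_pdivrMr//.
  apply: le_trans (_ : D * lm R m ^+ 2 <= _); first by apply: le_trans ab; rewrite distrC ler_norm.
  apply: le_trans (ler_wpM2l _ a1); last by rewrite divr_ge0 ?mulr_ge0 ?exprn_ge0// ltW.
  by rewrite le_eqVlt; apply/orP; left; apply/eqP; field; rewrite !gt_eqF.
have nd := le_trans (nc_dist_le _ _) lip.
have e1 := diff _ _ low1 (lt_le_trans q0 low2) nd.
have e2 := diff _ _ low2 (lt_le_trans q0 low1); rewrite distrC in e2; have {}e2 := e2 nd.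
exact: close_diff_abs hd hD e1 e2.
Qed.

Lemma lnE_princ C d D x : 0 < d -> d <= D ->
  `|lnZ (1 + d) x + ln d| <= C -> `|lnZ (1 + D) x + ln D| <= C ->
  `|lnE chi i0 (1 + d) x - lnE chi i0 (1 + D) x - (- ln d + ln D)| <= 2 * C + 4.
Proof.
move=> d0 dD; have sd : 1 <= 1 + d by lra. have sD : 1 <= 1 + D by lra.
have /andP[a1 a2] := lnE_i0 x sd; have /andP[a3 a4] := lnE_i0 x sD.
rewrite !ler_norml => /andP[a5 a6] /andP[a7 a8].
by apply/andP; split; lra.
Qed.

Lemma lser_ln_le i s : i != i0 -> 1 < s -> 0 < nc (lser (chi i) s) ->
  ln (nc (lser (chi i) s)) <= lm R m.
Proof.
move=> ii0 s1 L0; have l0 : 0 < lm R m by have := lm_ge2 R m; lra.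
apply: le_trans (_ : ln (lm R m) <= _).
  rewrite ler_ln ?posrE//; exact: (lser_le (dc_le1 dc i) (fun X Y => dc_sum dc X Y ii0) s1).
by have := ln_diff_le ltr01 l0; rewrite ln1 divr1 subr0; lra.
Qed.

Lemma scale_bound (n : nat) (Q v w : R) : 0 < n%:R :> R -> (m <= 4 * n)%N -> 0 <= Q ->
  n%:R * v <= w + Q -> v <= w / n%:R + 4 * npow 1 m * Q.
Proof.
move=> n0 mn Q0 h; have m0 : (0 < m)%N by exact: leq_trans m3.
have nI : n%:R^-1 <= 4 * npow 1 m :> R.
  rewrite (@npow_1 R)// -[leLHS]mul1r ler_pdivrMr// mulrAC ler_pdivlMr ?ltr0n// mul1r.
  by rewrite -natrM ler_nat.
apply: le_trans (_ : (w + Q) / n%:R <= _); first by rewrite ler_pdivlMr// mulrC.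
by rewrite mulrDl lerD2l mulrC ler_wpM2r.
Qed.

(** By orthogonality, |I| times the increment of [apsum] is, up to O(D) for each character, the sum
    of the increments of ln |L|: ln D - ln d for the principal character, crude bounds of
    logarithmic size for the at most four real ones, and O(D lm^9) for the others. Real series have
    to be bounded from below only for the lower estimate, hence the implication in the second
    half. *)
Lemma apsum_core C c d D B x : 1 <= C -> 0 < c -> 0 < d -> d <= D -> D <= 1 / 2 -> 0 <= B ->
  `|lnZ (1 + d) x + ln d| <= C -> `|lnZ (1 + D) x + ln D| <= C ->
  (forall i s, i \notin S -> 1 < s <= 2 -> c <= nc (lser (chi i) s) * lm R m ^+ 7) ->
  (forall i, 0 < nc (lser (chi i) (1 + d)) /\ `|lnE chi i (1 + d) x - ln (nc (lser (chi i) (1 + d)))| <= 2 * D) ->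
  (forall i, 0 < nc (lser (chi i) (1 + D)) /\ `|lnE chi i (1 + D) x - ln (nc (lser (chi i) (1 + D)))| <= 2 * D) ->
  let u := npow 1 m * (40 * (C + lm R m - ln D)) + 200 * D + D * lm R m ^+ 9 / c + apsum m (1 + D) x in
  apsum m (1 + d) x <= - ln d / #|I|%:R + u /\
  ((forall i, i \in S -> i != i0 -> - (B * lm R m) <= ln (nc (lser (chi i) (1 + d)))) ->
   - ln d / #|I|%:R - (u + npow 1 m * (40 * (B * lm R m))) <= apsum m (1 + d) x).
Proof.
move=> C1 c0 d0 dD D2 B0 hZd hZD hc hd hD u; rewrite {}/u.
have D0 : 0 < D by dlra.
have sD : 1 <= 1 + D by dlra.
have s1d : 1 < 1 + d by dlra. have s1D : 1 < 1 + D by dlra.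
have l2 := lm_ge2 R m; have l0 : 0 < lm R m by dlra.
have I0 : 0 < #|I|%:R :> R by rewrite ltr0n; case: (#|I|) mI m3 => //; rewrite muln0 leqn0 => /eqP ->.
have lnD0 : ln D <= 0 by apply: ln_le0; dlra.
pose T i : R := lnE chi i (1 + d) x - lnE chi i (1 + D) x.
have [b1 b2] : #|I|%:R * (apsum m (1 + d) x - apsum m (1 + D) x) <= \sum_i T i + #|I|%:R * (192 * D) /\
   \sum_i T i - #|I|%:R * (192 * D) <= #|I|%:R * (apsum m (1 + d) x - apsum m (1 + D) x).
  rewrite (apsum_orth dc) mulr_natl -sumr_const -big_split /= -sumrB.
  split; apply: ler_sum => i _; have := lnE_diff dc i x d0 dD; rewrite ler_norml /T => /andP[]; dlra.
have T0 := lnE_princ d0 dD hZd hZD; rewrite -/(T i0) in T0.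
set z := D * lm R m ^+ 9 / c; set c1 := 4 * D + z.
have nonreal i : i \notin S -> `|T i| <= c1.
  by move=> iS; rewrite /c1 /z; exact: lnE_nonreal c0 d0 dD D2 iS (fun s => hc i s iS) (hd i).2 (hD i).2.
have c10 : 0 <= c1.
  by rewrite /c1 /z addr_ge0 ?mulr_ge0 ?invr_ge0 ?exprn_ge0 ?(ltW D0) ?(ltW l0) ?(ltW c0).
have realU i : i != i0 -> T i <= lm R m + C - ln D + 2 * D.
  move=> ii0; have [Ld hd'] := hd i; have h1 := lser_ln_le ii0 s1d Ld; have h2 := lnE_ge i x sD.
  move: h1 h2 hd' hZD; rewrite /T !ler_norml => h1 h2 /andP[a1 a2] /andP[a3 a4]; dlra.
have A0 := apsum_ge0 m (1 + D) x; have n0 := npow_ge0 (1 : R) m.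
set a := apsum m (1 + D) x in b1 b2 A0 *; set ad := apsum m (1 + d) x in b1 b2 *.
have bb (v : R) i : 0 <= v -> 0 <= (i \in S)%:R * v by move=> v0; rewrite mulr_ge0.
split.
  have U1 : \sum_i T i <= (- ln d + 2 * C + 4) + 4 * (lm R m + C - ln D + 2 * D) + #|I|%:R * c1.
    apply: sum_three; first by move: C1 l0 lnD0 D0; dlra.
    have v0 : 0 <= lm R m + C - ln D + 2 * D by move: C1 l0 lnD0 D0; dlra.
    move=> i; have [->|ii0] := eqVneq i i0.
      have := bb _ i0 v0; move: T0; rewrite ler_norml mul1r; move: lnD0 c10 => h1 h2 /andP[a1 a2]; dlra.
    rewrite mul0r add0r; have [iS|iS] := boolP (i \in S).
      by have := realU i ii0; move: c10; rewrite mul1r; dlra.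
    by have := nonreal i iS; rewrite mul0r add0r ler_norml => /andP[].
  have Q0 : 0 <= 6 * C + 4 + 4 * lm R m - 4 * ln D + 8 * D by move: C1 l0 lnD0 D0; dlra.
  have := @scale_bound #|I| _ (ad - a - 192 * D - c1) (- ln d) I0 mI Q0.
  move=> /(_ _)/wrap[|F]; first by move: b1 U1; rewrite mulrBr; dlra.
  have : 4 * npow 1 m * (6 * C + 4 + 4 * lm R m - 4 * ln D + 8 * D) <= npow 1 m * (40 * (C + lm R m - ln D)).
    by rewrite -mulrA mulrCA ler_wpM2l//; move: C1 l2 lnD0 D2; dlra.
  by move: F D0; rewrite /c1; set w := - ln d / _; move: w (z); clear - dc; move=> w z; lra.
move=> hB.
have realL i : i \in S -> i != i0 -> - T i <= lm R m + B * lm R m + 2 * (2 * D).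
  move=> iS ii0; have [Ld hd'] := hd i; have [LD hD'] := hD i; have h1 := lser_ln_le ii0 s1D LD; have h2 := hB i iS ii0.
  exact: close_diff hd' hD' h1 h2.
have Bl : 0 <= B * lm R m by rewrite mulr_ge0// ltW.
have U2 : \sum_i - T i <= (ln d - ln D + 2 * C + 4) + 4 * ((B + 1) * lm R m + 4 * D) + #|I|%:R * c1.
  have v0 : 0 <= (B + 1) * lm R m + 4 * D by move: Bl l0 D0; dlra.
  apply: sum_three => // i; have [->|ii0] := eqVneq i i0.
    have := bb _ i0 v0; move: T0; rewrite ler_norml mul1r; move: c10 => h2 /andP[a1 a2]; dlra.
  rewrite mul0r add0r; have [iS|iS] := boolP (i \in S).
    by have := realL i iS ii0; move: c10; rewrite mul1r; dlra.
  by have := nonreal i iS; rewrite mul0r add0r ler_norml => /andP[]; dlra.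
rewrite sumrN in U2.
have Q0 : 0 <= 2 * C + 4 + 4 * ((B + 1) * lm R m + 4 * D) - ln D by move: C1 Bl l0 lnD0 D0; dlra.
have := @scale_bound #|I| _ (a - ad - 192 * D - c1) (ln d) I0 mI Q0.
move=> /(_ _)/wrap[|F]; first by move: b2 U2; rewrite !mulrBr; dlra.
have F2 : 4 * npow 1 m * (2 * C + 4 + 4 * ((B + 1) * lm R m + 4 * D) - ln D) <= npow 1 m * (40 * (C + lm R m - ln D)) + npow 1 m * (40 * (B * lm R m)).
  by rewrite -mulrDr -mulrA mulrCA ler_wpM2l//; move: C1 l2 lnD0 D2 Bl; dlra.
by move: F F2 A0 D0; rewrite /c1 mulNr; set w := ln d / _; move: w (z); clear - dc; move=> w z; lra.
Qed.

Transparent lser lnE lnZ apsum nc npow lm.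
End Equidistribution.

(** * A lower bound for real characters at 1 *)

Section RealCharacters.
Variable R : realType.
Implicit Types (e : nat -> R) (z w : R).

Definition geo z d : R := \sum_(0 <= i < d) z ^+ i.

Lemma geoS z d : geo z d.+1 = 1 + z * geo z d.
Proof.
rewrite /geo big_nat_recl//= expr0 mulr_sumr; congr (_ + _).
by apply: eq_bigr => i _; rewrite exprS.
Qed.

Lemma geo_mul z d : geo z d * (1 - z) = 1 - z ^+ d.
Proof.
elim: d => [|d ih]; first by rewrite /geo big_geq// mul0r expr0 subrr.
by rewrite geoS mulrDl -mulrA ih exprS; ring.
Qed.

(** Pair the exponents i and d - 1 - i and use x^2 + y^2 >= 2xy. *)
Lemma geo_amgm w d : 0 <= w -> d%:R * w ^+ d.-1 <= geo (w ^+ 2) d.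
Proof.
move=> w0; case: d => [|d]; first by rewrite mul0r /geo big_geq.
rewrite /= -(@ler_pM2l _ 2)//.
have -> : 2 * geo (w ^+ 2) d.+1 = \sum_(0 <= i < d.+1) ((w ^+ 2) ^+ i + (w ^+ 2) ^+ (d - i)).
  rewrite big_split /= mulr_natl mulr2n; congr (_ + _).
  by rewrite /geo big_nat_rev /= add0n; apply: eq_bigr => i _; rewrite subSS.
have -> : 2 * (d.+1%:R * w ^+ d) = \sum_(0 <= i < d.+1) 2 * w ^+ d.
  by rewrite sumr_const_nat subn0 -[RHS]mulr_natl; ring.
apply: ler_sum_nat => i /andP[_ id]; rewrite ltnS in id.
have := sqr_ge0 (w ^+ i - w ^+ (d - i)); rewrite sqrrB -!exprM -exprD subnKC// ![(_ * 2)%N]mulnC -mulr_natl; lra.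
Qed.

Lemma geo_gt0 z d : 0 <= z -> (0 < d)%N -> 0 < geo z d.
Proof.
case: d => // d z0 _; rewrite geoS ltr_pwDl//.
by rewrite mulr_ge0// sumr_ge0// => i _; rewrite exprn_ge0.
Qed.

(** This is 1/d - (1 - z) z^d / (1 - z^d), with the factor 1 - z cancelled. *)
Definition lamb z (d : nat) : R := d%:R^-1 - z ^+ d / geo z d.

Lemma lamb_ge0 z d : 0 <= z -> z <= 1 -> (0 < d)%N -> 0 <= lamb z d.
Proof.
move=> z0 z1 d0; have g0 := geo_gt0 z0 d0.
rewrite subr_ge0 ler_pdivrMr// mulrC ler_pdivlMr ?ltr0n//.
have -> : z ^+ d * d%:R = \sum_(0 <= i < d) z ^+ d by rewrite sumr_const_nat subn0 mulr_natr.
by apply: ler_sum_nat => i /andP[_ id]; apply: ler_wiXn2l => //; exact: ltnW.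
Qed.

(** Monotonicity amounts to d (d+1) z^d <= geo(d) geo(d+1), a product of two arithmetic-geometric
    inequalities; the square root w of z makes their exponents integral. *)
Lemma lamb_dec w d : 0 <= w -> w <= 1 -> (0 < d)%N -> lamb (w ^+ 2) d.+1 <= lamb (w ^+ 2) d.
Proof.
move=> w0 w1 d0; set z := w ^+ 2; have z0 : 0 <= z by rewrite exprn_ge0.
have g0 := geo_gt0 z0 d0; have g1 := geo_gt0 z0 (ltn0Sn d).
have dR : 0 < d%:R :> R by rewrite ltr0n. have dR1 : 0 < d.+1%:R :> R by rewrite ltr0n.
have key : d%:R * d.+1%:R * z ^+ d <= geo z d * geo z d.+1.
  apply: le_trans (ler_pM _ _ (geo_amgm d w0) (geo_amgm d.+1 w0)); rewrite ?mulr_ge0 ?exprn_ge0//.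
  rewrite /= mulrACA -exprD ler_wpM2l ?mulr_ge0// /z -exprM; apply: ler_wiXn2l => //.
  by case: (d) d0 => // k _ /=; lia.
have e : z ^+ d / geo z d - z ^+ d.+1 / geo z d.+1 = z ^+ d / (geo z d * geo z d.+1).
  move: g0 g1; rewrite exprS geoS; move: (geo z d) (z ^+ d) => G A g0 g1.
  by field; rewrite !gt_eqF.
have e2 : d%:R^-1 - d.+1%:R^-1 = (d%:R * d.+1%:R)^-1 :> R.
  have -> : d.+1%:R = d%:R + 1 :> R by rewrite natr1.
  have dn0 : d%:R != 0 :> R by rewrite gt_eqF.
  have dn1 : d%:R + 1 != 0 :> R by rewrite natr1 gt_eqF.
  by field; rewrite ?dn0 ?dn1.
suff : z ^+ d / (geo z d * geo z d.+1) <= (d%:R * d.+1%:R)^-1.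
  rewrite -e -e2 /lamb; set A := z ^+ d / _; set A' := z ^+ d.+1 / _.
  by set c := d%:R^-1; set c' := d.+1%:R^-1; move: c c' A A' => c c' A A'; lra.
by rewrite ler_pdivrMr ?mulr_gt0// mulrC ler_pdivlMr ?mulr_gt0// mulrC.
Qed.

Definition rdiv e n : R := \sum_(1 <= d < n.+1 | (d %| n)%N) e d.

Lemma rdiv_divisors e n : (0 < n)%N -> rdiv e n = \sum_(d <- divisors n) e d.
Proof.
move=> n0; rewrite /rdiv -big_filter; apply: perm_big; apply: uniq_perm.
- by rewrite filter_uniq// iota_uniq.
- exact: divisors_uniq.
move=> d; rewrite mem_filter mem_index_iota -dvdn_divisors//.
by apply/idP/idP => [/andP[]//|dn]; rewrite dn (dvdn_gt0 n0 dn) ltnS dvdn_leq.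
Qed.

Definition rchar e := [/\ e 1%N = 1, forall j k, (0 < j)%N -> (0 < k)%N -> e (j * k)%N = e j * e k &
  forall n, [\/ e n = 0, e n = 1 | e n = -1]].

(** The divisors of p^(j+1) n are those of p^j n together with p^(j+1) times those of n. *)
Lemma rdiv_step e p j n : rchar e -> prime p -> (0 < n)%N -> ~~ (p %| n)%N ->
  rdiv e (p ^ j.+1 * n) = rdiv e (p ^ j * n) + e p ^+ j.+1 * rdiv e n.
Proof.
move=> [e1 eM _] pp n0 pn; have p0 := prime_gt0 pp.
have pj i : (0 < p ^ i)%N by rewrite expn_gt0 p0.
have eX i : e (p ^ i)%N = e p ^+ i.
  by elim: i => [|i ih]; rewrite ?expn0 ?expr0// expnS exprS eM// ih.
rewrite !rdiv_divisors ?muln_gt0 ?pj// mulr_sumr.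
have -> : \sum_(d <- divisors n) e p ^+ j.+1 * e d = \sum_(d <- [seq (p ^ j.+1 * d)%N | d <- divisors n]) e d.
  rewrite big_map; apply: eq_big_seq => d; rewrite -dvdn_divisors// => dn.
  by rewrite eM ?pj ?(dvdn_gt0 n0 dn)// eX.
rewrite -big_cat; apply: perm_big; apply: uniq_perm; first exact: divisors_uniq.
  rewrite cat_uniq divisors_uniq map_inj_uniq ?divisors_uniq ?andbT; last first.
    by move=> x y /eqP; rewrite eqn_pmul2l// => /eqP.
  apply/hasPn => _ /mapP[d _ ->]; rewrite /= -dvdn_divisors ?muln_gt0 ?pj//.
  apply/negP => h; have : (p ^ j * p %| p ^ j * n)%N by rewrite -expnSr; apply: dvdn_trans h; exact: dvdn_mulr.
  by rewrite dvdn_pmul2l// (negbTE pn).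
move=> d; rewrite mem_cat -!dvdn_divisors ?muln_gt0 ?pj//.
apply/idP/orP => [dn|[dn|/mapP[d' + ->]]]; last 2 first.
- by apply: dvdn_trans dn _; rewrite dvdn_pmul2r// dvdn_exp2l.
- by rewrite -dvdn_divisors// => dn; rewrite dvdn_mul.
have d0 : (0 < d)%N by apply: dvdn_gt0 dn; rewrite muln_gt0 pj.
have [h|h] := boolP (p ^ j.+1 %| d)%N; [right|left].
  apply/mapP; exists (d %/ p ^ j.+1)%N; last by rewrite mulnC divnK.
  by rewrite -dvdn_divisors// -(@dvdn_pmul2l (p ^ j.+1))// [(_ * (_ %/ _))%N]mulnC divnK.
have [i ij hd] : exists2 i, (i <= j)%N & exists2 d', (d' %| n)%N & d = (p ^ i * d')%N.
  exists (logn p d).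
    by rewrite -ltnS ltnNge -pfactor_dvdn//.
  have [d' cd' ed] := pfactor_coprime pp d0; exists d'; last by rewrite mulnC.
  have : (d' %| p ^ j.+1 * n)%N by apply: dvdn_trans dn; rewrite ed dvdn_mulr.
  by rewrite Gauss_dvdr// coprime_sym coprimeXl.
by case: hd => d' dn' ->; rewrite dvdn_mul// dvdn_exp2l.
Qed.

Lemma rdiv_pow e p j n : rchar e -> prime p -> (0 < n)%N -> ~~ (p %| n)%N ->
  rdiv e (p ^ j * n) = (\sum_(0 <= i < j.+1) e p ^+ i) * rdiv e n.
Proof.
move=> re pp n0 pn; elim: j => [|j ih]; first by rewrite expn0 mul1n big_nat1 expr0 mul1r.
by rewrite rdiv_step// ih [in RHS]big_nat_recr//= mulrDl.
Qed.

Lemma sign_sum (a : R) j : [\/ a = 0, a = 1 | a = -1] ->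
  0 <= \sum_(0 <= i < j.+1) a ^+ i /\ 1 <= \sum_(0 <= i < (j.*2).+1) a ^+ i.
Proof.
case=> ->.
- have z k : \sum_(0 <= i < k.+1) (0 : R) ^+ i = 1.
    rewrite big_nat_recl//= expr0 big1 ?addr0// => i _; by rewrite expr0n.
  by rewrite !z.
- under eq_bigr do rewrite expr1n. under [X in _ /\ _ <= X]eq_bigr do rewrite expr1n.
  by rewrite !sumr_const_nat !subn0 ler1n.
have z k : \sum_(0 <= i < k.+1) (-1 : R) ^+ i = (~~ odd k)%:R.
  elim: k => [|k ih]; first by rewrite big_nat1 expr0.
  by rewrite big_nat_recr//= ih -signr_odd /=; case: odd => /=; rewrite ?expr0 ?expr1; lra.
by rewrite !z odd_double; split; [exact: ler0n|exact: lexx].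
Qed.

Lemma rdiv_ge0 e n : rchar e -> (0 < n)%N -> 0 <= rdiv e n.
Proof.
move=> re; have [k] := ubnP n; elim: k n => // k ih n nk n0.
have [n1|n1] := leqP n 1.
  have -> : n = 1%N by apply/eqP; rewrite eqn_leq n1.
  by rewrite /rdiv big_mkcond big_nat1 dvdnn; have [-> _ _] := re.
have pp := pdiv_prime n1; have [n' cn' en] := pfactor_coprime pp n0.
rewrite en mulnC; have n'0 : (0 < n')%N by move: n0; rewrite en muln_gt0 => /andP[].
have pn' : ~~ (pdiv n %| n')%N by rewrite -prime_coprime.
rewrite rdiv_pow// mulr_ge0//; first by have [_ _ h] := re; have [] := sign_sum (logn (pdiv n) n) (h (pdiv n)).
apply: ih => //; apply: leq_trans (_ : n <= k)%N => //.
rewrite [X in (_ < X)%N]en -[X in (X < _)%N]muln1 ltn_pmul2l// -[1%N](expn0 (pdiv n)) ltn_exp2l ?prime_gt1//.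
by rewrite logn_gt0 mem_primes pp n0 pdiv_dvd.
Qed.

Lemma rdiv_sqr e n : rchar e -> (0 < n)%N -> 1 <= rdiv e (n ^ 2).
Proof.
move=> re; have [k] := ubnP n; elim: k n => // k ih n nk n0.
have [n1|n1] := leqP n 1.
  have -> : n = 1%N by apply/eqP; rewrite eqn_leq n1.
  by rewrite exp1n /rdiv big_mkcond big_nat1 dvdnn; have [-> _ _] := re.
have pp := pdiv_prime n1; have [n' cn' en] := pfactor_coprime pp n0.
rewrite en mulnC expnMn -expnM muln2; have n'0 : (0 < n')%N by move: n0; rewrite en muln_gt0 => /andP[].
have pn' : ~~ (pdiv n %| n' ^ 2)%N by rewrite -prime_coprime// coprimeXr.
rewrite rdiv_pow ?expn_gt0 ?n'0//.
have [_ _ h] := re; have [_ s1] := sign_sum (logn (pdiv n) n) (h (pdiv n)).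
apply: le_trans s1 _; apply: le_trans (_ : (\sum_(0 <= i < (logn (pdiv n) n).*2.+1) e (pdiv n) ^+ i) * 1 <= _).
  by rewrite mulr1.
have s0 : 0 <= \sum_(0 <= i < (logn (pdiv n) n).*2.+1) e (pdiv n) ^+ i.
  by have [] := sign_sum (logn (pdiv n) n).*2 (h (pdiv n)).
rewrite ler_wpM2l//.
apply: ih => //; apply: leq_trans (_ : n <= k)%N => //.
rewrite [X in (_ < X)%N]en -[X in (X < _)%N]muln1 ltn_pmul2l// -[1%N](expn0 (pdiv n)) ltn_exp2l ?prime_gt1//.
by rewrite logn_gt0 mem_primes pp n0 pdiv_dvd.
Qed.

Lemma rdiv_partial e (z : R) N : \sum_(1 <= n < N.+1) rdiv e n * z ^+ n =
  \sum_(1 <= d < N.+1) e d * \sum_(1 <= k < (N %/ d).+1) z ^+ (d * k).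
Proof.
transitivity (\sum_(1 <= n < N.+1) \sum_(1 <= d < N.+1 | (d %| n)%N) e d * z ^+ n).
  apply: eq_big_nat => n /andP[n0 nN]; rewrite /rdiv mulr_suml.
  rewrite [RHS](@big_cat_nat _ _ _ n.+1)//= [X in _ = _ + X]big_nat_cond [X in _ = _ + X]big1 ?addr0// => d /andP[/andP[nd _] dn].
  by have := dvdn_leq n0 dn; rewrite leqNgt nd.
rewrite (exchange_big_dep xpredT)//=; apply: eq_big_nat => d /andP[d0 _].
rewrite mulr_sumr -(@big_multiples R (fun k => e d * z ^+ (d * k)) d N)//.
by apply: eq_bigr => n dn; rewrite mulnC divnK.
Qed.

(* Monsky: compare [sum e d / d] with the Lambert series of [e], whose power
   series coefficients are nonnegative and at least 1 at the squares. *)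
Lemma real_char_lower e m : rchar e -> (1 < m)%N ->
  (forall X Y, `|\sum_(X <= n < Y) e n| <= m%:R) ->
  exists N0 : nat, forall N, (N0 <= N)%N -> (32 * m%:R ^+ 2)^-1 <= \sum_(1 <= d < N.+1) e d / d%:R.
Proof.
move=> re m1 eS; have m0 : 0 < m%:R :> R by rewrite ltr0n ltnW.
have m1R : 1 <= m%:R :> R by rewrite ler1n ltnW.
(* For the 4m squares k^2 <= 16 m^2 one has 16 m^2 eta = 1/2, so z^(k^2) >= 1/2 and the Lambert sum
   is at least 2m. Multiplied by 1 - z = eta, and diminished by the Abel error m eta and the
   truncation error eta, it leaves (m - 1) eta >= eta. *)
pose eta : R := (32 * m%:R ^+ 2)^-1.
have eta0 : 0 < eta by rewrite invr_gt0 mulr_gt0// exprn_gt0.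
have eta1 : eta <= 1 / 32.
  by rewrite div1r lef_pV2 ?posrE ?mulr_gt0 ?exprn_gt0// ler_peMr// exprn_ege1.
pose z := 1 - eta; pose w := Num.sqrt z.
have z0 : 0 < z by rewrite /z; rlra. have z1 : z < 1 by rewrite /z; rlra.
have wz : w ^+ 2 = z by rewrite sqr_sqrtr// ltW.
have w0 : 0 <= w by exact: sqrtr_ge0.
have w1 : w <= 1 by rewrite -(@ler_pXn2r _ 2)// ?nnegrE// wz expr1n ltW.
pose K := (4 * m)%N.
(* Truncating the Lambert series at N costs at most N z^(N+1). *)
have [N1 hN1] : exists N1, forall N, (N1 <= N)%N -> N%:R * z ^+ N.+1 <= eta.
  have lz : 0 < - ln z by rewrite oppr_gt0 ln_lt0// z0.
  have a0 : 0 < (- ln z) ^+ 2 * eta / 2 by rewrite divr_gt0 ?mulr_gt0 ?exprn_gt0.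
  exists (Num.truncn (((- ln z) ^+ 2 * eta / 2)^-1)).+1 => N hN.
  have NR : ((- ln z) ^+ 2 * eta / 2)^-1 <= N%:R.
    by apply: ltW; apply: lt_le_trans (lt_truncnS _) _; rewrite ler_nat.
  have N0 : 0 < N%:R :> R by apply: lt_le_trans NR; rewrite invr_gt0.
  have := @exp_pow_le R 1 (- ln z * N%:R) 2 ltr01 (mulr_ge0 (ltW lz) (ler0n _ _)).
  rewrite invr1 expr1n mulr1 mul1r (_ : 2`!%:R = 2 :> R)// exprMn => h.
  have zN : z ^+ N * expR (- ln z * N%:R) = 1.
    by rewrite -{1}[z]lnK ?posrE// -expRM_natl -expRD (_ : _ + _ = 0) ?expR0//; ring.
  have zN0 : 0 < z ^+ N by rewrite exprn_gt0.
  have h2 : (- ln z) ^+ 2 * N%:R ^+ 2 * z ^+ N <= 2.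
    by have := ler_wpM2r (ltW zN0) h; rewrite -[2 * _ * _]mulrA [expR _ * _]mulrC zN mulr1.
  have h3 : N%:R * z ^+ N <= eta.
    have i0 := a0; rewrite -invr_gt0 in i0.
    have h4 : 1 <= (- ln z) ^+ 2 * eta / 2 * N%:R.
      by rewrite -[leLHS](mulfV (lt0r_neq0 a0)) ler_wpM2l// ltW.
    have h5 : (N%:R * z ^+ N) * 1 <= (N%:R * z ^+ N) * ((- ln z) ^+ 2 * eta / 2 * N%:R).
      by rewrite ler_wpM2l// mulr_ge0// ltW.
    have h6 := ler_wpM2r (ltW eta0) h2; rewrite mulr1 in h5; apply: le_trans h5 _.
    by move: h6; rewrite expr2; rlra.
  by apply: le_trans h3; rewrite exprS ler_wpM2l// ler_piMl// ltW.
exists (maxn N1 (K ^ 2)) => N; rewrite geq_max => /andP[NN1 NK].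
have g1 d : (0 < d)%N -> 0 < geo z d by move=> d0; apply: geo_gt0 => //; exact: ltW.
have ab : `|\sum_(1 <= d < N.+1) e d * lamb z d| <= m%:R * lamb z 1.
  apply: (@abel_le R e (lamb z) 1 N.+1 m%:R) => //.
  - by rewrite ltnS (leq_trans _ NK)// expn_gt0 /K muln_gt0 /= (ltnW m1).
  - by move=> d d0 _; apply: lamb_ge0; rewrite ?(ltW z0) ?(ltW z1).
  - by move=> d d0 _; rewrite -wz; exact: lamb_dec.
have l1 : lamb z 1 = eta by rewrite /lamb /geo big_nat1 expr0 expr1 /z; field.
have tail : `|\sum_(1 <= d < N.+1) e d * (z ^+ d / geo z d) - (1 - z) * \sum_(1 <= n < N.+1) rdiv e n * z ^+ n| <= eta.
  rewrite rdiv_partial mulr_sumr -sumrB; apply: le_trans (ler_norm_sum _ _ _) _.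
  apply: le_trans (_ : \sum_(1 <= d < N.+1) z ^+ N.+1 <= _); last first.
    by rewrite sumr_const_nat subSS subn0 -[leLHS]mulr_natl; exact: hN1.
  apply: ler_sum_nat => d /andP[d0 dN].
  have gk J : (1 - z) * \sum_(1 <= k < J.+1) z ^+ (d * k) = z ^+ d / geo z d * (1 - z ^+ (d * J)).
    have gd := geo_mul z d; have gn : geo z d != 0 by rewrite gt_eqF// g1.
    elim: J => [|J ih]; first by rewrite big_geq// muln0 expr0; ring.
    rewrite big_nat_recr//= mulrDr ih.
    have -> : 1 - z = (1 - z ^+ d) / geo z d by rewrite -gd mulrC mulKf.
    by rewrite mulnS exprD; field.
  rewrite [(1 - z) * _]mulrCA gk -mulrBr normrM mulrBr mulr1 opprB addrC subrK.
  have [_ _ h] := re; have e1 : `|e d| <= 1 by case: (h d) => ->; rewrite ?normr0 ?normr1 ?normrN ?normr1.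
  have gz : 1 <= geo z d by case: (d) d0 => // k _; rewrite geoS lerDl mulr_ge0 ?(ltW z0)// sumr_ge0// => i _; rewrite exprn_ge0// ltW.
  have q0 : 0 <= z ^+ d / geo z d * z ^+ (d * (N %/ d)) by rewrite mulr_ge0 ?divr_ge0 ?exprn_ge0 ?(ltW z0) ?(ltW (g1 _ d0)).
  rewrite (ger0_norm q0); apply: le_trans (_ : z ^+ d / geo z d * z ^+ (d * (N %/ d)) <= _).
    by rewrite ler_piMl.
  rewrite mulrAC ler_pdivrMr ?g1// -exprD; apply: le_trans (_ : z ^+ N.+1 * 1 <= _); last first.
    by rewrite ler_wpM2l// exprn_ge0// ltW.
  rewrite mulr1; apply: ler_wiXn2l; rewrite ?(ltW z0) ?(ltW z1)//.
  by rewrite -mulnS mulnC ltn_ceil.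
have sq : 2 * m%:R <= \sum_(1 <= n < N.+1) rdiv e n * z ^+ n.
  have t0 n : (0 < n)%N -> 0 <= rdiv e n * z ^+ n by move=> n0; rewrite mulr_ge0 ?rdiv_ge0// exprn_ge0// ltW.
  apply: le_trans (_ : \sum_(1 <= k < K.+1) rdiv e (k ^ 2) * z ^+ (k ^ 2) <= _); last first.
    rewrite -(big_map (fun k => (k ^ 2)%N) xpredT (fun n => rdiv e n * z ^+ n)).
    rewrite [leRHS](bigID (fun n => n \in [seq (k ^ 2)%N | k <- index_iota 1 K.+1])) /=.
    have -> : \sum_(1 <= n < N.+1 | n \in [seq (k ^ 2)%N | k <- index_iota 1 K.+1]) rdiv e n * z ^+ n =
        \sum_(n <- [seq (k ^ 2)%N | k <- index_iota 1 K.+1]) rdiv e n * z ^+ n.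
      rewrite -big_filter; apply: perm_big; apply: uniq_perm.
      - by rewrite filter_uniq// iota_uniq.
      - by rewrite map_inj_uniq ?iota_uniq// => x y /eqP; rewrite eqn_exp2r// => /eqP.
      move=> n; rewrite mem_filter mem_index_iota; apply/idP/idP => [/andP[]//|h].
      rewrite h /=; case/mapP: h => k; rewrite mem_index_iota ltnS => /andP[k0 kK] ->.
      by rewrite expn_gt0 k0 ltnS (leq_trans _ NK)// leq_exp2r.
    rewrite lerDl big_seq_cond sumr_ge0// => n /andP[]; rewrite mem_index_iota => /andP[n0 _] _; exact: t0.
  have zK : 1 / 2 <= z ^+ (K ^ 2).
    have bern n : 1 - n%:R * eta <= z ^+ n.
      elim: n => [|n ih]; first by rewrite mul0r subr0 expr0.
      rewrite exprS -natr1 /z; have n0 : 0 <= n%:R * eta by rewrite mulr_ge0// ltW.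
      have := ler_wpM2l (ltW z0) ih; rewrite /z; have := mulr_ge0 n0 (ltW eta0); rlra.
    apply: le_trans (bern _); rewrite /eta /K natrX natrM exprMn.
    have -> : (4%:R ^+ 2 * m%:R ^+ 2) / (32 * m%:R ^+ 2) = 1 / 2 :> R by field; rewrite gt_eqF.
    rlra.
  apply: le_trans (_ : \sum_(1 <= k < K.+1) 1 / 2 <= _).
    rewrite sumr_const_nat subSS subn0 -[leRHS]mulr_natr /K natrM; rlra.
  apply: ler_sum_nat => k /andP[k0 kK]; apply: le_trans zK _.
  rewrite -[leLHS]mul1r ler_pM ?exprn_ge0 ?(ltW z0) ?rdiv_sqr//.
  by apply: ler_wiXn2l; rewrite ?(ltW z0) ?(ltW z1)// leq_exp2r.
have E : \sum_(1 <= d < N.+1) e d / d%:R = \sum_(1 <= d < N.+1) e d * lamb z d + \sum_(1 <= d < N.+1) e d * (z ^+ d / geo z d).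
  by rewrite -big_split /=; apply: eq_bigr => d _; rewrite /lamb; ring.
rewrite -/eta E; move: ab tail; rewrite l1 (_ : 1 - z = eta); last by rewrite /z; ring.
have := ler_wpM2l (ltW eta0) sq; have em := ler_wpM2l (ltW eta0) m1R.
have m2R : 2 <= m%:R :> R by rewrite (ler_nat _ 2).
have em2 := ler_wpM2l (ltW eta0) m2R.
move: (\sum_(_ <= _ < _) _) (\sum_(_ <= _ < _) _ * _) (\sum_(_ <= _ < _) _) => s1 s2 s3.
rewrite !ler_norml => h /andP[a1 a2] /andP[a3 a4]; rlra.
Qed.

End RealCharacters.

(** * Uniform bounds for primes congruent to 1 near s = 1 *)

Section APBounds.
Variable R : realType.
Implicit Types (d D : R).

(** With t = 1/(128 m^2) the partial sums at 1 are at least 4t. Moving to 1 + d costs 2t by the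
    hypothesis on d, and truncation costs t; so the value is at least t, and ln t >= - 4 lm. *)
Lemma real_lser_lower m (I : finType) (chi : I -> nat -> R[i]) (i0 : I) (S : {set I}) i d :
  dchar m chi i0 S -> (3 < m)%N -> i \in S -> i != i0 -> 0 < d ->
  d * (64 * m%:R ^+ 2 * lm R m ^+ 2) <= 1 ->
  - (4 * lm R m) <= ln (nc (lser (chi i) (1 + d))).
Proof.
move=> dc m3 iS ii0 d0 dm; pose e n := Re (chi i n).
have m0 : 0 < m%:R :> R by rewrite ltr0n (leq_trans _ m3).
have cases n : [\/ chi i n = 0, chi i n = 1 | chi i n = -1].
  have := dc_real dc n iS; case: coprime => /eqP; last first.
    by rewrite sqrf_eq0 => /eqP ->; constructor 1.
  by rewrite sqrf_eq1 => /orP[]/eqP ->; [constructor 2|constructor 3].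
have eE n : chi i n = (e n)%:C.
  by rewrite /e; case: (cases n) => -> //; apply/eqP; rewrite eq_complex /= ?oppr0 !eqxx.
have inj (x y : R) : x%:C = y%:C :> R[i] -> x = y by case.
have re : rchar e.
  split.
  - by apply: inj; rewrite -eE; have [-> _] := dc_cmul dc i.
  - move=> j k j0 k0; have [_ h] := dc_cmul dc i.
    by have := h j k j0 k0; rewrite !eE -rmorphM => /inj.
  - move=> n; case: (cases n) => h; [constructor 1|constructor 2|constructor 3]; apply: inj; rewrite -eE h //.
    by rewrite rmorphN.
have eS X Y : `|\sum_(X <= n < Y) e n| <= m%:R.
  have -> : `|\sum_(X <= n < Y) e n| = nc (\sum_(X <= n < Y) chi i n).
    by rewrite -nc_real rmorph_sum; congr nc; apply: eq_bigr => n _; rewrite eE.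
  exact: (dc_sum dc X Y ii0).
have [N1 h1] := real_char_lower re (dc_m dc) eS.
have s1 : 1 < 1 + d by rlra.
pose t : R := (128 * m%:R ^+ 2)^-1; have t0 : 0 < t by rewrite invr_gt0 mulr_gt0// exprn_gt0.
have [N2 h2] := lserP s1 (dc_le1 dc i) t0.
pose N := maxn N1 N2; have {}h1 := h1 N (leq_maxl _ _); have {}h2 := h2 N (leq_maxr _ _).
have h3 := lser_lip_fin (dc_le1 dc i) (fun X Y => dc_sum dc X Y ii0) N (lexx 0) (ltW d0) d0 m3.
have lm0 : 0 < lm R m by have := lm_ge2 R m; rlra.
have e32 : (32 * m%:R ^+ 2)^-1 = 4 * t by rewrite /t; field; rewrite gt_eqF.
have d2 : d * lm R m ^+ 2 <= 2 * t.
  have -> : 2 * t = (64 * m%:R ^+ 2)^-1 by rewrite /t; field; rewrite gt_eqF.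
  by rewrite -[leRHS]mul1r ler_pdivlMr ?mulr_gt0 ?exprn_gt0// mulrC mulrCA.
have lowL : t <= nc (lser (chi i) (1 + d)).
  have k1 : nc (\sum_(1 <= n < N.+1) lterm (chi i) (1 + d) n) - nc (lser (chi i) (1 + d)) <= t.
    by apply: le_trans (nc_triB _ _) _; rewrite nc_distrC.
  have k2 : 4 * t <= nc (\sum_(1 <= n < N.+1) chi i n * (npow 1 n)%:C).
    have -> : \sum_(1 <= n < N.+1) chi i n * (npow 1 n)%:C = (\sum_(1 <= n < N.+1) e n / n%:R)%:C.
      rewrite rmorph_sum; apply: eq_big_nat => n /andP[n0 _].
      by rewrite eE npow_1// -rmorphM.
    by rewrite nc_real -e32; apply: le_trans h1 _; exact: ler_norm.
  have k3 := nc_triB (\sum_(1 <= n < N.+1) chi i n * (npow 1 n)%:C) (\sum_(1 <= n < N.+1) lterm (chi i) (1 + d) n).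
  have k4 : nc (\sum_(1 <= n < N.+1) chi i n * (npow 1 n)%:C - \sum_(1 <= n < N.+1) lterm (chi i) (1 + d) n) <= 2 * t.
    apply: le_trans d2; apply: le_trans h3; rewrite -sumrB le_eqVlt; apply/orP; left; apply/eqP; congr nc.
    by apply: eq_bigr => n _; rewrite /lterm addr0 rmorphB mulrBr.
  move: k1 k2 k3 k4; move: (nc _) (nc _) (nc _) (nc _) => a b c f; rlra.
apply: le_trans (_ : ln t <= _); last by rewrite ler_ln ?posrE// (lt_le_trans t0).
have -> : ln t = - (7 * ln 2%:R + 2 * ln m%:R) :> R.
  have -> : t = (2%:R ^+ 7 * m%:R ^+ 2)^-1 by rewrite /t; congr (_ * _)^-1; rewrite -natrX.
  by rewrite lnV ?posrE ?mulr_gt0 ?exprn_gt0// lnM ?posrE ?exprn_gt0// !lnXn// !mulr_natl.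
have := ln_diff_le (@ltr01 R) (ltr0n R 2); rewrite ln1 subr0 divr1 (_ : 2%:R - 1 = 1 :> R); last rlra.
by have := ln_nat_ge0 R m; rewrite /lm; rlra.
Qed.

Lemma lm_npow (k : nat) (a : R) : 0 < a -> exists2 K : R, 0 <= K & forall m, lm R m ^+ k * npow a m <= K.
Proof.
move=> a0; exists (k`!%:R * a^-1 ^+ k * expR (2 * a)).
  by rewrite !mulr_ge0 ?exprn_ge0 ?invr_ge0 ?expR_ge0 ?(ltW a0).
move=> m; have l0 : 0 <= lm R m by have := lm_ge2 R m; lra.
apply: le_trans (ler_wpM2r (npow_ge0 _ _) (exp_pow_le k a0 l0)) _.
rewrite -[leLHS]mulrA ler_wpM2l ?mulr_ge0 ?exprn_ge0 ?invr_ge0 ?(ltW a0)//.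
by rewrite /npow -expRD /lm ler_expR; lra.
Qed.

Lemma apsum_mono m s x y : (x <= y)%N -> apsum m s x <= apsum m s y :> R.
Proof.
move=> xy; rewrite /apsum [leRHS](@big_cat_nat _ _ _ x.+1)//= lerDl.
by apply: sumr_ge0 => q _; exact: npow_ge0.
Qed.

(** The comparison point is 1 + D with D = m^(-1/2): small enough for D lm^9 to be O(m^(-1/4)),
    large enough for the trivial bound at 1 + D, about 1/(m D), to be so too. The threshold [C ^+ 2]
    for m makes D C <= 1. *)
Theorem ap_bounds : exists C M0 : R, 0 <= C /\
  forall m (I : finType) (chi : I -> nat -> R[i]) (i0 : I) (S : {set I}),
  dchar m chi i0 S -> (3 < m)%N -> (#|S| <= 4)%N -> (m <= 4 * #|I|)%N -> (size (primes m) <= 2)%N ->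
  M0 <= m%:R -> forall d, 0 < d -> d <= npow (1 / 2) m ->
  (forall x, apsum m (1 + d) x <= - ln d / #|I|%:R + C * npow (1 / 4) m) /\
  (d * (64 * m%:R ^+ 2 * lm R m ^+ 2) <= 1 -> exists x0 : nat, forall x, (x0 <= x)%N ->
     - ln d / #|I|%:R - C * npow (1 / 4) m <= apsum m (1 + d) x).
Proof.
have [c c0 hc] := nonreal_lower R; have [C C1 hC] := lnZ_bound R.
have q40 : 0 < 1 / 4 :> R by rlra.
have [K K0 hK] := lm_npow 9 q40.
pose A := 40 * C + 80 * K + 200 + K / c + 2 + 160 * K.
have A0 : 0 <= A by have := divr_ge0 K0 (ltW c0); rewrite /A; rlra.
exists A, (C ^+ 2); split=> // m I chi i0 S dc m3 S4 mI m2 mC d d0 dD.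
have C0 : 0 <= C by exact: le_trans ler01 C1.
set D := npow (1 / 2) m in dD; set q := npow (1 / 4) m.
have qD : D = q ^+ 2.
  have e : 1 / 2 = 1 / 4 + 1 / 4 :> R by rlra.
  by rewrite /D e npowD expr2.
have q1D : npow 1 m = D ^+ 2.
  have e : 1 = 1 / 2 + 1 / 2 :> R by rlra.
  by rewrite {1}e npowD expr2.
have m0 : (0 < m)%N by exact: leq_trans m3.
have D0 : 0 < D by exact: npow_gt0. have q0 : 0 < q by exact: npow_gt0.
have q1 : q <= 1 by apply: npow_le1; rlra.
have Dq : D <= q by rewrite qD expr2; nra.
have D2 : D <= 1 / 2.
  rewrite -(@ler_pXn2r _ 2)// ?nnegrE ?(ltW D0)//; last rlra.
  rewrite -q1D npow_1//; have -> : (1 / 2) ^+ 2 = 4^-1 :> R by field.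
  by rewrite lef_pV2 ?posrE ?ltr0n// (ler_nat _ 4).
have DC : D * C <= 1.
  have : (D * C) ^+ 2 <= 1.
    by rewrite exprMn -q1D npow_1// mulrC ler_pdivrMr ?ltr0n// mul1r.
  by move=> h; rewrite -(@ler_pXn2r _ 2)// ?nnegrE ?expr1n// mulr_ge0 ?(ltW D0).
have dC : d * C <= 1 by apply: le_trans DC; rewrite ler_wpM2r.
have [x1 hx1] := hC d d0 dC; have [x2 hx2] := hC D D0 DC.
have [y1 hy1] := boolp.choice (fun i => lser_lnE dc i d0 D0 D2).
have [y2 hy2] := boolp.choice (fun i => lser_lnE dc i D0 D0 D2).
pose x0 := maxn (maxn x1 x2) (maxn (\max_i y1 i) (\max_i y2 i)).
have core x : (x0 <= x)%N -> _ := fun h =>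
  @apsum_core R m I chi i0 S dc m3 S4 mI m2 C c d D 4 x C1 c0 d0 dD D2 (ler0n R 4)
   (hx1 x (leq_trans (leq_trans (leq_maxl _ _) (leq_maxl _ _)) h))
   (hx2 x (leq_trans (leq_trans (leq_maxr _ _) (leq_maxl _ _)) h))
   (fun i s => hc m I chi i0 S dc m3 i s)
   (fun i => hy1 i x (leq_trans (leq_bigmax (F := y1) i) (leq_trans (leq_trans (leq_maxl _ _) (leq_maxr _ _)) h)))
   (fun i => hy2 i x (leq_trans (leq_bigmax (F := y2) i) (leq_trans (leq_trans (leq_maxr _ _) (leq_maxr _ _)) h))).
have l2 := lm_ge2 R m; have l9 : lm R m <= lm R m ^+ 9.
  by rewrite -{1}[lm R m]expr1 ler_weXn2l//; rlra.
have hKq : lm R m ^+ 9 * q <= K := hK m.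
have lq : lm R m * q <= K by apply: le_trans hKq; rewrite ler_wpM2r// ltW.
have lnD : - ln D <= lm R m.
  by rewrite /D /npow expRK opprK /lm; have := ln_nat_ge0 R m; clear; lra.
have lnD0 : ln D <= 0 by apply: ln_le0; move: D2; clear; lra.
have n1q : npow 1 m <= q * q by rewrite q1D expr2 ler_pM ?(ltW D0).
have n10 := npow_ge0 (1 : R) m.
have b1 : npow 1 m * (40 * (C + lm R m - ln D)) <= q * (40 * C + 80 * K).
  apply: le_trans (ler_wpM2r _ n1q) _; first by move: C0 l2 lnD0; clear; lra.
  rewrite -mulrA; apply: ler_wpM2l; first exact: ltW.
  have : q * C <= C by rewrite ler_piMl.
  have : q * - ln D <= K by apply: le_trans lq; rewrite mulrC ler_wpM2r// ltW.
  by move: lq; clear; lra.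
have b2 : D * lm R m ^+ 9 / c <= q * (K / c).
  rewrite mulrA ler_wpM2r ?invr_ge0 ?(ltW c0)// qD expr2 -mulrA ler_wpM2l ?(ltW q0)//.
  by rewrite mulrC.
have b3 x : apsum m (1 + D) x <= q * 2.
  apply: le_trans (apsum_triv dc x D0) _; rewrite q1D mulrDr mulr1 expr2 -mulrA mulfV ?gt_eqF// mulr1.
  have : D * D <= D by rewrite ler_piMl ?(ltW D0)//; move: D2; clear; lra.
  by move: Dq; clear; lra.
have b4 : npow 1 m * (40 * (4 * lm R m)) <= q * (160 * K).
  apply: le_trans (ler_wpM2r _ n1q) _; first by move: l2; clear; lra.
  by rewrite -mulrA; apply: ler_wpM2l; [exact: ltW|move: lq; clear; lra].
split.
  move=> x; pose y := maxn x x0; apply: le_trans (apsum_mono m _ (leq_maxl x x0)) _.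
  have [h _] := core y (leq_maxr _ _); apply: le_trans h _; rewrite lerD2l /A.
  have := b3 y; move: b1 b2 Dq A0 q0 K0; move: (npow 1 m * _) (D * _ / c) (apsum _ _ _) (K / c); clear => v1 v2 v3 v4; nra.
move=> dm; exists x0 => x xx0; have [_ h] := core x xx0.
apply: le_trans (h _); last by move=> i iS ii0; exact: real_lser_lower dc m3 iS ii0 d0 dm.
rewrite lerD2l lerN2 /A; have := b3 x; move: b1 b2 b4 Dq A0 q0 K0.
move: (npow 1 m * (40 * (4 * _))) (npow 1 m * _) (D * _ / c) (apsum _ _ _) (K / c); clear => v5 v1 v2 v3 v4; nra.
Qed.

Lemma npow_half_ge m d : (0 < m)%N -> 0 < d -> d * (64 * m%:R ^+ 2 * lm R m ^+ 2) <= 1 -> d <= npow (1 / 2) m.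
Proof.
move=> m0 d0 dp; have p1 : 1 <= m%:R :> R by rewrite ler1n.
have l1 : 1 <= lm R m by have := lm_ge2 R m; lra.
apply: le_trans (_ : npow 1 m <= _); last by apply: npow_le; lra.
rewrite npow_1// -[leRHS]mul1r ler_pdivlMr ?ltr0n//.
apply: le_trans dp; rewrite ler_wpM2l ?(ltW d0)//.
have l2 : 1 <= lm R m ^+ 2 by rewrite exprn_ege1.
have : m%:R <= m%:R ^+ 2 :> R by rewrite expr2 ler_peMr.
have : m%:R ^+ 2 <= m%:R ^+ 2 * lm R m ^+ 2 by rewrite ler_peMr ?exprn_ge0.
by rewrite -mulrA; have := sqr_ge0 (m%:R : R); lra.
Qed.

Theorem ap_prime : exists C M0 : R, 0 <= C /\ forall p : nat, prime p -> (3 < p)%N -> M0 <= p%:R ->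
  forall d, 0 < d -> d <= npow (1 / 2) p ->
  (forall x, apsum p (1 + d) x <= - ln d / p.-1%:R + C * npow (1 / 4) p) /\
  (d * (64 * p%:R ^+ 2 * lm R p ^+ 2) <= 1 -> exists x0 : nat, forall x, (x0 <= x)%N ->
     - ln d / p.-1%:R - C * npow (1 / 4) p <= apsum p (1 + d) x).
Proof.
have [C [M0 [C0 h]]] := ap_bounds; exists C, M0; split => // p pp p3 pM d d0 dD.
have [chi [i0 [S [dc S2]]]] := @dchar_prime R p pp (ltnW p3).
have S4 : (#|S| <= 4)%N by apply: leq_trans S2 _.
have [||h1 h2] := h p _ chi i0 S dc p3 S4 _ _ pM d d0 dD.
- by rewrite card_ord; case: (p) p3 => // k k3 /=; lia.
- by rewrite primes_prime.
by rewrite card_ord in h1 h2; split.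
Qed.

Theorem ap_prime2 : exists C M0 : R, 0 <= C /\ forall p p' : nat, prime p -> prime p' -> (2 < p)%N -> (2 < p')%N ->
  p != p' -> M0 <= (p * p')%:R -> forall d, 0 < d -> d <= npow (1 / 2) (p * p') ->
  (forall x, apsum (p * p') (1 + d) x <= - ln d / (p.-1 * p'.-1)%:R + C * npow (1 / 4) (p * p')) /\
  (d * (64 * (p * p')%:R ^+ 2 * lm R (p * p') ^+ 2) <= 1 -> exists x0 : nat, forall x, (x0 <= x)%N ->
     - ln d / (p.-1 * p'.-1)%:R - C * npow (1 / 4) (p * p') <= apsum (p * p') (1 + d) x).
Proof.
have [C [M0 [C0 h]]] := ap_bounds; exists C, M0; split => // p p' pp pp' p2 p2' npp pM d d0 dD.
have [chi [i0 [S [dc S2]]]] := @dchar_prime R p pp p2.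
have [chi' [i0' [S' [dc' S2']]]] := @dchar_prime R p' pp' p2'.
have cop : coprime p p' by rewrite prime_coprime// dvdn_prime2.
have := h _ _ _ _ _ (dchar_mul cop dc dc') _ _ _ _ pM d d0 dD.
rewrite card_prod !card_ord => h1; apply: h1.
- by apply: leq_trans (leq_mul p2 p2').
- by rewrite cardsX (leq_trans (leq_mul S2 S2')).
- by case: (p) (p') p2 p2' => // k [|k'] //=; nia.
apply: (@uniq_leq_size _ _ [:: p; p']); first exact: primes_uniq.
by move=> q; rewrite primesM ?prime_gt0// !primes_prime// !inE.
Qed.

Lemma pred_range r m : (1 < r -> r <= m -> 0 < r.-1 <= m)%N.
Proof. by case: r => [|[|r]]// _ h; rewrite /= (leq_trans _ h). Qed.

Lemma pred_mul_range p r m : (1 < p -> 1 < r -> p * r <= m -> 0 < p.-1 * r.-1 <= m)%N.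
Proof.
case: p r => [|[|p]]// [|[|r]]// _ _ h; rewrite /= (leq_trans _ h)//.
by apply: leq_mul; exact: leqnSn.
Qed.

Lemma apsum_sub m m' s x : (forall q, prime q -> q = 1 %[mod m] -> q = 1 %[mod m'])%N ->
  apsum m s x <= apsum m' s x :> R.
Proof.
move=> h; rewrite /apsum big_mkcond [leRHS]big_mkcond; apply: ler_sum => q _.
case: ifP => [/andP[pq /eqP/(h q pq) /eqP ->]|_]; first by rewrite pq.
by case: ifP => // _; exact: npow_ge0.
Qed.

(* A residue class modulo a small prime [p] contains a class modulo [p * r] (or [r] when [p = 2])
   with [r] large enough for the previous bounds. *)
Theorem ap_small (P0 : nat) : exists c C d1 : R, [/\ 0 < c, 0 <= C & 0 < d1 /\
  forall p : nat, prime p -> (p <= P0)%N -> forall d, 0 < d -> d <= d1 ->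
  exists x0 : nat, forall x, (x0 <= x)%N -> c * - ln d - C <= apsum p (1 + d) x].
Proof.
have [C [M0 [C0 h1]]] := ap_prime; have [C' [M0' [C0' h2]]] := ap_prime2.
have [r rM pr] := prime_above (maxn (maxn P0 3) (maxn (Num.truncn `|M0|) (Num.truncn `|M0'|))).
move: rM; rewrite !gtn_max => /andP[/andP[rP r3] /andP[rM rM']].
have rr : 0 < r%:R :> R by rewrite ltr0n prime_gt0.
have hM : M0 <= r%:R.
  by apply: le_trans (ler_norm _) _; apply/ltW; apply: lt_le_trans (truncnS_gt _) _; rewrite ler_nat.
have hM' : M0' <= r%:R.
  by apply: le_trans (ler_norm _) _; apply/ltW; apply: lt_le_trans (truncnS_gt _) _; rewrite ler_nat.
pose m := (P0.+1 * r)%N; have m0 : (0 < m)%N by rewrite muln_gt0 (prime_gt0 pr).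
have B0 (k : nat) : (0 < k)%N -> 0 < 64 * k%:R ^+ 2 * lm R k ^+ 2.
  by move=> k0; rewrite !mulr_gt0 ?exprn_gt0 ?ltr0n//; have := lm_ge2 R k; rlra.
pose d1 := (64 * m%:R ^+ 2 * lm R m ^+ 2)^-1; have d10 : 0 < d1 by rewrite invr_gt0 B0.
have hd k d : (0 < k <= m)%N -> 0 < d -> d <= d1 -> d * (64 * k%:R ^+ 2 * lm R k ^+ 2) <= 1.
  move=> /andP[k0 km] d0 dd; rewrite -ler_pdivlMr ?B0// mul1r; apply: le_trans dd _.
  rewrite lef_pV2 ?posrE ?B0//; have kR : k%:R <= m%:R :> R by rewrite ler_nat.
  have lk : lm R k <= lm R m by rewrite /lm lerD2l ler_ln ?posrE ?ltr0n.
  have l2 := lm_ge2 R k.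
  by apply: ler_pM; rewrite ?mulr_ge0 ?exprn_ge0 ?lerXn2r ?nnegrE ?ler_wpM2l ?lerXn2r ?nnegrE ?ler0n//; rlra.
exists m%:R^-1, (C + C'), d1; split; [by rewrite invr_gt0 ltr0n| by rewrite addr_ge0|split=> //].
move=> p pp pP d d0 dd; have d11 : d <= 1.
  apply: le_trans dd _; rewrite /d1 invf_le1 ?B0//; have := lm_ge2 R m.
  have : 1 <= m%:R :> R by rewrite ler1n.
  move: (lm R m) (m%:R : R) => a b b1 a2; have : 1 <= b ^+ 2 by rewrite exprn_ege1.
  have : 1 <= a ^+ 2 by rewrite exprn_ege1//; rlra.
  by move: (a ^+ 2) (b ^+ 2) => a' b'; nra.
have lnd : 0 <= - ln d by rewrite oppr_ge0 ln_le0.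
have le1 (k : nat) : npow (1 / 4) k <= 1 :> R by apply: npow_le1; rlra.
have fin (k : nat) (D : R) : (0 < k <= m)%N -> 0 <= D -> D <= C + C' -> m%:R^-1 * - ln d - (C + C') <= - ln d / k%:R - D.
  move=> /andP[k0 km] D0 DC; apply: lerD; last by rewrite lerN2.
  by rewrite mulrC ler_wpM2l// lef_pV2 ?posrE ?ltr0n// ler_nat.
case: (ltnP 2 p) => [p2|p2].
- have npr : p != r by rewrite neq_ltn (leq_ltn_trans pP).
  have prm : (0 < p * r <= m)%N by rewrite muln_gt0 !prime_gt0//= leq_mul2r (leq_trans pP)// orbT.
  have hm := hd _ d prm d0 dd.
  have [||_ /(_ hm)[x0 hx]] := h2 p r pp pr p2 (ltnW r3) npr _ d d0.
  + by apply: le_trans hM' _; rewrite ler_nat leq_pmull// prime_gt0.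
  + by apply: npow_half_ge => //; rewrite muln_gt0 !prime_gt0.
  exists x0 => x xx; apply: le_trans (apsum_sub _ _ (_ : forall q, prime q -> q = 1 %[mod p * r] -> q = 1 %[mod p])%N).
    apply: le_trans (hx x xx); apply: fin.
    - by have /andP[_ h] := prm; exact: pred_mul_range (prime_gt1 pp) (prime_gt1 pr) h.
    - by rewrite mulr_ge0 ?npow_ge0.
    have := ler_wpM2l C0' (le1 (p * r)%N); rlra.
  by move=> q _ /(congr1 (modn^~ p)); rewrite !modn_dvdm ?dvdn_mulr.
have p2E : p = 2 by apply/eqP; rewrite eqn_leq p2 prime_gt1.
have rm : (0 < r <= m)%N by rewrite prime_gt0//= leq_pmull.
have hm := hd _ d rm d0 dd.
have [|_ /(_ hm)[x0 hx]] := h1 r pr r3 hM d d0; first by apply: npow_half_ge => //; rewrite prime_gt0.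
exists x0 => x xx; apply: le_trans (apsum_sub _ _ (_ : forall q, prime q -> q = 1 %[mod r] -> q = 1 %[mod p])%N).
  apply: le_trans (hx x xx); apply: fin.
  - by have /andP[_ h] := rm; exact: pred_range (prime_gt1 pr) h.
  - by rewrite mulr_ge0 ?npow_ge0.
  have := ler_wpM2l C0 (le1 r); rlra.
move=> q pq qr; rewrite p2E; case: (even_prime pq) => [q2|oq]; last by rewrite !modn2 oq.
by move: qr; rewrite q2 (modn_small (ltnW r3)) (modn_small (ltnW (ltnW r3))).
Qed.
End APBounds.

(** * An inclusion-exclusion sieve with conditional constraints *)

Section Sieve.
Variable R : realType.
Implicit Types (S I : seq nat) (X n r : nat).

Definition sifted S n := all (fun s => ~~ (s %| n)%N) S.
Definition Phi X S := count (sifted S) (iota 1 X).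
Definition Vol S : R := \prod_(s <- S) (1 - s%:R^-1).
Definition rsum S : R := \sum_(s <- S) s%:R^-1.

Lemma count_split (T : Type) (P a : pred T) (s : seq T) :
  count P s = (count (fun x => P x && a x) s + count (fun x => P x && ~~ a x) s)%N.
Proof. by elim: s => //= x s ->; case: (P x); case: (a x) => /=; lia. Qed.

Lemma count_mul (P : pred nat) s X : (0 < s)%N ->
  count (fun n => (s %| n)%N && P n) (iota 1 X) = count (fun m => P (s * m)%N) (iota 1 (X %/ s)).
Proof.
move=> s0; elim: X => [|X ih]; first by rewrite div0n.
rewrite divnS// [in RHS]addnC -[X.+1 in LHS]addn1 iotaD count_cat ih add1n /= addn0.
have := @divnK s X.+1; rewrite divnS//; case: (s %| X.+1)%N => [/(_ isT) e|_] /=; last by rewrite !addn0.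
rewrite iotaD count_cat /= addn0 add1n; congr (_ + nat_of_bool (P _))%N.
by rewrite -[LHS]e mulnC.
Qed.

Lemma sifted_mul s S m : prime s -> all prime S -> s \notin S -> sifted S (s * m) = sifted S m.
Proof.
move=> ps pS sS; apply: eq_in_all => t tS; congr negb.
have pt := allP pS t tS; rewrite Euclid_dvdM// dvdn_prime2//.
by rewrite (_ : (t == s) = false)//; apply: contraNF sS => /eqP <-.
Qed.

Lemma Phi_cons X s S : prime s -> all prime S -> s \notin S ->
  (Phi X (s :: S) + Phi (X %/ s) S)%N = Phi X S.
Proof.
move=> ps pS sS; rewrite /Phi.
under [X in (_ + X)%N]eq_count do rewrite -(sifted_mul _ ps pS sS).
rewrite -(count_mul (sifted S))//; last exact: prime_gt0.
rewrite [RHS](count_split _ (fun n => s %| n)%N) addnC.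
by congr addn; apply: eq_count => n /=; rewrite andbC.
Qed.

Lemma inv_prime_bounds s : prime s -> 0 < s%:R^-1 :> R /\ s%:R^-1 <= 1 / 2 :> R.
Proof.
move=> ps; have s0 : 0 < s%:R :> R by rewrite ltr0n prime_gt0.
by split; [rewrite invr_gt0|rewrite mul1r lef_pV2 ?posrE// (ler_nat _ 2) prime_gt1].
Qed.

Lemma Vol_cons s S : Vol (s :: S) = (1 - s%:R^-1) * Vol S.
Proof. by rewrite /Vol big_cons. Qed.

Lemma Vol01 S : all prime S -> 0 <= Vol S <= 1.
Proof.
elim: S => [|s S ih] /=; first by rewrite /Vol big_nil ler01 lexx.
move=> /andP[ps /ih /andP[v0 v1]]; have [a0 a1] := inv_prime_bounds ps.
by rewrite Vol_cons; apply/andP; split; nra.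
Qed.

Lemma rsum_ge0 S : 0 <= rsum S.
Proof. by apply: sumr_ge0 => s _; rewrite invr_ge0. Qed.

Lemma pow_add_ge (h a : R) r : 0 <= h -> 0 <= a -> h ^+ r.+1 + r.+1%:R * a * h ^+ r <= (h + a) ^+ r.+1.
Proof.
move=> h0 a0; elim: r => [|r ih]; first by rewrite !expr1 expr0 mulr1 mul1r.
rewrite [in leRHS]exprS; apply: le_trans (ler_wpM2l (addr_ge0 h0 a0) ih).
rewrite [in leRHS]mulrDl mulrDr [h * h ^+ _]mulrC -exprSr.
have -> : h * (r.+1%:R * a * h ^+ r) = r.+1%:R * a * h ^+ r.+1 by rewrite exprS mulrCA mulrA.
have -> : r.+2%:R = r.+1%:R + 1 :> R by rewrite -natr1.
have : 0 <= a * (r.+1%:R * a * h ^+ r) by rewrite !mulr_ge0 ?exprn_ge0.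
rewrite (mulrDr a); move: (a * (_ * _ * _)) => c; have : 0 <= h ^+ r.+1 by rewrite exprn_ge0.
move: (h ^+ r.+1) (h ^+ r.+2) (r.+1%:R : R) => u v k; lra.
Qed.

Lemma divn_real X s : (0 < s)%N -> (X %/ s)%:R <= X%:R * s%:R^-1 :> R /\ X%:R * s%:R^-1 <= (X %/ s)%:R + 1 :> R.
Proof.
move=> s0; split; first by rewrite ler_pdivlMr ?ltr0n// -natrM ler_nat leq_trunc_div.
by rewrite ler_pdivrMr ?ltr0n// natr1 -natrM ler_nat ltnW// ltn_ceil.
Qed.

(** Brun's pure sieve by induction on the list: Phi X (s :: S) = Phi X S - Phi (X/s) S, with depth r
    + 1 for the first term and r for the second, and the trivial bound at depth 0. The term H^r / r!
    propagates by two terms of the binomial formula, and the power of 3 + 2 |S| collects the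
    rounding errors. *)
Lemma sieve_err r S X : uniq S -> all prime S ->
  `|(Phi X S)%:R - X%:R * Vol S| <= X%:R * (rsum S ^+ r / r`!%:R) + (3 + 2 * (size S)%:R) ^+ r.
Proof.
have triv T k : all prime T -> `|(Phi k T)%:R - k%:R * Vol T| <= k%:R.
  move=> pT; have /andP[v0 v1] := Vol01 pT.
  have : (Phi k T)%:R <= k%:R :> R by rewrite ler_nat -{2}(size_iota 1 k) count_size.
  have k0 : 0 <= k%:R :> R by [].
  rewrite ler_norml; have : 0 <= (Phi k T)%:R :> R by [].
  by move: (Phi k T)%:R => f; move=> *; apply/andP; split; nra.
elim: S r X => [|s S ih] r X; case: r => [|r].
- by move=> _ _; rewrite !expr0 divr1 mulr1 ler_wpDr// triv.
- move=> _ _; rewrite /Vol big_nil mulr1 /Phi (eq_count (a2 := predT))// count_predT size_iota subrr normr0.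
  by rewrite addr_ge0 ?exprn_ge0 ?mulr_ge0 ?invr_ge0 ?exprn_ge0 ?rsum_ge0//= mulr0 addr0.
- by move=> _ pS; rewrite !expr0 divr1 mulr1 ler_wpDr// triv.
move=> /= /andP[sS uS] /andP[ps pS].
have [a0 a1] := inv_prime_bounds ps; have [f1 f2] := divn_real X (prime_gt0 ps).
have h1 := ih r.+1 X uS pS; have h2 := ih r (X %/ s)%N uS pS.
have h0 := rsum_ge0 S; have /andP[v0 v1] := Vol01 pS.
have e : (Phi X (s :: S))%:R = (Phi X S)%:R - (Phi (X %/ s) S)%:R :> R.
  by rewrite -(Phi_cons X ps pS sS) natrD addrK.
have r0 : 0 < r`!%:R :> R by rewrite ltr0n fact_gt0.
have hH : rsum S ^+ r.+1 / r.+1`!%:R + s%:R^-1 * (rsum S ^+ r / r`!%:R) <= rsum (s :: S) ^+ r.+1 / r.+1`!%:R.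
  rewrite [in leRHS]/rsum big_cons -/(rsum S) [in leRHS]addrC.
  apply: le_trans (ler_wpM2r _ (pow_add_ge r h0 (ltW a0))); last by rewrite invr_ge0.
  rewrite mulrDl lerD2l factS natrM invfM.
  have r1 : 0 < r.+1%:R :> R by [].
  by move: r1 r0; move: (r.+1%:R : R) (r`!%:R : R) (rsum S ^+ r) (s%:R^-1) => x y z t x0 y0; rewrite le_eqVlt; apply/orP; left; apply/eqP; field; rewrite !gt_eqF.
have hB : (3 + 2 * (size S)%:R) ^+ r.+1 + (3 + 2 * (size S)%:R) ^+ r + 1 <= (3 + 2 * (size S).+1%:R) ^+ r.+1 :> R.
  have -> : 3 + 2 * (size S).+1%:R = 3 + 2 * (size S)%:R + 2 :> R by rewrite -natr1; ring.
  have b3 : 3 <= 3 + 2 * (size S)%:R :> R by rewrite lerDl mulr_ge0.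
  move: (3 + _) b3; clear => b b3; have b1 : 1 <= b ^+ r by rewrite exprn_ege1//; lra.
  have : b ^+ r <= (b + 2) ^+ r by rewrite lerXn2r ?nnegrE; lra.
  by rewrite !exprS; move: (b ^+ r) ((b + 2) ^+ r) b1 => u v; nra.
rewrite e Vol_cons; move: h1 h2 hH hB f1 f2; rewrite !ler_norml.
have X0 : 0 <= X%:R :> R by [].
have k0 : 0 <= (X %/ s)%:R :> R by [].
have g0 : 0 <= rsum S ^+ r / r`!%:R by rewrite divr_ge0// exprn_ge0.
move: X0 k0 g0 v0 v1 a0; move: (rsum S ^+ r / _) (rsum S ^+ r.+1 / _) (rsum (s :: S) ^+ r.+1 / _).
move: ((3 + 2 * (size S)%:R) ^+ r.+1 : R) ((3 + 2 * (size S)%:R) ^+ r : R) ((3 + 2 * (size S).+1%:R) ^+ r.+1 : R).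
move: (X%:R : R) ((X %/ s)%:R : R) (s%:R^-1 : R) (Vol S) ((Phi X S)%:R : R) ((Phi (X %/ s) S)%:R : R).
move=> x k a v F1 F2 B1 B0 B2 G G1 G2 x0 k0 g0 v0 v1 a0 /andP[p1 p2] /andP[p3 p4] hH hB f1 f2.
have w1 : 0 <= (x * a - k) * v by rewrite mulr_ge0// subr_ge0.
have w2 : (x * a - k) * v <= 1 by nra.
have w3 : k * G <= x * (a * G) by rewrite mulrA ler_wpM2r.
have w4 : x * (G1 + a * G) <= x * G2 by rewrite ler_wpM2l.
by apply/andP; split; lra.
Qed.

Variable Q : nat -> seq nat.

Definition blocked p n := (p %| n)%N && has (fun q => q %| n)%N (Q p).
Definition NPhi X I S := count (fun n => sifted S n && all (fun p => ~~ blocked p n) I) (iota 1 X).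
(** Repetitions are removed because [Vol] is a product over the list. *)
Definition addQ p S := [seq q <- Q p | q \notin S] ++ S.
(** The density obtained by branching on each p: either p does not divide n and joins the sifting
    set, or it does, with weight 1/p, and then [Q p] joins it. *)
Fixpoint Mod I S : R := if I is p :: I' then Mod I' (p :: S) + p%:R^-1 * Mod I' (addQ p S) else Vol S.

Variables z w : nat.
Definition disj I S := all (fun p => p \notin S) I.
Definition goodI I := uniq I && all (fun p => prime p && (p <= z)%N) I.
Definition goodS S := uniq S && all (fun p => prime p && (p <= w)%N) S.
Hypothesis zw : (z <= w)%N.
Hypothesis Qgood : forall p, goodS (Q p).
Hypothesis Qz : forall p q, q \in Q p -> (z < q)%N.

Lemma goodS_prime S : goodS S -> uniq S /\ all prime S.
Proof. by case/andP => u a; split=> //; apply: sub_all a => x /andP[]. Qed.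

Lemma goodS_cons p I S : goodI (p :: I) -> goodS S -> disj (p :: I) S ->
  [/\ goodI I, goodS (p :: S) & disj I (p :: S)].
Proof.
move=> /andP[/= /andP[pI uI] /andP[/andP[pp pz] aI]] /andP[uS aS] /andP[/= pS aIS].
split; first by rewrite /goodI uI.
  by rewrite /goodS /= pS uS pp (leq_trans pz zw).
apply/allP => x xI; rewrite inE negb_or (allP aIS x xI) andbT.
by apply: contraNneq pI => <-.
Qed.

Lemma goodS_addQ p I S : goodI (p :: I) -> goodS S -> disj (p :: I) S ->
  goodS (addQ p S) /\ disj I (addQ p S).
Proof.
move=> /andP[/= /andP[pI uI] /andP[/andP[pp pz] aI]] /andP[uS aS] /andP[/= pS aIS].
have /andP[uQ aQ] := Qgood p; split.
  apply/andP; split; last first.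
    by rewrite all_cat aS andbT all_filter; apply: sub_all aQ => x /= ->; rewrite implybT.
  rewrite cat_uniq uS filter_uniq//= andbT; apply/hasPn => x xS.
  by rewrite /= mem_filter xS.
apply/allP => x xI; rewrite mem_cat negb_or (allP aIS x xI) andbT mem_filter negb_and.
apply/orP; right; apply/negP => /Qz; have /andP[_ xz] := allP aI x xI.
by rewrite ltnNge xz.
Qed.

(** When p divides n, write n = p m. Every element of a [Q p'] exceeds z, hence p, so the other
    conditions do not see the factor p. *)
Lemma NPhi_cons X p I S : goodI (p :: I) -> goodS S -> disj (p :: I) S ->
  NPhi X (p :: I) S = (NPhi X I (p :: S) + NPhi (X %/ p) I (addQ p S))%N.
Proof.
move=> gI gS IS; have [uS pS] := goodS_prime gS.
have /andP[/= /andP[pI uI] /andP[/andP[pp pz] aI]] := gI; have /andP[/= pnS _] := IS.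
have [uQ pQ] := goodS_prime (Qgood p).
have notQ x p' : (x <= z)%N -> x \notin Q p'.
  by move=> xz; apply/negP => /Qz; rewrite ltnNge xz.
rewrite /NPhi (count_split _ (fun n => ~~ (p %| n)%N)); congr addn.
  apply: eq_count => n /=; rewrite /blocked; case: (p %| n)%N => /=; first by rewrite andbF.
  by rewrite andbT.
rewrite -(eq_count (a1 := fun n => (p %| n)%N && (sifted S n && all (fun p' => ~~ blocked p' n) (p :: I)))); last first.
  by move=> n /=; rewrite negbK andbC.
rewrite count_mul ?prime_gt0//; apply: eq_count => m /=.
rewrite sifted_mul// /blocked dvdn_mulr//= -all_predC.
have -> : all (predC (dvdn^~ (p * m)%N)) (Q p) = sifted (Q p) m by apply: sifted_mul => //; exact: notQ.
have -> : sifted (addQ p S) m = sifted S m && sifted (Q p) m.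
  rewrite /addQ /sifted all_cat andbC; case: (boolP (all _ S)) => //= aS.
  rewrite all_filter; apply: eq_in_all => q _ /=; case: (boolP (q \in S)) => //= qS.
  by rewrite (allP aS q qS).
rewrite -andbA; congr (_ && (_ && _)); apply: eq_in_all => p' p'I; congr (~~ _).
have /andP[pp' pz'] := allP aI p' p'I.
rewrite Euclid_dvdM// dvdn_prime2// (_ : (p' == p) = false) /=; last by apply: contraNF pI => /eqP <-.
congr (_ && _); apply: eq_in_has => q qQ; have [uQ' /allP/(_ q qQ) pq] := goodS_prime (Qgood p').
rewrite Euclid_dvdM// dvdn_prime2// (_ : (q == p) = false)//; apply: contraNF (notQ p p' pz) => /eqP <-.
by [].
Qed.

Lemma Vol_addQ p S : Vol (addQ p S) = Vol [seq q <- Q p | q \notin S] * Vol S.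
Proof. by rewrite /Vol /addQ big_cat. Qed.

Lemma prime_Qf p (a : pred nat) : all prime [seq x <- Q p | a x].
Proof.
have [_ pQ] := goodS_prime (Qgood p).
by rewrite all_filter; apply: sub_all pQ => x /= ->; rewrite implybT.
Qed.

Lemma Mod01 I S : goodI I -> goodS S -> disj I S -> 0 <= Mod I S <= Vol S.
Proof.
elim: I S => [|p I ih] S gI gS IS /=.
  by have /andP[v0 _] := Vol01 (goodS_prime gS).2; rewrite v0 lexx.
have [gI' gS1 IS1] := goodS_cons gI gS IS; have [gS2 IS2] := goodS_addQ gI gS IS.
have /andP[m0 m1] := ih _ gI' gS1 IS1; have /andP[m2 m3] := ih _ gI' gS2 IS2.
have [a0 _] : 0 < p%:R^-1 :> R /\ p%:R^-1 <= 1 / 2 :> R.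
  by apply: inv_prime_bounds; have /andP[_ /= /andP[/andP[]]] := gI.
move: m0 m1 m2 m3; rewrite Vol_cons Vol_addQ.
have /andP[v0 _] := Vol01 (goodS_prime gS).2; have /andP[u0 u1] := Vol01 (prime_Qf p (fun q => q \notin S)).
move: (Mod _ _) (Mod _ _) (Vol _) (Vol _) v0 u0 u1 (p%:R^-1 : R) a0 => m m' u v v0 u0 u1 a a0 m0 m1 m2 m3.
have : u * v <= v by rewrite ler_piMl.
by move=> h; apply/andP; split; nra.
Qed.

(** The branching has 2^|I| leaves, each a plain sieve problem. Each branching also rounds X/p once,
    at cost at most 1; the + 1 and - 1 in the bound let this pass through the induction. *)
Lemma NPhi_err (e k : R) I S X : 0 <= e ->
  (forall T Y, goodS T -> `|(Phi Y T)%:R - Y%:R * Vol T| <= Y%:R * e + k) ->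
  goodI I -> goodS S -> disj I S ->
  `|(NPhi X I S)%:R - X%:R * Mod I S| <= 2 ^+ size I * (X%:R * e + k + 1) - 1.
Proof.
move=> e0 h; elim: I S X => [|p I ih] S X gI gS IS.
  rewrite /= expr0 mul1r addrK; apply: le_trans (h S X gS).
  by rewrite /NPhi /Phi (eq_count (a2 := sifted S))// => n; rewrite /= andbT.
have [gI' gS1 IS1] := goodS_cons gI gS IS; have [gS2 IS2] := goodS_addQ gI gS IS.
have h1 := ih _ X gI' gS1 IS1; have h2 := ih _ (X %/ p)%N gI' gS2 IS2.
have pp : prime p by have /andP[_ /= /andP[/andP[]]] := gI.
have [f1 f2] := divn_real X (prime_gt0 pp).
have /andP[m0 m1] := Mod01 gI' gS2 IS2; have /andP[_ v1] := Vol01 (goodS_prime gS2).2.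
have le : (X %/ p)%:R <= X%:R :> R by rewrite ler_nat leq_div.
rewrite NPhi_cons// natrD /= exprS; move: h1 h2; rewrite !ler_norml.
have B0 : 0 <= 2 ^+ size I :> R by rewrite exprn_ge0.
have : 2 ^+ size I * ((X %/ p)%:R * e + k + 1) <= 2 ^+ size I * (X%:R * e + k + 1).
  by rewrite ler_wpM2l// !lerD2r ler_wpM2r.
move: f1 f2 m0 {m1} (le_trans m1 v1).
move: (2 ^+ size I * ((X %/ p)%:R * e + k + 1)) (Mod I (p :: S)) (Mod I (addQ p S)) ((X %/ p)%:R : R) (p%:R^-1 : R) ((NPhi X I (p :: S))%:R : R) ((NPhi (X %/ p) I (addQ p S))%:R : R).
rewrite -[2 * _ * _]mulrA; move: (2 ^+ size I * (X%:R * e + k + 1)) (X%:R : R).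
move=> B x B' m m' y a n n' f1 f2 m0 m1 BB /andP[p1 p2] /andP[p3 p4].
have w1 : 0 <= (x * a - y) * m' by rewrite mulr_ge0// subr_ge0.
have w2 : (x * a - y) * m' <= 1 by nra.
by apply/andP; split; lra.
Qed.

Variables (theta : nat -> R) (tau om : R).
Definition Piprod I : R := \prod_(p <- I) (1 - (1 - theta p) / p%:R).
(** The primes of [Q p] that are already sifted when p is reached: they measure the failure of
    independence. *)
Definition osum p S : R := \sum_(q <- Q p | q \in S) q%:R^-1.
Hypothesis theta01 : forall p, 0 <= theta p <= 1.
Hypothesis tau0 : 0 <= tau.
Hypothesis om0 : 0 <= om.

Lemma Vol_weier S : all prime S -> 1 - rsum S <= Vol S.
Proof.
elim: S => [|s S ih] /=; first by rewrite /Vol /rsum !big_nil subr0.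
move=> /andP[ps pS]; have /andP[v0 v1] := Vol01 pS; have [a0 a1] := inv_prime_bounds ps.
rewrite Vol_cons /rsum big_cons -/(rsum S); have := ih pS; have := rsum_ge0 S.
by move: (rsum S) (Vol S) v0 v1 (s%:R^-1 : R) a0 a1 => h v v0 v1 a a0 a1; nra.
Qed.

Lemma Vol_filter p S : goodS S ->
  `|Vol [seq q <- Q p | q \notin S] - Vol (Q p)| <= osum p S.
Proof.
move=> gS; have e : Vol (Q p) = Vol [seq q <- Q p | q \in S] * Vol [seq q <- Q p | q \notin S].
  by rewrite /Vol (bigID (mem S)) /= !big_filter.
have pf := prime_Qf p; have /andP[v0 v1] := Vol01 (pf (mem S)).
have /andP[u0 u1] := Vol01 (pf (fun q => q \notin S)).
have := Vol_weier (pf (mem S)); rewrite e /rsum big_filter -/(osum p S).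
move: (osum p S) (Vol [seq q <- Q p | q \notin S]) u0 u1 v0 v1; move: (Vol _) => v o u u0 u1 v0 v1 h.
by rewrite ger0_norm; nra.
Qed.

Lemma osum_cons x p S : (x <= z)%N -> osum p (x :: S) = osum p S.
Proof.
move=> xz; rewrite /osum [LHS]big_seq_cond [RHS]big_seq_cond; apply: eq_bigl => q /=.
rewrite inE; case: (boolP (q \in Q p)) => //= /Qz zq; case: eqP => // e.
by rewrite e ltnNge xz in zq.
Qed.

Lemma osum_addQ p p' S : osum p (addQ p' S) <= osum p S + osum p (Q p').
Proof.
rewrite /osum big_mkcond [X in _ <= X + _]big_mkcond [X in _ <= _ + X]big_mkcond -big_split.
apply: ler_sum => q _; rewrite mem_cat mem_filter; have := invr_ge0 (q%:R : R); rewrite ler0n => i0.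
by case: (q \in S); case: (q \in Q p') => /=; rewrite ?addr0 ?add0r// ?lerDl.
Qed.

Lemma mod_step (a v f P E1 E2 h o t m m' : R) : 0 <= a <= 1 -> 0 <= v -> 0 <= f <= 1 -> 0 <= P <= 1 ->
  0 <= E2 -> E2 <= E1 + om * h -> 0 <= h -> `|f - t| <= o + tau ->
  `|m - (1 - a) * v * P| <= (1 - a) * v * (E1 + tau * h + om * h ^+ 2) ->
  `|m' - f * v * P| <= f * v * (E2 + tau * h + om * h ^+ 2) ->
  `|m + a * m' - v * ((1 - (1 - t) * a) * P)| <= v * (a * o + E1 + tau * (a + h) + om * (a + h) ^+ 2).
Proof.
move=> /andP[a0 a1] v0 /andP[f0 f1] /andP[P0 P1] E20 E2E h0 ft h1 h2.
have -> : m + a * m' - v * ((1 - (1 - t) * a) * P) =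
  (m - (1 - a) * v * P) + a * (m' - f * v * P) + a * v * P * (f - t) by ring.
set K := tau * h + om * h ^+ 2.
have K0 : 0 <= K by rewrite addr_ge0 ?mulr_ge0 ?exprn_ge0.
apply: le_trans (ler_normD _ _) _; apply: le_trans (lerD (ler_normD _ _) (lexx _)) _.
rewrite !normrM (ger0_norm a0) (ger0_norm v0) (ger0_norm P0).
have k1 : a * `|m' - f * v * P| <= a * (v * (E1 + om * h + K)).
  rewrite ler_wpM2l//; apply: le_trans h2 _; rewrite -addrA -/K -mulrA.
  apply: le_trans (_ : v * (E2 + K) <= _); first by rewrite ler_piMl// mulr_ge0// addr_ge0.
  by rewrite ler_wpM2l// lerD2r.
have k2 : a * v * P * `|f - t| <= a * v * (o + tau).
  have av : 0 <= a * v by rewrite mulr_ge0.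
  apply: le_trans (ler_wpM2l _ ft); last by [].
  by rewrite ler_wpM2r// ler_piMr.
apply: le_trans (lerD (lerD h1 k1) k2) _; rewrite -[E1 + _ + _]addrA -/K.
have e0 : 0 <= v * (om * (a * h + a ^+ 2)) by rewrite !mulr_ge0 ?addr_ge0 ?mulr_ge0 ?exprn_ge0.
by rewrite -subr_ge0 (_ : _ - _ = v * (om * (a * h + a ^+ 2)))// /K; ring.
Qed.

(** Comparison with the product in which the conditions for different p are independent. Each p
    loses [tau] for replacing [Vol (Q p)] by [theta p], and the overlap of [Q p] with what is
    already sifted; every earlier p' adds at most [om] to that overlap, which yields the quadratic
    term. *)
Lemma Mod_err I S : goodI I -> goodS S -> disj I S ->
  (forall p, p \in I -> `|Vol (Q p) - theta p| <= tau) ->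
  (forall p p', p \in I -> p' \in I -> p != p' -> osum p (Q p') <= om) ->
  `|Mod I S - Vol S * Piprod I| <= Vol S * (\sum_(p <- I) p%:R^-1 * osum p S + tau * rsum I + om * rsum I ^+ 2).
Proof.
elim: I S => [|p I ih] S gI gS IS ht ho.
  by rewrite /= /Piprod /rsum !big_nil expr0n /= !mulr0 !addr0 mulr0 mulr1 subrr normr0.
have [gI' gS1 IS1] := goodS_cons gI gS IS; have [gS2 IS2] := goodS_addQ gI gS IS.
have /andP[/= /andP[pI uI] /andP[/andP[pp pz] aI]] := gI.
have ht' p' : p' \in I -> `|Vol (Q p') - theta p'| <= tau by move=> h; apply: ht; rewrite inE h orbT.
have ho' x y : x \in I -> y \in I -> x != y -> osum x (Q y) <= om.
  by move=> h h'; apply: ho; rewrite inE ?h ?h' orbT.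
have h1 := ih _ gI' gS1 IS1 ht' ho'; have h2 := ih _ gI' gS2 IS2 ht' ho'.
have [a0 a1] := inv_prime_bounds pp; have hI := rsum_ge0 I.
have /andP[v0 v1] := Vol01 (goodS_prime gS).2; have /andP[u0 u1] := Vol01 (prime_Qf p (fun q => q \notin S)).
have o0 : 0 <= osum p S by apply: sumr_ge0 => q _; rewrite invr_ge0.
have /andP[t0 t1] := theta01 p.
have uf := Vol_filter p gS; have ut := ht p (mem_head _ _).
have P01 : 0 <= Piprod I <= 1.
  rewrite /Piprod big_seq; elim/big_ind: _ => [|x y /andP[x0 x1] /andP[y0 y1]|q qI].
  - by rewrite ler01 lexx.
  - by rewrite mulr_ge0//= mulr_ile1.
  have /andP[qp _] := allP aI q qI; have [b0 b1] := inv_prime_bounds qp; have /andP[c0 c1] := theta01 q.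
  by move: (q%:R^-1 : R) (theta q) b0 b1 c0 c1 => b c b0 b1 c0 c1; apply/andP; split; nra.
rewrite Vol_cons in h1; rewrite Vol_addQ in h2.
have eS : \sum_(q <- I) q%:R^-1 * osum q (p :: S) = \sum_(q <- I) q%:R^-1 * osum q S.
  by apply: eq_bigr => q _; rewrite osum_cons.
rewrite eS in h1.
have s2 : \sum_(q <- I) q%:R^-1 * osum q (addQ p S) <= \sum_(q <- I) q%:R^-1 * osum q S + om * rsum I.
  rewrite /rsum mulr_sumr -big_split /= big_seq [leRHS]big_seq; apply: ler_sum => q qI.
  rewrite [om * _]mulrC -mulrDr ler_wpM2l ?invr_ge0//; apply: le_trans (osum_addQ _ _ _) _.
  rewrite lerD2l; apply: ho; rewrite ?inE ?qI ?eqxx ?orbT//.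
  by apply: contraNneq pI => <-.
have s0 T : 0 <= \sum_(q <- I) q%:R^-1 * osum q T.
  by apply: sumr_ge0 => q _; rewrite mulr_ge0 ?invr_ge0//; apply: sumr_ge0 => x _; rewrite invr_ge0.
rewrite /= big_cons [Piprod _]big_cons -/(Piprod I) [rsum (p :: I)]big_cons -/(rsum I).
apply: (mod_step _ v0 _ P01 (s0 _) s2 hI _ h1 h2).
- by rewrite (ltW a0); apply: le_trans a1 _; lra.
- by rewrite u0.
by apply: le_trans (ler_distD (Vol (Q p)) _ _) (lerD uf ut).
Qed.
End Sieve.

(** * Reciprocal sums of primes congruent to 1 in each range *)

Section APSums.
Variable R : realType.
Implicit Types (d y t : R) (m p q X : nat).

Definition psum m a b : R := \sum_(a.+1 <= q < b.+1 | prime q && (q == 1 %[mod m])) q%:R^-1.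

Lemma psum_ge0 m a b : 0 <= psum m a b.
Proof. by apply: sumr_ge0 => q _; rewrite invr_ge0. Qed.

Lemma psum_cat m a b c : (a <= b)%N -> (b <= c)%N -> psum m a c = psum m a b + psum m b c.
Proof. by move=> ab bc; rewrite /psum (@big_cat_nat _ _ _ b.+1). Qed.

(** Rankin's device: q^d <= e^(dE) for ln q <= E. *)
Lemma psum_le_apsum m X d E : 0 <= d -> ln X%:R <= E -> psum m 0 X <= expR (d * E) * apsum m (1 + d) X.
Proof.
move=> d0 XE; rewrite /psum /apsum mulr_sumr big_nat_cond [leRHS]big_nat_cond.
apply: ler_sum => q /andP[/andP[q0 qX] _]; rewrite -npow_1// npowD mulrCA ler_peMr ?npow_ge0//.
rewrite /npow -expRD -[leLHS]expR0 ler_expR subr_ge0 ler_wpM2l//.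
by apply: le_trans XE; exact: ln_nat_le.
Qed.

Lemma apsum_le_psum m w d x : 0 < d -> (0 < w)%N -> apsum m (1 + d) x <= psum m 0 w + npow d w / d.
Proof.
move=> d0 w0; apply: le_trans (apsum_mono m _ (leq_maxl x w)) _.
rewrite /apsum (@big_cat_nat _ _ _ w.+1)//=; last by rewrite ltnS leq_maxr.
apply: lerD; last first.
  apply: le_trans (npow_tail (maxn x w) d0 w0); rewrite big_mkcond; apply: ler_sum => q _.
  by case: ifP => // _; exact: npow_ge0.
rewrite /psum big_nat_cond [leRHS]big_nat_cond; apply: ler_sum => q /andP[/andP[q0 _] _].
by rewrite -npow_1// npow_le//; lra.
Qed.

(** Rankin's device with D = 1/(1 + ln z), followed by the bound that ignores primality. *)
Lemma psum_triv p z : prime p -> (2 < p)%N -> (0 < z)%N ->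
  psum p 0 z <= expR 1 * (2 + ln z%:R) * p%:R^-1.
Proof.
move=> pp p2 z0; have [chi [i0 [S [dc _]]]] := @dchar_prime R p pp p2.
have l0 := ln_nat_ge0 R z; pose D : R := (1 + ln z%:R)^-1.
have D0 : 0 < D by rewrite invr_gt0; lra.
apply: le_trans (psum_le_apsum p (ltW D0) (lexx _)) _; rewrite -mulrA.
apply: ler_pM; rewrite ?expR_ge0 ?apsum_ge0//.
  by rewrite ler_expR mulrC ler_pdivrMr; lra.
apply: le_trans (apsum_triv dc z D0) _; rewrite npow_1 ?prime_gt0// /D invrK mulrC.
by rewrite ler_wpM2r ?invr_ge0//; lra.
Qed.

Lemma psum_harmonic m z : psum m 0 z <= 1 + ln z%:R.
Proof.
apply: le_trans (harmonic_le R z); rewrite /psum big_mkcond big_nat_cond [leRHS]big_nat_cond.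
apply: ler_sum => q /andP[/andP[q0 _] _]; rewrite npow_1//.
by case: ifP => _ //; rewrite invr_ge0.
Qed.

Lemma npow_quarter (v : R) k p : 0 < v -> v ^+ (4 * k) <= p%:R -> npow (1 / 4) p <= v^-1 ^+ k.
Proof.
move=> v0 vp; have vk : 0 < v ^+ (4 * k) by rewrite exprn_gt0.
have h : ln (v ^+ (4 * k)) <= ln p%:R by rewrite ler_ln ?posrE ?(lt_le_trans vk).
rewrite -[leRHS](@lnK _); last by rewrite posrE exprn_gt0 ?invr_gt0.
rewrite ler_expR lnXn ?invr_gt0// lnV ?posrE//; move: h; rewrite lnXn//.
rewrite -[ln v *+ _]mulr_natl -[(- ln v) *+ _]mulr_natl natrM.
by move: (ln v) (ln p%:R) (k%:R : R) => a b c; lra.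
Qed.

Section Params.
Variable v : R.
Hypothesis v16 : 16 <= v.
Definition yv : R := v ^+ 16.
Definition z1v := Num.truncn (v ^+ 12).
Definition z2v := Num.truncn (v ^+ 32).
Definition wv := Num.truncn (expR (expR (yv - v ^+ 4))).
Definition Xv := Num.truncn (expR (expR yv)).
Let t := v^-1.

Lemma v_gt0 : 0 < v. Proof. by have := v16; lra. Qed.
Local Hint Resolve v_gt0 : core.
Lemma t_bounds : 0 < t <= 1 / 16.
Proof. by rewrite invr_gt0 v_gt0 /t mul1r lef_pV2 ?posrE. Qed.
Lemma vt : v * t = 1. Proof. by rewrite mulfV// gt_eqF. Qed.
Lemma vt_pow i j : v ^+ i * t ^+ (i + j) = t ^+ j.
Proof. by rewrite exprD mulrA -exprMn vt expr1n mul1r. Qed.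
Lemma t_pow_le i j : (i <= j)%N -> t ^+ j <= t ^+ i.
Proof. by have /andP[t0 t1] := t_bounds; apply: ler_wiXn2l; lra. Qed.
Lemma v_pow_le i j : (i <= j)%N -> v ^+ i <= v ^+ j.
Proof. by apply: ler_weXn2l; have := v16; lra. Qed.
Lemma v_pow_ge1 i : 1 <= v ^+ i. Proof. by apply: exprn_ege1; have := v16; lra. Qed.

Lemma ln_v_bounds : 0 <= ln v <= v.
Proof.
have v1 := v16; have := ln_diff_le ltr01 v_gt0; rewrite ln1 subr0 divr1 => h.
by rewrite ln_ge0 /=; lra.
Qed.

Lemma pow_le_exp k (a : R) : k%:R * v <= a -> v ^+ k <= expR a.
Proof.
move=> h; rewrite -[leLHS](@lnK _) ?posrE ?exprn_gt0// ler_expR lnXn// -mulr_natl.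
by apply: le_trans h; have /andP[_ lv] := ln_v_bounds; rewrite ler_wpM2l.
Qed.

Lemma v2_ge : 256 <= v ^+ 2. Proof. by rewrite expr2; have := v16; nra. Qed.

(** v^2 >= 256 gives k v <= v^3, and ln v <= v. *)
Lemma pow_le_exp3 k : (k <= 256)%N -> v ^+ k <= expR (v ^+ 3).
Proof.
move=> k256; apply: pow_le_exp; rewrite exprSr ler_wpM2r ?(ltW v_gt0)//.
apply: le_trans (_ : 256%:R <= _); first by rewrite ler_nat.
exact: v2_ge.
Qed.

Lemma expN_le_t k : (k <= 256)%N -> expR (- v ^+ 3) <= t ^+ k.
Proof. by move=> h; rewrite expRN exprVn lef_pV2 ?posrE ?expR_gt0 ?exprn_gt0 ?pow_le_exp3. Qed.

Lemma X_gt0 : (0 < Xv)%N.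
Proof. by rewrite truncn_gt0 -expR0 ler_expR expR_ge0. Qed.
Lemma w_gt0 : (0 < wv)%N.
Proof. by rewrite truncn_gt0 -expR0 ler_expR expR_ge0. Qed.
Lemma z2_gt0 : (0 < z2v)%N. Proof. by rewrite truncn_gt0 v_pow_ge1. Qed.
Lemma lnX_le : ln Xv%:R <= expR yv.
Proof.
by rewrite -[leRHS]expRK ler_ln ?posrE ?ltr0n ?X_gt0// ?expR_gt0// Num.Theory.truncn_le// expR_ge0.
Qed.
Lemma lnw_ge : expR (yv - v ^+ 4) - 1 <= ln wv%:R.
Proof.
have w1 : 1 <= wv%:R :> R by rewrite ler1n w_gt0.
rewrite -[leLHS]expRK ler_ln ?posrE ?expR_gt0 ?ltr0n ?w_gt0// expRD.
have h : expR (expR (yv - v ^+ 4)) <= 2 * wv%:R.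
  by apply: le_trans (ltW (lt_truncnS _)) _; rewrite -natr1; rewrite -/wv; lra.
have e1 : expR (-1) <= 1 / 2 :> R.
  by rewrite expRN mul1r lef_pV2 ?posrE ?expR_gt0//; have := expR_ge1Dx (1 : R); lra.
by have := ler_pM (expR_ge0 _) (expR_ge0 _) h e1; lra.
Qed.
Lemma yv_gap : v ^+ 15 + 2 * v ^+ 4 <= yv.
Proof.
have h : v ^+ 4 <= v ^+ 15 by exact: v_pow_le.
by rewrite /yv [in leRHS]exprS; have := v_pow_ge1 15; have := v16; nra.
Qed.

Lemma le_w (a : R) : a <= expR (v ^+ 3) -> a <= expR (expR (yv - v ^+ 4)).
Proof.
move/le_trans; apply; rewrite ler_expR; apply: le_trans (expR_ge1Dx _).
have := yv_gap; have : v ^+ 3 <= v ^+ 15 by exact: v_pow_le.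
by have := v_pow_ge1 4; lra.
Qed.

Lemma z2_le_w : (z2v <= wv)%N.
Proof. by apply: le_truncn; apply: le_w; apply: pow_le_exp3. Qed.

Lemma w_le_X : (wv <= Xv)%N.
Proof. by apply: le_truncn; rewrite !ler_expR gerBl; have := v_pow_ge1 4; lra. Qed.

Lemma z1_le_z2 : (z1v <= z2v)%N. Proof. by apply: le_truncn; exact: v_pow_le. Qed.

Lemma gt_z1 p : (z1v < p)%N -> v ^+ 12 <= p%:R.
Proof. by move=> h; apply: le_trans (ltW (lt_truncnS _)) _; rewrite ler_nat. Qed.
Lemma gt_z2 p : (z2v < p)%N -> v ^+ 32 <= p%:R.
Proof. by move=> h; apply: le_trans (ltW (lt_truncnS _)) _; rewrite ler_nat. Qed.
Lemma le_z2 p : (p <= z2v)%N -> p%:R <= v ^+ 32.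
Proof. by move=> h; apply: le_trans (_ : z2v%:R <= _); rewrite ?ler_nat// Num.Theory.truncn_le exprn_ge0 ?(ltW v_gt0). Qed.
Lemma le_z1 p : (p <= z1v)%N -> p%:R <= v ^+ 12.
Proof. by move=> h; apply: le_trans (_ : z1v%:R <= _); rewrite ?ler_nat// Num.Theory.truncn_le exprn_ge0 ?(ltW v_gt0). Qed.

(** Two points on either side of e^(-y). At [d1] the factor e^(d ln X) is at most exp (e^(-v^4)),
    nearly 1, so twisted sums bound sums up to X from above. At [d2] the primes beyond w are
    negligible, since d2 ln w is about e^(v^4), so twisted sums bound sums up to w from below. The
    discrepancy in y / p is O(v^4 / p), small for p > v^12. *)
Let d1 := expR (- (yv + v ^+ 4)).
Let d2 := expR (- (yv - 2 * v ^+ 4)).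

Lemma d1_le_npow (m : nat) : (0 < m)%N -> m%:R <= expR (2 * yv) -> d1 <= npow (1 / 2) m.
Proof.
move=> m0 h; rewrite /npow ler_expR lerN2; have := ler_ln (x := m%:R) (y := expR (2 * yv)).
rewrite !posrE ltr0n m0 expR_gt0 h expRK => /(_ isT isT) l; have := v_pow_ge1 4; lra.
Qed.

Lemma boost_le : expR (d1 * expR yv) <= 1 + 2 * t ^+ 16.
Proof.
have e : d1 * expR yv = expR (- v ^+ 4) by rewrite /d1 -expRD; congr expR; ring.
have h : expR (- v ^+ 4) <= t ^+ 16.
  apply: le_trans (expN_le_t (isT : 16 <= 256)%N); rewrite ler_expR lerN2; exact: v_pow_le.
have /andP[t0 t1] := t_bounds; have h2 : t ^+ 16 <= t by rewrite -[leRHS]expr1 t_pow_le.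
rewrite e; apply: le_trans (_ : expR (t ^+ 16) <= _); first by rewrite ler_expR.
have := expR_ge1Dx (- t ^+ 16); rewrite expRN; have := expR_gt0 (t ^+ 16).
have : 0 <= t ^+ 16 by rewrite exprn_ge0// ltW.
move: (t ^+ 16) h2 => s h2 s0 E0 k.
move: E0 k; move: (expR s) => F F0 k.
have : (1 - s) * F <= 1 by apply: le_trans (ler_wpM2r (ltW F0) k) _; rewrite mulVf ?gt_eqF.
nra.
Qed.

(* The primes q > w contribute little to the twisted sum because d2 * ln w is large. *)
Lemma tail_w : npow d2 wv / d2 <= t ^+ 3.
Proof.
have d20 : 0 < d2 by exact: expR_gt0.
have e1 : d2 * expR (yv - v ^+ 4) = expR (v ^+ 4) by rewrite /d2 -expRD; congr expR; ring.
have d21 : d2 <= 1.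
  by rewrite /d2 -[leRHS]expR0 ler_expR oppr_le0; have := yv_gap; have := v_pow_ge1 15; lra.
have h1 : expR (v ^+ 4) - 1 <= d2 * ln wv%:R.
  by have := ler_wpM2l (ltW d20) lnw_ge; rewrite mulrBr mulr1 e1; lra.
rewrite /npow {2}/d2 -expRN opprK -expRD.
apply: le_trans (_ : expR (- v ^+ 3) <= _); last exact: expN_le_t.
rewrite ler_expR; have : v ^+ 18 <= expR (v ^+ 4).
  by apply: le_trans (pow_le_exp3 _) _ => //; rewrite ler_expR v_pow_le.
have k1 : v ^+ 3 <= v ^+ 16 by exact: v_pow_le.
have -> : v ^+ 18 = v ^+ 2 * yv by rewrite /yv -exprD.
have := v_pow_ge1 16; rewrite -/yv in k1 *; have := v_pow_ge1 4; have := v2_ge.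
by move: h1; move: (expR (v ^+ 4)) (d2 * _) (v ^+ 4) (v ^+ 2) (v ^+ 3) (yv) k1 => a b c d e f *; nra.
Qed.

Lemma inv_t12 p : v ^+ 12 <= p%:R -> p%:R^-1 <= t ^+ 12.
Proof. by move=> h; rewrite exprVn lef_pV2 ?posrE ?exprn_gt0//; apply: lt_le_trans h; rewrite exprn_gt0. Qed.

Lemma inv_pred p : (1 < p)%N -> p%:R^-1 <= p.-1%:R^-1 :> R /\ p.-1%:R^-1 <= p%:R^-1 + 2 * p%:R^-1 ^+ 2 :> R.
Proof.
case: p => [|[|k]]// _; have k0 : 0 < k.+1%:R :> R by [].
have e : k.+2%:R = k.+1%:R + 1 :> R by rewrite natr1.
have k2 : 1 <= k.+1%:R :> R by rewrite ler1n.
split; first by rewrite lef_pV2 ?posrE// ler_nat.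
rewrite /= e; move: (k.+1%:R : R) k0 k2 => x x0 x1; have y0 : 0 < x + 1 by lra.
rewrite -subr_ge0 (_ : _ - _ = (x - 1) / (x * (x + 1) ^+ 2)); last by field; rewrite !gt_eqF.
by rewrite divr_ge0 ?mulr_ge0 ?exprn_ge0; lra.
Qed.
Lemma t0 : 0 < t. Proof. by have /andP[] := t_bounds. Qed.
Lemma tp_ge0 i : 0 <= t ^+ i. Proof. by rewrite exprn_ge0// ltW// t0. Qed.
Local Hint Resolve tp_ge0 : core.

(** With r = 1/p <= v^(-12) one has y r <= v^4, v^4 r <= v^(-8) and y r^2 <= v^(-8), so every
    deviation from y r is O(v^(-3)). *)
Lemma up_calc (S a r r' n C : R) : 0 <= C -> 0 <= S -> a <= 1 + 2 * t ^+ 16 ->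
  S <= a * ((yv + v ^+ 4) * r' + C * n) -> 0 <= r -> r <= t ^+ 12 -> 0 <= r' -> r' <= r + 2 * r ^+ 2 ->
  0 <= n -> n <= t ^+ 3 -> S <= yv * r + (17 + 3 * C) * t ^+ 3.
Proof.
move=> C0 S0 ha hS r0 rt r'0 hr n0 nt; have y0 : 0 <= yv by rewrite exprn_ge0// ltW// v_gt0.
have w0 := v_pow_ge1 4; set y := yv in y0 hS *; set w := v ^+ 4 in w0 hS.
have e1 : y * r <= w.
  apply: le_trans (ler_wpM2l y0 rt) _; rewrite /y /yv (exprD v 4 12 : v ^+ 16 = _) -mulrA.
  by rewrite (_ : v ^+ 12 * t ^+ 12 = 1) ?mulr1// -exprMn vt expr1n.
have e2 : w * r <= t ^+ 8.
  by rewrite -(vt_pow 4 8) ler_wpM2l//; lra.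
have e3 : y * r ^+ 2 <= t ^+ 8.
  apply: le_trans (_ : y * (t ^+ 12 * t ^+ 12) <= _).
    by rewrite ler_wpM2l// expr2 ler_pM.
  by rewrite -exprD (vt_pow 16 8).
have e4 : w * r ^+ 2 <= t ^+ 8.
  have w00 : 0 <= w by apply: le_trans w0.
  apply: le_trans e2; rewrite expr2 mulrA ler_piMr ?(mulr_ge0 w00 r0)//.
  by apply: le_trans rt _; rewrite -[leRHS](expr0 t) t_pow_le.
have t83 : t ^+ 8 <= t ^+ 3 by exact: t_pow_le.
have t123 : t ^+ 12 <= t ^+ 3 by exact: t_pow_le.
have t163 : t ^+ 16 <= t ^+ 3 by exact: t_pow_le.
have t161 : t ^+ 16 * t ^+ 3 <= t ^+ 3.
  by rewrite ler_piMl// -[leRHS](expr0 t) t_pow_le.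
have B0 : 0 <= (y + w) * r' + C * n by rewrite addr_ge0 ?mulr_ge0//; lra.
have hB : (y + w) * r' + C * n <= y * r + (5 + C) * t ^+ 3.
  have : (y + w) * r' <= (y + w) * (r + 2 * r ^+ 2) by rewrite ler_wpM2l//; lra.
  have : C * n <= C * t ^+ 3 by rewrite ler_wpM2l.
  by move: (r ^+ 2) e3 e4 => r2; lra.
apply: le_trans hS _; apply: le_trans (ler_wpM2r B0 ha) _.
have h1 : t ^+ 16 * ((y + w) * r' + C * n) <= t ^+ 3 + (5 + C) * t ^+ 3.
  apply: le_trans (ler_wpM2l (tp_ge0 16) hB) _; rewrite mulrDr; apply: lerD.
    apply: le_trans (ler_wpM2l (tp_ge0 16) e1) _; rewrite mulrC /w.
    by rewrite (vt_pow 4 12).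
  by rewrite mulrCA ler_wpM2l//; lra.
by move: ((y + w) * r' + C * n) hB h1 => B *; lra.
Qed.

Lemma lnz2 : ln z2v%:R <= 32 * v.
Proof.
have h : ln z2v%:R <= ln (v ^+ 32).
  rewrite ler_ln ?posrE ?ltr0n ?z2_gt0 ?exprn_gt0//.
  by rewrite Num.Theory.truncn_le exprn_ge0// ltW// v_gt0.
apply: le_trans h _; rewrite lnXn// -mulr_natl; have /andP[_] := ln_v_bounds.
by move: (ln v) => l; lra.
Qed.

Lemma psum_up C p : 0 <= C -> (1 < p)%N -> v ^+ 12 <= p%:R ->
  (forall x, apsum p (1 + d1) x <= - ln d1 / p.-1%:R + C * npow (1 / 4) p) ->
  psum p 0 Xv <= yv * p%:R^-1 + (17 + 3 * C) * t ^+ 3.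
Proof.
move=> C0 p1 pv h; have [r1 r2] := inv_pred p1.
apply: (up_calc C0 (psum_ge0 _ _ _) boost_le _ _ (inv_t12 pv) _ r2 (npow_ge0 (1 / 4) p)); rewrite ?invr_ge0//.
- apply: le_trans (psum_le_apsum p (expR_ge0 (- (yv + v ^+ 4))) lnX_le) _; rewrite ler_wpM2l ?expR_ge0//.
  by apply: le_trans (h _) _; rewrite expRK opprK.
by apply: (@npow_quarter v 3) => //; exact: v_gt0.
Qed.

Lemma psum_lo C p x : 0 <= C -> (1 < p)%N -> v ^+ 12 <= p%:R ->
  - ln d2 / p.-1%:R - C * npow (1 / 4) p <= apsum p (1 + d2) x ->
  yv * p%:R^-1 - (3 + C) * t ^+ 3 <= psum p 0 wv.
Proof.
move=> C0 p1 pv h; have [r1 r2] := inv_pred p1.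
have h1 := apsum_le_psum p x (expR_gt0 (- (yv - 2 * v ^+ 4))) w_gt0; rewrite -/d2 in h1.
have h2 := tail_w; have h3 : npow (1 / 4) p <= t ^+ 3 by apply: (@npow_quarter v 3) => //; exact: v_gt0.
have h4 : v ^+ 4 * p%:R^-1 <= t ^+ 8.
  by apply: le_trans (ler_wpM2l _ (inv_t12 pv)) _; rewrite ?(vt_pow 4 8)// exprn_ge0// ltW// v_gt0.
have t83 : t ^+ 8 <= t ^+ 3 by exact: t_pow_le.
move: h; rewrite expRK opprK => h.
have h5 : (yv - 2 * v ^+ 4) * p%:R^-1 <= (yv - 2 * v ^+ 4) / p.-1%:R.
  by rewrite ler_wpM2l//; have := yv_gap; have := v_pow_ge1 15; lra.
have h6 := ler_wpM2l C0 h3.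
rewrite mulrBl in h5; have {}h4 : 2 * v ^+ 4 * p%:R^-1 <= 2 * t ^+ 8 by rewrite -mulrA ler_wpM2l.
move: h h1 h2 h4 h5 h6; move: (2 * v ^+ 4 * _) (yv * p%:R^-1) ((yv - _) / p.-1%:R) (C * npow _ _) (npow d2 wv / d2).
move: (apsum _ _ _) (psum _ _ _) => *; lra.
Qed.

Lemma psum_z2 p : prime p -> (2 < p)%N -> v ^+ 12 <= p%:R -> psum p 0 z2v <= 34 * expR 1 * t ^+ 3.
Proof.
move=> pp p2 pv; apply: le_trans (psum_triv pp p2 z2_gt0) _.
rewrite [34 * _]mulrC -!mulrA ler_wpM2l ?expR_ge0//.
apply: le_trans (ler_pM _ _ (_ : _ <= 34 * v) (inv_t12 pv)) _; rewrite ?invr_ge0//.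
- by have := ln_nat_ge0 R z2v; lra.
- by have := lnz2; have := v16; lra.
have : v * t ^+ 12 = t ^+ 11 by rewrite -[v]expr1 (vt_pow 1 11).
by rewrite -mulrA => ->; rewrite ler_wpM2l// t_pow_le.
Qed.

Lemma d2_small p : (0 < p)%N -> p%:R <= v ^+ 32 -> d2 * (64 * p%:R ^+ 2 * lm R p ^+ 2) <= 1.
Proof.
move=> p0 pv; have v0 := v_gt0.
have l : lm R p <= 34 * v.
  have : ln p%:R <= ln (v ^+ 32) by rewrite ler_ln ?posrE ?ltr0n// exprn_gt0.
  by rewrite /lm lnXn// -mulr_natl; have /andP[_] := ln_v_bounds; have := v16; lra.
have l0 : 0 <= lm R p by have := lm_ge2 R p; lra.
have k1 : lm R p ^+ 2 <= (34 * v) ^+ 2 by rewrite lerXn2r ?nnegrE//; lra.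
have k2 : p%:R ^+ 2 <= v ^+ 64 by rewrite (exprM v 32 2 : v ^+ 64 = _) lerXn2r ?nnegrE ?exprn_ge0 ?(ltW v0).
have k3 : 64 * p%:R ^+ 2 * lm R p ^+ 2 <= expR (v ^+ 3).
  apply: le_trans (_ : v ^+ 80 <= _); last exact: pow_le_exp3.
  rewrite -mulrA; apply: le_trans (ler_wpM2l _ (ler_pM _ _ k2 k1)) _; rewrite ?exprn_ge0//.
  rewrite (_ : v ^+ 80 = v ^+ 64 * v ^+ 2 * v ^+ 2 * (v ^+ 2) ^+ 6); last by rewrite -!exprM -!exprD.
  rewrite exprMn; have := v2_ge; have := v_pow_ge1 64; move: (v ^+ 64) (v ^+ 2) => a b a1 b1.
  have c1 : 64 * 34 ^+ 2 <= b ^+ 6.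
    apply: le_trans (_ : b ^+ 3 <= _); last by rewrite ler_weXn2l//; lra.
    by rewrite [leRHS]exprS; apply: ler_pM; rewrite ?exprn_ge0 ?lerXn2r ?nnegrE//; lra.
  move: (b ^+ 6) c1 => c c1; rewrite (_ : 64 * _ = a * b * (64 * 34 ^+ 2)); last by ring.
  apply: le_trans (_ : a * b * c <= _); first by rewrite ler_wpM2l// mulr_ge0; lra.
  rewrite ler_wpM2r//; first by apply: le_trans c1; rewrite mulr_ge0// exprn_ge0.
  by rewrite ler_peMr// ?mulr_ge0; lra.
apply: le_trans (ler_wpM2l (expR_ge0 _) k3) _; rewrite -expRD -[leRHS]expR0 ler_expR.
by have := yv_gap; have : v ^+ 3 <= v ^+ 15 by [exact: v_pow_le]; lra.
Qed.
Lemma psum_lo_gen m (L : R) x : L <= apsum m (1 + d2) x -> L - t ^+ 3 - (1 + 32 * v) <= psum m z2v wv.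
Proof.
have h1 := apsum_le_psum m x (expR_gt0 (- (yv - 2 * v ^+ 4))) w_gt0; rewrite -/d2 in h1.
have h2 := tail_w; have h3 : psum m 0 z2v <= 1 + 32 * v.
  by apply: le_trans (psum_harmonic _ _) _; rewrite lerD2l lnz2.
move: h1 h2 h3; rewrite (psum_cat m (leq0n z2v) z2_le_w).
by move: (npow _ _ / _) (psum _ _ _) (psum _ _ _) (apsum _ _ _) => *; lra.
Qed.

Lemma d1_small m : (0 < m)%N -> m%:R <= v ^+ 64 -> d1 <= npow (1 / 2) m.
Proof.
move=> m0 h; apply: d1_le_npow => //; apply: le_trans h _; apply: le_trans (pow_le_exp3 _) _ => //.
rewrite ler_expR; have := yv_gap; have : v ^+ 3 <= v ^+ 15 by exact: v_pow_le.
by have := v_pow_ge1 4; have := v_pow_ge1 15; lra.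
Qed.

Lemma inv_z2 : z2v%:R^-1 <= t ^+ 28.
Proof.
rewrite exprVn lef_pV2 ?posrE ?ltr0n ?z2_gt0 ?exprn_gt0 ?v_gt0//.
have h := lt_truncnS (v ^+ 32); rewrite -natr1 -/z2v in h.
have : v ^+ 32 = v ^+ 28 * v ^+ 4 by rewrite -exprD.
have : 16 <= v ^+ 4 by apply: le_trans v16 _; rewrite -{1}[v]expr1 v_pow_le.
by have := v_pow_ge1 28; move: h; move: (v ^+ 32) (v ^+ 28) (v ^+ 4) (z2v%:R : R) => a b c d *; nra.
Qed.

(** For p <= e^(2y) the bound at [d1] applies. For larger p the trivial bound suffices: the factor
    ln X <= e^y that it loses is at most p^(1/2). *)
Lemma z2_large_psum C p : 0 <= C -> prime p -> (z2v < p)%N ->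
  (p%:R <= expR (2 * yv) -> forall x, apsum p (1 + d1) x <= - ln d1 / p.-1%:R + C * npow (1 / 4) p) ->
  p%:R^-1 * psum p 0 Xv <= 12 * yv * npow 2 p + (3 * C + 3 * expR 1) * npow (1 + 1 / 4) p.
Proof.
move=> C0 pp zp h; have p0 := prime_gt0 pp; have pv := gt_z2 zp.
have y0 : 0 <= yv by rewrite exprn_ge0// ltW// v_gt0.
have e2 : npow 2 p = p%:R^-1 * p%:R^-1 :> R by rewrite -[2]/(1 + 1) npowD npow_1.
have e5 : npow (1 + 1 / 4) p = p%:R^-1 * npow (1 / 4) p :> R by rewrite npowD npow_1.
have i0 : 0 <= p%:R^-1 :> R by rewrite invr_ge0.
have n0 := npow_ge0 (1 / 4 : R) p; have n2 := npow_ge0 (2 : R) p; have E0 := expR_gt0 (1 : R).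
have [le|gt] := leP p%:R (expR (2 * yv)).
  have [r1 r2] := inv_pred (prime_gt1 pp).
  have {}h := h le Xv; rewrite expRK opprK in h.
  have hb : expR (d1 * expR yv) <= 3.
    by apply: le_trans boost_le _; have : t ^+ 16 <= 1 by [rewrite -[leRHS](expr0 t) t_pow_le]; lra.
  have k : psum p 0 Xv <= 3 * (4 * yv * p%:R^-1 + C * npow (1 / 4) p).
    apply: le_trans (psum_le_apsum p (expR_ge0 (- (yv + v ^+ 4))) lnX_le) _; rewrite -/d1.
    apply: ler_pM; rewrite ?expR_ge0 ?apsum_ge0//; apply: le_trans h _; rewrite lerD2r.
    have w1 : v ^+ 4 <= yv by exact: v_pow_le.
    have p2 : p.-1%:R^-1 <= 2 * p%:R^-1 :> R.
      apply: le_trans r2 _; have : p%:R^-1 <= 1 / 2 :> R by have [] := @inv_prime_bounds R p pp.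
      by move: (p%:R^-1 : R) i0 => x *; nra.
    apply: le_trans (_ : (2 * yv) * (2 * p%:R^-1) <= _); last by lra.
    by apply: ler_pM; rewrite ?invr_ge0 ?addr_ge0 ?exprn_ge0 ?(ltW v_gt0)//; lra.
  apply: le_trans (ler_wpM2l i0 k) _; rewrite e2 e5.
  have := mulr_ge0 (mulr_ge0 (ler0n R 3) (ltW E0)) (mulr_ge0 i0 n0).
  by move: (expR 1) (npow _ _) (p%:R^-1 : R) => *; lra.
have p2 : (2 < p)%N.
  rewrite -(ltr_nat R); apply: lt_le_trans pv; have := v_pow_ge1 31; have := v16.
  by rewrite exprS; move: (v ^+ 31) => *; nra.
have Y1 : 1 <= expR yv by rewrite -[leLHS]expR0 ler_expR.
have k : psum p 0 Xv <= 3 * expR 1 * expR yv * p%:R^-1.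
  apply: le_trans (psum_triv pp p2 X_gt0) _; rewrite ler_wpM2r//.
  have := lnX_le; move: (ln Xv%:R) (expR yv) (expR 1) Y1 E0 => a b c *; nra.
have k2 : expR yv * npow (1 / 2) p <= 1.
  rewrite /npow -expRD -[leRHS]expR0 ler_expR.
  have : ln (expR (2 * yv)) <= ln p%:R by rewrite ler_ln ?posrE ?expR_gt0 ?ltr0n// ltW.
  by rewrite expRK; lra.
have k3 : npow 1 p = npow (1 / 2) p * npow (1 / 2) p :> R.
  have e12 : 1 = 1 / 2 + 1 / 2 :> R by lra.
  by rewrite {1}e12 npowD.
have k4 : npow (1 / 2) p <= npow (1 / 4) p :> R by apply: npow_le; lra.
apply: le_trans (ler_wpM2l i0 k) _; rewrite e2 e5 -{2}npow_1// k3.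
have n12 := npow_ge0 (1 / 2 : R) p.
have : expR yv * (npow (1 / 2) p * npow (1 / 2) p) <= npow (1 / 4) p.
  rewrite mulrA; apply: le_trans k4; by rewrite ler_piMl.
move/(ler_wpM2l (mulr_ge0 i0 (ltW E0))).
have : 0 <= C * (p%:R^-1 * npow (1 / 4) p) by rewrite !mulr_ge0.
have := mulr_ge0 y0 (mulr_ge0 i0 i0).
by move: (expR 1) (expR yv) (npow (1 / 2) p) (npow (1 / 4) p) (p%:R^-1 : R) => *; lra.
Qed.

Lemma sum_z2 C N : 0 <= C ->
  \sum_(z2v.+1 <= p < N.+1) (12 * yv * npow 2 p + C * npow (1 + 1 / 4) p) <= (12 + 4 * C) * t.
Proof.
move=> C0; rewrite big_split /= -!mulr_sumr.
have y0 : 0 <= 12 * yv by rewrite mulr_ge0// exprn_ge0// ltW// v_gt0.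
have q0 : 0 < 1 / 4 :> R by lra.
have h1 := npow_tail N (@ltr01 R) z2_gt0; have h2 := npow_tail N q0 z2_gt0.
have k1 : npow 1 z2v / 1 <= t ^+ 28 by rewrite divr1 npow_1 ?z2_gt0// inv_z2.
have k2 : npow (1 / 4) z2v <= t ^+ 7.
  apply: (@npow_quarter v 7); first exact: v_gt0.
  by have := inv_z2; rewrite exprVn lef_pV2 ?posrE ?ltr0n ?z2_gt0 ?exprn_gt0 ?v_gt0.
have e1 : yv * t ^+ 28 = t ^+ 12 by exact: (vt_pow 16 12).
have t121 : t ^+ 12 <= t by rewrite -[leRHS]expr1 t_pow_le.
have t71 : t ^+ 7 <= t by rewrite -[leRHS]expr1 t_pow_le.
have m1 := ler_wpM2l y0 (le_trans h1 k1).
have m2 : C * \sum_(z2v.+1 <= n < N.+1) npow (1 + 1 / 4) n <= C * (4 * t).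
  rewrite ler_wpM2l//; apply: le_trans h2 _; rewrite (_ : _ / (1 / 4) = 4 * npow (1 / 4) z2v); last by field.
  by rewrite ler_wpM2l//; exact: le_trans k2 t71.
rewrite [(1 + 1 : R)]/(2 : R) in m1.
move: m1 m2; rewrite -[12 * yv * t ^+ _]mulrA e1; move: (C * \sum_(_ <= _ < _) _) (12 * yv * _) => *; lra.
Qed.
End Params.

(** The inputs of the sieve. In the order of the conclusion they provide the densities [thetav] of
    the conditions, the near independence of two conditions, the negligibility of pairs with a large
    p, and the rarity of cyclic n with a prime factor up to z1. *)
Theorem psum_ranges : exists K v0 : R, [/\ 0 <= K, 16 <= v0 & forall v, v0 <= v ->
  [/\ forall p, prime p -> (z1v v < p <= z2v v)%N ->
        `|psum p (z2v v) (wv v) - yv v / p%:R| <= K * v^-1 ^+ 3 /\ psum p (wv v) (Xv v) <= K * v^-1 ^+ 3,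
      forall p p', prime p -> prime p' -> p != p' -> (z1v v < p <= z2v v)%N -> (z1v v < p' <= z2v v)%N ->
        psum (p * p') (z2v v) (wv v) <= K * v^-1 ^+ 3,
      \sum_((z2v v).+1 <= p < (Xv v).+1 | prime p) p%:R^-1 * psum p 0 (Xv v) <= K * v^-1 &
      forall p, prime p -> (p <= z1v v)%N -> v <= psum p (z2v v) (wv v)]].
Proof.
have [C [M0 [C0 h1]]] := ap_prime R; have [C' [M0' [C0' h2]]] := ap_prime2 R.
(* Up to [P0] the bounds for large moduli may not apply, and [ap_small] takes over. *)
pose P0 := (Num.truncn `|M0|).+4.
have [c [Cs [ds [c0 Cs0 [ds0 hs]]]]] := ap_small R P0.
pose K := 60 + 3 * C + 34 * expR 1 + (200 + 3 * C') + (12 + 4 * (3 * C + 3 * expR 1)).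
have E0 := expR_gt0 (1 : R).
pose v0 := 16 + `|M0| + `|M0'| + (C + 3) + (Cs + 40) / c + ds^-1.
have di0 : 0 < ds^-1 by rewrite invr_gt0.
have ci0 : 0 <= (Cs + 40) / c by rewrite divr_ge0 ?(ltW c0)//; rlra.
have m10 := normr_ge0 M0; have m20 := normr_ge0 M0'.
exists K, v0; split; [by rewrite /K; rlra|by rewrite /v0; rlra|move=> v vv0].
have v16 : 16 <= v by move: vv0 m10 m20 C0 ci0 di0; rewrite /v0; clear; lra.
have vM : M0 <= v by move: vv0 m10 m20 C0 ci0 di0 (ler_norm M0); rewrite /v0; clear; lra.
have vM' : M0' <= v by move: vv0 m10 m20 C0 ci0 di0 (ler_norm M0'); rewrite /v0; clear; lra.
have vC : C + 3 <= v by move: vv0 m10 m20 ci0 di0; rewrite /v0; clear; lra.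
have vc : Cs + 40 <= c * v by rewrite mulrC -ler_pdivrMr//; move: vv0 m10 m20 C0 di0; rewrite /v0; clear; lra.
have vd : ds^-1 <= v by move: vv0 m10 m20 C0 ci0; rewrite /v0; clear; lra.
have v0' : 0 < v by rlra.
have v12 : v <= v ^+ 12 by rewrite -{1}[v]expr1 (v_pow_le v16).
have t3 : 0 <= v^-1 ^+ 3 by rewrite exprn_ge0// invr_ge0 ltW.
have big p : (z1v v < p)%N -> [/\ M0 <= p%:R, M0' <= p%:R, (3 < p)%N & v ^+ 12 <= p%:R].
  move=> zp; have h := gt_z1 zp; have h' := le_trans v12 h.
  split; [exact: le_trans h'|exact: le_trans h'| |exact: h].
  by rewrite -(ltr_nat R); move: v16 h'; clear; lra.
have single p : prime p -> (z1v v < p <= z2v v)%N -> psum p 0 (Xv v) <= yv v * p%:R^-1 + (17 + 3 * C) * v^-1 ^+ 3 /\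
    yv v * p%:R^-1 - (3 + C) * v^-1 ^+ 3 <= psum p 0 (wv v).
  move=> pp /andP[zp pz]; have [b1 b2 b3 b4] := big p zp; have p0 := prime_gt0 pp.
  have pz' := le_z2 v16 pz; split.
    apply: (psum_up v16 C0 (prime_gt1 pp) b4) => x.
    apply: (h1 p pp b3 b1 _ (expR_gt0 _) _).1; apply: (d1_small v16 p0).
    by apply: le_trans pz' _; exact: (v_pow_le v16).
  have ds2 := d2_small v16 p0 pz'.
  have [_ /(_ ds2)[x hx]] := h1 p pp b3 b1 _ (expR_gt0 _) (npow_half_ge p0 (expR_gt0 _) ds2).
  exact: (psum_lo v16 C0 (prime_gt1 pp) b4 (hx x (leqnn x))).
split.
- move=> p pp zpz; have [u l] := single p pp zpz; have /andP[zp pz] := zpz.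
  have [_ _ b3 b4] := big p zp; have s2 := psum_z2 v16 pp (ltnW b3) b4.
  have e1 := psum_cat p (leq0n (z2v v)) (z2_le_w v16).
  have e2 := psum_cat p (leq0n (wv v)) (w_le_X v16).
  have p1 := psum_ge0 p 0 (z2v v); have p2 := psum_ge0 p (wv v) (Xv v).
  have : 0 <= C * v^-1 ^+ 3 by rewrite mulr_ge0. have : 0 <= C' * v^-1 ^+ 3 by rewrite mulr_ge0.
  have : 0 <= expR 1 * v^-1 ^+ 3 by rewrite mulr_ge0// ltW.
  move: u l s2 e1 e2 p1 p2; rewrite /K.
  move: (psum p 0 (Xv v)) (psum p 0 (wv v)) (psum p 0 (z2v v)) (psum p (z2v v) _) (psum p (wv v) _) => a1 a2 a3 a4 a5.
  move: (yv v / _) (v^-1 ^+ 3) t3 (expR 1); clear => a6 T T0 e u l s2 e1 e2 p1 p2 *; split; last by lra.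
  by rewrite ler_norml; apply/andP; split; lra.
- move=> p p' pp pp' npp zpz zpz'; have /andP[zp pz] := zpz; have /andP[zp' pz'] := zpz'.
  have [b1 b2 b3 b4] := big p zp; have [b1' b2' b3' b4'] := big p' zp'.
  have m0 : (0 < p * p')%N by rewrite muln_gt0 !prime_gt0.
  have mv : (p * p')%:R <= v ^+ 64.
    by rewrite natrM (exprD v 32 32 : v ^+ 64 = _); apply: ler_pM; rewrite ?(le_z2 v16).
  have hM : M0' <= (p * p')%:R by apply: le_trans b2 _; rewrite ler_nat leq_pmulr// prime_gt0.
  have [hu _] := h2 p p' pp pp' (ltnW b3) (ltnW b3') npp hM _ (expR_gt0 _) (d1_small v16 m0 mv).
  have {}hu := hu (Xv v); rewrite expRK opprK in hu.
  have tp k : 0 <= v^-1 ^+ k by rewrite exprn_ge0// invr_ge0 ltW.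
  have ip q : prime q -> v ^+ 12 <= q%:R -> q.-1%:R^-1 <= 2 * v^-1 ^+ 12.
    move=> pq qv; have [_ r2] := inv_pred (prime_gt1 pq); have qt := inv_t12 v16 qv.
    have [i0 i2] := @inv_prime_bounds R q pq.
    by move: (q%:R^-1 : R) (v^-1 ^+ 12) i0 i2 r2 qt; clear => x T *; nra.
  have w4 : v ^+ 4 <= yv v by exact: (v_pow_le v16).
  have e1 : (yv v + v ^+ 4) / (p.-1 * p'.-1)%:R <= 8 * v^-1 ^+ 3.
    apply: le_trans (_ : 8 * v^-1 ^+ 8 <= _); last by rewrite ler_wpM2l// (t_pow_le v16).
    rewrite -(vt_pow v16 16 8) -/(yv v) natrM invfM.
    apply: le_trans (_ : (2 * yv v) * ((2 * v^-1 ^+ 12) * (2 * v^-1 ^+ 12)) <= _).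
      apply: ler_pM; rewrite ?mulr_ge0 ?invr_ge0 ?addr_ge0 ?exprn_ge0 ?(ltW v0')//; first by move: w4; clear; lra.
      by apply: ler_pM; rewrite ?invr_ge0// ip.
    rewrite (_ : v^-1 ^+ (16 + 8) = v^-1 ^+ 12 * v^-1 ^+ 12); last by rewrite -exprD.
    by move: (yv v) (v^-1 ^+ 12); clear => *; lra.
  have e2 : npow (1 / 4) (p * p') <= v^-1 ^+ 3.
    apply: le_trans (_ : v^-1 ^+ 6 <= _); last by rewrite (t_pow_le v16).
    apply: npow_quarter => //; rewrite natrM (exprD v 12 12 : v ^+ 24 = _).
    by apply: ler_pM; rewrite ?exprn_ge0 ?(ltW v0').
  have hb : expR (expR (- (yv v + v ^+ 4)) * expR (yv v)) <= 3.
    apply: le_trans (boost_le v16) _; have : v^-1 ^+ 16 <= 1 by rewrite -[leRHS](expr0 v^-1) (t_pow_le v16).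
    by move: (v^-1 ^+ 16); clear => *; lra.
  have e3 : psum (p * p') 0 (Xv v) <= 3 * ((8 + C') * v^-1 ^+ 3).
    have lX : ln (Xv v)%:R <= expR (yv v) by apply: lnX_le.
    apply: le_trans (psum_le_apsum (p * p') (expR_ge0 (- (yv v + v ^+ 4))) lX) _.
    apply: ler_pM; rewrite ?expR_ge0 ?apsum_ge0//; apply: le_trans hu _.
    by apply: le_trans (lerD e1 (ler_wpM2l C0' e2)) _; rewrite -mulrDl.
  have := psum_cat (p * p') (leq0n (z2v v)) (leq_trans (z2_le_w v16) (w_le_X v16)).
  have := psum_cat (p * p') (z2_le_w v16) (w_le_X v16).
  have := psum_ge0 (p * p') 0 (z2v v); have := psum_ge0 (p * p') (wv v) (Xv v).
  have : 0 <= (60 + 3 * C + 34 * expR 1 + 176 + (12 + 4 * (3 * C + 3 * expR 1))) * v^-1 ^+ 3.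
    by rewrite mulr_ge0//; move: C0 E0; clear; lra.
  by move: e3; rewrite /K; move: (v^-1 ^+ 3) (psum _ _ _) (psum _ _ _) (psum _ _ _) (psum _ _ _) (psum _ _ _); clear => *; lra.
- have C3 : 0 <= 3 * C + 3 * expR 1 by move: C0 E0; clear; lra.
  apply: le_trans (_ : (12 + 4 * (3 * C + 3 * expR 1)) * v^-1 <= _); last first.
    by rewrite ler_wpM2r ?invr_ge0 ?(ltW v0')// /K; move: C0 C0' E0; clear; lra.
  apply: le_trans (sum_z2 v16 (Xv v) C3); rewrite big_mkcond big_nat_cond [leRHS]big_nat_cond.
  apply: ler_sum => p /andP[/andP[zp _] _]; case: ifP => [pp|_]; last first.
    by rewrite addr_ge0 ?mulr_ge0 ?npow_ge0 ?exprn_ge0 ?(ltW v0').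
  have pv := gt_z2 zp; have zp1 := leq_ltn_trans (z1_le_z2 v16) zp.
  have [b1 b2 b3 b4] := big p zp1; apply: (z2_large_psum v16 C0 pp zp) => pY x.
  by apply: (h1 p pp b3 b1 _ (expR_gt0 _) _).1; apply: d1_le_npow => //; exact: prime_gt0.
move=> p pp pz; have p0 := prime_gt0 pp; have pv := le_z1 v16 pz.
have t31 : v^-1 ^+ 3 <= 1 by rewrite -[leRHS](expr0 v^-1) (t_pow_le v16).
have g15 := yv_gap v16; have g1 : 1 <= v ^+ 14 by exact: (v_pow_ge1 v16).
have [pP|Pp] := leqP p P0.
  have dd : expR (- (yv v - 2 * v ^+ 4)) <= ds.
    rewrite -[leRHS]invrK expRN lef_pV2 ?posrE ?expR_gt0//; apply: le_trans vd _.
    apply: le_trans (expR_ge1Dx _); have : v <= v ^+ 15 by rewrite -{1}[v]expr1 (v_pow_le v16).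
    by move: g15; clear; lra.
  have [x hx] := hs p pp pP _ (expR_gt0 _) dd; apply: le_trans (psum_lo_gen v16 (hx x (leqnn x))).
  rewrite expRK opprK.
  have k1 : c * v ^+ 15 <= c * (yv v - 2 * v ^+ 4) by rewrite ler_wpM2l ?(ltW c0)//; move: g15; clear; lra.
  have k2 : (Cs + 40) * v ^+ 14 <= c * v ^+ 15.
    rewrite (_ : c * v ^+ 15 = (c * v) * v ^+ 14); last by rewrite -mulrA -exprS.
    by rewrite ler_wpM2r// (le_trans _ g1).
  have k3 : (Cs + 40) * v <= (Cs + 40) * v ^+ 14.
    by rewrite ler_wpM2l//; [move: Cs0; clear; lra|rewrite -{1}[v]expr1 (v_pow_le v16)].
  have k4 : 0 <= Cs * (v - 1) by rewrite mulr_ge0//; move: v16; clear; lra.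
  by move: k1 k2 k3 k4 t31 v16; move: (c * (_ - _)) (c * _) (_ * v ^+ 14) (v^-1 ^+ 3); clear => *; lra.
have pM : M0 <= p%:R.
  apply: le_trans (ler_norm _) _; apply: le_trans (ltW (lt_truncnS _)) _; rewrite ler_nat.
  by apply: leq_trans (ltnW Pp); rewrite /P0 -addn4 -addn1 leq_add2l.
have p3 : (3 < p)%N by apply: leq_trans Pp; rewrite /P0 !ltnS.
have ds2 : expR (- (yv v - 2 * v ^+ 4)) * (64 * p%:R ^+ 2 * lm R p ^+ 2) <= 1.
  by apply: (d2_small v16 p0); apply: le_trans pv _; exact: (v_pow_le v16).
have [_ /(_ ds2)[x hx]] := h1 p pp p3 pM _ (expR_gt0 _) (npow_half_ge p0 (expR_gt0 _) ds2).
apply: le_trans (psum_lo_gen v16 (hx x (leqnn x))); rewrite expRK opprK.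
have n1 : npow (1 / 4) p <= 1 :> R by apply: npow_le1; clear; lra.
have k1 : v ^+ 3 <= (yv v - 2 * v ^+ 4) / p.-1%:R.
  rewrite ler_pdivlMr; last by rewrite ltr0n -ltnS prednK// prime_gt1.
  apply: le_trans (_ : v ^+ 15 <= _); last by move: g15; clear; lra.
  rewrite (exprD v 3 12 : v ^+ 15 = _) ler_wpM2l ?exprn_ge0 ?(ltW v0')//.
  by apply: le_trans pv; rewrite ler_nat leq_pred.
have k2 : C * npow (1 / 4) p <= C by rewrite ler_piMr.
have k3 : 256 * v <= v ^+ 3 by rewrite exprSr ler_wpM2r ?(ltW v0')// (v2_ge v16).
by move: k1 k2 k3 t31 vC v16 C0; move: (_ / p.-1%:R) (C * npow _ _) (v ^+ 3) (v^-1 ^+ 3); clear => *; lra.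
Qed.
End APSums.

(** * Cyclic numbers and the sifted set *)

Section CyclicNumbers.
Implicit Types (n p q X : nat).

Definition cyc n := gcdn n (totient n) == 1%N.

Lemma eqmod1 p q : prime q -> (q == 1 %[mod p]) = (p %| q.-1)%N.
Proof. by move=> pq; rewrite eqn_mod_dvd ?prime_gt0// subn1. Qed.

Lemma cyc_no_pair n p q : cyc n -> prime p -> prime q -> (0 < n)%N -> (p %| n)%N -> (q %| n)%N ->
  (q == 1 %[mod p]) = false.
Proof.
move=> cn pp pq n0 pn qn; apply/negP; rewrite eqmod1// => pq1.
have pt : (p %| totient n)%N.
  rewrite totientE// (big_rem q) /=; last by rewrite mem_primes pq n0 qn.
  by rewrite !dvdn_mulr.
have : (p %| gcdn n (totient n))%N by rewrite dvdn_gcd pn.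
by rewrite (eqP cn) dvdn1 => /eqP p1; rewrite p1 in pp.
Qed.

Lemma dvdn_prod_seq p (s : seq nat) (F : nat -> nat) : prime p ->
  (p %| \prod_(q <- s) F q)%N -> exists2 q, q \in s & (p %| F q)%N.
Proof.
move=> pp; elim: s => [|a s ih]; first by rewrite big_nil dvdn1 => /eqP p1; rewrite p1 in pp.
rewrite big_cons Euclid_dvdM// => /orP[h|/ih[q qs h]]; first by exists a; rewrite ?mem_head.
by exists q; rewrite // inE qs orbT.
Qed.

(** A prime p dividing n and phi(n) divides some factor (q - 1) q^(a-1) of phi(n): either q = 1 mod
    p, and then q differs from p, or q = p with a >= 2. *)
Lemma not_cyc n : (0 < n)%N -> ~~ cyc n -> exists p, [/\ prime p, (p %| n)%N &
  (p * p %| n)%N \/ exists q, [/\ prime q, (q == 1 %[mod p]) & (p * q %| n)%N]].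
Proof.
move=> n0 ncn; pose g := gcdn n (totient n).
have g0 : (0 < g)%N by rewrite gcdn_gt0 n0.
have g1 : (1 < g)%N by rewrite ltn_neqAle g0 andbT eq_sym.
have pp := pdiv_prime g1; have := pdiv_dvd g; move: (pdiv g) pp => p pp.
rewrite dvdn_gcd => /andP[pn]; rewrite totientE// => /(dvdn_prod_seq pp)[q].
rewrite mem_primes => /and3P[pq _ qn]; rewrite Euclid_dvdM// => h.
exists p; split => //; case/orP: h => [h|].
  right; exists q; split => //; first by rewrite eqmod1.
  rewrite Gauss_dvd ?pn// prime_coprime// dvdn_prime2//; apply: contraTneq h => ->.
  by rewrite gtnNdvd//; [rewrite -ltnS prednK ?prime_gt1 ?prime_gt0|rewrite prednK ?prime_gt0].
rewrite Euclid_dvdX// dvdn_prime2// => /andP[/eqP e l1]; left.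
rewrite -e in l1; apply: dvdn_trans (pfactor_dvdnn p n); rewrite -[(p * p)%N]/(p ^ 2)%N dvdn_exp2l//.
by case: (logn p n) l1 => [|[|k]].
Qed.

Section Compare.
Variables z1 z2 w X : nat.
Hypotheses (z12 : (z1 <= z2)%N) (z2w : (z2 <= w)%N) (wX : (w <= X)%N).

Definition prange a b := [seq p <- index_iota a.+1 b.+1 | prime p].
Definition Qs p := [seq q <- index_iota z2.+1 w.+1 | prime q && (q == 1 %[mod p])].

Lemma mem_prange a b p : (p \in prange a b) = [&& prime p, (a < p)%N & (p <= b)%N].
Proof. by rewrite mem_filter mem_index_iota ltnS. Qed.
Lemma mem_Qs p q : (q \in Qs p) = [&& prime q, q == 1 %[mod p], (z2 < q)%N & (q <= w)%N].
Proof. by rewrite mem_filter mem_index_iota ltnS -andbA. Qed.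

Lemma count_has (T U : Type) (P : U -> pred T) (s : seq U) (l : seq T) :
  (count (fun x => has (P^~ x) s) l <= \sum_(a <- s) count (P a) l)%N.
Proof.
elim: s => [|a s ih]; first by rewrite big_nil /= (eq_count (a2 := pred0)) ?count_pred0.
by rewrite big_cons; apply: leq_trans (leq_add (leqnn _) ih); rewrite -count_predUI leq_addr.
Qed.

Lemma count_leqor (T : eqType) (P A B : pred T) (l : seq T) :
  {in l, forall x, P x -> A x || B x} -> (count P l <= count A l + count B l)%N.
Proof.
move=> h; rewrite -count_predUI; apply: leq_trans (leq_addr _ _).
rewrite -!sum1_count big_mkcond [leqRHS]big_mkcond big_seq [leqRHS]big_seq.
by apply: leq_sum => x /h /=; case: (P x) => // /(_ isT) ->.
Qed.

Lemma count_dvd d : (0 < d)%N -> count (fun n => d %| n)%N (iota 1 X) = (X %/ d)%N.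
Proof.
move=> d0; rewrite -(eq_count (a1 := fun n => (d %| n)%N && true)) => [|n]; last by rewrite andbT.
by rewrite (count_mul predT)// count_predT size_iota.
Qed.

(** A cyclic n is never blocked, so if [NPhi] misses it, it has a prime factor p <= z1, and then no
    factor in [Qs p]. *)
Lemma cyc_lower : (count cyc (iota 1 X) <=
  NPhi Qs X (prange z1 z2) (prange 0 z1) + \sum_(p <- prange 0 z1) Phi (X %/ p) (Qs p))%N.
Proof.
apply: leq_trans (_ : NPhi Qs X (prange z1 z2) (prange 0 z1) + \sum_(p <- prange 0 z1) count (fun n => (p %| n)%N && sifted (Qs p) n) (iota 1 X) <= _)%N; last first.
  rewrite leq_add2l big_seq [leqRHS]big_seq; apply: leq_sum => p; rewrite mem_prange => /and3P[pp _ pz].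
  rewrite count_mul ?prime_gt0//; apply: eq_leq; apply: eq_count => m; apply: sifted_mul => //.
    by apply/allP => q; rewrite mem_Qs => /and4P[].
  by rewrite mem_Qs; apply/negP => /and4P[_ _ zp _]; have := leq_trans pz z12; rewrite leqNgt zp.
apply: leq_trans (leq_add (leqnn _) (count_has (fun p n => (p %| n)%N && sifted (Qs p) n) _ _)).
apply: count_leqor => n; rewrite mem_iota => /andP[n0 _] cn.
have noq p : prime p -> (p %| n)%N -> sifted (Qs p) n.
  move=> pp pn; apply/allP => q; rewrite mem_Qs => /and4P[pq q1 _ _]; apply/negP => qn.
  by rewrite (cyc_no_pair cn pp pq n0 pn qn) in q1.
case: (boolP (sifted (prange 0 z1) n)) => [sn|/allPn[p pS]]; last first.
  rewrite negbK => pn; apply/orP; right; apply/hasP; exists p => //; rewrite pn noq//.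
  by move: pS; rewrite mem_prange => /and3P[].
apply/orP; left; apply/allP => p; rewrite mem_prange => /and3P[pp _ _].
rewrite /blocked; apply/negP => /andP[pn]; have := noq p pp pn; rewrite /sifted.
by rewrite (all_predC (fun q => q %| n)%N) => /negP.
Qed.

(** The witnesses q against cyclicity that the conditions tested by [NPhi] do not exclude. *)
Definition badq p := [seq q <- index_iota 1 X.+1 | (prime q && (q == 1 %[mod p])) && ((z2 < p) || (q <= z2) || (w < q))%N].

(** If n survives the sieve without being cyclic, the offending p exceeds z1, and n is divisible by
    p^2 or by p q with q in [badq p]. *)
Lemma cyc_upper_nat : (NPhi Qs X (prange z1 z2) (prange 0 z1) <= count cyc (iota 1 X) +
  (\sum_(p <- prange z1 X) X %/ (p * p) + \sum_(p <- prange z1 X) \sum_(q <- badq p) X %/ (p * q)))%N.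
Proof.
pose bad p n := ((p * p %| n) || has (fun q => p * q %| n) (badq p))%N.
apply: leq_trans (_ : count cyc (iota 1 X) + \sum_(p <- prange z1 X) count (bad p) (iota 1 X) <= _)%N; last first.
  rewrite leq_add2l -big_split big_seq [leqRHS]big_seq; apply: leq_sum => p /=.
  rewrite mem_prange => /and3P[pp _ _]; have p0 := prime_gt0 pp.
  rewrite -count_dvd ?muln_gt0 ?p0//; apply: leq_trans (_ : count _ _ + count (fun n => has (fun q => p * q %| n)%N (badq p)) (iota 1 X) <= _)%N.
    by apply: (@count_leqor _ _ (fun n => p * p %| n)%N) => n _.
  rewrite leq_add2l; apply: leq_trans (count_has (fun q n => p * q %| n)%N _ _) _.
  rewrite big_seq [leqRHS]big_seq; apply: leq_sum => q; rewrite mem_filter => /andP[/andP[/andP[pq _] _] _].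
  by rewrite count_dvd// muln_gt0 p0 prime_gt0.
apply: leq_trans (leq_add (leqnn _) (count_has bad _ _)).
apply: count_leqor => n; rewrite mem_iota add1n ltnS => /andP[n0 nX] /andP[sn bn].
case: (boolP (cyc n)) => //= ncn; have [p [pp pn h]] := not_cyc n0 ncn.
have dX d : (d %| n)%N -> (d <= X)%N by move=> /(dvdn_leq n0) dn; exact: leq_trans dn nX.
have z1p : (z1 < p)%N.
  rewrite ltnNge; apply/negP => pz; have := allP sn p; rewrite mem_prange pp prime_gt0// pz => /(_ isT).
  by rewrite pn.
apply/hasP; exists p; first by rewrite mem_prange pp z1p dX.
rewrite /bad; case: h => [->//|[q [pq q1 pqn]]]; apply/orP; right; apply/hasP; exists q => //.
have qn : (q %| n)%N := dvdn_trans (dvdn_mull p (dvdnn q)) pqn.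
rewrite mem_filter mem_index_iota pq q1 /= prime_gt0// ltnS dX// andbT.
case: (ltnP z2 p) => //= pz2; have := allP bn p; rewrite mem_prange pp z1p pz2 => /(_ isT).
rewrite /blocked pn /=; case: (leqP q z2) => //= z2q; case: (ltnP w q) => //= qw.
by move/negP; case; apply/hasP; exists q; rewrite // mem_Qs pq q1 z2q qw.
Qed.

Variable R : realType.

Lemma cyc_upper : (NPhi Qs X (prange z1 z2) (prange 0 z1))%:R <= (count cyc (iota 1 X))%:R +
  X%:R * (\sum_(p <- prange z1 X) npow 2 p + \sum_(p <- prange z1 X) p%:R^-1 *
    (if (z2 < p)%N then psum R p 0 X else psum R p 0 z2 + psum R p w X)) :> R.
Proof.
have h : (NPhi Qs X (prange z1 z2) (prange 0 z1))%:R <= (count cyc (iota 1 X) +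
  (\sum_(p <- prange z1 X) X %/ (p * p) + \sum_(p <- prange z1 X) \sum_(q <- badq p) X %/ (p * q)))%:R :> R.
  by rewrite ler_nat cyc_upper_nat.
have dv d : (0 < d)%N -> (X %/ d)%:R <= X%:R * d%:R^-1 :> R by move=> d0; have [] := divn_real R X d0.
apply: le_trans h _; rewrite !natrD lerD2l mulrDr !natr_sum; apply: lerD.
  rewrite mulr_sumr big_seq [leRHS]big_seq; apply: ler_sum => p; rewrite mem_prange => /and3P[pp _ _].
  apply: le_trans (dv _ _) _; first by rewrite muln_gt0 prime_gt0.
  by rewrite -[2]/(1 + 1) npowD !npow_1 ?prime_gt0// natrM invfM.
rewrite mulr_sumr big_seq [leRHS]big_seq; apply: ler_sum => p; rewrite mem_prange => /and3P[pp _ _].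
apply: le_trans (_ : X%:R * (p%:R^-1 * \sum_(q <- badq p) q%:R^-1) <= _).
  rewrite natr_sum !mulr_sumr big_seq [leRHS]big_seq; apply: ler_sum => q.
  rewrite mem_filter => /andP[/andP[/andP[pq _] _] _]; rewrite -invfM -natrM.
  by apply: dv; rewrite muln_gt0 !prime_gt0.
rewrite ler_wpM2l// ler_wpM2l ?invr_ge0// /badq big_filter.
case: ltnP => zp; first by rewrite /psum; under eq_bigl do rewrite /= andbT.
rewrite (@big_cat_nat _ _ _ z2.+1)//=; last by rewrite ltnS (leq_trans z2w).
apply: lerD.
  by rewrite /psum big_mkcond [leRHS]big_mkcond; apply: ler_sum => q _; case: ifP => [/andP[->]|_] //; case: ifP; rewrite ?invr_ge0.
rewrite (@big_cat_nat _ _ _ w.+1)//=.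
rewrite [X in X + _]big1_seq ?add0r; last first.
  move=> q /andP[/andP[_ h]]; rewrite mem_index_iota => /andP[zq qw].
  by move: h; rewrite leqNgt zq /= ltnNge -ltnS qw.
by rewrite /psum big_mkcond [leRHS]big_mkcond; apply: ler_sum => q _; case: ifP => [/andP[->]|_] //; case: ifP; rewrite ?invr_ge0.
Qed.
End Compare.
End CyclicNumbers.

(** * The density model for cyclic numbers *)

Section Assembly.
Variable R : realType.
Implicit Types (v : R) (p q X : nat).

Lemma expN_lip (a b : R) : 0 <= a -> 0 <= b -> `|expR (- a) - expR (- b)| <= `|a - b|.
Proof.
wlog ab : a b / a <= b.
  by move=> h a0 b0; have [/h->//|/ltW ba] := leP a b; rewrite distrC [leRHS]distrC h.
move=> a0 b0; rewrite ger0_norm ?subr_ge0 ?ler_expR ?lerN2// distrC ger0_norm ?subr_ge0//.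
have e : expR (- b) = expR (- a) * expR (- (b - a)) by rewrite -expRD; congr expR; ring.
have e1 : expR (- a) <= 1 by rewrite -[leRHS]expR0 ler_expR oppr_le0.
have := expR_ge1Dx (- (b - a)); have := expR_gt0 (- a); rewrite e.
have : expR (- (b - a)) <= 1 by rewrite -[leRHS]expR0 ler_expR oppr_le0 subr_ge0.
by move: (expR (- a)) (expR _) e1 => x z *; nra.
Qed.

Lemma Vol_exp S : all prime S -> Vol R S = expR (- \sum_(s <- S) kap R s).
Proof.
elim: S => [|s S ih] /=; first by rewrite /Vol !big_nil oppr0 expR0.
move=> /andP[ps pS]; rewrite Vol_cons ih// big_cons opprD expRD; congr (_ * _).
have [a0 a1] := @inv_prime_bounds R s ps.
by rewrite /kap opprK lnK// posrE; lra.
Qed.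

Lemma sum_kap_bounds S : all prime S ->
  rsum R S <= \sum_(s <- S) kap R s <= rsum R S + 2 * \sum_(s <- S) npow 2 s.
Proof.
move=> /allP pS; rewrite /rsum mulr_sumr -big_split /=; apply/andP; split;
  rewrite big_seq [leRHS]big_seq; apply: ler_sum => s /pS ps; have /andP[] := kap_bounds R (prime_gt1 ps);
  by rewrite npow_1 ?prime_gt0.
Qed.

Lemma sub_sum (F : nat -> R) (S T : seq nat) : uniq S -> uniq T -> {subset S <= T} -> (forall n, 0 <= F n) ->
  \sum_(s <- S) F s <= \sum_(s <- T) F s.
Proof.
move=> uS uT ST F0; have e : perm_eq S [seq x <- T | x \in S].
  apply: uniq_perm => // [|x]; first exact: filter_uniq.
  by rewrite mem_filter; case: (boolP (x \in S)) => // /ST ->.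
by rewrite (perm_big _ e) big_filter big_mkcond; apply: ler_sum => i _; case: ifP.
Qed.

(** From r^r <= r! e^r and H <= r e^(-2). *)
Lemma pow_fact_le (H : R) r : 0 <= H -> expR 2 * H <= r%:R -> H ^+ r / r`!%:R <= expR (- r%:R).
Proof.
move=> H0 h; rewrite ler_pdivrMr ?ltr0n ?fact_gt0//.
have h1 := exp_pow_le r (@ltr01 R) (ler0n R r); rewrite invr1 expr1n mulr1 mul1r in h1.
have h2 : H <= r%:R * expR (- 2) by rewrite expRN ler_pdivlMr ?expR_gt0// mulrC.
apply: le_trans (_ : (r%:R * expR (- 2)) ^+ r <= _).
  by rewrite lerXn2r ?nnegrE ?mulr_ge0 ?expR_ge0.
rewrite exprMn; apply: le_trans (ler_wpM2r (exprn_ge0 _ (expR_ge0 _)) h1) _.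
rewrite -expRM_natl mulrC [leRHS]mulrC mulrCA ler_wpM2l// -expRD ler_expR; lra.
Qed.

Lemma expR2_le : expR 2 <= 16 :> R.
Proof.
have e : expR 2 = (expR (1 / 2) ^+ 4 : R) by rewrite -expRM_natl; congr expR; lra.
have h : expR (1 / 2) <= 2 :> R.
  have := expR_ge1Dx (- (1 / 2) : R); rewrite expRN; have := expR_gt0 (1 / 2 : R).
  move: (expR _) => x x0 h; have : 1 / 2 * x <= 1; last by lra.
  by rewrite -[leRHS](@mulVf _ x) ?gt_eqF// ler_wpM2r ?(ltW x0)//; lra.
rewrite e; apply: le_trans (_ : 2 ^+ 4 <= _); first by rewrite lerXn2r ?nnegrE ?expR_ge0.
by rewrite -natrX.
Qed.

Section Fixed.
Variables (v C1 : R).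
Hypothesis v16 : 16 <= v.
Hypothesis C1v : C1 <= v.
Hypothesis merw : merL R (wv v) <= yv v + C1.
Let v0 : 0 < v. Proof. by apply: lt_le_trans v16. Qed.
Let X := Xv v. Let w := wv v. Let z1 := z1v v. Let z2 := z2v v.
Let t := v^-1.
Let e := expR (- v ^+ 33).
Let k := expR (expR (yv v) - 2 * v ^+ 33).

Lemma goodS_rsum T : goodS w T -> rsum R T <= 2 * yv v.
Proof.
move=> gT; have [uT pT] := goodS_prime gT.
apply: le_trans (_ : merL R w <= _); last first.
  have : v <= yv v by rewrite -{1}[v]expr1 (v_pow_le v16).
  by have := merw; have := C1v; rewrite -/w; lra.
have /andP[h _] := sum_kap_bounds pT; apply: le_trans h _.
have k0 n : prime n -> 0 <= kap R n.
  by move=> pn; have /andP[h _] := kap_bounds R (prime_gt1 pn); apply: le_trans h; exact: npow_ge0.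
rewrite /merL -[leRHS]big_filter; pose F n := if prime n then kap R n else 0.
have -> : \sum_(s <- T) kap R s = \sum_(s <- T) F s.
  by rewrite big_seq [RHS]big_seq; apply: eq_bigr => s /(allP pT) ps; rewrite /F ps.
have -> : \sum_(i <- [seq i <- index_iota 1 w.+1 | prime i]) kap R i = \sum_(i <- [seq i <- index_iota 1 w.+1 | prime i]) F i.
  by rewrite !big_filter; apply: eq_bigr => s ps; rewrite /F ps.
apply: sub_sum => //; first by rewrite filter_uniq// iota_uniq.
  move=> s sT; have /andP[_ /allP/(_ s sT)/andP[ps sw]] := gT.
  by rewrite mem_filter ps mem_index_iota prime_gt0// ltnS.
by move=> n; rewrite /F; case: ifP => // /k0.
Qed.

Lemma goodS_size T : goodS w T -> (size T <= w)%N.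
Proof.
move=> /andP[uT /allP pT]; rewrite -[leqRHS](size_iota 1); apply: uniq_leq_size => // s /pT /andP[ps sw].
by rewrite mem_iota prime_gt0// add1n ltnS.
Qed.

Lemma E_ge : v ^+ 15 <= expR (yv v - v ^+ 4) /\ v ^+ 40 * expR (yv v - v ^+ 4) <= expR (yv v).
Proof.
split.
  have := expR_ge1Dx (yv v - v ^+ 4); have := yv_gap v16; have := v_pow_ge1 v16 4; lra.
have -> : expR (yv v) = expR (v ^+ 4) * expR (yv v - v ^+ 4) by rewrite -expRD; congr expR; ring.
rewrite ler_wpM2r ?expR_ge0//; apply: le_trans (pow_le_exp3 v16 _) _ => //.
by rewrite ler_expR (v_pow_le v16).
Qed.

(** The depth r, about v^33, exceeds e^2 times the reciprocal sum, which is at most 2 v^16; so the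
    main error is at most exp (- v^33). The remainder (3 + 2w)^r has logarithm of order v^33 e^(y -
    v^4), far below e^y: this is what the gap v^4 in the choice of w is for. *)
Lemma sieve_good T Y : goodS w T -> `|(Phi Y T)%:R - Y%:R * Vol R T| <= Y%:R * e + k.
Proof.
move=> gT; have [uT pT] := goodS_prime gT; pose r := (Num.truncn (v ^+ 33)).+1.
apply: le_trans (sieve_err R r Y uT pT) _; have rv : v ^+ 33 <= r%:R by apply/ltW/lt_truncnS.
have v33 := v_pow_ge1 v16 33.
apply: lerD.
  rewrite ler_wpM2l//; apply: le_trans (pow_fact_le (rsum_ge0 R T) _) _; last by rewrite ler_expR lerN2.
  apply: le_trans rv; apply: le_trans (ler_pM _ _ expR2_le (goodS_rsum gT)) _; rewrite ?expR_ge0 ?rsum_ge0//.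
  rewrite (exprD v 17 16 : v ^+ 33 = _) -/(yv v); have : 0 <= yv v by rewrite exprn_ge0// ltW.
  have : 32 <= v ^+ 17.
    have : v * v <= v ^+ 17 by rewrite -expr2 (v_pow_le v16).
    by have := v16; nra.
  by move: (v ^+ 17) (yv v) => *; nra.
have [E1 E2] := E_ge; set E := expR (yv v - v ^+ 4) in E1 E2.
have r2 : r%:R <= 2 * v ^+ 33.
  have h : (Num.truncn (v ^+ 33))%:R <= v ^+ 33 by rewrite Num.Theory.truncn_le (le_trans _ v33).
  by rewrite /r -natr1; lra.
apply: le_trans (_ : expR (4 + E) ^+ r <= _).
  rewrite lerXn2r ?nnegrE ?expR_ge0 ?addr_ge0 ?mulr_ge0//.
  have wE : w%:R <= expR E by rewrite Num.Theory.truncn_le expR_ge0.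
  have ws : (size T)%:R <= w%:R :> R by rewrite ler_nat goodS_size.
  have w1 : 1 <= w%:R :> R by rewrite ler1n w_gt0.
  have e4 : 5 <= expR 4 :> R by have := expR_ge1Dx (4 : R); lra.
  apply: le_trans (_ : 5 * expR E <= _); first by lra.
  by rewrite expRD ler_wpM2r ?expR_ge0.
rewrite -expRM_natl ler_expR lerBrDr.
have v1 : 1 <= v ^+ 15 by exact: v_pow_ge1.
have v4 : 4 <= v ^+ 15.
  by apply: le_trans (_ : v <= _); [have := v16; lra|rewrite -{1}[v]expr1 (v_pow_le v16)].
apply: le_trans E2; rewrite (exprD v 33 7 : v ^+ 40 = _).
have v7 : 6 <= v ^+ 7.
  by apply: le_trans (_ : v <= _); [have := v16; lra|rewrite -{1}[v]expr1 (v_pow_le v16)].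
have : r%:R * (4 + E) <= (2 * v ^+ 33) * (2 * E) by apply: ler_pM; rewrite ?addr_ge0 ?expR_ge0//; lra.
have : v ^+ 33 * E * 6 <= v ^+ 33 * E * v ^+ 7 by rewrite ler_wpM2l// mulr_ge0 ?expR_ge0//; lra.
have : v ^+ 33 * 1 <= v ^+ 33 * E by rewrite ler_wpM2l//; lra.
rewrite (_ : v ^+ 33 * v ^+ 7 * E = v ^+ 33 * E * v ^+ 7); last by ring.
by move: (v ^+ 33 * E * v ^+ 7) (v ^+ 33 * E) (r%:R * _) (v ^+ 33) => *; lra.
Qed.

Lemma X_big : expR (expR (yv v)) <= 2 * X%:R.
Proof.
have := lt_truncnS (expR (expR (yv v))); rewrite -natr1 -/(Xv v) -/X => h.
by have : 1 <= X%:R :> R by [rewrite ler1n X_gt0]; lra.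
Qed.

Lemma k_bounds : 1 <= k <= 2 * X%:R * e.
Proof.
have [E1 E2] := E_ge; apply/andP; split.
  rewrite /k -[leLHS]expR0 ler_expR subr_ge0; apply: le_trans E2.
  rewrite (exprD v 33 7 : v ^+ 40 = _) -mulrA mulrC ler_wpM2l ?exprn_ge0 ?(ltW v0)//.
  have : 1 <= v ^+ 15 by exact: v_pow_ge1. have := v16.
  have : v <= v ^+ 7 by rewrite -{1}[v]expr1 (v_pow_le v16).
  by move: (v ^+ 7) (v ^+ 15) (expR _) E1 => *; nra.
rewrite /k /e expRD; apply: ler_pM; rewrite ?expR_ge0 ?X_big// ler_expR.
by have := v_pow_ge1 v16 33; lra.
Qed.

Let Q := Qs z2 w.
Let I := prange z1 z2.
Let S0 := prange 0 z1.

Lemma Q_good p : goodS w (Q p).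
Proof.
rewrite /goodS filter_uniq ?iota_uniq//=; apply/allP => q; rewrite mem_Qs => /and4P[pq _ _ qw].
by rewrite pq.
Qed.
Lemma Q_gt p q : q \in Q p -> (z2 < q)%N. Proof. by rewrite mem_Qs => /and4P[]. Qed.
Lemma I_good : goodI z2 I.
Proof. by rewrite /goodI filter_uniq ?iota_uniq//=; apply/allP => q; rewrite mem_prange => /and3P[-> _ ->]. Qed.
Lemma S0_good : goodS w S0.
Proof.
rewrite /goodS filter_uniq ?iota_uniq//=; apply/allP => q; rewrite mem_prange => /and3P[-> _ h] /=.
by apply: leq_trans h _; apply: leq_trans (z1_le_z2 v16) (z2_le_w v16).
Qed.
Lemma IS_disj : disj I S0.
Proof.
apply/allP => q; rewrite !mem_prange => /and3P[_ h _]; apply/negP => /and3P[_ _ h2].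
by rewrite leqNgt h in h2.
Qed.

Lemma I_size : 2 ^+ size I <= expR (v ^+ 32) :> R.
Proof.
have hs : (size I)%:R <= v ^+ 32.
  apply: le_trans (_ : z2%:R <= _).
    rewrite ler_nat -[leqRHS](size_iota 1); apply: uniq_leq_size; first by rewrite filter_uniq ?iota_uniq.
    by move=> q; rewrite mem_prange mem_iota add1n ltnS => /and3P[pq _ ->]; rewrite prime_gt0.
  by rewrite Num.Theory.truncn_le exprn_ge0// ltW.
apply: le_trans (_ : expR 1 ^+ size I <= _).
  by rewrite lerXn2r ?nnegrE ?expR_ge0//; have := expR_ge1Dx (1 : R); lra.
by rewrite -expRM_natl mulr1 ler_expR.
Qed.

(** The number of branches, at most exp (v^32), is beaten by the sieve error exp (- v^33). *)
Lemma NPhi_model : `|(NPhi Q X I S0)%:R - X%:R * Mod R Q I S0| <= 5 * X%:R * t.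
Proof.
have e0 : 0 <= e by exact: expR_ge0.
apply: le_trans (NPhi_err (z2_le_w v16) Q_good Q_gt X e0 sieve_good I_good S0_good IS_disj) _.
apply: le_trans (_ : 2 ^+ size I * (X%:R * e + k + 1) <= _); first by lra.
have /andP[k1 k2] := k_bounds.
apply: le_trans (ler_pM _ _ I_size (_ : _ <= 5 * X%:R * e)) _; rewrite ?exprn_ge0 ?addr_ge0 ?mulr_ge0 ?expR_ge0//.
  by move: k2; rewrite -[2 * _ * _]mulrA -[5 * _ * _]mulrA; move: (X%:R * e) => a *; lra.
rewrite mulrCA ler_wpM2l ?mulr_ge0// /e -expRD.
apply: le_trans (_ : expR (- v ^+ 3) <= _); last by have := expN_le_t v16 (isT : 1 <= 256)%N; rewrite expr1.
rewrite ler_expR (exprS v 32); have : v ^+ 3 <= v ^+ 32 by exact: v_pow_le.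
by have := v_pow_ge1 v16 32; have := v16; move: (v ^+ 32) (v ^+ 3) => *; nra.
Qed.

Lemma rsum_I : rsum R I <= 33 * v.
Proof.
apply: le_trans (_ : 1 + ln z2%:R <= _); last by have := lnz2 v16; have := v16; rewrite -/z2; lra.
apply: le_trans (harmonic_le R z2); rewrite /rsum.
have -> : \sum_(s <- I) s%:R^-1 = \sum_(s <- I) npow (1 : R) s.
  by rewrite big_seq [RHS]big_seq; apply: eq_bigr => s; rewrite mem_prange => /and3P[ps _ _]; rewrite npow_1// prime_gt0.
apply: sub_sum; rewrite ?filter_uniq ?iota_uniq//; last by move=> n; exact: npow_ge0.
by move=> s; rewrite mem_prange mem_index_iota ltnS => /and3P[ps _ ->]; rewrite prime_gt0.
Qed.

Variable K : R.
Hypothesis K0 : 0 <= K.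
Hypothesis hA : forall p, prime p -> (z1 < p <= z2)%N ->
  `|psum R p z2 w - yv v / p%:R| <= K * t ^+ 3 /\ psum R p w X <= K * t ^+ 3.
Hypothesis hC : forall p p', prime p -> prime p' -> p != p' -> (z1 < p <= z2)%N -> (z1 < p' <= z2)%N ->
  psum R (p * p') z2 w <= K * t ^+ 3.
Hypothesis hD : \sum_(z2.+1 <= p < X.+1 | prime p) p%:R^-1 * psum R p 0 X <= K * t.
Hypothesis hE : forall p, prime p -> (p <= z1)%N -> v <= psum R p z2 w.
Variable C2 : R.
Hypothesis hC2 : v ^+ 13 * expR (- v) <= C2.

Definition thetav p : R := expR (- (yv v / p%:R)).
Definition Wv : R := Vol R (prange 0 (z1v v)) * Piprod thetav (prange (z1v v) (z2v v)).

Lemma rsum_Q p : rsum R (Q p) = psum R p z2 w.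
Proof. by rewrite /rsum /Q /Qs big_filter. Qed.

Lemma sum_npow2_Q p : \sum_(q <- Q p) npow 2 q <= t ^+ 3.
Proof.
rewrite /Q /Qs big_filter; apply: le_trans (_ : \sum_(z2.+1 <= n < w.+1) npow (1 + 1) n <= _).
  by rewrite big_mkcond; apply: ler_sum => q _; case: ifP => // _; exact: npow_ge0.
apply: le_trans (npow_tail _ ltr01 (z2_gt0 v16)) _; rewrite divr1 npow_1 ?(z2_gt0 v16)//.
by apply: le_trans (inv_z2 v16) _; exact: t_pow_le.
Qed.

Lemma Vol_Q_exp p : all prime (Q p) /\ `|Vol R (Q p) - expR (- psum R p z2 w)| <= 2 * t ^+ 3.
Proof.
have [_ pQ] := goodS_prime (Q_good p); split => //.
have /andP[h1 h2] := sum_kap_bounds pQ; rewrite rsum_Q in h1 h2.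
rewrite Vol_exp//; apply: le_trans (expN_lip _ _) _; rewrite ?psum_ge0//.
  by apply: le_trans h1; exact: psum_ge0.
by have := sum_npow2_Q p; rewrite ger0_norm ?subr_ge0//; lra.
Qed.

Lemma tau_bound p : p \in I -> `|Vol R (Q p) - thetav p| <= (K + 2) * t ^+ 3.
Proof.
rewrite mem_prange => /and3P[pp zp pz]; have [_ h1] := Vol_Q_exp p.
have [h2 _] := hA pp (introT andP (conj zp pz)).
have y0 : 0 <= yv v / p%:R by rewrite divr_ge0// exprn_ge0// ltW.
have h3 := expN_lip (psum_ge0 R p z2 w) y0; rewrite -/(thetav p) in h3.
have := ler_distD (expR (- psum R p z2 w)) (Vol R (Q p)) (thetav p); lra.
Qed.

Lemma om_bound p p' : p \in I -> p' \in I -> p != p' -> osum R Q p (Q p') <= K * t ^+ 3.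
Proof.
rewrite !mem_prange => /and3P[pp zp pz] /and3P[pp' zp' pz'] npp.
apply: le_trans (hC pp pp' npp (introT andP (conj zp pz)) (introT andP (conj zp' pz'))).
rewrite /osum /psum {1}/Q /Qs big_filter_cond big_mkcond [leRHS]big_mkcond; apply: ler_sum => q _.
case: ifP => [/andP[/andP[pq q1]]|_]; last by case: ifP; rewrite ?invr_ge0.
rewrite mem_Qs => /and4P[_ q1' _ _]; have cop : coprime p p' by rewrite prime_coprime// dvdn_prime2.
by rewrite pq eqmod1// Gauss_dvd// -!eqmod1// q1 q1'.
Qed.

Lemma Vol_S0 : 0 <= Vol R S0 <= 1.
Proof. exact: Vol01 (goodS_prime S0_good).2. Qed.

(** The initial overlaps vanish, because [S0] lies below z1 and every [Q p] above z2; the remaining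
    errors are O(v^(-3)) times at most the square of a reciprocal sum of size O(v). *)
Lemma Mod_W : `|Mod R Q I S0 - Wv| <= ((K + 2) * 33 + K * 33 ^+ 2) * t.
Proof.
have t0 : 0 < t by rewrite invr_gt0.
have tp j : 0 <= t ^+ j by rewrite exprn_ge0// ltW.
have th p : 0 <= thetav p <= 1.
  rewrite expR_ge0 /= -[leRHS]expR0 ler_expR oppr_le0 divr_ge0// exprn_ge0// ltW//.
have tau0 : 0 <= (K + 2) * t ^+ 3 by rewrite mulr_ge0//; have := K0; lra.
have om0 : 0 <= K * t ^+ 3 by rewrite mulr_ge0.
apply: le_trans (Mod_err (z2_le_w v16) Q_good Q_gt th tau0 om0 I_good S0_good IS_disj tau_bound om_bound) _.
have -> : \sum_(p <- I) p%:R^-1 * osum R Q p S0 = 0.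
  apply: big1 => p _; rewrite /osum big_seq_cond big1 ?mulr0// => q /andP[/Q_gt zq].
  rewrite mem_prange => /and3P[_ _ qz]; have := leq_trans qz (z1_le_z2 v16).
  by rewrite leqNgt; rewrite /z2 in zq; rewrite zq.
have /andP[V0 V1] := Vol_S0; have h0 := rsum_ge0 R I; have h1 := rsum_I.
have vt1 : v * t ^+ 3 <= t.
  by rewrite -{1}[v]expr1 (vt_pow v16 1 2) -[leRHS]expr1 (t_pow_le v16).
have vt2 : v ^+ 2 * t ^+ 3 = t by rewrite (vt_pow v16 2 1).
have a1 : t ^+ 3 * rsum R I <= 33 * t.
  apply: le_trans (ler_wpM2l (tp 3) h1) _.
  by rewrite (_ : t ^+ 3 * (33 * v) = 33 * (v * t ^+ 3)) ?ler_wpM2l//; ring.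
have a2 : t ^+ 3 * rsum R I ^+ 2 <= 33 ^+ 2 * t.
  apply: le_trans (ler_wpM2l (tp 3) (_ : _ <= (33 * v) ^+ 2)) _.
    by rewrite lerXn2r ?nnegrE// mulr_ge0// ltW.
  have -> : t ^+ 3 * (33 * v) ^+ 2 = 33 ^+ 2 * (v ^+ 2 * t ^+ 3) by ring.
  by rewrite vt2.
have A1 : (K + 2) * t ^+ 3 * rsum R I <= (K + 2) * 33 * t.
  have K2 : 0 <= K + 2 by have := K0; lra.
  by have := ler_wpM2l K2 a1; move: (t ^+ 3) => T; rewrite !mulrA.
have A2 : K * t ^+ 3 * rsum R I ^+ 2 <= K * 33 ^+ 2 * t.
  by have := ler_wpM2l K0 a2; move: (t ^+ 3) (rsum R I ^+ 2) (33 ^+ 2 : R) => T H A; rewrite !mulrA.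
rewrite add0r; apply: le_trans (ler_piMl _ V1) _; first by rewrite (addr_ge0 (mulr_ge0 tau0 h0) (mulr_ge0 om0 (exprn_ge0 2 h0))).
by rewrite [leRHS]mulrDl lerD.
Qed.

Lemma e_small : v ^+ 12 * e <= t.
Proof.
apply: le_trans (_ : v ^+ 12 * t ^+ (12 + 1) <= _); last by rewrite vt_pow.
rewrite ler_wpM2l ?exprn_ge0 ?(ltW v0)//; apply: le_trans (_ : expR (- v ^+ 3) <= _); last exact: expN_le_t.
by rewrite ler_expR lerN2 (v_pow_le v16).
Qed.

(** For each of the at most v^12 primes p <= z1, the integers without factor in [Q p] have density
    at most e^(-v). *)
Lemma sum_small : \sum_(p <- S0) (Phi (X %/ p) (Q p))%:R <= X%:R * ((C2 + 3) * t) :> R.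
Proof.
have X0 : 0 <= X%:R :> R by [].
have e0 : 0 <= e by exact: expR_ge0.
have /andP[k1 k2] := k_bounds.
have term p : p \in S0 -> (Phi (X %/ p) (Q p))%:R <= X%:R * (expR (- v) + 3 * e).
  rewrite mem_prange => /and3P[pp _ pz].
  have [pQ _] := Vol_Q_exp p; have := sieve_good (X %/ p) (Q_good p).
  rewrite ler_distl => /andP[_]; move/le_trans; apply.
  have le : (X %/ p)%:R <= X%:R :> R by rewrite ler_nat leq_div.
  have V : Vol R (Q p) <= expR (- v).
    rewrite Vol_exp// ler_expR lerN2; have /andP[h _] := sum_kap_bounds pQ.
    by apply: le_trans (hE pp pz) _; rewrite -rsum_Q.
  have := ler_pM (ler0n R _) (proj1 (andP (Vol01 R pQ))) le V.
  have := ler_wpM2r e0 le; move: k2; rewrite -[2 * _ * _]mulrA mulrDr (_ : X%:R * (3 * e) = 3 * (X%:R * e)); last by ring.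
  by move: (X%:R * e) => *; lra.
apply: le_trans (_ : \sum_(p <- S0) X%:R * (expR (- v) + 3 * e) <= _).
  by rewrite big_seq [leRHS]big_seq; apply: ler_sum.
rewrite -mulr_sumr big_const_seq count_predT iter_addr addr0 -[(_ + _) *+ _]mulr_natl.
rewrite ler_wpM2l//.
have sz : (size S0)%:R <= v ^+ 12.
  apply: le_trans (_ : z1%:R <= _).
    rewrite ler_nat -[leqRHS](size_iota 1); apply: uniq_leq_size; first by rewrite filter_uniq ?iota_uniq.
    by move=> q; rewrite mem_prange mem_iota add1n ltnS => /and3P[pq _ ->]; rewrite prime_gt0.
  by rewrite Num.Theory.truncn_le exprn_ge0// ltW.
apply: le_trans (ler_wpM2r _ sz) _; first by rewrite addr_ge0 ?expR_ge0 ?mulr_ge0.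
have h1 := e_small; have h2 : v ^+ 12 * expR (- v) <= C2 * t.
  have := ler_wpM2r (ltW (_ : 0 < t)) hC2; rewrite invr_gt0 => /(_ v0); apply: le_trans.
  have -> : v ^+ 13 * expR (- v) * t = v ^+ 12 * expR (- v) * (v * t) by ring.
  by rewrite (vt v16) mulr1.
rewrite mulrDr; apply: le_trans (lerD h2 (_ : v ^+ 12 * (3 * e) <= 3 * t)) _; last by rewrite [leRHS]mulrDl.
by rewrite mulrCA ler_wpM2l.
Qed.

Lemma sum_bad : \sum_(p <- prange z1 X) npow 2 p + \sum_(p <- prange z1 X) p%:R^-1 *
    (if (z2 < p)%N then psum R p 0 X else psum R p 0 z2 + psum R p w X) <= (1 + 33 * (34 * expR 1 + K) + K) * t.
Proof.
have t0 : 0 < t by rewrite invr_gt0.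
have tp j : 0 <= t ^+ j by rewrite exprn_ge0// ltW.
have z10 : (0 < z1)%N by rewrite truncn_gt0 (v_pow_ge1 v16).
have h1 : \sum_(p <- prange z1 X) npow 2 p <= t.
  rewrite /prange big_filter; apply: le_trans (_ : \sum_(z1.+1 <= n < X.+1) npow (1 + 1) n <= _).
    by rewrite big_mkcond; apply: ler_sum => q _; case: ifP => // _; exact: npow_ge0.
  apply: le_trans (npow_tail _ ltr01 z10) _; rewrite divr1 npow_1// /t lef_pV2 ?posrE ?ltr0n//.
  have h := lt_truncnS (v ^+ 12); rewrite -natr1 -/(z1v v) -/z1 in h.
  have : v ^+ 2 <= v ^+ 12 by exact: v_pow_le.
  by have := v16; rewrite expr2; move: (v ^+ 12) h => a *; nra.
have zX : (z2 <= X)%N by apply: leq_trans (z2_le_w v16) (w_le_X v16).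
have h2 : \sum_(p <- I) p%:R^-1 * (if (z2 < p)%N then psum R p 0 X else psum R p 0 z2 + psum R p w X) <= 33 * (34 * expR 1 + K) * t.
  have B0 : 0 <= (34 * expR 1 + K) * t ^+ 3 by rewrite mulr_ge0// addr_ge0// mulr_ge0 ?expR_ge0.
  apply: le_trans (_ : rsum R I * ((34 * expR 1 + K) * t ^+ 3) <= _).
    rewrite /rsum mulr_suml big_seq [leRHS]big_seq; apply: ler_sum => p; rewrite mem_prange => /and3P[pp zp pz].
    rewrite ler_wpM2l ?invr_ge0// ltnNge pz /=; have [_ h] := hA pp (introT andP (conj zp pz)).
    have pv := gt_z1 zp; rewrite mulrDl; apply: lerD => //; apply: psum_z2 => //.
    rewrite -(ltr_nat R); apply: lt_le_trans pv; have : v ^+ 1 <= v ^+ 12 by exact: v_pow_le.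
    by have := v16; rewrite expr1; lra.
  apply: le_trans (ler_wpM2r B0 rsum_I) _; rewrite -!mulrA ler_wpM2l// mulrCA ler_wpM2l//.
    by rewrite addr_ge0// mulr_ge0 ?expR_ge0.
  by rewrite -{1}[v]expr1 (vt_pow v16 1 2) -[leRHS]expr1 (t_pow_le v16).
apply: le_trans (lerD h1 (_ : _ <= 33 * (34 * expR 1 + K) * t + K * t)) _; last by rewrite le_eqVlt; apply/orP; left; apply/eqP; ring.
rewrite /prange big_filter (@big_cat_nat _ _ _ z2.+1)//=; last by rewrite ltnS (z1_le_z2 v16).
apply: lerD; first by move: h2; rewrite /I /prange big_filter.
apply: le_trans hD; rewrite le_eqVlt; apply/orP; left; apply/eqP.
by rewrite big_nat_cond [RHS]big_nat_cond; apply: eq_bigr => p /andP[/andP[-> _] _].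
Qed.

Lemma count_W : `|(count cyc (iota 1 X))%:R - X%:R * Wv| <=
  (5 + ((K + 2) * 33 + K * 33 ^+ 2) + (C2 + 3) + (1 + 33 * (34 * expR 1 + K) + K)) * (X%:R * t).
Proof.
have X0 : 0 <= X%:R :> R by [].
have t0 : 0 <= t by rewrite invr_ge0 ltW.
have h1 := NPhi_model; have h2 := ler_wpM2l X0 Mod_W.
have h3 := ler_wpM2l X0 sum_bad.
have h4 := cyc_upper z1 (z2_le_w v16) (w_le_X v16) R.
have h5 : (count cyc (iota 1 X))%:R <= (NPhi Q X I S0)%:R + \sum_(p <- S0) (Phi (X %/ p) (Q p))%:R :> R.
  by rewrite -natr_sum -natrD ler_nat; apply: cyc_lower; exact: z1_le_z2.
have h6 := sum_small.
rewrite -/Q -/I -/S0 -/X in h4.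
have C20 : 0 <= (C2 + 3) * (X%:R * t).
  by rewrite mulr_ge0 ?mulr_ge0// addr_ge0//; apply: le_trans hC2; rewrite mulr_ge0 ?expR_ge0 ?exprn_ge0 ?(ltW v0).
have B0 : 0 <= (1 + 33 * (34 * expR 1 + K) + K) * (X%:R * t).
  by rewrite mulr_ge0 ?mulr_ge0// !addr_ge0 ?mulr_ge0 ?addr_ge0 ?mulr_ge0 ?expR_ge0.
have {}h2 : `|X%:R * Mod R Q I S0 - X%:R * Wv| <= X%:R * (((K + 2) * 33 + K * 33 ^+ 2) * t).
  by rewrite -mulrBr normrM ger0_norm.
move: h1 h2 h3 h4 h5 h6 C20 B0; rewrite -[5 * _ * _]mulrA [X%:R * (_ * t)]mulrCA.
rewrite [X%:R * ((1 + 33 * (34 * expR 1 + K) + K) * t)]mulrCA [X%:R * ((C2 + 3) * t)]mulrCA !ler_distl.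
have : 0 <= X%:R * t by rewrite mulr_ge0.
have : 0 <= ((K + 2) * 33 + K * 33 ^+ 2) * (X%:R * t).
  by rewrite mulr_ge0 ?mulr_ge0// addr_ge0 ?mulr_ge0 ?addr_ge0 ?exprn_ge0.
move: (X%:R * (\sum_(_ <- _) _ + _)) (\sum_(_ <- S0) _) (X%:R * Mod _ _ _ _) (X%:R * Wv) (X%:R * t).
move: ((K + 2) * 33 + K * 33 ^+ 2) (1 + 33 * (34 * expR 1 + K) + K) (C2 + 3) ((NPhi Q X I S0)%:R : R) ((count cyc (iota 1 X))%:R : R).
by move=> c1 c2 c3 N c B S M W A *; apply/andP; split; lra.
Qed.
End Fixed.

Theorem cyclic_model : exists K v0 : R, [/\ 0 <= K, 16 <= v0 & forall v, v0 <= v ->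
  `|(count cyc (iota 1 (Xv v)))%:R - (Xv v)%:R * Wv v| <= K * ((Xv v)%:R * v^-1)].
Proof.
have [K [v1 [K0 v1_16 h]]] := psum_ranges R.
(* Order 0 is enough here: it gives merL(w) <= y + O(1). *)
have [g hg] := merL_limit R; have [Cm Cm0 hm] := hg 0%N.
have [C2 C20 hC2] := pow_exp_bound 13 (@ltr01 R).
exists (5 + ((K + 2) * 33 + K * 33 ^+ 2) + (C2 + 3) + (1 + 33 * (34 * expR 1 + K) + K)).
exists (v1 + `|g| + Cm); split.
- by rewrite !addr_ge0 ?mulr_ge0 ?addr_ge0 ?mulr_ge0 ?expR_ge0 ?exprn_ge0.
- by have := normr_ge0 g; lra.
move=> v vv; have g0 := normr_ge0 g; have v1v : v1 <= v by lra.
have v16 : 16 <= v by lra.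
have [hA hC hD hE] := h v v1v.
have w1 : (1 < wv v)%N.
  apply: leq_trans (z2_le_w v16); have v0 : 0 <= v by lra.
  rewrite Num.Theory.truncn_ge_nat ?exprn_ge0//.
  have : v ^+ 1 <= v ^+ 32 by exact: v_pow_le.
  by rewrite expr1; lra.
apply: (@count_W v (`|g| + Cm) v16 _ _ K K0 hA hC hD hE C2); first by lra.
- have := hm _ w1; rewrite expr0 divr1 ler_distl => /andP[_ h2].
  rewrite lerBlDl in h2; apply: le_trans h2 _; apply: lerD; last by rewrite lerD2r ler_norm.
  rewrite -[leRHS]expRK ler_ln ?posrE ?expR_gt0//; last first.
    by rewrite ln_gt0// ltr1n.
  apply: le_trans (@lnX_le _ v); rewrite ler_ln ?posrE ?ltr0n ?(ltnW w1) ?X_gt0//.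
  by rewrite ler_nat; exact: w_le_X.
by have := hC2 v (le_trans (ler0n R 16) v16); rewrite mul1r.
Qed.
End Assembly.

From mathcomp Require Import constructive_ereal ereal measure lebesgue_measure lebesgue_integral ftc.

(** * Antiderivatives and limits at infinity *)

Section Antiderivative.
Variable R : realType.
Implicit Types (h G : R -> R) (x z a b C : R).

Lemma antideriv_right h a : continuous h -> exists F : R -> R, forall x, a < x -> is_derive x 1 F (h x).
Proof.
move=> hc; exists (fun x => \int[lebesgue_measure]_(t in [set` `[a, x]]) h t)%R => x ax.
have xu : x < x + 1 by rewrite ltrDl.
have int : lebesgue_measure.-integrable `[a, x + 1] (EFin \o h).
  apply: continuous_compact_integrable; first exact: segment_compact.
  by apply: continuous_subspaceT => z; exact: hc.
have [d e] := continuous_FTC1_closed xu int ax (hc x).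
by split; [exact: d|rewrite -derive1E; exact: e].
Qed.

(** The fundamental theorem yields antiderivatives only to the right of a base point. One on (-1,
    oo) is glued to the reflection of one for h(-x); on the overlap they differ by a constant. *)
Lemma antideriv h : continuous h -> exists G : R -> R, forall x, is_derive x 1 G (h x).
Proof.
move=> hc; have hNc : continuous (h \o -%R).
  by move=> x; apply: continuous_comp; [exact: opp_continuous|exact: hc].
have [F1 d1] := antideriv_right (-1) hc; have [F2 d2] := antideriv_right (-1) hNc.
pose F3 x := - F2 (- x).
have d3 x : x < 1 -> is_derive x 1 F3 (h x).
  move=> x1; have x1' : -1 < - x by rewrite ltrN2.
  have d2' := d2 _ x1'; rewrite /= opprK in d2'.
  have dN : is_derive x 1 (fun z : R => - z) (-1) by apply: is_derive_eq.
  have := @is_derive1_comp R F2 (fun z : R => - z) x _ _ d2' dN => dd.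
  by apply: (is_derive_eq (is_deriveN dd)); rewrite /= mulrN1 opprK.
pose c := F1 0 - F3 0; pose G x := if x < 0 then F3 x + c else F1 x.
have GF1 x : -1 < x -> G x = F1 x.
  move=> x1; rewrite /G; case: ltP => // x0.
  have [|k _ e] := @mvt_le R (F1 \- F3) (fun=> 0) x 0 (ltW x0).
    move=> z /andP[xz z0]; have z1 : -1 < z by lra.
    have z2 : z < 1 by lra.
    by apply: (is_derive_eq (is_deriveB (d1 z z1) (d3 z z2))); rewrite subrr.
  by move: e; rewrite mul0r /= /c; lra.
exists G => x; have [x1|x1] := ltP (-1) x.
  apply: near_eq_is_derive (d1 x x1); near=> z; rewrite GF1//; near: z.
  exact: lt_nbhsr.
have x0 : x < 1 by lra.
have xn : x < 0 by lra.
have dc : is_derive x 1 (F3 + cst c) (h x).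
  by apply: (is_derive_eq (is_deriveD (d3 x x0) (is_derive_cst c x 1))); rewrite addr0.
apply: near_eq_is_derive dc; near=> z; rewrite /G ifT//; near: z.
exact: lt_nbhsl.
Unshelve. all: by end_near. Qed.

Lemma deriv_ge0_le (f df : R -> R) a b : a <= b -> (forall x, a <= x <= b -> is_derive x 1 f (df x)) ->
  (forall x, a <= x <= b -> 0 <= df x) -> f a <= f b.
Proof.
move=> ab d d0; have [c cab e] := mvt_le ab d.
by rewrite -subr_ge0 e mulr_ge0 ?d0// subr_ge0.
Qed.

Lemma limit_of_le (G e : R -> R) : (forall a b, 0 <= a -> a <= b -> `|G b - G a| <= e a) ->
  exists L, forall a, 0 <= a -> `|G a - L| <= e a.
Proof.
move=> h; pose A : set R := [set G a - e a | a in [set a | 0 <= a]].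
have e0 a : 0 <= a -> 0 <= e a by move=> a0; have := h a a a0 (lexx a); rewrite subrr normr0.
have ub b : 0 <= b -> ubound A (G b + e b).
  move=> b0 _ [a /= a0 <-]; have ea := e0 a a0; have eb := e0 b b0.
  have [ab|/ltW ba] := leP a b; first by have := h a b a0 ab; rewrite ler_distl => /andP[]; lra.
  by have := h b a b0 ba; rewrite ler_distl => /andP[]; lra.
have A0 : A !=set0 by exists (G 0 - e 0); exists 0 => //=.
exists (sup A) => a a0; rewrite ler_distl; apply/andP; split; last first.
  by rewrite -lerBlDr; apply: ub_le_sup; [exists (G 0 + e 0); exact: ub|exists a].
by rewrite lerBlDr; apply: ge_sup => //; exact: ub.
Qed.

(** An explicit primitive of the majorant, plus or minus [G], is monotone, which makes [G] a Cauchy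
    function with an exponential rate. *)
Lemma deriv_limit (G h : R -> R) C : 0 <= C -> (forall x, is_derive x 1 G (h x)) ->
  (forall x, 0 <= x -> `|h x| <= C * expR (- (x / 2))) ->
  exists L, forall a, 0 <= a -> `|G a - L| <= 2 * C * expR (- (a / 2)).
Proof.
move=> C0 d hC; apply: limit_of_le => a b a0 ab.
pose g (x : R) := - (2 * C) * expR (- (x / 2)).
have dg x : is_derive x 1 g (C * expR (- (x / 2))).
  have di : is_derive x 1 (fun z : R => - (2^-1) * z) (- 2^-1).
    by apply: (is_derive_eq (is_deriveZl (- 2^-1) (is_derive_id x 1))); rewrite mulr1.
  have ge : g = (fun z => - (2 * C) * expR (- (2^-1) * z)).
    by apply/funext => z; rewrite /g; congr (_ * expR _); rewrite mulrC mulNr.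
  rewrite ge; have := @is_derive1_comp R expR _ x _ _ (is_derive_expR _) di => dd.
  apply: (is_derive_eq (is_deriveZl (- (2 * C)) dd)).
  by rewrite /= (_ : - 2^-1 * x = - (x / 2)); [field|rewrite mulNr mulrC].
have b1 x : a <= x <= b -> `|h x| <= C * expR (- (x / 2)).
  by move=> /andP[ax _]; apply: hC; exact: le_trans ax.
have u : (g - G) a <= (g - G) b.
  apply: (@deriv_ge0_le _ (fun x => C * expR (- (x / 2)) - h x)) => // x xab.
  by have := b1 x xab; have := ler_norm (h x); rlra.
have l : (g + G) a <= (g + G) b.
  apply: (@deriv_ge0_le _ (fun x => C * expR (- (x / 2)) + h x)) => // x xab.
  by have := b1 x xab; have := ler_norm (- h x); rewrite normrN; rlra.
have e0 := mulr_ge0 C0 (expR_ge0 (- (b / 2))).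
have u' : g a - G a <= g b - G b by exact: u.
have l' : g a + G a <= g b + G b by exact: l.
by rewrite /g in u' l'; rewrite ler_distl; apply/andP; split; rlra.
Qed.
End Antiderivative.

(** * Moments of exp (s - exp s) *)

Section Moments.
Variable R : realType.
Implicit Types (G : R -> R) (x s y v : R) (k n : nat).

(** The factor exp (s - e^s) is the derivative of - exp (- e^s), and e^s = y / n at
    [s = slog y n]. *)
Definition expk k (s : R) : R := s ^+ k * expR (s - expR s).

Lemma is_derive_expexp (s : R) : is_derive s 1 (fun s => - expR (- expR s)) (expR (s - expR s)).
Proof.
have d1 : is_derive s 1 (fun z : R => - expR z) (- expR s) by exact: is_deriveN.
have := @is_derive1_comp R expR _ s _ _ (is_derive_expR _) d1 => dd.
apply: (is_derive_eq (is_deriveN dd)).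
by rewrite expRD mulrN opprK mulrC.
Qed.

Lemma continuous_expk k : continuous (expk k).
Proof.
move=> s; apply: (@continuousM _ _ (fun s : R => s ^+ k) (fun s : R => expR (s - expR s))); first exact: exprn_continuous.
apply: (@continuous_comp _ _ _ (fun s : R => s - expR s) expR); last exact: continuous_expR.
by apply: continuousB; [exact: cvg_id|exact: continuous_expR].
Qed.

Lemma expk_bound k : exists2 C : R, 0 <= C & forall s, `|expk k s| <= C * expR (- (`|s| / 2)).
Proof.
have h2 : 0 < 1 / 2 :> R by lra.
have [C C0 hC] := pow_exp_bound k h2; exists C => // s.
have e1 : expR (s - expR s) <= expR (- `|s|).
  rewrite ler_expR; have := expR_gt0 s; have [s0|s0] := leP 0 s; last by rewrite ltr0_norm//; lra.
  rewrite ger0_norm// => _; have := expR_ge1Dx (s / 2).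
  have -> : expR s = expR (s / 2) * expR (s / 2) by rewrite -expRD; congr expR; lra.
  move=> h; have : (1 + s / 2) * (1 + s / 2) <= expR (s / 2) * expR (s / 2) by apply: ler_pM => //; lra.
  have := sqr_ge0 (1 - s / 2); rewrite expr2; move: (expR _ * expR _) => z; lra.
rewrite /expk normrM normrX (ger0_norm (expR_ge0 _)).
apply: le_trans (ler_wpM2l (exprn_ge0 _ (normr_ge0 _)) e1) _.
have e2 : expR (- `|s|) = expR (- (1 / 2 * `|s|)) * expR (- (`|s| / 2)) by rewrite -expRD; congr expR; lra.
by rewrite e2 mulrA ler_wpM2r ?expR_ge0// hC.
Qed.

Lemma pow_diff_le k (a b S : R) : 1 <= S -> `|a| <= S -> `|b| <= S -> `|a ^+ k - b ^+ k| <= k%:R * S ^+ k * `|a - b|.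
Proof.
move=> S1 aS bS; elim: k => [|k ih]; first by rewrite !expr0 subrr normr0 !mul0r.
have -> : a ^+ k.+1 - b ^+ k.+1 = a * (a ^+ k - b ^+ k) + (a - b) * b ^+ k by rewrite !exprS; ring.
apply: le_trans (ler_normD _ _) _; rewrite !normrM normrX.
have S0 : 0 <= S by lra.
have h1 : `|a| * `|a ^+ k - b ^+ k| <= S * (k%:R * S ^+ k * `|a - b|) by apply: ler_pM.
have h2 : `|a - b| * `|b| ^+ k <= `|a - b| * S ^+ k.+1.
  rewrite ler_wpM2l//; apply: le_trans (_ : S ^+ k <= _); first by rewrite lerXn2r ?nnegrE.
  by rewrite exprS ler_peMl// exprn_ge0.
apply: le_trans (lerD h1 h2) _; rewrite -natr1 exprS le_eqVlt; apply/orP; left; apply/eqP; ring.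
Qed.

Definition psi (y : R) n : R := expR (- (y / n.+1%:R)) - expR (- (y / n%:R)).
Definition slog (y : R) n : R := ln y - ln n%:R.

Lemma exp_slog y n : 0 < y -> (0 < n)%N -> expR (slog y n) = y / n%:R.
Proof.
by move=> y0 n0; rewrite expRD expRN !lnK ?posrE ?ltr0n.
Qed.

(** One cell of a Riemann-Stieltjes sum. The mean value theorem is applied to G minus c times - exp
    (- e^s), whose derivative (s^k - c) e^(s - e^s) is small because s varies by at most 1/n. *)
Lemma moment_step G k y n (S : R) : (forall s, is_derive s 1 G (expk k s)) -> 0 < y -> (0 < n)%N -> 1 <= S ->
  `|slog y n| <= S -> `|slog y n.+1| <= S ->
  `|G (slog y n) - G (slog y n.+1) - slog y n ^+ k * psi y n| <= k%:R * S ^+ k * npow 2 n.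
Proof.
move=> dG y0 n0 S1 a1 a2; set c := slog y n ^+ k.
have lnn : ln n.+1%:R - ln n%:R <= n%:R^-1 :> R.
  apply: le_trans (ln_diff_le _ _) _; rewrite ?ltr0n// -natr1 addrAC subrr add0r mul1r.
  by [].
have lnn0 : ln n%:R <= ln n.+1%:R :> R by rewrite ler_ln ?posrE ?ltr0n// ler_nat.
have ab : slog y n.+1 <= slog y n by rewrite /slog; rlra.
have [|x xab e] := @mvt_le R (fun s => G s - c * - expR (- expR s)) (fun s => expk k s - c * expR (s - expR s)) _ _ ab.
  by move=> x _; apply: is_deriveB; apply: is_deriveZl; exact: is_derive_expexp.
have -> : G (slog y n) - G (slog y n.+1) - c * psi y n = (expk k x - c * expR (x - expR x)) * (slog y n - slog y n.+1).
  by rewrite -e /psi !exp_slog//; ring.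
have -> : expk k x - c * expR (x - expR x) = (x ^+ k - c) * expR (x - expR x) by rewrite /expk mulrBl.
have i0 : 0 <= n%:R^-1 :> R by rewrite invr_ge0.
have dd : slog y n - slog y n.+1 <= n%:R^-1 by move: lnn; rewrite /slog; clear; lra.
have E1 : expR (x - expR x) <= 1.
  by rewrite -[leRHS]expR0 ler_expR; have := expR_ge1Dx x; rlra.
have xS : `|x| <= S.
  move: a1 a2 xab; rewrite !ler_norml => /andP[p1 p2] /andP[p3 p4] /andP[p5 p6].
  by rewrite (le_trans p3 p5) (le_trans p6 p2).
have xd : `|x - slog y n| <= n%:R^-1.
  by case/andP: xab => x1 x2; rewrite distrC ger0_norm ?subr_ge0//; apply: le_trans dd; rewrite lerD2l lerN2.
have B0 : 0 <= k%:R * S ^+ k by rewrite mulr_ge0// exprn_ge0// (le_trans ler01 S1).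
rewrite !normrM (ger0_norm (expR_ge0 _)) (ger0_norm (_ : 0 <= slog y n - slog y n.+1)) ?subr_ge0//.
have h1 : `|x ^+ k - c| <= k%:R * S ^+ k * n%:R^-1.
  by apply: le_trans (pow_diff_le k S1 xS a1) _; rewrite ler_wpM2l.
have e2 : npow 2 n = n%:R^-1 * n%:R^-1 :> R by rewrite -[2]/(1 + 1) npowD npow_1.
rewrite e2 mulrA; apply: ler_pM; rewrite ?mulr_ge0 ?expR_ge0 ?subr_ge0//.
by apply: le_trans h1; rewrite ler_piMr.
Qed.

(** The moment is the difference of the limits of an antiderivative at both ends, so no improper
    integral is formed. Between v and z2 the variable ln (y/n) descends from at least 15 ln v to at
    most - 12 ln v, where the exponential tails are below 1/v up to constants. *)
Lemma moment_limit k : exists mu C : R, 0 <= C /\ forall v, 16 <= v ->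
  `|\sum_(Num.truncn v <= n < z2v v) psi (yv v) n * slog (yv v) n ^+ k - mu| <= C * (16 * ln v) ^+ k * v^-1.
Proof.
have [G dG] := antideriv (@continuous_expk k); have [C C0 hC] := expk_bound k.
have [|L1 h1] := deriv_limit C0 dG.
  by move=> x x0; have := hC x; rewrite (ger0_norm x0).
have dN x : is_derive x 1 (fun z => - G (- z)) (expk k (- x)).
  have dNx : is_derive x 1 (fun z : R => - z) (-1) by apply: is_derive_eq.
  have := @is_derive1_comp R G (fun z : R => - z) x _ _ (dG (- x)) dNx => dd.
  by apply: (is_derive_eq (is_deriveN dd)); rewrite mulrN1 opprK.
have [|L2 h2] := deriv_limit C0 dN.
  by move=> x x0; have := hC (- x); rewrite (normrN x) (ger0_norm x0).
exists (L1 + L2), (4 * k%:R + 4 * C); split; first by rewrite addr_ge0 ?mulr_ge0.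
move=> v v16; set M := Num.truncn v; set N := z2v v; set y := yv v.
have v0 : 0 < v by rlra.
have y0 : 0 < y by rewrite exprn_gt0.
have lny : ln y = 16 * ln v by rewrite /y /yv lnXn// -[ln _ *+ _]mulr_natl.
have lv1 : 1 <= ln v.
  have : ln (2 ^+ 4) <= ln v by rewrite ler_ln ?posrE// -natrX.
  by rewrite lnXn// -[ln _ *+ _]mulr_natl; have := ln2_half R; rlra.
set S := 16 * ln v; have S1 : 1 <= S by rewrite /S; rlra.
have N0 : (0 < N)%N by exact: z2_gt0.
have Mv : M%:R <= v by rewrite Num.Theory.truncn_le ltW.
have vM : v < M%:R + 1 by rewrite natr1; exact: lt_truncnS.
have M1 : (1 < M)%N by rewrite -(ltr_nat R); rlra.
have lnb n : (0 < n)%N -> (n <= N)%N -> 0 <= ln (n%:R : R) <= 32 * ln v.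
  move=> n0 nN; rewrite ln_nat_ge0 /=; have := le_z2 v16 nN => h.
  have : ln n%:R <= ln (v ^+ 32) by rewrite ler_ln ?posrE ?ltr0n// exprn_gt0.
  by rewrite lnXn// -[ln _ *+ _]mulr_natl.
have sb n : (0 < n)%N -> (n <= N)%N -> `|slog y n| <= S.
  move=> n0 nN; have /andP[b1 b2] := lnb n n0 nN.
  by rewrite /slog lny ler_norml /S; apply/andP; split; rlra.
have MN : (M <= N)%N by apply: le_truncn; rewrite -{1}[v]expr1 (v_pow_le v16).
have tele : \sum_(M <= n < N) (G (slog y n) - G (slog y n.+1)) = G (slog y M) - G (slog y N).
  have := telescope_sumr (fun n => - G (slog y n)) MN; rewrite [RHS]addrC opprK => <-.
  by apply: eq_bigr => n _; rewrite opprK addrC.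
have S0 : 0 <= k%:R * S ^+ k by rewrite mulr_ge0// exprn_ge0// (le_trans ler01 S1).
have err : `|\sum_(M <= n < N) psi y n * slog y n ^+ k - (G (slog y M) - G (slog y N))| <= k%:R * S ^+ k * (2 * v^-1).
  rewrite -tele -sumrB; apply: le_trans (ler_norm_sum _ _ _) _.
  apply: le_trans (_ : \sum_(M <= n < N) k%:R * S ^+ k * npow 2 n <= _).
    apply: ler_sum_nat => n /andP[Mn nN]; have n0 : (0 < n)%N by apply: leq_trans Mn; exact: ltnW.
    rewrite distrC [psi _ _ * _]mulrC; exact: moment_step dG y0 n0 S1 (sb _ n0 (ltnW nN)) (sb _ (ltn0Sn n) nN).
  rewrite -mulr_sumr ler_wpM2l//.
  apply: le_trans (_ : \sum_(M.-1.+1 <= n < N.+1) npow (1 + 1) n <= _).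
    by rewrite prednK ?(ltnW M1)// big_nat_recr //= lerDl npow_ge0.
  have M10 : (0 < M.-1)%N by rewrite -ltnS prednK// ltnW.
  apply: le_trans (npow_tail _ ltr01 M10) _; rewrite divr1 npow_1//.
  have e : M%:R = M.-1%:R + 1 :> R by rewrite natr1 prednK// ltnW.
  rewrite -[leLHS]mul1r ler_pdivrMr ?ltr0n// mulrAC ler_pdivlMr//; rlra.
have b1 : `|G (slog y M) - L1| <= 2 * C * v^-1.
  have sM : 15 * ln v <= slog y M.
    have : ln M%:R <= ln v by rewrite ler_ln ?posrE ?ltr0n// ltnW.
    by rewrite /slog lny; rlra.
  apply: le_trans (h1 _ _) _; first by rlra.
  rewrite ler_wpM2l ?mulr_ge0// -[leRHS]lnK ?posrE ?invr_gt0// lnV ?posrE// ler_expR; rlra.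
have b2 : `|- G (slog y N) - L2| <= 2 * C * v^-1.
  have sN : slog y N <= - (12 * ln v).
    have := inv_z2 v16; rewrite exprVn lef_pV2 ?posrE ?ltr0n ?exprn_gt0// => h.
    have : ln (v ^+ 28) <= ln N%:R by rewrite ler_ln ?posrE ?ltr0n ?exprn_gt0.
    by rewrite lnXn// -[ln _ *+ _]mulr_natl /slog lny; rlra.
  have := h2 (- slog y N); rewrite opprK => h; apply: le_trans (h _) _; first by rlra.
  rewrite ler_wpM2l ?mulr_ge0// -[leRHS]lnK ?posrE ?invr_gt0// lnV ?posrE// ler_expR; rlra.
have Sk : 1 <= S ^+ k by exact: exprn_ege1.
have vi0 : 0 < v^-1 by rewrite invr_gt0.
have c1 : C * v^-1 <= C * S ^+ k * v^-1 by rewrite ler_wpM2r ?(ltW vi0)// ler_peMr.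
have c2 : 0 <= k%:R * S ^+ k * v^-1 by rewrite mulr_ge0// ltW.
move: err b1 b2 c1 c2; rewrite !ler_distl (_ : (4 * k%:R + 4 * C) * S ^+ k / v = 4 * (k%:R * S ^+ k * v^-1) + 4 * (C * S ^+ k * v^-1)); last by ring.
rewrite (_ : k%:R * S ^+ k * (2 * v^-1) = 2 * (k%:R * S ^+ k * v^-1)); last by ring.
rewrite -!(mulrA 2 C); move: (\sum_(M <= _ < _) _) (G _) (G _) (k%:R * _ * _) (C * S ^+ k * _) (C * v^-1).
by move=> a b c e f g /andP[? ?] /andP[? ?] /andP[? ?] ? ?; apply/andP; split; rlra.
Qed.
End Moments.

(** * Expansion of the logarithm of the density *)

Section LogModel.
Variable R : realType.
Implicit Types (v x y u : R) (n p k K : nat).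

Lemma is_derive_ln_rem K y : y < 1 ->
  is_derive y 1 (fun y : R => - ln (1 - y) - \sum_(1 <= k < K.+1) y ^+ k / k%:R) (y ^+ K / (1 - y)).
Proof.
move=> y1'; have y1 : 0 < 1 - y by lra.
have d1 : is_derive y 1 (fun y : R => 1 - y) (- 1).
  have /is_derive_eq := is_deriveB (is_derive_cst (1 : R) y 1) (@is_derive_id R R y 1).
  by apply; rewrite sub0r.
have d2 := @is_derive1_comp R (@ln R) (fun y => 1 - y) y _ _ (is_derive1_ln y1) d1.
have d3 : is_derive y 1 (fun y => \sum_(1 <= k < K.+1) k%:R^-1 * y ^+ k) (\sum_(1 <= k < K.+1) k%:R^-1 * (k%:R * y ^+ k.-1)).
  exact: (@is_derive_sum R (fun k y => k%:R^-1 * y ^+ k) (fun k y => k%:R^-1 * (k%:R * y ^+ k.-1)) y K (fun k => is_deriveZl _ (is_derive_pow k y))).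
have /is_derive_eq := is_deriveB (is_deriveN d2) d3.
rewrite (_ : _ - _ = (fun y : R => - ln (1 - y) - \sum_(1 <= k < K.+1) y ^+ k / k%:R)); last first.
  by apply/funext => z; congr (_ - _); apply: eq_bigr => k _; rewrite mulrC.
apply; rewrite mulrN1 opprK.
have -> : \sum_(1 <= k < K.+1) k%:R^-1 * (k%:R * y ^+ k.-1) = (1 - y ^+ K) / (1 - y).
  elim: K {d2 d3} => [|k ih]; first by rewrite big_geq// expr0 subrr mul0r.
  rewrite big_nat_recr//= ih mulrA mulVf ?mul1r ?pnatr_eq0// exprS; field; rewrite gt_eqF//; lra.
by field; rewrite gt_eqF.
Qed.

(** By the mean value theorem the remainder is x c^K / (1 - c) with c between 0 and x, and 1 - c >=
    1/32. Hence the bound extends to negative x of any size, outside the disc of convergence. *)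
Lemma ln_rem_le K x : x <= 31 / 32 -> `|ln (1 - x) + \sum_(1 <= k < K.+1) x ^+ k / k%:R| <= 32 * `|x| ^+ K.+1.
Proof.
move=> x1; pose f y := - ln (1 - y) - \sum_(1 <= k < K.+1) y ^+ k / k%:R.
have f0 : f 0 = 0.
  rewrite /f subr0 ln1 oppr0 sub0r big_nat_cond big1 ?oppr0// => k /andP[/andP[k0 _] _].
  by rewrite expr0n gtn_eqF// mul0r.
rewrite -normrN opprD -/(f x).
have bound c : `|c| <= `|x| -> c <= 31 / 32 -> `|c ^+ K / (1 - c)| <= 32 * `|x| ^+ K.
  move=> cx c1; rewrite normrM normrX (ger0_norm (_ : 0 <= (1 - c)^-1)) ?invr_ge0; last by rlra.
  rewrite mulrC; apply: ler_pM; rewrite ?invr_ge0 ?exprn_ge0 ?lerXn2r ?nnegrE//; first by rlra.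
  by rewrite -[leRHS]invrK lef_pV2 ?posrE; rlra.
have key c : f x = c ^+ K / (1 - c) * x -> `|c| <= `|x| -> c <= 31 / 32 -> `|f x| <= 32 * `|x| ^+ K.+1.
  by move=> -> cx c1; rewrite normrM exprSr mulrA ler_wpM2r// bound.
have [x0|x0] := leP 0 x.
  have [|c /andP[c0 cx] e] := @mvt_le R f (fun y => y ^+ K / (1 - y)) 0 x x0.
    by move=> y /andP[_ yx]; apply: is_derive_ln_rem; rlra.
  by apply: (key c); rewrite ?ger0_norm//; [move: e; rewrite f0 !subr0|rlra].
have [|c /andP[cx c0] e] := @mvt_le R f (fun y => y ^+ K / (1 - y)) x 0 (ltW x0).
  by move=> y /andP[_ yx]; apply: is_derive_ln_rem; rlra.
apply: (key c); [|by rewrite !ler0_norm ?lerN2// ltW|rlra].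
by move: e; rewrite f0 !sub0r mulrN => /oppr_inj.
Qed.

(** Both - ln (1 - u/p) and u kap(p) are u/p + O(1/p^2). *)
Lemma kap_interp p u : prime p -> 0 <= u <= 1 -> exists2 a : R, 1 - u / p%:R = expR (- a) & `|a - u * kap R p| <= 2 * npow 2 p.
Proof.
move=> pp /andP[u0 u1]; have [i0 i1] := @inv_prime_bounds R p pp.
have e2 : npow 2 p = p%:R^-1 * p%:R^-1 :> R by rewrite -[2]/(1 + 1) npowD npow_1 ?prime_gt0.
have /andP[k1 k2] := kap_bounds R (prime_gt1 pp); rewrite npow_1 ?prime_gt0// e2 in k1 k2.
rewrite e2; move: (p%:R^-1) i0 i1 k1 k2 => i i0 i1 k1 k2.
have w0 : 0 <= u * i by rewrite mulr_ge0// ltW.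
have wi : u * i <= i by rewrite ler_piMl// ltW.
have ii : 0 <= i * i by rewrite mulr_ge0// ltW.
have x0 : 0 < 1 - u * i by lra.
exists (- ln (1 - u * i)); first by rewrite opprK lnK.
have l1 : ln (1 - u * i) <= - (u * i) by apply: le_ln1Dx; lra.
have := ln_diff_le x0 ltr01; rewrite ln1 sub0r (_ : 1 - (1 - u * i) = u * i); last by ring.
have : u * i / (1 - u * i) <= u * i + 2 * (i * i).
  rewrite ler_pdivrMr//; have : u * i * (u * i) <= i * i by apply: ler_pM.
  have : 0 <= i * i by rewrite mulr_ge0// ltW.
  have : 0 <= i * i * (1 - 2 * (u * i)) by rewrite !mulr_ge0 ?(ltW i0)//; lra.
  by move: (u * i) w0 wi => w *; nra.
have : u * i <= u * kap R p by rewrite ler_wpM2l.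
have : u * kap R p <= u * i + 2 * (i * i).
  apply: le_trans (ler_wpM2l u0 k2) _; by rewrite mulrDr lerD2l ler_piMl// mulr_ge0.
move: (u * i / (1 - u * i)) l1 => q; move: (ln (1 - u * i)) (u * kap R p) (u * i) (i * i) => *; rewrite ler_norml; apply/andP; split; lra.
Qed.

Lemma Piprod_interp (th : nat -> R) S : (forall n, 0 <= th n <= 1) -> all prime S ->
  exists2 a, Piprod th S = expR (- a) & `|a - \sum_(p <- S) (1 - th p) * kap R p| <= 2 * \sum_(p <- S) npow 2 p.
Proof.
move=> t01; elim: S => [_|p S ih /= /andP[pp /ih[a e1 h1]]].
  by exists 0; [rewrite /Piprod big_nil oppr0 expR0|rewrite !big_nil subr0 normr0 mulr0].
have /andP[t0 t1] := t01 p; have u01 : 0 <= 1 - th p <= 1 by apply/andP; split; lra.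
have [b e2 h2] := kap_interp pp u01; exists (b + a).
  by rewrite /Piprod big_cons -/(Piprod th S) e1 e2 -expRD opprD.
rewrite !big_cons mulrDr opprD addrACA; exact: le_trans (ler_normD _ _) (lerD h2 h1).
Qed.

Lemma abel_merL (f : nat -> R) N :
  \sum_(1 <= p < N.+1 | prime p) f p * kap R p = f N * merL R N + \sum_(1 <= n < N) (f n - f n.+1) * merL R n.
Proof.
elim: N => [|N ih]; first by rewrite !big_geq// /merL big_geq// mulr0 addr0.
have eL : merL R N.+1 = merL R N + (if prime N.+1 then kap R N.+1 else 0).
  by rewrite /merL !(big_mkcond prime) big_nat_recr.
have -> : \sum_(1 <= p < N.+2 | prime p) f p * kap R p = \sum_(1 <= p < N.+1 | prime p) f p * kap R p + f N.+1 * (if prime N.+1 then kap R N.+1 else 0).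
  by rewrite !(big_mkcond prime) big_nat_recr//=; case: ifP; rewrite ?mulr0.
rewrite ih eL; case: N {ih eL} => [|N].
  by rewrite /merL !big_geq//=; ring.
rewrite [X in _ = _ + X]big_nat_recr//=.
by move: (\sum_(1 <= n < N.+1) _) => s; ring.
Qed.

Lemma merL_bound n : (0 < n)%N -> 0 <= merL R n <= 3 * (1 + ln n%:R).
Proof.
move=> n0; apply/andP; split.
  by apply: sumr_ge0 => p pp; have /andP[h _] := kap_bounds R (prime_gt1 pp); apply: le_trans h; exact: npow_ge0.
apply: le_trans (ler_wpM2l (ler0n R 3) (harmonic_le R n)); rewrite mulr_sumr /merL big_mkcond.
apply: ler_sum => p _; case: ifP => [pp|_]; last by rewrite mulr_ge0 ?npow_ge0.
have /andP[_ h] := kap_bounds R (prime_gt1 pp); apply: le_trans h _.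
have : npow 2 p <= npow 1 p :> R by apply: npow_le; lra.
by lra.
Qed.

Lemma ln_pow_small j : exists2 C : R, 0 <= C & forall v, 16 <= v -> v^-1 <= C / (16 * ln v) ^+ j.
Proof.
have q0 : 0 < 1 / 16 :> R by lra.
have [C C0 hC] := pow_exp_bound j q0.
exists C => // v v16; have v0 : 0 < v by lra.
have l0 : 0 < 16 * ln v by rewrite mulr_gt0// ln_gt0//; lra.
have := hC _ (ltW l0); rewrite (_ : 1 / 16 * (16 * ln v) = ln v); last by lra.
by rewrite expRN lnK ?posrE// ler_pdivlMr ?exprn_gt0// mulrC.
Qed.

Section Fixed.
Variable v : R.
Hypothesis v16 : 16 <= v.
Let v0 : 0 < v. Proof. by apply: lt_le_trans v16. Qed.
Let y := yv v. Let z1 := z1v v. Let N := z2v v. Let M := Num.truncn v.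
Let t := v^-1.
Let l := 16 * ln v.
Definition phiv n : R := 1 - thetav v n.

Lemma thetav01 n : 0 <= thetav v n <= 1.
Proof.
rewrite expR_ge0 /= -[leRHS]expR0 ler_expR oppr_le0 divr_ge0// exprn_ge0// ltW//.
Qed.

Lemma psi_phi n : phiv n - phiv n.+1 = psi y n.
Proof. by rewrite /phiv /psi /thetav; ring. Qed.

Lemma lnv_ge1 : 1 <= ln v.
Proof.
have : ln (2 ^+ 4) <= ln v by rewrite ler_ln ?posrE// -natrX.
by rewrite lnXn// -[ln _ *+ _]mulr_natl; have := ln2_half R; lra.
Qed.

(** For p <= z1 one has y/p >= v^4, so exp (- y/p) is negligible and the factor 1 - 1/p fits the
    formula of the larger primes. The logarithm becomes a single sum over the primes up to z2. *)
Lemma Wv_interp : exists2 a, Wv v = expR (- a) & `|a - \sum_(1 <= p < N.+1 | prime p) phiv p * kap R p| <= 5 * t.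
Proof.
have pS : all prime (prange z1 N) by apply/allP => p; rewrite mem_prange => /and3P[].
have [b e2 h2] := Piprod_interp thetav01 pS.
have p0 : all prime (prange 0 z1) by apply/allP => p; rewrite mem_prange => /and3P[].
exists (\sum_(p <- prange 0 z1) kap R p + b).
  by rewrite /Wv Vol_exp// e2 -expRD opprD.
have -> : \sum_(1 <= p < N.+1 | prime p) phiv p * kap R p =
  \sum_(p <- prange 0 z1) phiv p * kap R p + \sum_(p <- prange z1 N) phiv p * kap R p.
  by rewrite /prange !big_filter (@big_cat_nat _ _ _ z1.+1)//= ltnS z1_le_z2.
have t0 : 0 < t by rewrite invr_gt0.
have h1 : `|\sum_(p <- prange 0 z1) kap R p - \sum_(p <- prange 0 z1) phiv p * kap R p| <= 3 * t.
  rewrite -sumrB; apply: le_trans (ler_norm_sum _ _ _) _.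
  apply: le_trans (_ : \sum_(p <- prange 0 z1) 3 * expR (- v ^+ 3) <= _).
    rewrite big_seq [leRHS]big_seq; apply: ler_sum => p; rewrite mem_prange => /and3P[pp _ pz].
    have /andP[k1 k2] := kap_bounds R (prime_gt1 pp).
    have n1 : npow 1 p <= 1 :> R by apply: npow_le1; lra.
    have n2 : npow 2 p <= 1 :> R by apply: npow_le1; lra.
    have n0 := npow_ge0 (1 : R) p; have /andP[th0 th1] := thetav01 p.
    have k0 := le_trans n0 k1; have kk : kap R p <= 3 by lra.
    rewrite /phiv (_ : kap R p - (1 - thetav v p) * kap R p = kap R p * thetav v p); last by ring.
    rewrite ger0_norm ?mulr_ge0//; apply: ler_pM => //.
    rewrite /thetav ler_expR lerN2 ler_pdivlMr ?ltr0n ?prime_gt0//.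
    apply: le_trans (ler_wpM2l _ (le_z1 v16 pz)) _; first by rewrite exprn_ge0// ltW.
    by rewrite -exprD (v_pow_le v16).
  rewrite big_const_seq count_predT iter_addr addr0 -[(_ * _) *+ _]mulr_natl.
  have sz : (size (prange 0 z1))%:R <= v ^+ 12.
    apply: le_trans (_ : z1%:R <= _).
      rewrite ler_nat -[leqRHS](size_iota 1); apply: uniq_leq_size; first by rewrite filter_uniq ?iota_uniq.
      by move=> q; rewrite mem_prange mem_iota add1n ltnS => /and3P[pq _ ->]; rewrite prime_gt0.
    by rewrite Num.Theory.truncn_le exprn_ge0// ltW.
  have := expN_le_t v16 (isT : 13 <= 256)%N => hE.
  apply: le_trans (ler_pM _ _ sz (ler_wpM2l (ler0n R 3) hE)) _; rewrite ?mulr_ge0 ?expR_ge0//.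
  by rewrite mulrCA (vt_pow v16 12 1) expr1.
have z10 : (0 < z1)%N by rewrite truncn_gt0 (v_pow_ge1 v16).
have h3 : \sum_(p <- prange z1 N) npow 2 p <= t.
  rewrite /prange big_filter; apply: le_trans (_ : \sum_(z1.+1 <= n < N.+1) npow (1 + 1) n <= _).
    by rewrite big_mkcond; apply: ler_sum => q _; case: ifP => // _; exact: npow_ge0.
  apply: le_trans (npow_tail _ ltr01 z10) _; rewrite divr1 npow_1// /t lef_pV2 ?posrE ?ltr0n//.
  have h := lt_truncnS (v ^+ 12); rewrite -natr1 -/(z1v v) -/z1 in h.
  have : v ^+ 2 <= v ^+ 12 by exact: v_pow_le.
  by have := v16; rewrite expr2; move: (v ^+ 12) h => a *; nra.
rewrite opprD addrACA; apply: le_trans (ler_normD _ _) _.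
apply: le_trans (lerD h1 (le_trans h2 (ler_wpM2l (ler0n R 2) h3))) _; lra.
Qed.
Lemma psi_ge0 n : (0 < n)%N -> 0 <= psi y n.
Proof.
move=> n0; rewrite /psi subr_ge0 ler_expR lerN2 ler_wpM2l ?exprn_ge0 ?(ltW v0)//.
by rewrite lef_pV2 ?posrE ?ltr0n// ler_nat.
Qed.

Lemma sum_psi a b : (a <= b)%N -> \sum_(a <= n < b) psi y n = phiv a - phiv b.
Proof.
move=> ab; have := telescope_sumr (fun n => - phiv n) ab; rewrite [RHS]addrC opprK => <-.
by apply: eq_bigr => n _; rewrite -psi_phi opprK addrC.
Qed.

Lemma M_bounds : [/\ (1 < M)%N, M%:R <= v, v < M%:R + 1 & (M <= N)%N].
Proof.
have Mv : M%:R <= v by rewrite Num.Theory.truncn_le ltW.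
have vM : v < M%:R + 1 by rewrite natr1; exact: lt_truncnS.
split => //; first by rewrite -(ltr_nat R); have := v16; lra.
by apply: le_truncn; rewrite -{1}[v]expr1 (v_pow_le v16).
Qed.

Lemma phi_N : 0 <= phiv N <= t ^+ 12.
Proof.
rewrite /phiv; have /andP[_ th1] := thetav01 N; apply/andP; split; first by lra.
have := expR_ge1Dx (- (y / N%:R)); rewrite -/(thetav v N) => h.
apply: le_trans (_ : y / N%:R <= _); first by lra.
apply: le_trans (ler_wpM2l (exprn_ge0 _ (ltW v0)) (inv_z2 v16)) _.
by rewrite (vt_pow v16 16 12).
Qed.

Lemma theta_M : 0 <= thetav v M <= t ^+ 2.
Proof.
have [M1 Mv _ _] := M_bounds; have M0 : 0 < M%:R :> R by rewrite ltr0n ltnW.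
rewrite expR_ge0 /=; apply: le_trans (expN_le_t v16 (isT : 2 <= 256)%N).
rewrite ler_expR lerN2 ler_pdivlMr//.
apply: le_trans (ler_wpM2l _ Mv) _; first by rewrite exprn_ge0// ltW.
by rewrite -exprSr (v_pow_le v16).
Qed.

(** At z2 the factor phi is at most v^(-12), and on n < M the total variation of phi is at most
    v^(-2), while [merL] is O(v) in both places. *)
Lemma sum_low : 0 <= phiv N * merL R N + \sum_(1 <= n < M) psi y n * merL R n <= 105 * t.
Proof.
have [M1 Mv vM MN] := M_bounds; have /andP[p0 p1] := phi_N; have /andP[q0 q1] := theta_M.
have t0 : 0 <= t by rewrite invr_ge0 ltW.
have N0 := z2_gt0 v16; rewrite -/N in N0; have /andP[A0 A1] := merL_bound N0.
have lN := lnz2 v16; rewrite -/N in lN.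
have vge := v16.
have h1 : phiv N * merL R N <= 99 * t.
  apply: le_trans (ler_pM p0 A0 p1 (le_trans A1 (_ : _ <= 99 * v))) _; first by lra.
  have e : t ^+ 12 * (99 * v) = 99 * (v ^+ 1 * t ^+ (1 + 11)) by rewrite expr1; ring.
  by rewrite e (vt_pow v16) ler_wpM2l// -[leRHS]expr1 (t_pow_le v16).
have h2 : \sum_(1 <= n < M) psi y n * merL R n <= 6 * t.
  apply: le_trans (_ : \sum_(1 <= n < M) psi y n * (6 * v) <= _).
    apply: ler_sum_nat => n /andP[n0 nM]; rewrite ler_wpM2l ?psi_ge0//.
    have /andP[_ h] := merL_bound n0; apply: le_trans h _.
    have : ln n%:R <= ln v.
      by rewrite ler_ln ?posrE ?ltr0n//; apply: le_trans Mv; rewrite ler_nat ltnW.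
    by have /andP[_] := ln_v_bounds v16; lra.
  rewrite -mulr_suml sum_psi; last exact: ltnW.
  have : phiv 1 - phiv M <= t ^+ 2.
    by apply: le_trans q1; have /andP[] := thetav01 1; rewrite /phiv; lra.
  move/(ler_wpM2r (mulr_ge0 (ler0n R 6) (ltW v0)))/le_trans; apply.
  have -> : t ^+ 2 * (6 * v) = 6 * (v ^+ 1 * t ^+ (1 + 1)) by rewrite expr1; ring.
  by rewrite (vt_pow v16) expr1.
apply/andP; split; last by lra.
rewrite addr_ge0 ?mulr_ge0// big_nat sumr_ge0// => n /andP[n0 _].
by rewrite mulr_ge0 ?psi_ge0//; have /andP[] := merL_bound n0.
Qed.

Variables (j : nat) (g Ce : R) (mu Cmu : nat -> R).
(** Odd, so that the remainder of order K + 1 is an even power: its sum is again one of the moments,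
    and no absolute values have to be integrated. *)
Let K := j.*2.+1.
Hypothesis hg : forall X, (1 < X)%N -> `|merL R X - ln (ln X%:R) - g| <= Ce / ln X%:R ^+ K.+1.
Hypothesis Ce0 : 0 <= Ce.
Hypothesis Cmu0 : forall k, 0 <= Cmu k.
Hypothesis hmu : forall k, `|\sum_(M <= n < N) psi y n * slog y n ^+ k - mu k| <= Cmu k * l ^+ k * t.

Lemma l_ge1 : 16 <= l. Proof. by have := lnv_ge1; rewrite /l; lra. Qed.
Lemma l_gt0 : 0 < l. Proof. by have := l_ge1; lra. Qed.

(** ln n = l - slog(n), where l = 16 ln v = ln y. Since n >= M >= v/2, ln n is at least half of ln
    v, which is l/32; this is the origin of the bound 31/32. *)
Lemma ln_range n : (M <= n)%N -> (n < N)%N -> [/\ l / 32 <= ln (n%:R : R), slog y n / l <= 31 / 32 &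
  ln (ln n%:R) = ln l + ln (1 - slog y n / l)].
Proof.
move=> Mn nN; have [M1 Mv vM MN] := M_bounds; have n0 : (0 < n)%N by apply: leq_trans Mn; exact: ltnW.
have lny : ln y = l by rewrite /y /yv lnXn// -[ln _ *+ _]mulr_natl.
have ge : l / 32 <= ln (n%:R : R).
  have h : ln M%:R <= ln n%:R :> R by rewrite ln_nat_le// ltnW.
  have h2 : ln v <= ln (2 * M%:R).
    have : 2 <= M%:R :> R by rewrite ler_nat.
    by move=> M2; have M20 : 0 < 2 * M%:R :> R by [lra]; rewrite ler_ln ?posrE//; lra.
  rewrite lnM ?posrE ?ltr0n ?(ltnW M1)// in h2.
  have h3 : ln (2%:R ^+ 2) <= ln v.
    by rewrite ler_ln ?posrE// ?exprn_gt0// expr2; have := v16; lra.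
  rewrite lnXn// -[ln _ *+ _]mulr_natl in h3.
  by rewrite /l; lra.
have lp := l_gt0; have e : 1 - slog y n / l = ln n%:R / l.
  by rewrite /slog lny; field; rewrite gt_eqF.
have np : 0 < ln (n%:R : R) by apply: lt_le_trans ge; rewrite divr_gt0.
split => //.
  have : 1 / 32 <= ln n%:R / l by rewrite ler_pdivlMr// mulrAC mul1r.
  by rewrite -e; lra.
by rewrite e lnM ?posrE ?invr_gt0// lnV ?posrE//; ring.
Qed.

Lemma sum_psi_le1 : \sum_(M <= n < N) psi y n <= 1.
Proof.
have [_ _ _ MN] := M_bounds; rewrite sum_psi//; have /andP[a _] := phi_N; have /andP[b _] := theta_M.
by rewrite /phiv in a *; lra.
Qed.

(** Abel summation produces the sum of psi(n) merL(n). There [merL] is replaced by ln ln n + g, and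
    ln ln n is expanded in powers of slog(n) / l. Weighted by psi, whose total mass is nearly 1, the
    constant ln l + g survives and the powers become the moments. *)
Lemma log_expand : `|\sum_(1 <= p < N.+1 | prime p) phiv p * kap R p -
   (ln l + g - \sum_(1 <= k < K.+1) mu k / k%:R * l^-1 ^+ k)| <=
   (105 + 32 + 2 * `|g| + 32 * Cmu K.+1 + \sum_(1 <= k < K.+1) Cmu k) * t +
   (32 * `|mu K.+1| + Ce * 32 ^+ K.+1) * l^-1 ^+ K.+1.
Proof.
have [M1 Mv vM MN] := M_bounds; have lp := l_gt0; have t0 : 0 < t by rewrite invr_gt0.
have li0 : 0 < l^-1 by rewrite invr_gt0.
have M0 : (0 < M)%N by exact: ltnW.
pose T n := \sum_(1 <= k < K.+1) (slog y n / l) ^+ k / k%:R.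
have split1 : \sum_(1 <= p < N.+1 | prime p) phiv p * kap R p =
    (phiv N * merL R N + \sum_(1 <= n < M) psi y n * merL R n) + \sum_(M <= n < N) psi y n * merL R n.
  rewrite abel_merL -addrA; congr (_ + _); rewrite (@big_cat_nat _ _ _ M)//=.
  by congr (_ + _); apply: eq_bigr => n _; rewrite psi_phi.
have h0 := sum_low.
have m_pos n : (M <= n < N)%N -> 0 <= psi y n by move=> /andP[Mn _]; apply: psi_ge0; exact: leq_trans Mn.
have h1 : `|\sum_(M <= n < N) psi y n * (merL R n - (ln l + g - T n))| <=
    32 * \sum_(M <= n < N) psi y n * slog y n ^+ K.+1 * l^-1 ^+ K.+1 + Ce * 32 ^+ K.+1 * l^-1 ^+ K.+1.
  apply: le_trans (_ : \sum_(M <= n < N) (psi y n * (32 * (slog y n ^+ K.+1 * l^-1 ^+ K.+1)) + psi y n * (Ce * 32 ^+ K.+1 * l^-1 ^+ K.+1)) <= _).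
    apply: le_trans (ler_norm_sum _ _ _) _; apply: ler_sum_nat => n /[dup] /m_pos p0 /andP[Mn nN].
    have [b1 b2 b3] := ln_range Mn nN; rewrite normrM (ger0_norm p0) -mulrDr ler_wpM2l//.
    have e1 := hg (leq_trans M1 Mn); have e2 := ln_rem_le K b2.
    have e3 : Ce / ln n%:R ^+ K.+1 <= Ce * 32 ^+ K.+1 * l^-1 ^+ K.+1.
      rewrite -mulrA ler_wpM2l// -exprVn -exprMn lerXn2r ?nnegrE ?mulr_ge0 ?invr_ge0 ?(ltW lp)//.
        by apply: le_trans b1; rewrite divr_ge0// ltW.
      rewrite (_ : 32 * l^-1 = (l / 32)^-1); last by rewrite invf_div.
      by rewrite lef_pV2 ?posrE ?divr_gt0//; apply: lt_le_trans b1; rewrite divr_gt0.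
    have e4 : `|slog y n / l| ^+ K.+1 = slog y n ^+ K.+1 * l^-1 ^+ K.+1.
      rewrite -exprMn /K -doubleS -!mul2n !exprM; congr (_ ^+ _).
      by rewrite real_normK// num_real.
    rewrite e4 -/(T n) in e2; rewrite b3 in e1.
    move: e1 e2 e3; move: (merL R n) (T n) (ln (1 - _)) (_ * l^-1 ^+ _) (Ce / _) (_ * l^-1 ^+ _) (ln l) => a b c d f h i.
    by rewrite !ler_norml => /andP[? ?] /andP[? ?] ?; apply/andP; split; lra.
  rewrite big_split /= -mulr_suml; apply: lerD.
    rewrite mulr_sumr le_eqVlt; apply/orP; left; apply/eqP; apply: eq_bigr => n _.
    by move: (slog y n ^+ _) (l^-1 ^+ _) => a b; ring.
  rewrite ler_piMl ?sum_psi_le1//.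
  exact: mulr_ge0 (mulr_ge0 Ce0 (exprn_ge0 K.+1 (ler0n R 32))) (exprn_ge0 K.+1 (ltW li0)).
have h2 : \sum_(M <= n < N) psi y n * (ln l + g) = (ln l + g) - (ln l + g) * (thetav v M + phiv N).
  by rewrite -mulr_suml sum_psi// /phiv; ring.
have h3 : `|(ln l + g) * (thetav v M + phiv N)| <= (32 + 2 * `|g|) * t.
  have /andP[a0 a1] := theta_M; have /andP[b0 b1] := phi_N.
  have ln0 : 0 <= ln l by rewrite ln_ge0//; have := l_ge1; lra.
  have lnl : ln l <= 16 * v.
    have := ln_diff_le ltr01 lp; rewrite ln1 subr0 divr1 => h; have /andP[_ h7] := ln_v_bounds v16.
    by rewrite /l in h *; lra.
  rewrite normrM (ger0_norm (addr_ge0 a0 b0)).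
  have tt : thetav v M + phiv N <= 2 * t ^+ 2.
    by have : t ^+ 12 <= t ^+ 2 by [exact: t_pow_le]; lra.
  have gg : `|ln l + g| <= 16 * v + `|g| by apply: le_trans (ler_normD _ _) _; rewrite ger0_norm// lerD2r.
  apply: le_trans (ler_pM (normr_ge0 _) (addr_ge0 a0 b0) gg tt) _.
  have -> : (16 * v + `|g|) * (2 * t ^+ 2) = 32 * (v ^+ 1 * t ^+ (1 + 1)) + 2 * `|g| * t ^+ 2.
    by rewrite expr1; ring.
  rewrite (vt_pow v16) expr1 [leRHS]mulrDl lerD2l ler_wpM2l ?mulr_ge0//.
  by rewrite -[leRHS]expr1 (t_pow_le v16).
have h4 : `|\sum_(M <= n < N) psi y n * T n - \sum_(1 <= k < K.+1) mu k / k%:R * l^-1 ^+ k| <= (\sum_(1 <= k < K.+1) Cmu k) * t.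
  have -> : \sum_(M <= n < N) psi y n * T n = \sum_(1 <= k < K.+1) (\sum_(M <= n < N) psi y n * slog y n ^+ k) / k%:R * l^-1 ^+ k.
    under eq_bigr do rewrite /T mulr_sumr.
    rewrite exchange_big /=; apply: eq_bigr => k _; rewrite !mulr_suml; apply: eq_bigr => n _.
    by rewrite exprMn; move: (slog y n ^+ k) (l^-1 ^+ k) (k%:R^-1) => a b c; ring.
  rewrite -sumrB mulr_suml; apply: le_trans (ler_norm_sum _ _ _) _.
  apply: ler_sum_nat => k /andP[k0 _]; rewrite -!mulrBl !normrM.
  have lk : 0 < l ^+ k by rewrite exprn_gt0.
  rewrite [`|l^-1 ^+ k|]ger0_norm ?exprn_ge0 ?(ltW li0)// [`|_^-1|]ger0_norm ?invr_ge0//.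
  have k1 : k%:R^-1 <= 1 :> R by rewrite invf_le1 ?ltr0n// ler1n.
  have b0 : 0 <= Cmu k * t by rewrite mulr_ge0// ltW.
  apply: le_trans (_ : Cmu k * l ^+ k * t * l^-1 ^+ k <= _).
    rewrite ler_wpM2r ?exprn_ge0 ?(ltW li0)//; apply: le_trans (hmu k); rewrite ler_piMr//.
  have ee : l ^+ k * l^-1 ^+ k = 1 by rewrite exprVn mulfV// gt_eqF.
  rewrite (_ : Cmu k * l ^+ k * t * l^-1 ^+ k = Cmu k * t * (l ^+ k * l^-1 ^+ k)); last first.
    by move: (l ^+ k) (l^-1 ^+ k) => p q; ring.
  by rewrite ee mulr1.
have h5 : 32 * \sum_(M <= n < N) psi y n * slog y n ^+ K.+1 * l^-1 ^+ K.+1 <= 32 * `|mu K.+1| * l^-1 ^+ K.+1 + 32 * Cmu K.+1 * t.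
  have lk : 0 < l ^+ K.+1 by rewrite exprn_gt0.
  rewrite -mulr_suml -!(mulrA 32) -mulrDr ler_wpM2l//.
  have := hmu K.+1; rewrite ler_distl => /andP[_]; have := ler_norm (mu K.+1).
  move=> p1 p2; have lki : 0 <= l^-1 ^+ K.+1 by rewrite exprn_ge0// ltW.
  apply: le_trans (ler_wpM2r lki p2) _; rewrite mulrDl; apply: lerD; first by rewrite ler_wpM2r.
  have ee : l ^+ K.+1 * l^-1 ^+ K.+1 = 1 by rewrite exprVn mulfV// gt_eqF.
  rewrite (_ : Cmu K.+1 * l ^+ K.+1 * t * l^-1 ^+ K.+1 = Cmu K.+1 * t * (l ^+ K.+1 * l^-1 ^+ K.+1)); last first.
    by move: (l ^+ K.+1) (l^-1 ^+ K.+1) => p q; ring.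
  by rewrite ee mulr1.
have e1 : \sum_(M <= n < N) psi y n * (merL R n - (ln l + g - T n)) =
    \sum_(M <= n < N) psi y n * merL R n - \sum_(M <= n < N) psi y n * (ln l + g) + \sum_(M <= n < N) psi y n * T n.
  rewrite -sumrB -big_split /=; apply: eq_bigr => n _; ring.
rewrite e1 h2 in h1; rewrite split1.
move: h0 h1 h3 h4 h5; rewrite !ler_norml.
move: (phiv N * _ + _) (\sum_(M <= n < N) psi y n * merL R n) ((ln l + g) * _) (\sum_(M <= n < N) psi y n * T n).
move: (32 * \sum_(M <= n < N) _) (\sum_(1 <= k < K.+1) mu k / k%:R * _) (\sum_(1 <= k < K.+1) Cmu k) => a b c d e f h.
rewrite (_ : (105 + 32 + 2 * `|g| + 32 * Cmu K.+1 + c) * t + (32 * `|mu K.+1| + Ce * 32 ^+ K.+1) * l^-1 ^+ K.+1 =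
  105 * t + (32 + 2 * `|g|) * t + 32 * Cmu K.+1 * t + c * t + 32 * `|mu K.+1| * l^-1 ^+ K.+1 + Ce * 32 ^+ K.+1 * l^-1 ^+ K.+1); last by ring.
move: (32 * `|mu K.+1| * _) (Ce * _ * _) ((32 + 2 * `|g|) * t) (32 * Cmu K.+1 * t) (c * t) (ln l) => x1 x2 x3 x4 x5 x6.
by move=> /andP[? ?] /andP[? ?] /andP[? ?] /andP[? ?] ?; apply/andP; split; lra.
Qed.
End Fixed.

Theorem Wv_log : exists mu : nat -> R, forall j : nat, exists2 B : R, 0 <= B & forall v, 16 <= v ->
  exists2 a, Wv v = expR (- a) & `|a - (ln (16 * ln v) + euler_gamma R -
    \sum_(1 <= k < j.*2.+2) mu k / k%:R * (16 * ln v)^-1 ^+ k)| <= B * (16 * ln v)^-1 ^+ j.*2.+2.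
Proof.
have [mu hmu] := boolp.choice (moment_limit R); have [Cmu hC] := boolp.choice hmu.
have [g hg] := merL_limit R; have eg := merL_const hg; rewrite eg in hg.
exists mu => j; have [Ce Ce0 he] := hg j.*2.+2; have [D D0 hD] := ln_pow_small j.*2.+2.
have Cmu0 k : 0 <= Cmu k by have [] := hC k.
set A := 105 + 32 + 2 * `|euler_gamma R| + 32 * Cmu j.*2.+2 + \sum_(1 <= k < j.*2.+2) Cmu k.
have A0 : 0 <= A by rewrite !addr_ge0 ?mulr_ge0 ?sumr_ge0.
set E := 32 * `|mu j.*2.+2| + Ce * 32 ^+ j.*2.+2.
have E0 : 0 <= E := addr_ge0 (mulr_ge0 (ler0n R 32) (normr_ge0 _)) (mulr_ge0 Ce0 (exprn_ge0 _ (ler0n R 32))).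
exists ((5 + A) * D + E); first by rewrite addr_ge0// mulr_ge0// addr_ge0.
move=> v v16; have [a e1 h1] := Wv_interp v16; exists a => //.
have := log_expand v16 he Ce0 Cmu0 (fun k => (hC k).2 v v16); rewrite -/A -/E => h2.
have := hD v v16; rewrite -exprVn => h3; have A5 : 0 <= 5 + A by rewrite addr_ge0.
have := ler_wpM2l A5 h3; rewrite mulrA mulrDl [X in _ -> _ <= X]mulrDl => h4.
apply: le_trans (ler_distD _ _ _) (le_trans (lerD h1 h2) _).
by rewrite addrA lerD2r.
Qed.
End LogModel.

(** * Asymptotic series in 1 / ln ln ln x *)

Section AsymptoticSeries.
Variable R : realType.
Implicit Types (s C : R) (c d : nat -> R) (k n N : nat).

(** Each remainder vanishes at 0 and has the preceding one as derivative. *)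
Lemma exp_taylor n (x : R) : `|expR x - \sum_(0 <= i < n.+1) x ^+ i / i`!%:R| <= `|x| ^+ n.+1 * expR `|x|.
Proof.
elim: n x => [|n ih] x.
  rewrite big_nat1 expr0 divr1 expr1; have := expR_ge1Dx x; have := expR_ge1Dx (- x).
  have E0 := expR_gt0 x; have [x0|x0] := leP 0 x.
    rewrite expRN => h h2; rewrite ger0_norm; last by lra.
    have : (1 - x) * expR x <= 1 by apply: le_trans (ler_wpM2r (ltW E0) h) _; rewrite mulVf// gt_eqF.
    by rewrite (ger0_norm x0); lra.
  move=> _ h; rewrite ler0_norm; last by rewrite subr_le0 -[leRHS]expR0 ler_expR ltW.
  rewrite (ltr0_norm x0); have : 1 <= expR (- x) by rewrite -[leLHS]expR0 ler_expR; lra.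
  by move=> h2; apply: le_trans (_ : - x * 1 <= _); [lra|rewrite ler_wpM2l//; lra].
pose f m y : R := expR y - \sum_(0 <= i < m) y ^+ i / i`!%:R.
have df (y : R) : is_derive y 1 (f n.+2) (f n.+1 y).
  have d1 : is_derive y 1 (fun y => \sum_(1 <= i < n.+2) i`!%:R^-1 * y ^+ i) (\sum_(1 <= i < n.+2) i`!%:R^-1 * (i%:R * y ^+ i.-1)).
    exact: (@is_derive_sum R (fun i y => i`!%:R^-1 * y ^+ i) (fun i y => i`!%:R^-1 * (i%:R * y ^+ i.-1)) y n.+1 (fun i => is_deriveZl _ (is_derive_pow i y))).
  have /is_derive_eq := is_deriveB (is_deriveB (is_derive_expR y) (is_derive_cst (1 : R) y 1)) d1.
  rewrite (_ : _ - _ = f n.+2); last first.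
    apply/funext => z; rewrite /f [in RHS]big_ltn// expr0 divr1 opprD addrA; congr (_ - _).
    by apply: eq_bigr => i _; rewrite mulrC.
  apply; rewrite subr0 /f; congr (_ - _); rewrite big_add1 /=.
  apply: eq_bigr => i _ /=; by rewrite factS natrM invfM [X in X * _]mulrC -mulrA mulKf ?pnatr_eq0// mulrC.
have f0 : f n.+2 0 = 0.
  rewrite /f expR0 big_ltn// expr0 divr1 opprD addrA subrr sub0r big_nat_cond big1 ?oppr0// => i /andP[/andP[i0 _] _].
  by rewrite expr0n gtn_eqF// mul0r.
have key z : f n.+2 x = f n.+1 z * x -> `|z| <= `|x| -> `|f n.+2 x| <= `|x| ^+ n.+2 * expR `|x|.
  move=> -> zx; rewrite normrM exprSr -mulrA [`|x| * _]mulrC mulrA ler_wpM2r//.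
  apply: le_trans (ih z) _; apply: ler_pM; rewrite ?exprn_ge0 ?expR_ge0 ?ler_expR//.
  by rewrite lerXn2r ?nnegrE.
have [x0|x0] := leP 0 x.
  have [z /andP[z0 zx] e] := @mvt_le R (f n.+2) (f n.+1) 0 x x0 (fun y _ => df y).
  by apply: (key z); rewrite ?ger0_norm//; move: e; rewrite f0 !subr0.
have [z /andP[zx z0] e] := @mvt_le R (f n.+2) (f n.+1) x 0 (ltW x0) (fun y _ => df y).
apply: (key z); last by rewrite !ler0_norm ?lerN2// ltW.
by move: e; rewrite f0 !sub0r mulrN => /oppr_inj.
Qed.

Lemma sum_pow_le (a : nat -> R) m n s : 0 <= s <= 1 ->
  `|\sum_(m <= k < n) a k * s ^+ k| <= (\sum_(m <= k < n) `|a k|) * s ^+ m.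
Proof.
move=> /andP[s0 s1]; rewrite mulr_suml; apply: le_trans (ler_norm_sum _ _ _) _.
apply: ler_sum_nat => k /andP[mk _]; rewrite normrM ler_wpM2l// ger0_norm ?exprn_ge0//.
exact: ler_wiXn2l.
Qed.

Lemma poly_truncate (q : {poly R}) N : exists2 C, 0 <= C & forall s, 0 <= s <= 1 ->
  `|q.[s] - \sum_(0 <= k < N.+1) q`_k * s ^+ k| <= C * s ^+ N.+1.
Proof.
pose m := maxn (size q) N.+1; exists (\sum_(N.+1 <= k < m) `|q`_k|); first by rewrite sumr_ge0.
move=> s s01; rewrite (horner_coef_wide s (leq_maxl (size q) N.+1)) -/m.
rewrite -(big_mkord xpredT (fun k => q`_k * s ^+ k)) (@big_cat_nat _ _ _ N.+1)//= ?leq_maxr//.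
by rewrite addrAC subrr add0r sum_pow_le.
Qed.

(** A Taylor polynomial of exp, composed with the given polynomial, is again an element of
    [{poly R}], whose coefficients can be truncated. As the sum starts at k = 1, the Taylor error is
    O(s^(N+1)). *)
Lemma exp_poly (a : nat -> R) m N : exists c C, 0 <= C /\ forall s, 0 <= s <= 1 ->
  `|expR (\sum_(1 <= k < m) a k * s ^+ k) - \sum_(0 <= k < N.+1) c k * s ^+ k| <= C * s ^+ N.+1.
Proof.
pose P : {poly R} := \sum_(1 <= k < m) a k *: 'X^k.
pose q : {poly R} := \sum_(0 <= i < N.+1) i`!%:R^-1 *: P ^+ i.
have [C C0 hC] := poly_truncate q N; pose A := \sum_(1 <= k < m) `|a k|.
have A0 : 0 <= A by rewrite sumr_ge0.
exists (fun k => q`_k), (A ^+ N.+1 * expR A + C); split.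
  by rewrite addr_ge0// mulr_ge0 ?exprn_ge0 ?expR_ge0.
move=> s s01; have /andP[s0 s1] := s01.
have PE : P.[s] = \sum_(1 <= k < m) a k * s ^+ k.
  by rewrite /P horner_sum; apply: eq_bigr => k _; rewrite hornerZ hornerXn.
have qE : q.[s] = \sum_(0 <= i < N.+1) P.[s] ^+ i / i`!%:R.
  by rewrite /q horner_sum; apply: eq_bigr => i _; rewrite hornerZ horner_exp mulrC.
have Ps : `|P.[s]| <= A * s by rewrite PE -[s in leRHS]expr1 sum_pow_le.
have PA : `|P.[s]| <= A by apply: le_trans Ps _; rewrite ler_piMr.
rewrite -PE mulrDl; apply: le_trans (ler_distD q.[s] _ _) (lerD _ (hC s s01)).
rewrite qE; apply: le_trans (exp_taylor _ _) _; rewrite mulrAC -exprMn.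
by apply: ler_pM; rewrite ?exprn_ge0 ?expR_ge0 ?ler_expR// lerXn2r ?nnegrE// mulr_ge0.
Qed.

Lemma le_small_eq0 (a C s0 : R) : 0 < s0 -> (forall s, 0 < s -> s <= s0 -> `|a| <= C * s) -> a = 0.
Proof.
move=> s00 h; apply/eqP; rewrite -normr_eq0 eq_le normr_ge0 andbT; apply/ler_addgt0Pl => e e0.
rewrite addr0; pose b := 1 + `|C|; have b0 : 0 < b by rewrite /b; have := normr_ge0 C; lra.
have m0 : 0 < Num.min s0 (e / b) by rewrite lt_min s00 divr_gt0.
apply: le_trans (h _ m0 _) _; first by rewrite ge_min lexx.
have h1 : Num.min s0 (e / b) * b <= e by rewrite -ler_pdivlMr// ge_min lexx orbT.
by move: (Num.min _ _) m0 h1 (ler_norm C) => x x0; rewrite /b => h1 h2; have := normr_ge0 C; nra.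
Qed.

(** Letting s tend to 0 kills the constant term; then divide by s and repeat. *)
Lemma asym_unique N d C s0 : 0 < s0 -> s0 <= 1 ->
  (forall s, 0 < s -> s <= s0 -> `|\sum_(0 <= k < N.+1) d k * s ^+ k| <= C * s ^+ N.+1) ->
  forall k, (k <= N)%N -> d k = 0.
Proof.
move=> s00 s01; elim: N d => [|N ih] d h.
  have d0 : d 0%N = 0.
    by apply: (le_small_eq0 s00) => s p q; have := h s p q; rewrite big_nat1 expr0 mulr1 expr1; apply.
  by case.
have d0 : d 0%N = 0.
  apply: (@le_small_eq0 _ (`|C| + \sum_(1 <= k < N.+2) `|d k|) _ s00) => s p q.
  have s1 : s <= 1 by exact: le_trans q s01.
  have h1 := h s p q; have h2 := @sum_pow_le d 1 N.+2 s (introT andP (conj (ltW p) s1)).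
  rewrite big_ltn// expr0 mulr1 in h1; rewrite expr1 in h2; rewrite mulrDl.
  have h3 : C * s ^+ N.+2 <= `|C| * s.
    apply: le_trans (_ : `|C| * s ^+ N.+2 <= _); first by rewrite ler_wpM2r ?ler_norm ?exprn_ge0 ?(ltW p).
    by rewrite ler_wpM2l// -[leRHS]expr1 ler_wiXn2l ?(ltW p).
  move: (\sum_(1 <= k < N.+2) d k * _) h1 h2 => S h1 h2.
  rewrite -[d 0%N](addrK S); apply: le_trans (ler_normB _ _) _; exact: lerD (le_trans h1 h3) h2.
have hd : forall k, (k <= N)%N -> d k.+1 = 0.
  apply: ih => s p q; rewrite -(ler_pM2l p) mulrCA -exprS; apply: le_trans (h s p q).
  rewrite [X in _ <= `|X|]big_ltn// d0 mul0r add0r big_add1 -{1}(gtr0_norm p) -normrM mulr_sumr.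
  by rewrite le_eqVlt; apply/orP; left; apply/eqP; congr `|_|; apply: eq_bigr => i _; rewrite exprS mulrCA.
by case => // k; exact: hd.
Qed.

Lemma sum_tail_le c N M s : 0 <= s <= 1 -> (N <= M)%N ->
  `|\sum_(0 <= k < M.+1) c k * s ^+ k - \sum_(0 <= k < N.+1) c k * s ^+ k| <= (\sum_(N.+1 <= k < M.+1) `|c k|) * s ^+ N.+1.
Proof.
by move=> s01 NM; rewrite (@big_cat_nat _ _ _ N.+1)//= addrAC subrr add0r sum_pow_le.
Qed.

(* Truncating the expansion to order [M] gives an expansion to each order [N <= M], so uniqueness
   of the coefficients makes the expansions to different orders consistent. *)
Lemma asym_single (F : R -> R) s0 : 0 < s0 -> s0 <= 1 ->
  (forall N, exists c C, 0 <= C /\ forall s, 0 < s -> s <= s0 ->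
    `|F s - \sum_(0 <= k < N.+1) c k * s ^+ k| <= C * s ^+ N.+1) ->
  exists c, forall N, exists C, 0 <= C /\ forall s, 0 < s -> s <= s0 ->
    `|F s - \sum_(0 <= k < N.+1) c k * s ^+ k| <= C * s ^+ N.+1.
Proof.
move=> s00 s01 /boolp.choice[e he]; exists (fun k => e k k) => N.
have [C [C0 hC]] := he N; exists C; split => // s p q.
suff -> : \sum_(0 <= k < N.+1) e k k * s ^+ k = \sum_(0 <= k < N.+1) e N k * s ^+ k by exact: hC.
apply: eq_big_nat => k /andP[_]; rewrite ltnS => kN; congr (_ * _).
have [D [D0 hD]] := he k; apply/eqP; rewrite -subr_eq0; apply/eqP.
apply: (@asym_unique k (fun i => e k i - e N i) (D + (C + \sum_(k.+1 <= i < N.+1) `|e N i|)) s0 s00 s01 _ k (leqnn k)).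
move=> z zp zq; have z01 : 0 <= z <= 1 by rewrite (ltW zp) (le_trans zq s01).
have h1 := hD z zp zq; have h2 := hC z zp zq; have h3 := sum_tail_le (e N) z01 kN.
have h4 : C * z ^+ N.+1 <= C * z ^+ k.+1 by rewrite ler_wpM2l// ler_wiXn2l ?(ltW zp)//; have /andP[] := z01.
under eq_bigr do rewrite mulrBl; rewrite sumrB 2!mulrDl.
move: h1 (le_trans h2 h4) h3; rewrite !ler_norml.
move: (F z) (\sum_(0 <= i < k.+1) e k i * _) (\sum_(0 <= i < k.+1) e N i * _) (\sum_(0 <= i < N.+1) e N i * _).
move: (D * z ^+ k.+1) (C * z ^+ k.+1) ((\sum_(k.+1 <= i < N.+1) `|e N i|) * z ^+ k.+1) => a b c f x y w /andP[? ?] /andP[? ?] /andP[? ?]; apply/andP; split; lra.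
Qed.

(** The density with its leading factor e^(-gamma) / l removed, as a function of l = ln ln ln x, for
    which v = e^(l/16). *)
Definition Fv (l : R) : R := Wv (expR (l / 16)) * l * expR (euler_gamma R).

(** In the logarithm of the density the terms ln l and gamma cancel against the factors l and
    e^gamma, leaving the exponential of a polynomial in s = 1/l without constant term. For s <= 1/64
    one has v = e^(l/16) >= e^4 >= 16. *)
Lemma Fv_expand : exists c, c 0%N = 1 /\ forall N, exists C, 0 <= C /\ forall s, 0 < s -> s <= 1 / 64 ->
  `|Fv s^-1 - \sum_(0 <= k < N.+1) c k * s ^+ k| <= C * s ^+ N.+1.
Proof.
have [mu hmu] := Wv_log R; pose a k := mu k / k%:R.
have near_exp N : exists C, 0 <= C /\ forall s, 0 < s -> s <= 1 / 64 ->
    `|Fv s^-1 - expR (\sum_(1 <= k < N.*2.+2) a k * s ^+ k)| <= C * s ^+ N.+1.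
  have [B B0 hB] := hmu N; pose A := \sum_(1 <= k < N.*2.+2) `|a k|.
  exists (expR A * (B * expR B)); split; first by rewrite !mulr_ge0 ?expR_ge0.
  move=> s s0 s1; have s01 : 0 <= s <= 1 by apply/andP; split; rlra.
  pose v := expR (s^-1 / 16); have lv : 16 * ln v = s^-1 by rewrite expRK; rlra.
  have v16 : 16 <= v.
    apply: le_trans (_ : expR 1 ^+ 4 <= _).
      apply: le_trans (_ : 2 ^+ 4 <= _); first by rewrite -natrX.
      by rewrite lerXn2r ?nnegrE ?expR_ge0//; have := expR_ge1Dx (1 : R); rlra.
    rewrite -expRM_natl mulr1 ler_expR ler_pdivlMr// -natrM -[leLHS]invrK lef_pV2 ?posrE ?invr_gt0//.
    by rewrite mul1r in s1.
  have [b eb hb] := hB v v16; rewrite lv invrK -/(a _) in hb.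
  set P := \sum_(1 <= k < N.*2.+2) a k * s ^+ k in hb *.
  have Fe : Fv s^-1 = expR P * expR (- (b - (ln s^-1 + euler_gamma R - P))).
    rewrite /Fv -/v eb -[X in _ * X * _](@lnK _ s^-1) ?posrE ?invr_gt0// -!expRD; congr expR; ring.
  have PA : `|P| <= A.
    apply: le_trans (sum_pow_le a 1 N.*2.+2 s01) _; rewrite expr1 ler_piMr// ?sumr_ge0//.
    by case/andP: s01.
  pose dl := - (b - (ln s^-1 + euler_gamma R - P)); rewrite -/dl in Fe.
  rewrite (_ : Fv s^-1 - expR P = expR P * (expR dl - 1)); last by rewrite Fe; ring.
  rewrite normrM (ger0_norm (expR_ge0 _)) -mulrA.
  have dB : `|dl| <= B * s ^+ N.+1.
    rewrite /dl normrN; apply: le_trans hb _; rewrite ler_wpM2l// ler_wiXn2l ?(ltW s0)//; first by case/andP: s01.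
    by rewrite ltnS (leq_trans _ (leqnSn _))// -addnn leq_addr.
  apply: ler_pM; rewrite ?expR_ge0//.
    by rewrite ler_expR; apply: le_trans (ler_norm _) PA.
  have := exp_taylor 0 dl.
  rewrite big_nat1 expr0 divr1 expr1 => h; apply: le_trans h _; rewrite mulrAC.
  apply: ler_pM => //; rewrite ?expR_ge0// ler_expR; apply: le_trans dB _; rewrite ler_piMr// exprn_ile1//.
    exact: ltW.
  by case/andP: s01.
have [|||c hc] := @asym_single (fun s => Fv s^-1) (1 / 64).
- by rlra.
- by rlra.
- move=> N; have [C1 [C10 h1]] := near_exp N; have [c [C2 [C20 h2]]] := exp_poly a N.*2.+2 N.
  exists c, (C1 + C2); split; first by rewrite addr_ge0.
  move=> s s0 s1; have s01 : 0 <= s <= 1 by apply/andP; split; rlra.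
  by rewrite mulrDl; apply: le_trans (ler_distD _ _ _) (lerD (h1 s s0 s1) (h2 s s01)).
exists c; split=> //; have [C1 [C10 h1]] := near_exp 0%N; have [C2 [C20 h2]] := hc 0%N.
apply/eqP; rewrite -subr_eq0; apply/eqP; have q0 : 0 < 1 / 64 :> R by rlra.
apply: (@le_small_eq0 _ (C1 + C2 + `|a 1%N| * expR `|a 1%N|) _ q0) => s s0 s1.
have s01 : 0 <= s <= 1 by apply/andP; split; rlra.
have := h1 s s0 s1; have := h2 s s0 s1; rewrite !big_nat1 expr0 !expr1 mulr1.
have := exp_taylor 0 (a 1%N * s); rewrite big_nat1 expr0 divr1 expr1 normrM (gtr0_norm s0).
have : expR (`|a 1%N| * s) <= expR `|a 1%N| by rewrite ler_expR ler_piMr//; case/andP: s01.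
move=> e0 e1; have {e0 e1} : `|expR (a 1%N * s) - 1| <= `|a 1%N| * expR `|a 1%N| * s.
  by apply: le_trans e1 _; rewrite mulrAC ler_wpM2r ?(ltW s0)// ler_wpM2l.
rewrite !mulrDl; move: (Fv _) (expR (a 1%N * s)) (_ * expR _ * s) (C1 * s) (C2 * s) (c 0%N) => f e x y z c0.
by rewrite !ler_norml => /andP[? ?] /andP[? ?] /andP[? ?]; apply/andP; split; rlra.
Qed.
End AsymptoticSeries.

(** * From the density model to the count up to x *)

Lemma cyclic_countE (R : realType) (x : R) : cyclic_count x = count cyc (iota 1 (Num.truncn x)).
Proof. by rewrite /cyclic_count sum1_count /index_iota subSS subn0. Qed.

Theorem theorem1 (R : realType) :
  exists c : nat -> R, forall N : nat, (0 < N)%N ->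
    exists K : R, \forall x \near +oo,
      `| (cyclic_count x)%:R
         - expR (- euler_gamma R) * x / ln (ln (ln x))
           * (1 + \sum_(1 <= k < N.+1) c k / ln (ln (ln x)) ^+ k) |
      <= K * (x / ln (ln (ln x)) ^+ N.+2).
Proof.
have [c [c0 hc]] := Fv_expand R; exists c => N _.
have [K [v0 [K0 v016 hK]]] := cyclic_model R.
have [C [C0 hC]] := hc N; have [C1 [C10 hC1]] := hc 0%N; have [D D0 hD] := ln_pow_small R N.+2.
pose G := expR (- euler_gamma R); have G0 : 0 <= G by exact: expR_ge0.
(* Guarantees l >= 64, where the expansion holds, and v = e^(l/16) >= v0, where the density model
   holds. *)
pose B := 64 + 16 * ln v0; exists (K * D + G * (1 + C1) * D + G * C).
exists (expR (expR (expR B))); split; first exact: num_real.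
move=> x Bx; have v00 : 0 < v0 by rlra.
have ln0 : 0 <= ln v0 by rewrite ln_ge0//; rlra.
have lnlt (b z : R) : expR b < z -> b < ln z.
  by move=> h; rewrite -[ltLHS]expRK ltr_ln ?posrE ?expR_gt0// (lt_trans _ h)// expR_gt0.
have x1 := lnlt _ _ Bx; have x2 := lnlt _ _ x1; have x3 := lnlt _ _ x2.
have xp : 0 < x by apply: lt_trans Bx; exact: expR_gt0.
have lxp : 0 < ln x by apply: lt_trans x1; exact: expR_gt0.
have llxp : 0 < ln (ln x) by apply: lt_trans x2; exact: expR_gt0.
set l := ln (ln (ln x)) in x3 *; have l64 : 64 <= l by rewrite /B in x3; rlra.
have lp : 0 < l by rlra.
pose v := expR (l / 16); have lv : 16 * ln v = l by rewrite expRK; rlra.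
have vv0 : v0 <= v by rewrite -[leLHS](@lnK _) ?posrE// ler_expR; rewrite /B in x3; rlra.
have v16 : 16 <= v by exact: le_trans vv0.
have vp : 0 < v by exact: expR_gt0.
(* The real number x is recovered exactly from v, so [Xv v] is its integer part. *)
have yE : yv v = ln (ln x).
  rewrite (_ : yv v = expR l); first by rewrite /l lnK.
  by rewrite /yv /v -expRM_natl; congr expR; rlra.
have XE : Xv v = Num.truncn x by rewrite /Xv yE lnK// lnK.
have sp : 0 < l^-1 by rewrite invr_gt0.
have s64 : l^-1 <= 1 / 64 by rewrite mul1r lef_pV2 ?posrE.
have := hK v vv0; rewrite XE -cyclic_countE => h1.
have WE : Wv v = G * l^-1 * Fv l.
  rewrite /Fv -/v /G; have e : expR (- euler_gamma R) * expR (euler_gamma R) = 1 :> R by rewrite -expRD addNr expR0.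
  rewrite (_ : _ * _ = Wv v * (l * l^-1) * (expR (- euler_gamma R) * expR (euler_gamma R))); last by ring.
  by rewrite e mulfV ?gt_eqF// !mulr1.
have h2 := hC l^-1 sp s64; rewrite invrK big_ltn// expr0 c0 mulr1 in h2.
have h3 := hC1 l^-1 sp s64; rewrite invrK big_nat1 expr0 c0 mulr1 expr1 in h3.
have eS : \sum_(1 <= k < N.+1) c k / l ^+ k = \sum_(1 <= k < N.+1) c k * l^-1 ^+ k.
  by apply: eq_bigr => k _; rewrite exprVn.
(* Since v = e^(l/16), an error O(1/v) is O(l^(-N-2)) for every N. *)
have hv : v^-1 <= D * l^-1 ^+ N.+2 by have := hD v v16; rewrite lv exprVn.
have tx : (Num.truncn x)%:R <= x by rewrite Num.Theory.truncn_le ltW.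
have xt : x <= (Num.truncn x)%:R + 1 by rewrite natr1; exact/ltW/lt_truncnS.
have vx : v <= x.
  apply: le_trans (_ : expR l <= _); first by rewrite ler_expR; move: lp; clear; lra.
  rewrite /l lnK ?posrE//; have := ln_diff_le ltr01 lxp; have := ln_diff_le ltr01 xp.
  by rewrite ln1 !subr0 !divr1; clear; lra.
(* Passing from the integer part of x to x changes the main term by at most |W|, which is bounded;
   this makes it absorbable, because 1 <= x / v. *)
have one : 1 <= x * (D * l^-1 ^+ N.+2).
  by apply: le_trans (ler_wpM2l (ltW xp) hv); rewrite ler_pdivlMr ?mul1r.
have F1 : `|Fv l| <= 1 + C1.
  have := ler_distD 1 (Fv l) 0; rewrite !subr0 normr1 => h; apply: le_trans h _.
  rewrite addrC lerD2l; apply: le_trans h3 _; rewrite ler_piMr//; move: s64; clear; lra.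
have W1 : `|Wv v| <= G * (1 + C1).
  rewrite WE; move: (Fv l) F1 => f F1; rewrite !normrM (ger0_norm G0) (gtr0_norm sp) -mulrA ler_wpM2l//.
  by apply: le_trans F1; rewrite ler_piMl//; move: s64; clear; lra.
rewrite eS; set S := \sum_(1 <= k < N.+1) _ in h2 *.
have q1 : `|(cyclic_count x)%:R - (Num.truncn x)%:R * Wv v| <= K * D * (x * l^-1 ^+ N.+2).
  apply: le_trans h1 _; rewrite -mulrA ler_wpM2l// mulrCA; by apply: ler_pM; rewrite ?invr_ge0 ?(ltW vp).
have q2 : `|(Num.truncn x)%:R * Wv v - x * Wv v| <= G * (1 + C1) * D * (x * l^-1 ^+ N.+2).
  rewrite -mulrBl normrM -[leLHS]mulrC -[_ * D * _]mulrA; apply: ler_pM => //.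
  by rewrite mulrCA; apply: le_trans one; rewrite ler_norml; apply/andP; split; rlra.
have q3 : `|x * Wv v - G * x / l * (1 + S)| <= G * C * (x * l^-1 ^+ N.+2).
  rewrite WE (_ : _ - _ = G * x * l^-1 * (Fv l - (1 + S))); last by ring.
  move: (Fv l - (1 + S)) h2 => f h2; rewrite !normrM (ger0_norm G0) (gtr0_norm sp) (gtr0_norm xp).
  rewrite (_ : G * C * _ = G * x * l^-1 * (C * l^-1 ^+ N.+1)); last by rewrite [l^-1 ^+ N.+2]exprS; ring.
  by rewrite ler_wpM2l// !mulr_ge0// ltW.
rewrite -exprVn !mulrDl; apply: le_trans (ler_distD (x * Wv v) _ _) (lerD _ q3).
exact: le_trans (ler_distD _ _ _) (lerD q1 q2).
Qed.
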